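(* Let $\Gamma_1,\Gamma_2$ be two locally perturbed sound-soft surfaces (Dirichlet boundary condition) and fix the wave number $k>0$. If $u^{sc}_{1,\infty}(\hat x;d)=u^{sc}_{2,\infty}(\hat x;d)$ for all $\hat x\in\mathbb S^2_+$ and all $d\in\mathbb S^2_-$, then $\Gamma_1=\Gamma_2$.
   Context: Fix a wave number $k>0$. Write $x=(\tilde x,x_3)\in\mathbb R^3$ with $\tilde x=(x_1,x_2)$, and $\mathbb S^2_\pm=\{x\in\mathbb R^3:|x|=1,\ \pm x_3>0\}$. A locally perturbed surface is $\Gamma=\{(\tilde x,f(\tilde x)):\tilde x\in\mathbb R^2\}$, where $f:\mathbb R^2\to\mathbb R$ is Lipschitz continuous and $f(\tilde x)=0$ for $|\tilde x|>R$ for some $R>\max|f|$; $\Omega=\{x:x_3>f(\tilde x)\}$ is the region above $\Gamma$ and $\nu$ is the unit normal on $\Gamma$ pointing into $\Omega$. For $d=(\alpha,\beta,-\gamma)\in\mathbb S^2_-$ the incident plane wave is $u^{in}(x;d)=e^{ikx\cdot d}$ and its reflected wave from the flat plane $\{x_3=0\}$ is $u^{re}(x;d)=-e^{ik(\alpha x_1+\beta x_2+\gamma x_3)}$ in the Dirichlet case and $u^{re}(x;d)=+e^{ik(\alpha x_1+\beta x_2+\gamma x_3)}$ in the Neumann case. The total field is $u=u^{in}+u^{re}+u^{sc}$, where $u$ satisfies $\Delta u+k^2u=0$ in $\Omega$, the boundary condition $u=0$ on $\Gamma$ (sound-soft/Dirichlet) or $\partial_\nu u=0$ on $\Gamma$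 (sound-hard/Neumann), and the scattered field $u^{sc}$ satisfies the Sommerfeld radiation condition $\lim_{r\to\infty}r(\partial_ru^{sc}-iku^{sc})=0$, $r=|x|$, $x\in\Omega$; this problem is uniquely solvable. Then $u^{sc}(x;d)=\frac{e^{ik|x|}}{|x|}\{u^{sc}_\infty(\hat x;d)+O(1/|x|)\}$ as $|x|\to\infty$ in $\Omega$, $\hat x=x/|x|\in\mathbb S^2_+$, and $u^{sc}_\infty(\cdot;d)$ is the far-field pattern. Quantities associated with a surface $\Gamma_j=\{x_3=f_j(\tilde x)\}$ carry the index $j$. *)

(* Defs.v *)
From Stdlib Require Import Reals Lra.
Open Scope R_scope.

Definition pt : Type := (R * R * R)%type.
Definition Cx : Type := (R * R)%type.

Definition px1 (x : pt) : R := fst (fst x).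
Definition px2 (x : pt) : R := snd (fst x).
Definition px3 (x : pt) : R := snd x.
Definition mkpt (a b c : R) : pt := (a, b, c).

Definition dot (x y : pt) : R := px1 x * px1 y + px2 x * px2 y + px3 x * px3 y.
Definition norm3 (x : pt) : R := sqrt (dot x x).
Definition vsub (x y : pt) : pt := mkpt (px1 x - px1 y) (px2 x - px2 y) (px3 x - px3 y).
Definition vscale (r : R) (x : pt) : pt := mkpt (r * px1 x) (r * px2 x) (r * px3 x).

Definition shift (x : pt) (i : nat) (t : R) : pt :=
  match i with
  | O => mkpt (px1 x + t) (px2 x) (px3 x)
  | S O => mkpt (px1 x) (px2 x + t) (px3 x)
  | _ => mkpt (px1 x) (px2 x) (px3 x + t)
  end.
Definition coord (x : pt) (i : nat) : R :=
  match i with O => px1 x | S O => px2 x | _ => px3 x end.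

Definition cadd (z w : Cx) : Cx := (fst z + fst w, snd z + snd w).
Definition csub (z w : Cx) : Cx := (fst z - fst w, snd z - snd w).
Definition copp (z : Cx) : Cx := (- fst z, - snd z).
Definition cmul (z w : Cx) : Cx :=
  (fst z * fst w - snd z * snd w, fst z * snd w + snd z * fst w).
Definition cscale (r : R) (z : Cx) : Cx := (r * fst z, r * snd z).
Definition cabs (z : Cx) : R := sqrt (fst z ^ 2 + snd z ^ 2).
Definition cexpi (t : R) : Cx := (cos t, sin t).

Definition cont_on (S : pt -> Prop) (g : pt -> R) : Prop :=
  forall x, S x -> forall eps, eps > 0 -> exists delta, delta > 0 /\
    forall y, S y -> norm3 (vsub y x) < delta -> Rabs (g y - g x) < eps.

Definition partial_on (S : pt -> Prop) (g : pt -> R) (i : nat) (dg : pt -> R) : Prop :=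
  forall x, S x -> derivable_pt_lim (fun t => g (shift x i t)) 0 (dg x).

Definition C2_on (S : pt -> Prop) (g : pt -> R)
  (D1 : nat -> pt -> R) (D2 : nat -> nat -> pt -> R) : Prop :=
  cont_on S g /\
  (forall i, (i < 3)%nat -> partial_on S g i (D1 i) /\ cont_on S (D1 i)) /\
  (forall i j, (i < 3)%nat -> (j < 3)%nat ->
     partial_on S (D1 i) j (D2 i j) /\ cont_on S (D2 i j)).

Definition helmholtz_real (k : R) (S : pt -> Prop) (g : pt -> R) : Prop :=
  exists D1 D2, C2_on S g D1 D2 /\
    forall x, S x -> D2 0%nat 0%nat x + D2 1%nat 1%nat x + D2 2%nat 2%nat x + k ^ 2 * g x = 0.

Definition helmholtz (k : R) (S : pt -> Prop) (u : pt -> Cx) : Prop :=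
  helmholtz_real k S (fun x => fst (u x)) /\ helmholtz_real k S (fun x => snd (u x)).

(* Surfaces Gamma = {x3 = f(x1,x2)} *)
Definition lipschitz2 (f : R -> R -> R) : Prop :=
  exists L, forall a b a' b',
    Rabs (f a b - f a' b') <= L * sqrt ((a - a') ^ 2 + (b - b') ^ 2).

Definition locally_perturbed (f : R -> R -> R) : Prop :=
  lipschitz2 f /\
  exists R0, (forall a b, R0 < sqrt (a ^ 2 + b ^ 2) -> f a b = 0) /\
             (forall a b, Rabs (f a b) < R0).

Definition Omega (f : R -> R -> R) (x : pt) : Prop := px3 x > f (px1 x) (px2 x).
Definition Omega_bar (f : R -> R -> R) (x : pt) : Prop := px3 x >= f (px1 x) (px2 x).

Definition S2plus (x : pt) : Prop := norm3 x = 1 /\ px3 x > 0.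
Definition S2minus (x : pt) : Prop := norm3 x = 1 /\ px3 x < 0.

(* incident plane wave e^{i k x.d} and its Dirichlet reflection
   -e^{ik(alpha x1 + beta x2 + gamma x3)}, d = (alpha, beta, -gamma) *)
Definition u_in (k : R) (d : pt) (x : pt) : Cx := cexpi (k * dot x d).
Definition u_re_D (k : R) (d : pt) (x : pt) : Cx :=
  copp (cexpi (k * (px1 d * px1 x + px2 d * px2 x + (- px3 d) * px3 x))).

Definition radiating (k : R) (f : R -> R -> R) (v : pt -> Cx) : Prop :=
  exists G : nat -> pt -> Cx,
    (forall i, (i < 3)%nat ->
       partial_on (Omega f) (fun x => fst (v x)) i (fun x => fst (G i x)) /\
       partial_on (Omega f) (fun x => snd (v x)) i (fun x => snd (G i x))) /\
    forall eps, eps > 0 -> exists R0, forall x, Omega f x -> norm3 x > R0 ->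
      let r := norm3 x in
      let dr := cadd (cadd (cscale (px1 x / r) (G 0%nat x))
                           (cscale (px2 x / r) (G 1%nat x)))
                     (cscale (px3 x / r) (G 2%nat x)) in
      cabs (cscale r (csub dr (cmul (0, k) (v x)))) < eps.

Definition dirichlet_scattered (k : R) (f : R -> R -> R) (d : pt) (usc : pt -> Cx) : Prop :=
  let u := fun x => cadd (cadd (u_in k d x) (u_re_D k d x)) (usc x) in
  helmholtz k (Omega f) u /\
  cont_on (Omega_bar f) (fun x => fst (usc x)) /\
  cont_on (Omega_bar f) (fun x => snd (usc x)) /\
  (forall a b, u (mkpt a b (f a b)) = (0, 0)) /\
  radiating k f usc.

(* F is the far-field pattern of v:
   v(x) = e^{ik|x|}/|x| { F(xh) + O(1/|x|) } as |x| -> oo, xh = x/|x| in S^2_+ *)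
Definition far_field (k : R) (f : R -> R -> R) (v : pt -> Cx) (F : pt -> Cx) : Prop :=
  forall xh, S2plus xh -> exists M R0, forall r, r > R0 -> Omega f (vscale r xh) ->
    cabs (csub (cscale r (cmul (cexpi (- (k * r))) (v (vscale r xh)))) (F xh)) <= M / r.

(* Main.v *)
(* Let u_j be the total fields.

1. The difference w of the scattered fields vanishes on the plane x_3 = 0 outside a large ball, so its odd reflection
   solves the Helmholtz equation in the exterior of the ball; it is radiating and its far field is zero.  Green's
   representation turns this into |w| = O(|x|^-2), and a virial identity in the style of Kato then forces w = 0 near
   infinity.  Unique continuation (along coordinate segments, by analyticity) gives u_1 = u_2 above both surfaces.
2. Suppose that f_1 > f_2 somewhere.  In the bounded open set D = {f_2 < x_3 < f_1} the imaginary part of u_2(.; d),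
   extended by zero, is continuous on R^3, for every d: a Dirichlet eigenfunction of D with eigenvalue k^2.  Since
   (v^2 - e)_+^3 is, up to an error vanishing with e, a subsolution of a Helmholtz equation on the whole space, one has
   sup v^2 <= C int v^2 with C independent of the eigenfunction v; hence an orthonormal family of them is finite.
3. So the fields for the directions d_j = (sqrt (1 - g_j^2), 0, -g_j), g_j = 2^-(j+1), satisfy a linear relation in D,
   hence in the region above f_2.  On the axis r e_3 the j-th field is -2 sin (k g_j r) + o(1), and a suitable
   sequence r -> oo isolates one coefficient: a contradiction. *)
From Stdlib Require Import ZArith Reals Factorial Lra Lia Psatz Classical IndefiniteDescription
  FunctionalExtensionality.
From Coquelicot Require Import Coquelicot.
Require Import Defs.
Open Scope R_scope.

(** Everything is phrased through integrals over all of R^3 of continuous functions of compact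
    support, with radial cutoffs in place of balls and spheres, and through continuous weak
    solutions, a notion that survives odd reflection. Regularity and analyticity in the interior are
    recovered from one reproducing kernel: the commutator of the Laplacian with a cutoff, applied to
    cos (k s) / s.

    The truncation in step 2 is cubed because the cube of a positive part is C^2 across its zero
    set; the boundary of D then disappears from the argument. The bound on the supremum replaces a
    compact embedding: applied to the combination of n orthonormal modes whose coefficients are
    their own values at a point, it bounds n by a multiple of the volume of a box.

    Imaginary parts are chosen in step 2 because on the vertical axis the incident and reflected
    waves cancel in the real part and add up in the imaginary part. *)

Definition ct (f : pt -> R) (x : pt) : Prop := continuous (T := prod_UniformSpace (prod_UniformSpace R_UniformSpace
  R_UniformSpace) R_UniformSpace) (U := R_UniformSpace) f x.

(** Open cubes rather than Euclidean balls: they are the balls of the product uniform structure, and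
    a shift by t along an axis stays in every cube of half side larger than |t|. *)
Definition near (d : R) (x y : pt) : Prop :=
  Rabs (px1 y - px1 x) < d /\ Rabs (px2 y - px2 x) < d /\ Rabs (px3 y - px3 x) < d.

Lemma pt_eta (x : pt) : mkpt (px1 x) (px2 x) (px3 x) = x.
Proof. now destruct x as [[a b] c]. Qed.

Lemma pt_eq (x y : pt) : px1 x = px1 y -> px2 x = px2 y -> px3 x = px3 y -> x = y.
Proof. destruct x as [[a b] c], y as [[a' b'] c']; cbn; congruence. Qed.

Lemma near_refl d x : 0 < d -> near d x x.
Proof. intros; unfold near; rewrite !Rminus_diag, Rabs_R0; auto. Qed.

Lemma near_sym d x y : near d x y -> near d y x.
Proof. unfold near; now rewrite (Rabs_minus_sym (px1 y)), (Rabs_minus_sym (px2 y)), (Rabs_minus_sym (px3 y)). Qed.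

Lemma near_trans d e x y z : near d x y -> near e y z -> near (d + e) x z.
Proof.
unfold near; intros [A1 [A2 A3]] [B1 [B2 B3]]; repeat split.
- replace (px1 z - px1 x) with ((px1 y - px1 x) + (px1 z - px1 y)) by ring.
  eapply Rle_lt_trans; [apply Rabs_triang | lra].
- replace (px2 z - px2 x) with ((px2 y - px2 x) + (px2 z - px2 y)) by ring.
  eapply Rle_lt_trans; [apply Rabs_triang | lra].
- replace (px3 z - px3 x) with ((px3 y - px3 x) + (px3 z - px3 y)) by ring.
  eapply Rle_lt_trans; [apply Rabs_triang | lra].
Qed.

Lemma near_le d e x y : d <= e -> near d x y -> near e x y.
Proof. unfold near; intros; intuition lra. Qed.

Lemma ct_iff f x : ct f x <->
  forall e, 0 < e -> exists d, 0 < d /\ forall y, near d x y -> Rabs (f y - f x) < e.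
Proof.
split.
- intros H e He.
  destruct (proj1 (filterlim_locally f (f x)) H (mkposreal e He)) as [d Hd].
  exists d; split; [apply d|]. intros y [H1 [H2 H3]].
  apply Hd. repeat split; assumption.
- intros H; apply filterlim_locally; intros e.
  destruct (H e (cond_pos e)) as [d [Hd0 Hd]].
  exists (mkposreal d Hd0); intros y [[H1 H2] H3]; apply Hd; repeat split; assumption.
Qed.

Lemma ct_const c x : ct (fun _ => c) x.
Proof. apply continuous_const. Qed.
Lemma ct_plus f g x : ct f x -> ct g x -> ct (fun y => f y + g y) x.
Proof. intros; apply (continuous_plus (V := R_NormedModule) f g x); assumption. Qed.
Lemma ct_mult f g x : ct f x -> ct g x -> ct (fun y => f y * g y) x.
Proof. intros; apply (continuous_mult (K := R_AbsRing) f g x); assumption. Qed.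
Lemma ct_opp f x : ct f x -> ct (fun y => - f y) x.
Proof. intros; apply (continuous_opp (V := R_NormedModule) f x); assumption. Qed.
Lemma ct_minus f g x : ct f x -> ct g x -> ct (fun y => f y - g y) x.
Proof. intros; apply (continuous_minus (V := R_NormedModule) f g x); assumption. Qed.
Lemma ct_comp (h : R -> R) f x : ct f x -> continuous h (f x) -> ct (fun y => h (f y)) x.
Proof. intros; apply (continuous_comp f h x); assumption. Qed.
Lemma ct_px1 x : ct px1 x.
Proof. apply ct_iff; intros e He; exists e; split; [lra|]; intros y [H _]; exact H. Qed.
Lemma ct_px2 x : ct px2 x.
Proof. apply ct_iff; intros e He; exists e; split; [lra|]; intros y [_ [H _]]; exact H. Qed.
Lemma ct_px3 x : ct px3 x.
Proof. apply ct_iff; intros e He; exists e; split; [lra|]; intros y [_ [_ H]]; exact H. Qed.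
Lemma ct_coord i x : ct (fun y => coord y i) x.
Proof. destruct i as [|[|i]]; [apply ct_px1|apply ct_px2|apply ct_px3]. Qed.
Lemma ct_pow f n x : ct f x -> ct (fun y => f y ^ n) x.
Proof. intros; induction n; simpl; [apply ct_const|apply ct_mult; assumption]. Qed.

Lemma ct_ext_near f g x d : 0 < d -> (forall y, near d x y -> f y = g y) -> ct f x -> ct g x.
Proof.
intros Hd E H; apply ct_iff; intros e He. destruct (proj1 (ct_iff f x) H e He) as [d' [Hd' K]].
exists (Rmin d d'); split; [apply Rmin_pos; lra|]. intros y Hy.
rewrite <- (E y), <- (E x); [| now apply near_refl |].
- apply K. eapply near_le; [apply Rmin_r|exact Hy].
- eapply near_le; [apply Rmin_l|exact Hy].
Qed.

Lemma ct_ext f g x : (forall y, f y = g y) -> ct f x -> ct g x.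
Proof. intros E; apply (ct_ext_near f g x 1); auto; lra. Qed.

Lemma near_shift x i t d : Rabs t < d -> near d x (shift x i t).
Proof.
intros H; assert (0 < d) by (pose proof (Rabs_pos t); lra).
destruct i as [|[|i]]; cbn; repeat split; cbn;
 match goal with |- Rabs ?a < _ => first [replace a with t by ring; assumption | replace a with 0 by ring;
   rewrite Rabs_R0; assumption] end.
Qed.

Lemma shift_shift x i s t : shift (shift x i s) i t = shift x i (s + t).
Proof. destruct i as [|[|i]]; apply pt_eq; cbn; ring. Qed.

Lemma shift_0 x i : shift x i 0 = x.
Proof. destruct i as [|[|i]]; apply pt_eq; cbn; ring. Qed.

Lemma ct_shift f x i t : ct f (shift x i t) -> ct (fun y => f (shift y i t)) x.
Proof.
rewrite !ct_iff; intros H e He; destruct (H e He) as [d [Hd K]]; exists d; split; auto.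
intros y Hy; apply K. destruct Hy as [A [B C]].
destruct i as [|[|i]]; repeat split; cbn in *;
 match goal with |- Rabs ?a < _ => match goal with H : Rabs ?b < _ |- _ => replace a with b by ring;
   assumption end end.
Qed.

(** * Compactness of cubes and uniform continuity on sets with a margin *)

Definition inbox (L : R) (y : pt) : Prop :=
  Rabs (px1 y) <= L /\ Rabs (px2 y) <= L /\ Rabs (px3 y) <= L.

(** The gauge [delta] need not be continuous, yet every point of the box is covered by a tag whose
    radius has a common lower bound. [compactness_value] gives this up to a double negation, which
    [NNPP] removes. *)
Lemma box_compact (L : R) (delta : pt -> R) : (forall x, 0 < delta x) ->
  exists d, 0 < d /\ forall x, inbox L x -> exists t, near (delta t) t x /\ d <= delta t.
Proof.
intros Hd.
pose (u := fun v : Compactness.Tn 3 R => mkpt (fst v) (fst (snd v)) (fst (snd (snd v)))).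
destruct (compactness_value 3 ((-L,(-L,(-L,tt))) : Compactness.Tn 3 R) ((L,(L,(L,tt))) : Compactness.Tn 3 R)
  (fun v => mkposreal _ (Hd (u v)))) as [d K].
exists d; split; [apply d|].
intros x [H1 [H2 H3]]. apply Rabs_le_between in H1, H2, H3.
destruct (NNPP _ (K ((px1 x, (px2 x, (px3 x, tt))) : Compactness.Tn 3 R) ltac:(cbn;
  auto))) as [[t1 [t2 [t3 []]]] [_ [C D]]].
exists (mkpt t1 t2 t3); split; [|exact D].
cbn in C. unfold near; cbn. intuition.
Qed.

(** Together with a bounding box this replaces compact containment of K in S, without asking K to be
    closed. *)
Definition margin (S K : pt -> Prop) (m : R) : Prop :=
  0 < m /\ forall y, K y -> forall z, near m y z -> S z.

Lemma locally_uniform_cont S K m L V : margin S K m -> (forall y, K y -> inbox L y) ->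
  (forall y, S y -> ct V y) ->
  forall e, 0 < e -> exists d, 0 < d /\ forall y z, K y -> near d y z -> Rabs (V z - V y) < e.
Proof.
intros [Hm HS] HL HV e He.
(* The cap m / 2 forces every tag close to K to lie in S; tags outside S receive an arbitrary
   admissible radius. The factor 2 leaves room for z, which is only known to be close to a point y
   of the cube around the tag. *)
assert (P : forall t, exists d, 0 < d /\ d <= m / 2 /\ (S t -> forall z, near (2*d) t z -> Rabs (V z - V t) < e / 2)).
{ intros t. destruct (classic (S t)) as [St|St].
  - destruct (proj1 (ct_iff _ _) (HV t St) (e/2) ltac:(lra)) as [d [Hd Q]].
    exists (Rmin (d/2) (m/2)). split; [apply Rmin_pos; lra|]. split; [apply Rmin_r|].
    intros _ z Hz. apply Q. eapply near_le; [|exact Hz]. pose proof (Rmin_l (d/2) (m/2)); lra.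
  - exists (m/2); repeat split; try lra. contradiction. }
destruct (functional_choice _ P) as [delta Q].
destruct (box_compact L delta (fun t => proj1 (Q t))) as [d [Hd C]].
exists d; split; auto. intros y z Ky Hz.
destruct (C y (HL y Ky)) as [t [N D]]. destruct (Q t) as [Q1 [Q2 Q3]].
assert (St : S t). { apply (HS y Ky). apply near_sym. eapply near_le; [|exact N]. lra. }
assert (E1 : Rabs (V y - V t) < e/2) by (apply Q3; auto; eapply near_le; [|exact N]; lra).
assert (E2 : Rabs (V z - V t) < e/2).
{ apply Q3; auto. eapply near_le; [|eapply near_trans; [exact N|exact Hz]]. lra. }
replace (V z - V y) with ((V z - V t) - (V y - V t)) by ring.
eapply Rle_lt_trans; [apply Rabs_triang|]. rewrite Rabs_Ropp. lra.
Qed.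

Lemma locally_bounded S K m L V : margin S K m -> (forall y, K y -> inbox L y) ->
  (forall y, S y -> ct V y) -> exists M, 0 < M /\ forall y, K y -> Rabs (V y) <= M.
Proof.
intros [Hm HS] HL HV.
assert (P : forall t, exists d, 0 < d /\ d <= m / 2 /\ (S t -> forall z, near d t z -> Rabs (V z) <= Rabs (V t) + 1)).
{ intros t. destruct (classic (S t)) as [St|St].
  - destruct (proj1 (ct_iff _ _) (HV t St) 1 ltac:(lra)) as [d [Hd Q]].
    exists (Rmin d (m/2)). split; [apply Rmin_pos; lra|]. split; [apply Rmin_r|].
    intros _ z Hz. assert (Rabs (V z - V t) < 1).
    { apply Q. eapply near_le; [|exact Hz]. apply Rmin_l. }
    pose proof (Rabs_triang (V z - V t) (V t)). replace (V z - V t + V t) with (V z) in H0 by ring. lra.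
  - exists (m/2); repeat split; try lra. contradiction. }
destruct (functional_choice _ P) as [delta Q].
(* shrinking the radius where |V t| is large turns a lower bound on the radii into an upper bound on V *)
pose (delta' := fun t => Rmin (delta t) (/ (Rabs (V t) + 1))).
assert (Hp : forall t, 0 < Rabs (V t) + 1) by (intros t; pose proof (Rabs_pos (V t)); lra).
destruct (box_compact L delta') as [d [Hd C]].
{ intros t; apply Rmin_pos; [apply Q | apply Rinv_0_lt_compat, Hp]. }
exists (/ d); split; [now apply Rinv_0_lt_compat|]. intros y Ky.
destruct (C y (HL y Ky)) as [t [N D]]. destruct (Q t) as [Q1 [Q2 Q3]].
assert (N' : near (delta t) t y) by (eapply near_le; [apply Rmin_l|exact N]).
assert (St : S t). { apply (HS y Ky). apply near_sym. eapply near_le; [|exact N']. lra. }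
eapply Rle_trans; [apply Q3; auto|].
assert (d <= / (Rabs (V t) + 1)) by (eapply Rle_trans; [exact D|apply Rmin_r]).
rewrite <- (Rinv_inv (Rabs (V t) + 1)). now apply Rinv_le_contravar.
Qed.

(** * Continuous functions of compact support *)

Definition bsupp (f : pt -> R) (L : R) : Prop := forall y, f y <> 0 -> inbox L y.
Definition Cc (f : pt -> R) : Prop := (forall y, ct f y) /\ exists L, bsupp f L.

Lemma inbox_le L M y : L <= M -> inbox L y -> inbox M y.
Proof. unfold inbox; intuition lra. Qed.

Lemma Cc_uc f : Cc f -> forall e, 0 < e -> exists d, 0 < d /\ forall y z, near d y z -> Rabs (f z - f y) < e.
Proof.
intros [Hc [L HL]] e He.
assert (M : margin (fun _ => True) (inbox (L + 1)) 1) by (split; [lra|auto]).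
destruct (locally_uniform_cont _ _ 1 (L+1) f M (fun y h => h) (fun y _ => Hc y) e He) as [d [Hd Q]].
exists (Rmin d 1); split; [apply Rmin_pos; lra|]. intros y z N.
destruct (classic (inbox (L+1) y)) as [B|B].
- apply Q; auto. eapply near_le; [apply Rmin_l|exact N].
- assert (E1 : f y = 0).
  { destruct (Req_dec (f y) 0); auto. exfalso; apply B. eapply inbox_le; [|apply HL; auto]. lra. }
  assert (E2 : f z = 0).
  { destruct (Req_dec (f z) 0); auto. exfalso; apply B.
    destruct (HL z H) as [B1 [B2 B3]]. assert (N' := near_le _ 1 _ _ (Rmin_r _ _) N).
    destruct N' as [N1 [N2 N3]]. clear - B1 B2 B3 N1 N2 N3.
    repeat split; apply Rabs_le_between; apply Rabs_le_between in B1, B2, B3;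
      apply Rabs_lt_between in N1, N2, N3; lra. }
  rewrite E1, E2, Rminus_0_r, Rabs_R0; auto.
Qed.

Lemma Cc_bounded f : Cc f -> exists M, 0 < M /\ forall y, Rabs (f y) <= M.
Proof.
intros [Hc [L HL]].
destruct (locally_bounded (fun _ => True) (inbox L) 1 L f) as [M [HM Q]]; auto.
{ split; [lra|auto]. }
exists M; split; auto. intros y. destruct (Req_dec (f y) 0) as [E|E].
- rewrite E, Rabs_R0; lra.
- apply Q, HL, E.
Qed.

Lemma Cc_plus f g : Cc f -> Cc g -> Cc (fun y => f y + g y).
Proof.
intros [Hf [L HL]] [Hg [M HM]]; split; [intros; now apply ct_plus|].
exists (Rmax L M). intros y Hy. destruct (Req_dec (f y) 0) as [E|E].
- apply (inbox_le M); [apply Rmax_r|]. apply HM. intros E'; apply Hy; rewrite E, E'; ring.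
- apply (inbox_le L); [apply Rmax_l|]. now apply HL.
Qed.

Lemma Cc_mult_l f g : Cc f -> (forall y, ct g y) -> Cc (fun y => g y * f y).
Proof.
intros [Hf [L HL]] Hg; split; [intros; now apply ct_mult|].
exists L. intros y Hy. apply HL. intros E; apply Hy; rewrite E; ring.
Qed.

Lemma Cc_mult_r f g : Cc f -> (forall y, ct g y) -> Cc (fun y => f y * g y).
Proof.
intros [Hf [L HL]] Hg; split; [intros; now apply ct_mult|].
exists L. intros y Hy. apply HL. intros E; apply Hy; rewrite E; ring.
Qed.

Lemma Cc_scal c f : Cc f -> Cc (fun y => c * f y).
Proof. intros; apply (Cc_mult_l f (fun _ => c)); auto using ct_const. Qed.

Lemma Cc_ext f g : (forall y, f y = g y) -> Cc f -> Cc g.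
Proof. intros E; replace g with f; auto. now apply functional_extensionality. Qed.

Lemma Cc_0 : Cc (fun _ => 0).
Proof. split; [intros; apply ct_const|]. exists 0. intros y H; now contradict H. Qed.

Lemma Cc_minus f g : Cc f -> Cc g -> Cc (fun y => f y - g y).
Proof. intros Hf Hg; apply (Cc_ext (fun y => f y + (-1) * g y)); [intros; ring|]. apply Cc_plus; auto.
  now apply Cc_scal. Qed.

Lemma ct_abs f x : ct f x -> ct (fun y => Rabs (f y)) x.
Proof. intros; apply (ct_comp Rabs); auto. apply continuous_Rabs. Qed.

Lemma Cc_abs f : Cc f -> Cc (fun y => Rabs (f y)).
Proof.
intros [Hf [L HL]]; split; [intros; now apply ct_abs|]. exists L; intros y Hy; apply HL.
intros E; apply Hy; rewrite E; apply Rabs_R0.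
Qed.

Ltac ctt := repeat (cbv beta; match goal with
  | H : ct ?f ?x |- ct ?f ?x => exact H
  | |- ct (fun _ => ?c) ?x => exact (ct_const c x)
  | |- ct (fun y => @?f y + @?g y) ?x => refine (ct_plus f g x _ _)
  | |- ct (fun y => @?f y - @?g y) ?x => refine (ct_minus f g x _ _)
  | |- ct (fun y => @?f y * @?g y) ?x => refine (ct_mult f g x _ _)
  | |- ct (fun y => - @?f y) ?x => refine (ct_opp f x _)
  | |- ct (fun y => (@?f y) ^ ?n) ?x => refine (ct_pow f n x _)
  | |- ct (fun y => Rabs (@?f y)) ?x => refine (ct_abs f x _)
  | |- ct (fun y => px1 y) ?x => exact (ct_px1 x)
  | |- ct (fun y => px2 y) ?x => exact (ct_px2 x)
  | |- ct (fun y => px3 y) ?x => exact (ct_px3 x)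
  | |- ct px1 ?x => exact (ct_px1 x)
  | |- ct px2 ?x => exact (ct_px2 x)
  | |- ct px3 ?x => exact (ct_px3 x)
  | |- ct (fun y => coord y ?i) ?x => exact (ct_coord i x)
  end).

Ltac cct := repeat (cbv beta; match goal with
  | H : Cc ?f |- Cc ?f => exact H
  | |- Cc (fun y => @?f y + @?g y) => refine (Cc_plus f g _ _)
  | |- Cc (fun y => @?f y - @?g y) => refine (Cc_minus f g _ _)
  | |- Cc (fun y => ?c * @?f y) => refine (Cc_scal c f _)
  end).
Global Opaque ct.

Ltac rring := match goal with |- @eq _ ?a ?b => change (@eq R a b); try ring; try lra;
  rewrite ?Rplus_0_l, ?Rplus_0_r; reflexivity end.

(** * Integration of continuous functions of compact support *)
Definition line_int (L : R) (f : pt -> R) (a b : R) : R := RInt (fun c => f (mkpt a b c)) (-L) L.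
Definition plane_int (L : R) (f : pt -> R) (a : R) : R := RInt (fun b => line_int L f a b) (-L) L.
Definition box_int (L : R) (f : pt -> R) : R := RInt (fun a => plane_int L f a) (-L) L.

(* The limit is attained, and [int3] is the integral, for compactly supported continuous functions; the value is
   arbitrary otherwise. *)
Definition int3 (f : pt -> R) : R := real (Lim_seq (fun n => box_int (INR n) f)).

Lemma ex_RInt_ct (f : R -> R) a b : (forall t, continuous f t) -> ex_RInt f a b.
Proof. intros H; apply (ex_RInt_continuous (V := R_CompleteNormedModule)); auto. Qed.

Lemma RInt_zero (f : R -> R) a b : a <= b -> (forall t, a < t < b -> f t = 0) -> RInt f a b = 0.
Proof.
intros H E. rewrite (RInt_ext f (fun _ => 0)).
- rewrite RInt_const. unfold scal; simpl; unfold mult; simpl; rring.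
- intros x Hx. rewrite Rmin_left, Rmax_right in Hx by lra. now apply E.
Qed.

Lemma RInt_support (f : R -> R) L M : (forall t, continuous f t) -> (forall t, L < Rabs t -> f t = 0) ->
  0 <= L <= M -> RInt f (-M) M = RInt f (-L) L.
Proof.
intros Hc Hz H.
rewrite <- (RInt_Chasles f (-M) (-L) M), <- (RInt_Chasles f (-L) L M) by now apply ex_RInt_ct.
rewrite (RInt_zero f (-M) (-L)), (RInt_zero f L M); try lra.
- unfold plus; simpl; rring.
- intros t Ht; apply Hz; rewrite Rabs_right; lra.
- intros t Ht; apply Hz; rewrite Rabs_left; lra.
Qed.

Lemma RInt_slab (f : R -> R) L a b M : (forall t, continuous f t) -> (forall t, f t <> 0 -> a <= t <= b) ->
  (forall t, Rabs (f t) <= M) -> a <= b -> Rabs (RInt f (-L) L) <= M * (b - a).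
Proof.
intros Hc Hz HM Hab.
assert (M0 : 0 <= M) by (eapply Rle_trans; [apply (Rabs_pos (f 0))|apply HM]).
pose (K := Rmax (Rabs L) (Rmax (Rabs a) (Rabs b))).
assert (K1 : Rabs L <= K) by apply Rmax_l.
assert (K2 : Rabs a <= K) by (eapply Rle_trans; [apply Rmax_l|apply Rmax_r]).
assert (K3 : Rabs b <= K) by (eapply Rle_trans; [apply Rmax_r|apply Rmax_r]).
apply Rabs_le_between in K1, K2, K3.
assert (Z : forall t, ~ (a <= t <= b) -> f t = 0).
{ intros t Ht. destruct (Req_dec (f t) 0); auto. exfalso; auto. }
assert (gen : forall u v, u <= v -> Rabs (RInt f u v) <= M * (b - a)).
{ intros u v Huv.
  destruct (Rle_dec v a) as [V|V].
  { rewrite RInt_zero; [rewrite Rabs_R0; apply Rmult_le_pos; lra | lra |]. intros t Ht; apply Z; lra. }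
  destruct (Rle_dec b u) as [U|U].
  { rewrite RInt_zero; [rewrite Rabs_R0; apply Rmult_le_pos; lra | lra |]. intros t Ht; apply Z; lra. }
  pose (u' := Rmax u a). pose (v' := Rmin v b).
  assert (u <= u' /\ a <= u' /\ v' <= v /\ v' <= b /\ u' <= v').
  { unfold u', v'. repeat split; try apply Rmax_l; try apply Rmax_r; try apply Rmin_l; try apply Rmin_r.
    apply Rmax_lub; apply Rmin_glb; lra. }
  rewrite <- (RInt_Chasles f u u' v), <- (RInt_Chasles f u' v' v) by now apply ex_RInt_ct.
  rewrite (RInt_zero f u u'), (RInt_zero f v' v); try lra.
  - unfold plus; simpl. rewrite Rplus_0_l, Rplus_0_r.
    eapply Rle_trans; [apply abs_RInt_le_const with (M := M); [lra|now apply ex_RInt_ct|auto]|].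
      rewrite Rmult_comm. apply Rmult_le_compat_l; lra.
  - intros t Ht; apply Z. unfold v' in *. destruct (Rle_dec v b); [rewrite Rmin_left in * by lra;
    lra| rewrite Rmin_right in * by lra; lra].
  - intros t Ht; apply Z. unfold u' in *. destruct (Rle_dec a u); [rewrite Rmax_left in * by lra;
    lra| rewrite Rmax_right in * by lra; lra]. }
destruct (Rle_dec (-L) L).
- now apply gen.
- rewrite <- (opp_RInt_swap f) by now apply ex_RInt_ct. unfold opp; simpl; rewrite Rabs_Ropp. apply gen; lra.
Qed.

Lemma RInt_translate (f : R -> R) L M s : (forall t, continuous f t) -> (forall t, L < Rabs t -> f t = 0) ->
  0 <= L -> L + Rabs s <= M -> RInt (fun t => f (t + s)) (-M) M = RInt f (-M) M.
Proof.
intros Hc Hz HL HM.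
rewrite (RInt_ext _ (fun t => scal 1 (f (1 * t + s)))).
2:{ intros t _. unfold scal; simpl; unfold mult; simpl. rewrite !Rmult_1_l; reflexivity. }
rewrite (RInt_comp_lin (V := R_CompleteNormedModule)) by now apply ex_RInt_ct.
assert (Hs := Rabs_pos s).
assert (A1 : - Rabs s <= s <= Rabs s) by (apply Rabs_le_between; lra).
pose (N := M + Rabs s).
assert (E1 : RInt f (- N) N = RInt f (-L) L) by (apply RInt_support; unfold N; auto; lra).
assert (E2 : RInt f (- M) M = RInt f (-L) L) by (apply RInt_support; unfold N; auto; lra).
rewrite E2, <- E1.
rewrite <- (RInt_Chasles f (-N) (1 * -M + s) N), <- (RInt_Chasles f (1 * - M + s) (1 * M + s) N) by now apply
  ex_RInt_ct.
rewrite (RInt_zero f (-N)), (RInt_zero f _ N); unfold N; try lra.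
- unfold plus; simpl; rring.
- intros t Ht; apply Hz; rewrite Rabs_right; lra.
- intros t Ht; apply Hz; rewrite Rabs_left; lra.
Qed.

Definition unif_cont (f : pt -> R) := forall e, 0 < e -> exists d, 0 < d /\ forall y z,
  near d y z -> Rabs (f z - f y) < e.

Lemma near_mk d a b c a' b' c' : Rabs (a' - a) < d -> Rabs (b' - b) < d -> Rabs (c' - c) < d ->
  near d (mkpt a b c) (mkpt a' b' c').
Proof. now repeat split. Qed.

Lemma abs0_lt a d : 0 < d -> Rabs (a - a) < d.
Proof. intros; now rewrite Rminus_diag, Rabs_R0. Qed.

Lemma unif_cont_cont1 f a b c : unif_cont f -> continuous (fun c => f (mkpt a b c)) c.
Proof.
intros U; apply filterlim_locally; intros e. destruct (U e (cond_pos e)) as [d [Hd Q]].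
exists (mkposreal d Hd); intros c' Hc'. apply Q. apply near_mk; auto using abs0_lt.
Qed.

Lemma RInt_diff (f g : R -> R) L e : (forall t, continuous f t) -> (forall t, continuous g t) ->
  (forall t, Rabs (f t - g t) <= e) -> 0 <= L -> Rabs (RInt f (-L) L - RInt g (-L) L) <= 2 * L * e.
Proof.
intros Hf Hg H HL.
replace (RInt f (-L) L - RInt g (-L) L) with (RInt (fun t => minus (f t) (g t)) (-L) L).
- replace (2 * L * e) with ((L - - L) * e) by ring. apply abs_RInt_le_const; auto; [lra|].
  apply (ex_RInt_minus (V := R_NormedModule)); now apply ex_RInt_ct.
- apply (RInt_minus (V := R_CompleteNormedModule) f g); now apply ex_RInt_ct.
Qed.

Lemma line_int_diff f L a b a' b' e : unif_cont f -> 0 <= L -> (forall c,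
  Rabs (f (mkpt a' b' c) - f (mkpt a b c)) <= e) ->
  Rabs (line_int L f a' b' - line_int L f a b) <= 2 * L * e.
Proof. intros U HL H. apply RInt_diff; auto; intros; now apply unif_cont_cont1. Qed.

Lemma unif_cont_line_int f L : unif_cont f -> 0 <= L -> forall e, 0 < e -> exists d, 0 < d /\ forall a b a' b',
  Rabs (a' - a) < d -> Rabs (b' - b) < d ->
  Rabs (line_int L f a' b' - line_int L f a b) < e.
Proof.
intros U HL e He.
assert (P : 0 < e / (2 * L + 1)) by (apply Rdiv_lt_0_compat; lra).
destruct (U _ P) as [d [Hd Q]]. exists d; split; auto. intros a b a' b' Ha Hb.
eapply Rle_lt_trans.
- apply (line_int_diff f L a b a' b' (e / (2 * L + 1))); auto. intros c; left; apply Q, near_mk; auto using abs0_lt.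
- apply Rmult_lt_reg_r with (2 * L + 1); [lra|]. field_simplify; lra.
Qed.

Lemma line_int_cont f L a b : unif_cont f -> 0 <= L -> continuous (fun b => line_int L f a b) b.
Proof.
intros U HL; apply filterlim_locally; intros e. destruct (unif_cont_line_int f L U HL e (cond_pos e)) as [d [Hd Q]].
exists (mkposreal d Hd); intros b' Hb'. apply Q; auto using abs0_lt.
Qed.

Lemma plane_int_cont f L a : unif_cont f -> 0 <= L -> continuous (fun a => plane_int L f a) a.
Proof.
intros U HL; apply filterlim_locally; intros e.
assert (P : 0 < e / (2 * L + 1)) by (apply Rdiv_lt_0_compat; [apply cond_pos|lra]).
destruct (unif_cont_line_int f L U HL _ P) as [d [Hd Q]].
exists (mkposreal d Hd); intros a' Ha'.
eapply Rle_lt_trans.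
- apply (RInt_diff (fun b => line_int L f a' b) (fun b => line_int L f a b) L (e / (2 * L + 1))); auto; intros;
  try now apply line_int_cont.
  left; apply Q; auto using abs0_lt.
- apply Rmult_lt_reg_r with (2 * L + 1); [lra|]. field_simplify; try lra. destruct e; simpl; lra.
Qed.

Lemma bsupp_0 f L y : bsupp f L -> (L < Rabs (px1 y) \/ L < Rabs (px2 y) \/ L < Rabs (px3 y)) -> f y = 0.
Proof. intros B H. destruct (Req_dec (f y) 0) as [E|E]; auto. destruct (B y E) as [? [? ?]]; lra. Qed.

Lemma line_int_0 f L M a b : bsupp f L -> 0 <= M -> L < Rabs a \/ L < Rabs b -> line_int M f a b = 0.
Proof. intros B HM H. apply RInt_zero; [lra|]. intros t _. apply (bsupp_0 f L); cbn; tauto. Qed.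

Lemma plane_int_0 f L M a : bsupp f L -> 0 <= M -> L < Rabs a -> plane_int M f a = 0.
Proof. intros B HM H. apply RInt_zero; [lra|]. intros t _. apply (line_int_0 f L); auto. Qed.

Lemma box_int_box_int f L M : unif_cont f -> bsupp f L -> 0 <= L <= M -> box_int M f = box_int L f.
Proof.
intros U B H. unfold box_int.
rewrite (RInt_support (fun a => plane_int M f a) L M); auto.
2:{ intros; apply plane_int_cont; auto; lra. }
2:{ intros; apply (plane_int_0 f L); auto; lra. }
apply RInt_ext; intros a _. unfold plane_int.
rewrite (RInt_support (fun b => line_int M f a b) L M); auto.
2:{ intros; apply line_int_cont; auto; lra. }
2:{ intros; apply (line_int_0 f L); auto; lra. }
apply RInt_ext; intros b _. unfold line_int.
apply (RInt_support (fun c => f (mkpt a b c))); auto.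
- intros; now apply unif_cont_cont1.
- intros c Hc. apply (bsupp_0 f L); cbn; auto.
Qed.

Lemma I_box_int f L : Cc f -> bsupp f L -> 0 <= L -> int3 f = box_int L f.
Proof.
intros C B HL. unfold int3.
rewrite (Lim_seq_ext_loc _ (fun _ => box_int L f)).
- now rewrite Lim_seq_const.
- destruct (INR_unbounded L) as [N HN].
  exists N; intros n Hn. apply box_int_box_int; [exact (Cc_uc f C)|exact B|]. split; auto.
  apply le_INR in Hn; lra.
Qed.

Lemma bsupp_le f L M : L <= M -> bsupp f L -> bsupp f M.
Proof. intros H B y Hy; eapply inbox_le; [exact H|auto]. Qed.

Lemma Cc_box f : Cc f -> exists L, 0 <= L /\ bsupp f L.
Proof. intros [_ [L B]]; exists (Rmax 0 L); split; [apply Rmax_l|].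
  apply (bsupp_le f L); [apply Rmax_r|assumption]. Qed.

Lemma Cc_box2 f g : Cc f -> Cc g -> exists L, 0 <= L /\ bsupp f L /\ bsupp g L.
Proof.
intros F G; destruct (Cc_box f F) as [L [HL BL]], (Cc_box g G) as [M [HM BM]].
exists (Rmax L M); split; [|split].
- eapply Rle_trans; [exact HL|apply Rmax_l].
- apply (bsupp_le f L); [apply Rmax_l|assumption].
- apply (bsupp_le g M); [apply Rmax_r|assumption].
Qed.

Lemma I_lin f g s t : Cc f -> Cc g -> int3 (fun y => s * f y + t * g y) = s * int3 f + t * int3 g.
Proof.
intros F G. destruct (Cc_box2 f g F G) as [L [HL [BF BG]]].
assert (UF := Cc_uc f F). assert (UG := Cc_uc g G).
rewrite (I_box_int f L), (I_box_int g L) by auto.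
rewrite (I_box_int _ L); auto.
2:{ apply Cc_plus; now apply Cc_scal. }
2:{ intros y Hy. destruct (Req_dec (f y) 0) as [E|E]; [|now apply BF]. apply BG.
  intros E'; apply Hy; rewrite E, E'; ring. }
assert (lin : forall u v : R -> R, (forall x, continuous u x) -> (forall x, continuous v x) ->
   RInt (fun x => s * u x + t * v x) (-L) L = s * RInt u (-L) L + t * RInt v (-L) L).
{ intros u v Hu Hv.
  rewrite (RInt_plus (V := R_CompleteNormedModule) (fun x => s * u x) (fun x => t * v x)).
  - rewrite (RInt_scal (V := R_CompleteNormedModule) u), (RInt_scal (V := R_CompleteNormedModule) v) by now apply
    ex_RInt_ct. reflexivity.
  - apply (ex_RInt_scal (V := R_NormedModule)); now apply ex_RInt_ct.
  - apply (ex_RInt_scal (V := R_NormedModule)); now apply ex_RInt_ct. }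
unfold box_int. rewrite <- lin by (intros; now apply plane_int_cont). apply RInt_ext; intros a _.
unfold plane_int. rewrite <- lin by (intros; now apply line_int_cont). apply RInt_ext; intros b _.
unfold line_int. rewrite <- lin by (intros; now apply unif_cont_cont1). reflexivity.
Qed.

Lemma I_ext f g : (forall y, f y = g y) -> int3 f = int3 g.
Proof. intros E; now replace g with f by now apply functional_extensionality. Qed.

Lemma I_plus f g : Cc f -> Cc g -> int3 (fun y => f y + g y) = int3 f + int3 g.
Proof. intros F G. rewrite (I_ext _ (fun y => 1 * f y + 1 * g y)) by (intros; ring). rewrite I_lin; auto; ring. Qed.
Lemma I_minus f g : Cc f -> Cc g -> int3 (fun y => f y - g y) = int3 f - int3 g.
Proof. intros F G. rewrite (I_ext _ (fun y => 1 * f y + (-1) * g y)) by (intros; ring). rewrite I_lin; auto; ring.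
  Qed.
Lemma I_scal c f : Cc f -> int3 (fun y => c * f y) = c * int3 f.
Proof. intros F. rewrite (I_ext _ (fun y => c * f y + 0 * f y)) by (intros; ring). rewrite I_lin; auto; ring. Qed.
Lemma I_0 : int3 (fun _ => 0) = 0.
Proof. rewrite (I_ext _ (fun y => 0 * (fun _ => 0) y)) by (intros; ring). rewrite I_scal; [ring|apply Cc_0]. Qed.

Lemma I_ge0 f : Cc f -> (forall y, 0 <= f y) -> 0 <= int3 f.
Proof.
intros F H. destruct (Cc_box f F) as [L [HL B]]. assert (U := Cc_uc f F). rewrite (I_box_int f L) by auto.
apply RInt_ge_0; [lra|apply ex_RInt_ct; intros; now apply plane_int_cont|]. intros a _.
apply RInt_ge_0; [lra|apply ex_RInt_ct; intros; now apply line_int_cont|]. intros b _.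
apply RInt_ge_0; [lra|apply ex_RInt_ct; intros; now apply unif_cont_cont1|]. auto.
Qed.

Lemma I_le f g : Cc f -> Cc g -> (forall y, f y <= g y) -> int3 f <= int3 g.
Proof.
intros F G H. assert (0 <= int3 (fun y => g y - f y)).
{ apply I_ge0; [now apply Cc_minus|]. intros y; specialize (H y); lra. }
rewrite I_minus in H0; auto; lra.
Qed.

(** The thickness b - a appears as a factor. In the odd reflection this factor pays for a derivative
    of a cutoff in height that blows up like the inverse thickness. *)
Lemma I_slab f L M a b : Cc f -> bsupp f L -> 0 <= L -> (forall y, f y <> 0 -> a <= px3 y <= b) -> a <= b ->
  (forall y, Rabs (f y) <= M) -> Rabs (int3 f) <= M * (b - a) * (2 * L) * (2 * L).
Proof.
intros F B HL Hs Hab HM. assert (U := Cc_uc f F). rewrite (I_box_int f L) by auto.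
assert (K3 : forall a' b', Rabs (line_int L f a' b') <= M * (b - a)).
{ intros. apply RInt_slab; auto; intros.
  - now apply unif_cont_cont1.
  - apply (Hs _ H). }
assert (K2 : forall a', Rabs (plane_int L f a') <= M * (b - a) * (2 * L)).
{ intros. replace (M * (b - a) * (2 * L)) with ((L - - L) * (M * (b - a))) by ring.
  apply abs_RInt_le_const; auto; [lra|]. apply ex_RInt_ct; intros; now apply line_int_cont. }
replace (M * (b - a) * (2 * L) * (2 * L)) with ((L - - L) * (M * (b - a) * (2 * L))) by ring.
apply abs_RInt_le_const; auto; [lra|]. apply ex_RInt_ct; intros; now apply plane_int_cont.
Qed.

Lemma I_bound f L M : Cc f -> bsupp f L -> 0 <= L -> (forall y, Rabs (f y) <= M) -> Rabs (int3 f) <= 8 * L ^ 3 * M.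
Proof.
intros F B HL HM. replace (8 * L ^ 3 * M) with (M * (L - - L) * (2 * L) * (2 * L)) by ring.
apply I_slab; auto; try lra. intros y Hy. apply Rabs_le_between. now destruct (B y Hy) as [_ [_ ?]].
Qed.

Lemma Rabs_I_le f g : Cc f -> Cc g -> (forall y, Rabs (f y) <= g y) -> Rabs (int3 f) <= int3 g.
Proof.
intros F G H. apply Rabs_le; split.
- replace (- int3 g) with (int3 (fun y => -1 * g y)) by (rewrite I_scal; auto; ring).
  apply I_le; auto; [now apply Cc_scal|]. intros y; specialize (H y). apply Rabs_le_between in H; lra.
- apply I_le; auto. intros y; specialize (H y). apply Rabs_le_between in H; lra.
Qed.

Lemma RInt_gt0 (f : R -> R) L x : 0 <= L -> (forall t, continuous f t) -> (forall t, 0 <= f t) -> 0 < f x -> 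
  (forall t, L < Rabs t -> f t = 0) -> 0 < RInt f (-L) L.
Proof.
intros HL Hc H0 Hx Hz.
(* The interval is enlarged by one so that a neighbourhood of x of radius at most 1 fits inside even
   if x is an endpoint. *)
rewrite <- (RInt_support f L (L + 1)) by (auto; lra).
destruct (proj1 (filterlim_locally f (f x)) (Hc x) (mkposreal (f x) Hx)) as [d Hd].
assert (Dp := cond_pos d). assert (X : Rabs x <= L) by (destruct (Rle_dec (Rabs x) L) as [q|q]; auto; exfalso;
  assert (q0 : f x = 0) by (apply Hz; lra); lra).
apply Rabs_le_between in X.
pose (e := Rmin d 1). assert (0 < e <= d /\ e <= 1).
{ unfold e; repeat split; [apply Rmin_pos; lra|apply Rmin_l|apply Rmin_r]. }
rewrite <- (RInt_Chasles f _ (x - e)), <- (RInt_Chasles f (x - e) (x + e)) by now apply ex_RInt_ct.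
assert (0 <= RInt f (- (L + 1)) (x - e)) by (apply RInt_ge_0; auto; [lra|now apply ex_RInt_ct]).
assert (0 <= RInt f (x + e) (L + 1)) by (apply RInt_ge_0; auto; [lra|now apply ex_RInt_ct]).
assert (0 < RInt f (x - e) (x + e)).
{ apply RInt_gt_0; auto; [lra|]. intros t Ht.
  assert (Q : ball x d t) by (unfold ball; simpl; unfold AbsRing_ball, abs, minus, plus, opp; simpl;
    apply Rabs_lt_between; lra).
  specialize (Hd t Q). unfold ball in Hd; simpl in Hd; unfold AbsRing_ball, abs, minus, plus, opp in Hd; simpl in Hd.
  apply Rabs_lt_between in Hd; lra. }
unfold plus; simpl; lra.
Qed.

Lemma I_gt0 f x : Cc f -> (forall y, 0 <= f y) -> 0 < f x -> 0 < int3 f.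
Proof.
intros F H Hx. destruct (Cc_box f F) as [L [HL B]]. assert (U := Cc_uc f F). rewrite (I_box_int f L) by auto.
assert (Z3 : forall a b, 0 <= line_int L f a b).
{ intros. apply RInt_ge_0; [lra|apply ex_RInt_ct; intros; now apply unif_cont_cont1|auto]. }
assert (Z2 : forall a, 0 <= plane_int L f a).
{ intros. apply RInt_ge_0; [lra|apply ex_RInt_ct; intros; now apply line_int_cont|auto]. }
apply (RInt_gt0 _ L (px1 x)); auto; [intros; now apply plane_int_cont| |intros; now apply (plane_int_0 f L)].
apply (RInt_gt0 _ L (px2 x)); auto; [intros; now apply line_int_cont| |intros; now apply (line_int_0 f L); auto].
apply (RInt_gt0 _ L (px3 x)); auto; [intros; now apply unif_cont_cont1|now rewrite pt_eta|].
intros; apply (bsupp_0 f L); cbn; auto.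
Qed.

(** * Invariance of the integral under translations and under reflection in the plane *)

Lemma bsupp_shift f L i t : bsupp f L -> bsupp (fun y => f (shift y i t)) (L + Rabs t).
Proof.
intros B y Hy. destruct (B _ Hy) as [A1 [A2 A3]].
assert (T := Rabs_pos t). assert (Q : - Rabs t <= t <= Rabs t) by (apply Rabs_le_between; lra).
unfold inbox; rewrite !Rabs_le_between in *. destruct i as [|[|i]]; cbn in *; repeat split; lra.
Qed.

Lemma Cc_shift f i t : Cc f -> Cc (fun y => f (shift y i t)).
Proof.
intros [C [L B]]; split; [intros; now apply ct_shift|]. exists (L + Rabs t). now apply bsupp_shift.
Qed.

Lemma I_shift f i t : Cc f -> int3 (fun y => f (shift y i t)) = int3 f.
Proof.
intros F. destruct (Cc_box f F) as [L [HL B]]. assert (U := Cc_uc f F).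
assert (F' := Cc_shift f i t F). assert (U' := Cc_uc _ F'). assert (T := Rabs_pos t).
assert (B' : bsupp f (L + Rabs t)) by (apply (bsupp_le f L); [lra|assumption]).
assert (B2 := bsupp_shift f L i t B).
rewrite (I_box_int f (L + Rabs t) F B'), (I_box_int (fun y => f (shift y i t)) (L + Rabs t) F' B2) by lra.
pose (M := L + Rabs t). fold M. assert (HM : 0 <= M) by (unfold M; lra).
destruct i as [|[|i]]; unfold box_int.
- rewrite <- (RInt_translate (fun a => plane_int M f a) L M t); auto; try (unfold M; lra).
  + intros; apply plane_int_cont; auto.
  + intros; apply (plane_int_0 f L); auto.
- apply RInt_ext; intros a _. unfold plane_int.
  rewrite <- (RInt_translate (fun b => line_int M f a b) L M t); auto; try (unfold M; lra).
  + intros; apply line_int_cont; auto.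
  + intros; apply (line_int_0 f L); auto.
- apply RInt_ext; intros a _. apply RInt_ext; intros b _. unfold line_int.
  rewrite <- (RInt_translate (fun c => f (mkpt a b c)) L M t); auto; try (unfold M; lra).
  + intros; now apply unif_cont_cont1.
  + intros; apply (bsupp_0 f L); cbn; auto.
Qed.

Definition mirror (y : pt) : pt := mkpt (px1 y) (px2 y) (- px3 y).

Lemma mirror_mirror y : mirror (mirror y) = y.
Proof. apply pt_eq; cbn; ring. Qed.

Lemma near_mirror d x y : near d x y -> near d (mirror x) (mirror y).
Proof.
intros [A [B C]]; repeat split; cbn; auto. replace (- px3 y - - px3 x) with (- (px3 y - px3 x)) by ring.
  now rewrite Rabs_Ropp.
Qed.

Lemma ct_mirror f x : ct f (mirror x) -> ct (fun y => f (mirror y)) x.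
Proof.
rewrite !ct_iff; intros H e He; destruct (H e He) as [d [Hd K]]; exists d; split; auto.
intros y Hy; apply K; now apply near_mirror.
Qed.

Lemma Cc_mirror f : Cc f -> Cc (fun y => f (mirror y)).
Proof.
intros [C [L B]]; split; [intros; now apply ct_mirror|]. exists L. intros y Hy. destruct (B _ Hy) as [A1 [A2 A3]].
repeat split; cbn in *; auto. now rewrite Rabs_Ropp in A3.
Qed.

Lemma I_mirror f : Cc f -> int3 (fun y => f (mirror y)) = int3 f.
Proof.
intros F. destruct (Cc_box f F) as [L [HL B]]. assert (U := Cc_uc f F).
assert (B' : bsupp (fun y => f (mirror y)) L).
{ intros y Hy. destruct (B _ Hy) as [A1 [A2 A3]]. repeat split; cbn in *; auto. now rewrite Rabs_Ropp in A3. }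
rewrite (I_box_int f L F B HL), (I_box_int (fun y => f (mirror y)) L (Cc_mirror f F) B' HL).
apply RInt_ext; intros a _. apply RInt_ext; intros b _. unfold line_int.
rewrite <- (opp_RInt_swap (fun c => f (mkpt a b c))) by (apply ex_RInt_ct; intros; now apply unif_cont_cont1).
replace (RInt (fun c => f (mkpt a b c)) L (- L)) with (RInt (fun c => f (mkpt a b c)) (-1 * - L + 0) (-1 * L + 0))
  by (f_equal; ring).
rewrite <- (RInt_comp_lin (V := R_CompleteNormedModule) (fun c => f (mkpt a b c)) (-1) 0) by (apply ex_RInt_ct;
  intros; now apply unif_cont_cont1).
rewrite <- (RInt_opp (V := R_CompleteNormedModule)).
- apply RInt_ext; intros c _. unfold opp, scal; simpl; unfold mult; simpl. unfold mirror; cbn.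
  replace (-1 * c + 0) with (- c) by ring. ring.
- apply (ex_RInt_comp_lin (V := R_NormedModule) (fun c => f (mkpt a b c)) (-1) 0).
  apply ex_RInt_ct; intros; now apply unif_cont_cont1.
Qed.

(** * Partial derivatives and differentiation under translation *)

Definition pd (i : nat) (f : pt -> R) (x : pt) (l : R) : Prop := is_derive (fun t => f (shift x i t)) 0 l.

Lemma pd_shift i f x s l : pd i f (shift x i s) l -> is_derive (fun t => f (shift x i t)) s l.
Proof.
intros H. unfold pd in H.
apply (is_derive_ext (fun t => f (shift (shift x i s) i (t - s)))).
- intros t; rewrite shift_shift; do 2 f_equal; ring.
- evar_last.
  + apply (is_derive_comp (fun t => f (shift (shift x i s) i t)) (fun t => t - s)).
    * rewrite Rminus_diag; exact H.
    * auto_derive; auto.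
  + unfold scal; simpl; unfold mult; simpl; rring.
Qed.

Lemma pd_MVT i f g x t : (forall s, Rmin 0 t <= s <= Rmax 0 t -> pd i f (shift x i s) (g (shift x i s))) ->
  exists s, Rmin 0 t <= s <= Rmax 0 t /\ f (shift x i t) - f x = t * g (shift x i s).
Proof.
intros H.
destruct (MVT_gen (fun s => f (shift x i s)) 0 t (fun s => g (shift x i s))) as [s [Hs E]].
- intros s Hs. apply pd_shift, H. lra.
- intros s Hs. apply derivable_continuous_pt. exists (g (shift x i s)). apply is_derive_Reals. now apply pd_shift, H.
- exists s; split; auto. rewrite shift_0 in E. rewrite E; ring.
Qed.

Lemma Rabs_between_0 s t : Rmin 0 t <= s <= Rmax 0 t -> Rabs s <= Rabs t.
Proof.
intros H. unfold Rmin, Rmax, Rabs in *. destruct (Rle_dec 0 t); destruct (Rcase_abs s), (Rcase_abs t); lra.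
Qed.

(* Translation invariance makes every difference quotient integrate to zero. *)
Lemma I_pd i f g : Cc f -> Cc g -> (forall y, pd i f y (g y)) -> int3 g = 0.
Proof.
intros F G H. destruct (Cc_box2 f g F G) as [L [HL [BF BG]]].
apply NNPP; intros N. assert (P := Rabs_pos_lt _ N).
(* The difference quotient will differ from g by at most e on a cube of volume 8 (L + 1)^3, so the
   total error is half of the integral that is supposed to be nonzero. *)
pose (e := Rabs (int3 g) / 2 / (8 * (L + 1) ^ 3)).
assert (Q : 0 < 8 * (L + 1) ^ 3) by (assert (0 < (L+1)^3) by (apply pow_lt; lra); lra).
assert (He : 0 < e) by (unfold e; repeat apply Rdiv_lt_0_compat; lra).
destruct (Cc_uc g G e He) as [d [Hd U]].
pose (t := Rmin (d / 2) 1). assert (Ht : 0 < t <= d / 2 /\ t <= 1).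
{ unfold t; repeat split; [apply Rmin_pos; lra|apply Rmin_l|apply Rmin_r]. }
assert (C1 : Cc (fun y => f (shift y i t) - f y)) by (apply Cc_minus; auto using Cc_shift).
assert (B : Rabs (int3 (fun y => g y - / t * (f (shift y i t) - f y))) <= 8 * (L + 1) ^ 3 * e).
{ apply I_bound; try lra.
  - apply Cc_minus; auto. now apply Cc_scal.
  - intros y Hy. destruct (Req_dec (g y) 0) as [E|E].
    + destruct (Req_dec (f y) 0) as [E1|E1].
      * apply (inbox_le (L + Rabs t)); [rewrite Rabs_right; lra|]. apply (bsupp_shift f L i t); auto.
        intros E2; apply Hy; rewrite E, E1, E2; ring.
      * apply (inbox_le L); [lra|now apply BF].
    + apply (inbox_le L); [lra|now apply BG].
  - intros y. destruct (pd_MVT i f g y t) as [s [Hs E]]; [intros; apply H|].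
    rewrite E. replace (g y - / t * (t * g (shift y i s))) with (- (g (shift y i s) - g y)) by (field; lra).
    rewrite Rabs_Ropp. left; apply U, near_shift. apply Rabs_between_0 in Hs. rewrite (Rabs_right t) in Hs; lra. }
rewrite I_minus, I_scal, I_minus, I_shift in B; auto using Cc_scal, Cc_shift.
replace (int3 g - / t * (int3 f - int3 f)) with (int3 g) in B by ring.
unfold e in B. replace (8 * (L + 1) ^ 3 * (Rabs (int3 g) / 2 / (8 * (L + 1) ^ 3))) with (Rabs (int3 g) / 2) in B by
  (field; lra).
lra.
Qed.

Definition tr (v y : pt) : pt := mkpt (px1 y + px1 v) (px2 y + px2 v) (px3 y + px3 v).

Lemma tr_shift v y : tr v y = shift (shift (shift y 0 (px1 v)) 1 (px2 v)) 2 (px3 v).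
Proof. apply pt_eq; cbn; ring. Qed.

Lemma Cc_tr f v : Cc f -> Cc (fun y => f (tr v y)).
Proof.
intros F. apply (Cc_ext (fun y => f (shift (shift (shift y 0 (px1 v)) 1 (px2 v)) 2 (px3 v)))); [intros;
  now rewrite tr_shift|].
apply (Cc_shift (fun y => f (shift (shift y 1 (px2 v)) 2 (px3 v)))).
apply (Cc_shift (fun y => f (shift y 2 (px3 v)))). now apply Cc_shift.
Qed.

Lemma I_tr f v : Cc f -> int3 (fun y => f (tr v y)) = int3 f.
Proof.
intros F. rewrite (I_ext _ (fun y => f (shift (shift (shift y 0 (px1 v)) 1 (px2 v)) 2 (px3 v)))) by (intros;
  now rewrite tr_shift).
assert (F1 := Cc_shift f 2 (px3 v) F). assert (F2 := Cc_shift _ 1 (px2 v) F1).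
rewrite (I_shift (fun y => f (shift (shift y 1 (px2 v)) 2 (px3 v)))) by exact F2.
rewrite (I_shift (fun y => f (shift y 2 (px3 v)))) by exact F1. now apply I_shift.
Qed.
Global Opaque int3.

Lemma pd_const i c x : pd i (fun _ => c) x 0.
Proof. apply (is_derive_const c 0). Qed.
Lemma pd_plus i f g x a b : pd i f x a -> pd i g x b -> pd i (fun y => f y + g y) x (a + b).
Proof. intros; now apply (is_derive_plus (fun t => f (shift x i t)) (fun t => g (shift x i t))). Qed.
Lemma pd_minus i f g x a b : pd i f x a -> pd i g x b -> pd i (fun y => f y - g y) x (a - b).
Proof. intros; now apply (is_derive_minus (fun t => f (shift x i t)) (fun t => g (shift x i t))). Qed.
Lemma pd_mult i f g x a b : pd i f x a -> pd i g x b -> pd i (fun y => f y * g y) x (a * g x + f x * b).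
Proof.
intros Ha Hb. unfold pd. evar_last.
- apply (is_derive_mult (fun t => f (shift x i t)) (fun t => g (shift x i t)) 0 a b Ha Hb).
  intros; apply Rmult_comm.
- rewrite !shift_0. reflexivity.
Qed.
Lemma pd_val i f x a b : a = b -> pd i f x a -> pd i f x b.
Proof. now intros ->. Qed.
Lemma pd_scal i c f x a : pd i f x a -> pd i (fun y => c * f y) x (c * a).
Proof. intros; eapply pd_val; [|apply pd_mult; [apply pd_const|eassumption]]. cbn; ring. Qed.
Lemma pd_unique i f x a b : pd i f x a -> pd i f x b -> a = b.
Proof. intros Ha Hb. rewrite <- (is_derive_unique _ _ _ Ha). now apply is_derive_unique. Qed.
Lemma pd_ext_near i f g x a d : 0 < d -> (forall y, near d x y -> f y = g y) -> pd i f x a -> pd i g x a.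
Proof.
intros Hd E H. apply (is_derive_ext_loc (fun t => f (shift x i t))); auto.
exists (mkposreal d Hd). intros t Ht. apply E, near_shift. 
unfold ball in Ht; simpl in Ht; unfold AbsRing_ball, abs, minus, plus, opp in Ht; simpl in Ht.
now rewrite Ropp_0, Rplus_0_r in Ht.
Qed.
Lemma pd_ext i f g x a : (forall y, f y = g y) -> pd i f x a -> pd i g x a.
Proof. intros E; apply (pd_ext_near i f g x a 1); auto; lra. Qed.
Lemma pd_comp i (h : R -> R) f x a b : pd i f x a -> is_derive h (f x) b -> pd i (fun y => h (f y)) x (b * a).
Proof.
intros Ha Hb. unfold pd. evar_last.
- apply (is_derive_comp h (fun t => f (shift x i t)) 0 b a); [now rewrite shift_0|exact Ha].
- unfold scal; simpl; unfold mult; simpl; apply Rmult_comm.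
Qed.

(* As for [shift] and [coord], every index above 1 denotes the third coordinate. *)
Definition kronecker (i j : nat) : R := if Nat.eqb (Nat.min i 2) (Nat.min j 2) then 1 else 0.

Lemma pd_coord i j x : pd i (fun y => coord y j) x (kronecker i j).
Proof.
unfold pd, kronecker. destruct i as [|[|i]], j as [|[|j]]; cbn; rewrite ?Nat.min_0_r; cbn; auto_derive; auto; ring.
Qed.

Definition sq (x y : pt) : R := (px1 y - px1 x)^2 + (px2 y - px2 x)^2 + (px3 y - px3 x)^2.

Lemma sq_ge0 x y : 0 <= sq x y.
Proof. unfold sq. pose proof (pow2_ge_0 (px1 y - px1 x)); pose proof (pow2_ge_0 (px2 y - px2 x));
  pose proof (pow2_ge_0 (px3 y - px3 x)). lra. Qed.
Lemma ct_sq x y : ct (sq x) y.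
Proof. unfold sq; ctt. Qed.
Lemma pd_sq i x y : pd i (sq x) y (2 * (coord y i - coord x i)).
Proof. unfold pd, sq. destruct i as [|[|i]]; cbn; auto_derive; auto; ring. Qed.
Lemma near_sq x y d : 0 < d -> sq x y < d^2 -> near d x y.
Proof.
unfold sq; intros Hd H. assert (P : forall u, u^2 < d^2 -> Rabs u < d).
{ intros u Hu. apply Rabs_lt_between; nra. }
pose proof (pow2_ge_0 (px1 y - px1 x)); pose proof (pow2_ge_0 (px2 y - px2 x));
  pose proof (pow2_ge_0 (px3 y - px3 x)).
repeat split; apply P; lra.
Qed.
Lemma sq_near x y d : near d x y -> sq x y < 3 * d^2.
Proof.
intros [H1 [H2 H3]]. unfold sq. assert (P : forall u, Rabs u < d -> u^2 < d^2).
{ intros u Hu. apply Rabs_lt_between in Hu; nra. }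
apply P in H1, H2, H3. lra.
Qed.

Definition all (x : pt) : Prop := True.

(** * Second derivatives, test functions and weak solutions *)

(* [p i] and [q i] are the first and the pure second derivatives of [f] in the direction [i]. *)
Definition C2on (S : pt -> Prop) (f : pt -> R) (p q : nat -> pt -> R) : Prop :=
  forall y, S y -> ct f y /\ forall i, pd i f y (p i y) /\ ct (p i) y /\ pd i (p i) y (q i y) /\ ct (q i) y.

Definition lap (q : nat -> pt -> R) (y : pt) : R := q 0%nat y + q 1%nat y + q 2%nat y.

Lemma ct_lap q y : (forall i, ct (q i) y) -> ct (lap q) y.
Proof. intros H; unfold lap; ctt; apply H. Qed.

Lemma C2on_mult S f p q g p' q' : C2on S f p q -> C2on S g p' q' ->
  C2on S (fun y => f y * g y) (fun i y => p i y * g y + f y * p' i y)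
    (fun i y => q i y * g y + 2 * (p i y * p' i y) + f y * q' i y).
Proof.
intros F G y Sy. destruct (F y Sy) as [F0 F1], (G y Sy) as [G0 G1]. split; [now apply ct_mult|].
intros i. destruct (F1 i) as [A1 [A2 [A3 A4]]], (G1 i) as [B1 [B2 [B3 B4]]]. refine (conj _ (conj _ (conj _ _))).
- now apply pd_mult.
- ctt.
- eapply pd_val; [|apply pd_plus; apply pd_mult; eassumption]. cbn; ring.
- ctt.
Qed.

Lemma C2on_lin S f p q g p' q' a b : C2on S f p q -> C2on S g p' q' ->
  C2on S (fun y => a * f y + b * g y) (fun i y => a * p i y + b * p' i y) (fun i y => a * q i y + b * q' i y).
Proof.
intros F G y Sy. destruct (F y Sy) as [F0 F1], (G y Sy) as [G0 G1].
split; [ctt|].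
intros i. destruct (F1 i) as [A1 [A2 [A3 A4]]], (G1 i) as [B1 [B2 [B3 B4]]]. refine (conj _ (conj _ (conj _ _)));
 ctt; apply pd_plus; now apply pd_scal.
Qed.

Lemma C2on_sub S S' f p q : (forall y, S' y -> S y) -> C2on S f p q -> C2on S' f p q.
Proof. intros H F y Sy; auto. Qed.

(* Only derivatives on [0, oo) matter: the argument is a squared distance. *)
Lemma C2on_radial x (h h1 h2 : R -> R) : (forall t, 0 <= t -> is_derive h t (h1 t)) ->
  (forall t, 0 <= t -> is_derive h1 t (h2 t)) -> (forall t, 0 <= t -> continuous h2 t) ->
  C2on all (fun y => h (sq x y)) (fun i y => h1 (sq x y) * (2 * (coord y i - coord x i)))
    (fun i y => 4 * (coord y i - coord x i)^2 * h2 (sq x y) + 2 * h1 (sq x y)).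
Proof.
intros H H1 H2 y _. assert (P := sq_ge0 x y).
assert (C0 : continuous h (sq x y)) by (apply (ex_derive_continuous h); eexists; now apply H).
assert (C1 : continuous h1 (sq x y)) by (apply (ex_derive_continuous h1); eexists; now apply H1).
split; [apply ct_comp; auto using ct_sq|].
intros i. assert (Q : ct (fun y => coord y i - coord x i) y) by (apply ct_minus; auto using ct_coord, ct_const).
assert (Q1 : ct (fun y => h1 (sq x y)) y) by (apply ct_comp; auto using ct_sq).
refine (conj _ (conj _ (conj _ _))).
- apply pd_comp; auto using pd_sq.
- ctt.
- eapply pd_val; [|apply pd_mult; [apply pd_comp; [apply pd_sq|now apply H1]|apply pd_scal, pd_minus;
  [apply pd_coord|apply pd_const]]].
  unfold kronecker; rewrite Nat.eqb_refl. cbn; ring.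
- ctt. apply ct_comp; auto using ct_sq.
Qed.

Lemma lap_radial x (h1 h2 : R -> R) y :
  lap (fun i y => 4 * (coord y i - coord x i)^2 * h2 (sq x y) + 2 * h1 (sq x y)) y = 6 * h1 (sq x y) + 4 * sq x y *
    h2 (sq x y).
Proof. unfold lap; cbn. unfold sq at 5. ring_simplify. unfold sq; ring. Qed.

Definition nz (f : pt -> R) (y : pt) : Prop := f y <> 0.

(** C^2 regularity suffices, since test functions are only ever hit by the Laplacian. This admits
    products of the piecewise polynomial cutoff with regularised kernels. *)
Definition test (S : pt -> Prop) (f : pt -> R) (p q : nat -> pt -> R) : Prop :=
  C2on all f p q /\ (exists L, bsupp f L) /\ exists m, margin S (nz f) m.

(** The dichotomy behind every product V f with V meaningful only on S: either V is controlled at y,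
    or the product is zero around y whatever values V takes there. *)
Lemma margin_dead S f m y : margin S (nz f) m -> S y \/ forall z, near m y z -> f z = 0.
Proof.
intros [Hm H]. destruct (classic (forall z, near m y z -> f z = 0)) as [E|E]; auto.
left. apply not_all_ex_not in E as [z E]. apply imply_to_and in E as [E1 E2].
apply (H z E2). now apply near_sym.
Qed.

Lemma dead_derivs f p q y d : C2on all f p q -> 0 < d -> (forall z, near d y z -> f z = 0) ->
  forall z, near (d/2) y z -> forall i, p i z = 0 /\ q i z = 0.
Proof.
intros C Hd Z.
(* Each differentiation costs a quarter of the radius: the first derivatives vanish on the cube of 3
   d / 4, the second ones on that of d / 2. *)
assert (P : forall z, near (d*3/4) y z -> forall i, p i z = 0).
{ intros z Hz i. apply (pd_unique i f z).
  - destruct (C z Logic.I) as [_ C1]; apply C1.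
  - apply (pd_ext_near i (fun _ => 0) f z 0 (d/4)); [lra| |apply pd_const].
    intros u Hu. symmetry; apply Z. eapply near_le; [|eapply near_trans; eassumption]; lra. }
intros z Hz i. split; [apply P; eapply near_le; [|exact Hz]; lra|].
apply (pd_unique i (p i) z).
- destruct (C z Logic.I) as [_ C1]; apply C1.
- apply (pd_ext_near i (fun _ => 0) (p i) z 0 (d/4)); [lra| |apply pd_const].
  intros u Hu. symmetry; apply P. eapply near_le; [|eapply near_trans; eassumption]; lra.
Qed.

Lemma bsupp_dead f L y : bsupp f L -> ~ inbox (L + 1) y -> forall z, near 1 y z -> f z = 0.
Proof.
intros B N z Hz. destruct (Req_dec (f z) 0) as [E|E]; auto. exfalso; apply N.
destruct (B z E) as [B1 [B2 B3]]. destruct Hz as [N1 [N2 N3]].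
unfold inbox; rewrite !Rabs_le_between in *; apply Rabs_lt_between in N1, N2, N3. lra.
Qed.

Lemma bsupp_derivs f p q L : C2on all f p q -> bsupp f L -> forall i, bsupp (p i) (L+1) /\ bsupp (q i) (L+1).
Proof.
intros C B i; split; intros y Hy; apply NNPP; intros N; apply Hy;
 apply (dead_derivs f p q y 1 C Rlt_0_1 (bsupp_dead f L y B N) y); apply near_refl; lra.
Qed.

Lemma margin_derivs S f p q m : C2on all f p q -> margin S (nz f) m ->
  forall i, margin S (nz (p i)) (m/2) /\ margin S (nz (q i)) (m/2).
Proof.
intros C [Hm M].
assert (Q : forall i y, p i y <> 0 \/ q i y <> 0 -> exists z, near (m/2) y z /\ f z <> 0).
{ intros i y H. apply NNPP; intros N.
  destruct (dead_derivs f p q y (m/2) C ltac:(lra)) with (z := y) (i := i); [|apply near_refl; lra|tauto].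
  intros z Hz. apply NNPP; intros E. apply N; eauto. }
intros i; split; (split; [lra|]); intros y Hy z Hz; (destruct (Q i y) as [u [U1 U2]]; [unfold nz in Hy; auto|]);
 apply (M u U2); replace m with (m/2 + m/2) by field; eapply near_trans; eauto using near_sym.
Qed.

Lemma Cc_margin S V g L m : (forall y, S y -> ct V y) -> (forall y, ct g y) -> bsupp g L -> margin S (nz g) m ->
  Cc (fun y => V y * g y).
Proof.
intros HV Hg B M. split.
- intros y. destruct (margin_dead _ _ _ y M) as [Sy|D].
  + apply ct_mult; auto.
  + apply (ct_ext_near (fun _ => 0) _ y m); [apply M| |apply ct_const]. intros z Hz; rewrite (D z Hz); ring.
- exists L; intros y Hy; apply B. intros E; apply Hy; rewrite E; ring.
Qed.

Lemma test_Cc S f p q V : test S f p q -> (forall y, S y -> ct V y) ->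
  Cc (fun y => V y * f y) /\ forall i, Cc (fun y => V y * p i y) /\ Cc (fun y => V y * q i y).
Proof.
intros [C [[L B] [m M]]] HV. split.
- apply (Cc_margin S V f L m); auto. intros y; now destruct (C y Logic.I).
- intros i. destruct (bsupp_derivs _ _ _ _ C B i), (margin_derivs _ _ _ _ _ C M i). split.
  + apply (Cc_margin S V (p i) (L+1) (m/2)); auto. intros y; destruct (C y Logic.I) as [_ C1]; apply C1.
  + apply (Cc_margin S V (q i) (L+1) (m/2)); auto. intros y; destruct (C y Logic.I) as [_ C1]; apply C1.
Qed.

Lemma test_Cc0 S f p q V : test S f p q -> (forall y, S y -> ct V y) -> Cc (fun y => V y * f y).
Proof. intros T HV; now destruct (test_Cc _ _ _ _ V T HV). Qed.
Lemma test_Cc1 S f p q V i : test S f p q -> (forall y, S y -> ct V y) -> Cc (fun y => V y * p i y).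
Proof. intros T HV; destruct (test_Cc _ _ _ _ V T HV) as [_ H]; apply H. Qed.
Lemma test_Cc2 S f p q V i : test S f p q -> (forall y, S y -> ct V y) -> Cc (fun y => V y * q i y).
Proof. intros T HV; destruct (test_Cc _ _ _ _ V T HV) as [_ H]; apply H. Qed.

Lemma test_Cc_lap S f p q V k : test S f p q -> (forall y, S y -> ct V y) -> Cc (fun y => V y * (lap q y + k * f y)).
Proof.
intros T HV. destruct (test_Cc _ _ _ _ V T HV) as [T0 T1].
apply (Cc_ext (fun y => V y * q 0%nat y + V y * q 1%nat y + V y * q 2%nat y + k * (V y * f y))).
- intros; unfold lap; ring.
- cct; apply T1.
Qed.

(** Solutions in the sense of distributions, but required to be continuous so that all pairings are
    integrals of continuous functions of compact support. No derivative of W is mentioned, which is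
    what makes the notion usable across the plane in the odd reflection. *)
Definition weak_helmholtz (k : R) (S : pt -> Prop) (W : pt -> R) : Prop :=
  (forall y, S y -> ct W y) /\
  forall f p q, test S f p q -> int3 (fun y => W y * (lap q y + k^2 * f y)) = 0.

Lemma weak_helmholtz_sub k S S' W : (forall y, S' y -> S y) -> weak_helmholtz k S W -> weak_helmholtz k S' W.
Proof.
intros H [C E]; split; auto. intros f p q [T1 [T2 [m [Hm M]]]]. apply (E f p q). split; [auto|split; auto].
exists m; split; auto. intros y Hy z Hz; apply H; eapply M; eauto.
Qed.

Lemma weak_helmholtz_lin k S V W a b : weak_helmholtz k S V -> weak_helmholtz k S W ->
  weak_helmholtz k S (fun y => a * V y + b * W y).
Proof.
intros [C E] [C' E']; split.
- intros y Sy; ctt; auto.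
- intros f p q T. rewrite (I_ext _ (fun y => a * (V y * (lap q y + k^2 * f y)) + b * (W y * (lap q y + k^2 * f y))))
  by (intros; ring).
  rewrite I_lin, (E f p q), (E' f p q); auto; try ring; eapply test_Cc_lap; eauto.
Qed.

(** In each direction i the integrand W q_i - Q_i f is the i-th partial derivative of W p_i - P_i f,
    which has compact support in S; [I_pd] makes its integral zero. *)
Lemma green S f p q W P Q : test S f p q -> C2on S W P Q ->
  int3 (fun y => W y * lap q y) = int3 (fun y => lap Q y * f y).
Proof.
intros T HW. assert (T' := T). destruct T' as [C [[L B] [m M]]].
assert (W0 : forall y, S y -> ct W y) by (intros y Sy; now destruct (HW y Sy)).
assert (W1 : forall i y, S y -> ct (P i) y) by (intros i y Sy; destruct (HW y Sy) as [_ H]; apply H).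
assert (W2 : forall i y, S y -> ct (Q i) y) by (intros i y Sy; destruct (HW y Sy) as [_ H]; apply H).
assert (K : forall i, int3 (fun y => W y * q i y - Q i y * f y) = 0).
{ intros i. apply (I_pd i (fun y => W y * p i y - P i y * f y)).
  - cct; [now apply (test_Cc1 S f p q)|apply (test_Cc0 S f p q); auto].
  - cct; [now apply (test_Cc2 S f p q)|apply (test_Cc0 S f p q); auto].
  - intros y. destruct (margin_dead _ _ _ y M) as [Sy|D].
    + destruct (HW y Sy) as [_ H], (C y Logic.I) as [_ H']. destruct (H i) as [A1 [A2 [A3 A4]]],
      (H' i) as [B1 [B2 [B3 B4]]].
      eapply pd_val; [|apply pd_minus; apply pd_mult; eassumption]. cbn; ring.
    + assert (Hm := proj1 M). destruct (dead_derivs _ _ _ _ _ C (proj1 M) D y (near_refl (m/2) y ltac:(lra)) i) as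
      [E1 E2].
      rewrite E2, D by (apply near_refl, M). apply (pd_ext_near i (fun _ => 0) _ y _ (m/2)); [lra| |].
      * intros z Hz. destruct (dead_derivs _ _ _ _ _ C (proj1 M) D z Hz i) as [E3 E4].
        rewrite E3, D; [ring|]. eapply near_le; [|exact Hz]; lra.
      * eapply pd_val; [|apply pd_const]. ring. }
assert (Z : int3 (fun y => (W y * q 0%nat y - Q 0%nat y * f y) + (W y * q 1%nat y - Q 1%nat y * f y) + (W y * q
  2%nat y - Q 2%nat y * f y)) = 0).
{ assert (CC : forall i, Cc (fun y => W y * q i y - Q i y * f y)).
  { intros i; cct; [now apply (test_Cc2 S f p q)|apply (test_Cc0 S f p q); auto]. }
  rewrite I_plus, I_plus, !K; auto using Cc_plus; ring. }
apply Rminus_diag_uniq. rewrite <- I_minus.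
- rewrite <- Z. apply I_ext; intros; unfold lap; ring.
- apply (Cc_ext (fun y => W y * (lap q y + 0 * f y))); [intros; ring|]. eapply test_Cc_lap; eauto.
- apply (test_Cc0 S f p q); auto. intros y Sy. apply ct_lap; auto.
Qed.

Lemma strong_weak k S W P Q : C2on S W P Q -> (forall y, S y -> lap Q y + k^2 * W y = 0) -> weak_helmholtz k S W.
Proof.
intros HW E. assert (W0 : forall y, S y -> ct W y) by (intros y Sy; now destruct (HW y Sy)).
split; auto. intros f p q T. assert (T' := T). destruct T' as [C [[L B] [m M]]].
assert (WQ : forall y, S y -> ct (lap Q) y) by (intros y Sy; apply ct_lap; intros i; destruct (HW y Sy) as [_ H];
  apply H).
rewrite (I_ext _ (fun y => W y * lap q y + k^2 * (W y * f y))) by (intros; ring).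
rewrite I_plus.
- rewrite (green S f p q W P Q), I_scal; auto; [|now apply (test_Cc0 S f p q)].
  rewrite <- I_scal, <- I_plus; [| |apply Cc_scal|]; try (now apply (test_Cc0 S f p q)).
  rewrite (I_ext _ (fun _ => 0)); [apply I_0|]. intros y.
  destruct (Req_dec (f y) 0) as [Z|Z]; [rewrite Z; ring|].
  replace (lap Q y) with (- k^2 * W y); [ring|]. 
  assert (Sy : S y) by (apply (proj2 M y Z); apply near_refl, M). specialize (E y Sy); lra.
- apply (Cc_ext (fun y => W y * (lap q y + 0 * f y))); [intros; ring|]. eapply test_Cc_lap; eauto.
- apply Cc_scal. now apply (test_Cc0 S f p q).
Qed.

Lemma test_mult S f p q g p' q' : test S f p q -> C2on all g p' q' ->
  test S (fun y => f y * g y) (fun i y => p i y * g y + f y * p' i y)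
    (fun i y => q i y * g y + 2 * (p i y * p' i y) + f y * q' i y).
Proof.
intros [C [[L B] [m [Hm M]]]] G. split; [now apply C2on_mult|split].
- exists L; intros y Hy; apply B. intros E; apply Hy; rewrite E; ring.
- exists m; split; auto. intros y Hy; apply M. intros E; apply Hy; rewrite E; ring.
Qed.

Lemma pd_def i f x l : pd i f x l <-> is_derive (fun t => f (shift x i t)) 0 l.
Proof. reflexivity. Qed.

Global Opaque pd.

Ltac toR := match goal with |- @eq _ ?a ?b => change (@eq R a b) end.

Lemma Rmax0_pos s : 0 < s -> Rmax 0 s = s.
Proof. intros; apply Rmax_right; lra. Qed.
Lemma Rmax0_neg s : s <= 0 -> Rmax 0 s = 0.
Proof. intros; apply Rmax_left; lra. Qed.

(** From exponent 2 on the kink of the positive part at zero disappears. Exponents 2 and 3 are used,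
    for the cutoff and for the truncation of eigenfunctions: the cube of the positive part is
    C^2. *)
Lemma is_derive_Rmax_pow n s : is_derive (fun s => (Rmax 0 s)^(S (S n))) s (INR (S (S n)) * (Rmax 0 s)^(S n)).
Proof.
destruct (Rtotal_order s 0) as [H|[H|H]].
- rewrite (Rmax0_neg s) by lra.
  apply (is_derive_ext_loc (fun _ => 0)).
  + assert (P : 0 < - s) by lra. exists (mkposreal _ P). intros y Hy.
    unfold ball in Hy; simpl in Hy; unfold AbsRing_ball, abs, minus, plus, opp in Hy; simpl in Hy.
      apply Rabs_lt_between in Hy.
    rewrite Rmax0_neg by lra. simpl; ring.
  + rewrite pow_i by lia. rewrite Rmult_0_r. apply (is_derive_const 0 s).
- subst s. rewrite (Rmax0_neg 0) by lra. rewrite pow_i, Rmult_0_r by lia.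
  apply is_derive_Reals. intros e He. exists (mkposreal _ (Rmin_pos e 1 He Rlt_0_1)). intros h Hh Hd. simpl in Hd.
  rewrite Rplus_0_l, (Rmax0_neg 0) by lra. rewrite (pow_i (S (S n))) by lia. rewrite Rminus_0_r, Rminus_0_r.
  assert (D1 : Rabs h < e) by (eapply Rlt_le_trans; [exact Hd|apply Rmin_l]).
  assert (D2 : Rabs h < 1) by (eapply Rlt_le_trans; [exact Hd|apply Rmin_r]).
  destruct (Rle_dec h 0) as [N|N].
  + rewrite Rmax0_neg, pow_i by (lra || lia). unfold Rdiv; rewrite Rmult_0_l, Rabs_R0; auto.
  + rewrite Rmax0_pos by lra. rewrite Rabs_right in D1, D2 by lra.
    replace (h ^ S (S n) / h) with (h * h^n) by (simpl; field; lra).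
    assert (0 < h^n <= 1) by (split; [apply pow_lt; lra|rewrite <- (pow1 n); apply pow_incr; lra]).
    rewrite Rabs_right; nra.
- rewrite (Rmax0_pos s) by lra.
  apply (is_derive_ext_loc (fun s => s^(S (S n)))).
  + exists (mkposreal _ H). intros y Hy.
    unfold ball in Hy; simpl in Hy; unfold AbsRing_ball, abs, minus, plus, opp in Hy; simpl in Hy.
      apply Rabs_lt_between in Hy.
    rewrite Rmax0_pos by lra. reflexivity.
  + evar_last; [apply is_derive_pow, is_derive_id|]. simpl. unfold one; simpl. ring.
Qed.

Lemma continuous_Rmax0 s : continuous (fun s => Rmax 0 s) s.
Proof.
apply (continuous_ext (fun s => (s + Rabs s) / 2)).
- intros t. unfold Rmax, Rabs. destruct (Rle_dec 0 t), (Rcase_abs t); lra.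
- apply (continuous_mult (fun s => s + Rabs s) (fun _ => /2)); [|apply continuous_const].
  apply (continuous_plus (fun s => s) Rabs); [apply continuous_id|apply continuous_Rabs].
Qed.

(** * The radial cutoff and the fundamental solutions *)

(* [tau] is a C^3 cutoff in the squared distance: 1 for t <= 1 and 0 for t >= 4. *)
Definition bump (t : R) : R := (Rmax 0 ((4 - t) * (t - 1)))^3.
Definition bump_mass : R := RInt bump 1 4.
Definition tau (t : R) : R := RInt bump t 4 / bump_mass.
Definition tau1 (t : R) : R := - (Rmax 0 ((4 - t) * (t - 1)))^3 / bump_mass.
Definition tau2 (t : R) : R := - (3 * (Rmax 0 ((4 - t) * (t - 1)))^2 * (5 - 2 * t)) / bump_mass.
Definition tau3 (t : R) : R :=
  - (6 * Rmax 0 ((4 - t) * (t - 1)) * (5 - 2 * t)^2 - 6 * (Rmax 0 ((4 - t) * (t - 1)))^2) / bump_mass.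

Lemma is_derive_tu t : is_derive (fun t => (4 - t) * (t - 1)) t (5 - 2 * t).
Proof. auto_derive; auto; ring. Qed.

Lemma is_derive_tm n t : is_derive (fun t => (Rmax 0 ((4 - t) * (t - 1)))^(S (S n))) t
  (INR (S (S n)) * (Rmax 0 ((4 - t) * (t - 1)))^(S n) * (5 - 2 * t)).
Proof.
evar_last; [apply (is_derive_comp (fun s => (Rmax 0 s)^(S (S n))) _ _ _ _ (is_derive_Rmax_pow n _) (is_derive_tu
  t))|].
apply Rmult_comm.
Qed.

Lemma continuous_tm t : continuous (fun t => Rmax 0 ((4 - t) * (t - 1))) t.
Proof.
apply (continuous_comp (fun t => (4 - t) * (t - 1)) (fun s => Rmax 0 s)); [|apply continuous_Rmax0].
apply (ex_derive_continuous (fun t => (4 - t) * (t - 1))). eexists; apply is_derive_tu.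
Qed.

Lemma continuous_bump t : continuous bump t.
Proof. apply (ex_derive_continuous bump). eexists; apply (is_derive_tm 1). Qed.

Lemma bump_0 t : t <= 1 \/ 4 <= t -> bump t = 0.
Proof. intros H. unfold bump. rewrite Rmax0_neg; [ring|nra]. Qed.

Lemma bump_pos t : 1 < t < 4 -> 0 < bump t.
Proof. intros H. unfold bump. rewrite Rmax0_pos by nra. apply pow_lt; nra. Qed.

Lemma bump_ge0 t : 0 <= bump t.
Proof. unfold bump. apply pow_le, Rmax_l. Qed.

Lemma bump_mass_pos : 0 < bump_mass.
Proof. apply RInt_gt_0; [lra|exact bump_pos|intros; apply continuous_bump]. Qed.

Lemma tau_low t : t <= 1 -> tau t = 1.
Proof.
intros H. unfold tau. rewrite <- (RInt_Chasles bump t 1 4) by (apply ex_RInt_ct, continuous_bump).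
rewrite (RInt_zero bump t 1); auto; [|intros; apply bump_0; lra]. unfold plus; simpl. rewrite Rplus_0_l.
  fold bump_mass. toR; field; apply Rgt_not_eq, bump_mass_pos.
Qed.

Lemma tau_high t : 4 <= t -> tau t = 0.
Proof.
intros H. unfold tau. rewrite <- (opp_RInt_swap bump) by (apply ex_RInt_ct, continuous_bump).
rewrite (RInt_zero bump 4 t); auto; [|intros; apply bump_0; lra]. unfold opp; simpl.
  toR; field; apply Rgt_not_eq, bump_mass_pos.
Qed.

Lemma is_derive_tau t : is_derive tau t (tau1 t).
Proof.
assert (P := bump_mass_pos). unfold tau.
apply (is_derive_ext (fun t => - / bump_mass * RInt bump 4 t)).
- intros u. rewrite <- (opp_RInt_swap bump) by (apply ex_RInt_ct, continuous_bump). unfold opp; simpl. field. lra.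
- evar_last.
  + apply (is_derive_scal (fun t => RInt bump 4 t)). apply (is_derive_RInt bump _ 4 t).
    * exists (mkposreal 1 Rlt_0_1). intros y _. apply (RInt_correct (V := R_CompleteNormedModule)), ex_RInt_ct,
      continuous_bump.
    * apply continuous_bump.
  + unfold scal; simpl; unfold mult; simpl. unfold tau1, bump. field; lra.
Qed.

Lemma is_derive_tau1 t : is_derive tau1 t (tau2 t).
Proof.
apply (is_derive_ext (fun t => - / bump_mass * bump t)).
- intros u; unfold tau1, bump. toR; field; apply Rgt_not_eq, bump_mass_pos.
- evar_last; [apply (is_derive_scal bump), (is_derive_tm 1)|]. unfold tau2. simpl.
  toR; field; apply Rgt_not_eq, bump_mass_pos.
Qed.

Lemma is_derive_tau2 t : is_derive tau2 t (tau3 t).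
Proof.
apply (is_derive_ext (fun t => (- 3 / bump_mass) * ((Rmax 0 ((4 - t) * (t - 1)))^2 * (5 - 2 * t)))).
- intros u; unfold tau2. toR; field; apply Rgt_not_eq, bump_mass_pos.
- evar_last; [apply (is_derive_scal (fun t => (Rmax 0 ((4 - t) * (t - 1)))^2 * (5 - 2 * t)))|].
  + apply (is_derive_mult (fun t => (Rmax 0 ((4 - t) * (t - 1)))^2) (fun t => 5 - 2 * t) t _ (-2) (is_derive_tm 0 t)).
    * auto_derive; auto; ring.
    * intros; apply Rmult_comm.
  + unfold tau3, plus, mult; simpl. toR; field; apply Rgt_not_eq, bump_mass_pos.
Qed.

Lemma continuous_tau3 t : continuous tau3 t.
Proof.
unfold tau3.
apply (continuous_ext (fun t => (- 6 / bump_mass) * (Rmax 0 ((4 - t) * (t - 1)) * (5 - 2 * t)^2 - Rmax 0 ((4 - t) *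
  (t - 1)) * Rmax 0 ((4 - t) * (t - 1))))).
{ intros u; toR; field; apply Rgt_not_eq, bump_mass_pos. }
assert (Q := continuous_tm t).
apply (continuous_mult (fun _ => -6 / bump_mass)); [apply continuous_const|].
apply (continuous_minus (fun t => Rmax 0 ((4 - t) * (t - 1)) * (5 - 2 * t)^2) (fun t => Rmax 0 ((4 - t) * (t - 1)) *
  Rmax 0 ((4 - t) * (t - 1)))).
- apply (continuous_mult (fun t => Rmax 0 ((4 - t) * (t - 1))) (fun t => (5 - 2 * t)^2)); auto.
  apply (ex_derive_continuous (fun t => (5 - 2 * t)^2)). auto_derive; auto.
- apply (continuous_mult (fun t => Rmax 0 ((4 - t) * (t - 1))) (fun t => Rmax 0 ((4 - t) * (t - 1)))); auto.
Qed.

Lemma continuous_tau1 t : continuous tau1 t.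
Proof. apply (ex_derive_continuous tau1). eexists; apply is_derive_tau1. Qed.
Lemma continuous_tau2 t : continuous tau2 t.
Proof. apply (ex_derive_continuous tau2). eexists; apply is_derive_tau2. Qed.

Lemma tau123_0 t : t <= 1 \/ 4 <= t -> tau1 t = 0 /\ tau2 t = 0 /\ tau3 t = 0.
Proof.
intros H. unfold tau1, tau2, tau3. assert (E : Rmax 0 ((4 - t) * (t - 1)) = 0) by (apply Rmax0_neg; nra).
rewrite E. assert (P := bump_mass_pos). repeat split; field; lra.
Qed.

Lemma tau1_le0 t : tau1 t <= 0.
Proof.
replace (tau1 t) with (- (bump t * / bump_mass)).
- assert (P := Rinv_0_lt_compat _ bump_mass_pos). assert (Q := bump_ge0 t). nra.
- unfold tau1, bump. toR; field; apply Rgt_not_eq, bump_mass_pos.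
Qed.

Lemma tau1_neg t : 1 < t < 4 -> tau1 t < 0.
Proof.
intros H. replace (tau1 t) with (- (bump t * / bump_mass)).
- assert (P := Rinv_0_lt_compat _ bump_mass_pos). assert (Q := bump_pos t H). nra.
- unfold tau1, bump. toR; field; apply Rgt_not_eq, bump_mass_pos.
Qed.

Lemma tau_bounds t : 0 <= tau t <= 1.
Proof.
assert (P := bump_mass_pos). destruct (Rle_dec t 1); [rewrite tau_low; lra|].
  destruct (Rle_dec 4 t); [rewrite tau_high; lra|].
assert (A : 0 <= RInt bump 1 t) by (apply RInt_ge_0; [lra|apply ex_RInt_ct, continuous_bump|intros; apply bump_ge0]).
assert (B : 0 <= RInt bump t 4) by (apply RInt_ge_0; [lra|apply ex_RInt_ct, continuous_bump|intros; apply bump_ge0]).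
assert (E : bump_mass = RInt bump 1 t + RInt bump t 4).
{ unfold bump_mass. rewrite <- (RInt_Chasles bump 1 t 4) by (apply ex_RInt_ct, continuous_bump). reflexivity. }
unfold tau. split.
- apply Rmult_le_pos; auto. left; now apply Rinv_0_lt_compat.
- apply Rmult_le_reg_r with bump_mass; auto. unfold Rdiv; rewrite Rmult_assoc, Rinv_l; lra.
Qed.

Lemma tau_bounded : exists M, 0 < M /\ forall t, Rabs (tau1 t) <= M /\ Rabs (tau2 t) <= M /\ Rabs (tau3 t) <= M.
Proof.
assert (U : forall t, Rmax 0 ((4 - t) * (t - 1)) <= 3 /\ 0 <= Rmax 0 ((4 - t) * (t - 1))).
{ intros t; split; [apply Rmax_lub; [lra|pose proof (pow2_ge_0 (t - 5/2)); nra]|apply Rmax_l]. }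
assert (P := bump_mass_pos). assert (P' := Rinv_0_lt_compat _ P).
exists (1000 * / bump_mass). split; [lra|]. intros t.
assert (Z : (t <= 1 \/ 4 <= t) \/ 1 < t < 4) by lra. destruct Z as [Z|Z].
{ destruct (tau123_0 t Z) as [-> [-> ->]]. rewrite Rabs_R0. lra. }
destruct (U t) as [U1 U2]. set (m := Rmax 0 _) in *.
assert (m^2 <= 9) by nra. assert (0 <= m^2) by (apply pow2_ge_0).
  assert (m^3 <= 27) by (replace (m^3) with (m * m^2) by ring; nra). assert (0 <= m^3) by (apply pow_le; auto).
assert (T1 : -3 <= 5 - 2 * t <= 3) by lra. assert (T2 : 0 <= (5-2*t)^2 <= 9) by (split; [apply pow2_ge_0|nra]).
assert (T3 : -27 <= m^2*(5-2*t) <= 27) by nra. assert (T4 : 0 <= m*(5-2*t)^2 <= 27) by nra.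
unfold tau1, tau2, tau3; fold m. unfold Rdiv.
repeat split; rewrite Rabs_mult, (Rabs_right (/ bump_mass)) by lra; apply Rmult_le_compat_r; try lra;
  apply Rabs_le; lra.
Qed.

(** * Spherical waves as functions of the squared distance *)

Section Kernel.
Variables A B k : R.

Definition kP s := A * cos (k * s) + B * sin (k * s).
Definition kQ s := - A * sin (k * s) + B * cos (k * s).
(* (A cos k s + B sin k s) / s as a function of T = s^2, with its derivatives in T. *)
Definition kap T := kP (sqrt T) / sqrt T.
Definition kap1 T := k * kQ (sqrt T) / (2 * sqrt T ^ 2) - kP (sqrt T) / (2 * sqrt T ^ 3).
Definition kap2 T := 3 * kP (sqrt T) / (4 * sqrt T ^ 5) - 3 * k * kQ (sqrt T) / (4 * sqrt T ^ 4) - k^2 * kP (sqrt T)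
  / (4 * sqrt T ^ 3).

Lemma is_derive_kap T : 0 < T -> is_derive kap T (kap1 T).
Proof.
intros H. assert (S := sqrt_lt_R0 _ H). unfold kap, kap1, kP, kQ. auto_derive; [repeat split; lra|]. field. lra.
Qed.
Lemma is_derive_kap1 T : 0 < T -> is_derive kap1 T (kap2 T).
Proof.
intros H. assert (S := sqrt_lt_R0 _ H). unfold kap1, kap2, kP, kQ. auto_derive.
- assert (0 < sqrt T ^ 2) by (apply pow_lt; auto). assert (0 < sqrt T ^ 3) by (apply pow_lt; auto). repeat split; lra.
- field. lra.
Qed.
(** The Laplacian in R^3 of h (|x|^2) is 6 h' + 4 T h'' at T = |x|^2, so this is the Helmholtz
    equation for (A cos k s + B sin k s) / s away from s = 0. *)
Lemma kap_eq T : 0 < T -> 6 * kap1 T + 4 * T * kap2 T + k^2 * kap T = 0.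
Proof.
intros H. assert (S := sqrt_lt_R0 _ H). replace (4 * T) with (4 * (sqrt T * sqrt T)) by (rewrite sqrt_sqrt; lra).
unfold kap, kap1, kap2. field. lra.
Qed.
Lemma continuous_kap2 T : 0 < T -> continuous kap2 T.
Proof.
intros H. assert (S := sqrt_lt_R0 _ H). apply (ex_derive_continuous kap2). unfold kap2, kP, kQ. auto_derive.
assert (0 < sqrt T ^ 3) by (apply pow_lt; auto). assert (0 < sqrt T ^ 4) by (apply pow_lt; auto).
  assert (0 < sqrt T ^ 5) by (apply pow_lt; auto).
repeat split; lra.
Qed.

Definition kN := Rabs A + Rabs B.
Lemma kN_ge0 : 0 <= kN.
Proof. unfold kN. pose proof (Rabs_pos A); pose proof (Rabs_pos B); lra. Qed.
Lemma kP_bound s : Rabs (kP s) <= kN.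
Proof.
unfold kP, kN. eapply Rle_trans; [apply Rabs_triang|]. rewrite !Rabs_mult.
assert (Rabs (cos (k * s)) <= 1) by (apply Rabs_le; apply COS_bound).
  assert (Rabs (sin (k * s)) <= 1) by (apply Rabs_le; apply SIN_bound).
pose proof (Rabs_pos A); pose proof (Rabs_pos B). nra.
Qed.
Lemma kQ_bound s : Rabs (kQ s) <= kN.
Proof.
unfold kQ, kN. eapply Rle_trans; [apply Rabs_triang|]. rewrite !Rabs_mult, Rabs_Ropp.
assert (Rabs (cos (k * s)) <= 1) by (apply Rabs_le; apply COS_bound).
  assert (Rabs (sin (k * s)) <= 1) by (apply Rabs_le; apply SIN_bound).
pose proof (Rabs_pos A); pose proof (Rabs_pos B). nra.
Qed.

Lemma inv_pow_le s r n : 0 < r <= s -> 0 < / s^n <= / r^n.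
Proof.
intros H. split; [apply Rinv_0_lt_compat, pow_lt; lra|]. apply Rinv_le_contravar; [apply pow_lt; lra|].
  apply pow_incr; lra.
Qed.

Lemma kap_bound T r : 0 < r -> r^2 <= T -> Rabs (kap T) <= kN * / r.
Proof.
intros Hr HT. assert (S : r <= sqrt T) by (rewrite <- (sqrt_pow2 r) by lra; apply sqrt_le_1_alt; lra).
unfold kap, Rdiv. rewrite Rabs_mult. apply Rmult_le_compat; try apply Rabs_pos; [apply kP_bound|].
pose proof (inv_pow_le _ _ 1 (conj Hr S)). rewrite !pow_1 in H. rewrite Rabs_right; lra.
Qed.

Lemma kap1_bound T r : 0 < r -> r^2 <= T -> Rabs (kap1 T) <= kN * (Rabs k / r^2 + / r^3).
Proof.
intros Hr HT. assert (S : r <= sqrt T) by (rewrite <- (sqrt_pow2 r) by lra; apply sqrt_le_1_alt; lra).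
pose proof (inv_pow_le _ _ 2 (conj Hr S)). pose proof (inv_pow_le _ _ 3 (conj Hr S)).
assert (E : kap1 T = k * kQ (sqrt T) * (/ 2 * / sqrt T ^ 2) - kP (sqrt T) * (/ 2 * / sqrt T ^ 3)) by (unfold kap1;
  field; lra).
rewrite E. unfold Rminus. eapply Rle_trans; [apply Rabs_triang|]. rewrite Rabs_Ropp, !Rabs_mult.
rewrite (Rabs_right (/2)), (Rabs_right (/ sqrt T ^2)), (Rabs_right (/ sqrt T ^3)) by lra.
pose proof (kP_bound (sqrt T)); pose proof (kQ_bound (sqrt T)); pose proof kN_ge0.
pose proof (Rabs_pos (kP (sqrt T))); pose proof (Rabs_pos (kQ (sqrt T))); pose proof (Rabs_pos k).
replace (kN * (Rabs k / r ^ 2 + / r ^ 3)) with (Rabs k * kN * / r^2 + kN * / r^3) by (field; lra).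
apply Rplus_le_compat; apply Rmult_le_compat; try nra. 
Qed.

Lemma kap2_bound T r : 0 < r -> r^2 <= T -> Rabs (kap2 T) <= kN * (/ r^5 + Rabs k / r^4 + k^2 / r^3).
Proof.
intros Hr HT. assert (S : r <= sqrt T) by (rewrite <- (sqrt_pow2 r) by lra; apply sqrt_le_1_alt; lra).
pose proof (inv_pow_le _ _ 5 (conj Hr S)) as I5. pose proof (inv_pow_le _ _ 3 (conj Hr S)) as I3.
  pose proof (inv_pow_le _ _ 4 (conj Hr S)) as I4.
assert (E : kap2 T = kP (sqrt T) * ((3/4) * / sqrt T ^ 5) + - (k * kQ (sqrt T) * ((3/4) * / sqrt T ^ 4)) + - (k^2 *
  kP (sqrt T) * ((1/4) * / sqrt T ^ 3))) by (unfold kap2; field; lra).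
rewrite E. eapply Rle_trans; [apply Rabs_triang|]. eapply Rle_trans; [apply Rplus_le_compat_r, Rabs_triang|].
rewrite !Rabs_Ropp, !Rabs_mult.
rewrite (Rabs_right (3/4)), (Rabs_right (1/4)), (Rabs_right (/ sqrt T ^5)), (Rabs_right (/ sqrt T ^3)),
  (Rabs_right (/ sqrt T ^4)), (Rabs_right (k^2)) by (nra || lra).
pose proof (kP_bound (sqrt T)); pose proof (kQ_bound (sqrt T)); pose proof kN_ge0.
pose proof (Rabs_pos (kP (sqrt T))); pose proof (Rabs_pos (kQ (sqrt T))); pose proof (Rabs_pos k).
replace (kN * (/ r^5 + Rabs k / r ^ 4 + k^2 / r ^ 3)) with (kN * / r^5 + Rabs k * kN * / r^4 + k^2 * kN * / r^3) by
  (field; lra).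
assert (0 <= k^2) by nra.
apply Rplus_le_compat; [apply Rplus_le_compat|]; apply Rmult_le_compat; try nra.
Qed.

(** Mean value theorem in T. Regularisation moves T by e^2, hence changes the kernel by O(e^2) at
    distance at least r from the pole. *)
Lemma kap_diff t r e : 0 < r -> r^2 <= t -> Rabs (kap (t + e^2) - kap t) <= kN * (Rabs k / r^2 + / r^3) * e^2 /\
   Rabs (kap1 (t + e^2) - kap1 t) <= kN * (/ r^5 + Rabs k / r^4 + k^2 / r^3) * e^2.
Proof.
intros Hr Ht. assert (R2 : 0 < r^2) by (apply pow_lt; auto). assert (E2 : 0 <= e^2) by nra.
split.
- destruct (MVT_gen kap t (t + e^2) kap1) as [c [Hc E]].
  + intros c Hc. rewrite Rmin_left in Hc by lra. apply is_derive_kap; lra.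
  + intros c Hc. rewrite Rmin_left in Hc by lra. apply derivable_continuous_pt. exists (kap1 c).
    apply is_derive_Reals, is_derive_kap; lra.
  + rewrite E. rewrite Rmin_left, Rmax_right in Hc by lra. replace (t + e^2 - t) with (e^2) by ring.
    rewrite Rabs_mult, (Rabs_right (e^2)) by lra.
    apply Rmult_le_compat_r; auto. apply kap1_bound; lra.
- destruct (MVT_gen kap1 t (t + e^2) kap2) as [c [Hc E]].
  + intros c Hc. rewrite Rmin_left in Hc by lra. apply is_derive_kap1; lra.
  + intros c Hc. rewrite Rmin_left in Hc by lra. apply derivable_continuous_pt. exists (kap2 c).
    apply is_derive_Reals, is_derive_kap1; lra.
  + rewrite E. rewrite Rmin_left, Rmax_right in Hc by lra. replace (t + e^2 - t) with (e^2) by ring.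
    rewrite Rabs_mult, (Rabs_right (e^2)) by lra.
    apply Rmult_le_compat_r; auto. apply kap2_bound; lra.
Qed.

(* [e <> 0] regularises the fundamental solution. *)
Definition Kf (e : R) (x y : pt) : R := kap (sq x y + e^2).
Definition Kg (e : R) (x : pt) (i : nat) (y : pt) : R := kap1 (sq x y + e^2) * (2 * (coord y i - coord x i)).
Definition Kh (e : R) (x : pt) (i : nat) (y : pt) : R :=
  4 * (coord y i - coord x i)^2 * kap2 (sq x y + e^2) + 2 * kap1 (sq x y + e^2).

Lemma Kf_C2 e x : e <> 0 -> C2on all (Kf e x) (Kg e x) (Kh e x).
Proof.
intros He. assert (E2 : 0 < e^2) by (apply pow2_gt_0; auto).
assert (D : forall (f f1 : R -> R), (forall T, 0 < T -> is_derive f T (f1 T)) -> forall t,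
  0 <= t -> is_derive (fun t => f (t + e^2)) t (f1 (t + e^2))).
{ intros f f1 Hf t Ht. evar_last; [apply (is_derive_comp f (fun t => t + e^2) t (f1 (t + e^2)) 1)|].
  - apply Hf; lra.
  - auto_derive; auto.
  - unfold scal; simpl; unfold mult; simpl. apply Rmult_1_l. }
apply (C2on_radial x (fun t => kap (t + e^2)) (fun t => kap1 (t + e^2)) (fun t => kap2 (t + e^2))).
- apply D, is_derive_kap.
- apply D, is_derive_kap1.
- intros t Ht. apply (continuous_comp (fun t => t + e^2) kap2); [|apply continuous_kap2; lra].
  apply (ex_derive_continuous (fun t => t + e^2)). auto_derive; auto.
Qed.

(** [kap_eq] is applied at the shifted argument sq + e^2, while the Laplacian only produces the
    factor 4 sq. The missing 4 e^2 is the source on the right, which concentrates at x as e tends to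
    zero. *)
Lemma Kf_lap e x y : e <> 0 -> lap (Kh e x) y + k^2 * Kf e x y = - (4 * e^2 * kap2 (sq x y + e^2)).
Proof.
intros He. assert (E2 : 0 < e^2) by (apply pow2_gt_0; auto). assert (P := sq_ge0 x y).
unfold Kh. rewrite (lap_radial x (fun t => kap1 (t + e^2)) (fun t => kap2 (t + e^2)) y). unfold Kf.
assert (Q := kap_eq (sq x y + e^2) ltac:(lra)). nra.
Qed.
End Kernel.

Definition grad_dot (p P : nat -> pt -> R) (y : pt) : R := p 0%nat y * P 0%nat y + p 1%nat y * P 1%nat y + p 2%nat y
  * P 2%nat y.

Lemma green1 S f p q W P Q : test S f p q -> C2on S W P Q ->
  int3 (fun y => lap Q y * f y + grad_dot P p y) = 0.
Proof.
intros T HW. assert (T' := T). destruct T' as [C [[L B] [m M]]].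
assert (W1 : forall i y, S y -> ct (P i) y) by (intros i y Sy; destruct (HW y Sy) as [_ H]; apply H).
assert (W2 : forall i y, S y -> ct (Q i) y) by (intros i y Sy; destruct (HW y Sy) as [_ H]; apply H).
assert (CC : forall i, Cc (fun y => Q i y * f y + P i y * p i y)).
{ intros i. cct; [apply (test_Cc0 S f p q)|apply (test_Cc1 S f p q)]; auto. }
assert (K : forall i, int3 (fun y => Q i y * f y + P i y * p i y) = 0).
{ intros i. apply (I_pd i (fun y => P i y * f y)); auto.
  - apply (test_Cc0 S f p q); auto.
  - intros y. destruct (margin_dead _ _ _ y M) as [Sy|D].
    + destruct (HW y Sy) as [_ H], (C y Logic.I) as [_ H']. apply pd_mult; [apply H|apply H'].
    + assert (Hm := proj1 M). destruct (dead_derivs _ _ _ _ _ C (proj1 M) D y (near_refl (m/2) y ltac:(lra)) i) as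
      [E1 E2].
      rewrite E1, D by (apply near_refl, M). apply (pd_ext_near i (fun _ => 0) _ y _ m); [lra| |].
      * intros z Hz. rewrite D; [ring|]. exact Hz.
      * eapply pd_val; [|apply pd_const]. ring. }
rewrite (I_ext _ (fun y => (Q 0%nat y * f y + P 0%nat y * p 0%nat y) + (Q 1%nat y * f y + P 1%nat y * p 1%nat y) +
  (Q 2%nat y * f y + P 2%nat y * p 2%nat y))).
- rewrite I_plus, I_plus, !K; auto using Cc_plus; ring.
- intros; unfold lap, grad_dot; ring.
Qed.

Definition cut (d : R) (x y : pt) : R := tau (sq x y / d^2).
Definition cutp (d : R) (x : pt) (i : nat) (y : pt) : R := tau1 (sq x y / d^2) / d^2 * (2 * (coord y i - coord x i)).
Definition cutq (d : R) (x : pt) (i : nat) (y : pt) : R :=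
  4 * (coord y i - coord x i)^2 * (tau2 (sq x y / d^2) / d^4) + 2 * (tau1 (sq x y / d^2) / d^2).

Lemma cut_C2 d x : 0 < d -> C2on all (cut d x) (cutp d x) (cutq d x).
Proof.
intros Hd. assert (D2 : 0 < d^2) by (apply pow_lt; auto).
assert (D : forall t, is_derive (fun t => t / d^2) t (/ d^2)) by (intros; auto_derive; [lra|field; lra]).
apply (C2on_radial x (fun t => tau (t / d^2)) (fun t => tau1 (t / d^2) / d^2) (fun t => tau2 (t / d^2) / d^4));
  intros t _.
- evar_last; [apply (is_derive_comp tau (fun t => t / d^2) t _ _ (is_derive_tau _) (D t))|]. apply Rmult_comm.
- evar_last.
  + apply (is_derive_ext (fun t => / d^2 * tau1 (t / d^2))); [intros; unfold Rdiv; apply Rmult_comm|].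
    apply (is_derive_scal (fun t => tau1 (t / d^2))). apply (is_derive_comp tau1 (fun t => t / d^2) t _ _
      (is_derive_tau1 _) (D t)).
  + unfold scal; simpl; unfold mult; simpl. toR; field. lra.
- apply (continuous_mult (fun t => tau2 (t / d^2)) (fun _ => / d^4)); [|apply continuous_const].
  apply (continuous_comp (fun t => t / d^2) tau2); [|apply continuous_tau2].
  apply (ex_derive_continuous (fun t => t / d^2)). eexists; apply D.
Qed.

Lemma cut_lap d x y : lap (cutq d x) y = 6 * (tau1 (sq x y / d^2) / d^2) + 4 * sq x y * (tau2 (sq x y / d^2) / d^4).
Proof. apply (lap_radial x (fun t => tau1 (t / d^2) / d^2) (fun t => tau2 (t / d^2) / d^4)). Qed.

Lemma div_le_iff a b c : 0 < c -> a / c <= b <-> a <= b * c.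
Proof. intros H; split; intros K; [apply (Rmult_le_compat_r c) in K; [|lra]; field_simplify in K; lra|].
apply Rmult_le_reg_r with c; auto. field_simplify; lra. Qed.

Lemma cut_one d x y : 0 < d -> sq x y <= d^2 -> cut d x y = 1.
Proof. intros Hd H. apply tau_low. apply div_le_iff; [apply pow_lt; auto|lra]. Qed.

Lemma cut_zero d x y : 0 < d -> 4 * d^2 <= sq x y -> cut d x y = 0.
Proof.
intros Hd H. assert (D2 : 0 < d^2) by (apply pow_lt; auto). apply tau_high. apply Rmult_le_reg_r with (d^2); auto.
unfold Rdiv; rewrite Rmult_assoc, Rinv_l; lra.
Qed.

Lemma cut_nz d x y : 0 < d -> cut d x y <> 0 -> near (2 * d) x y.
Proof.
intros Hd H. apply near_sq; [lra|]. destruct (Rlt_le_dec (sq x y) (4 * d^2)) as [K|K].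
- lra.
- exfalso; apply H; now apply cut_zero.
Qed.

Definition l1_norm (x : pt) : R := Rabs (px1 x) + Rabs (px2 x) + Rabs (px3 x).

Lemma near_inbox d x y : near d x y -> inbox (l1_norm x + d) y.
Proof.
intros [H1 [H2 H3]]. unfold l1_norm. assert (P := Rabs_pos (px1 x)); assert (P2 := Rabs_pos (px2 x));
  assert (P3 := Rabs_pos (px3 x)).
repeat split.
- replace (px1 y) with ((px1 y - px1 x) + px1 x) by ring. eapply Rle_trans; [apply Rabs_triang|lra].
- replace (px2 y) with ((px2 y - px2 x) + px2 x) by ring. eapply Rle_trans; [apply Rabs_triang|lra].
- replace (px3 y) with ((px3 y - px3 x) + px3 x) by ring. eapply Rle_trans; [apply Rabs_triang|lra].
Qed.

Lemma cut_bsupp d x : 0 < d -> bsupp (cut d x) (l1_norm x + 2 * d).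
Proof. intros Hd y Hy. apply near_inbox, cut_nz; auto. Qed.

Lemma cut_test S d x : 0 < d -> (forall z, near (3 * d) x z -> S z) -> test S (cut d x) (cutp d x) (cutq d x).
Proof.
intros Hd H. split; [now apply cut_C2|split].
- eexists; now apply cut_bsupp.
- exists d; split; auto. intros y Hy z Hz. apply H. eapply near_le; [|eapply near_trans; [apply cut_nz;
  eauto|exact Hz]]. lra.
Qed.

Lemma cut_Cc d x : 0 < d -> Cc (cut d x).
Proof.
intros Hd. split; [intros y; now destruct (cut_C2 d x Hd y Logic.I)|]. eexists; now apply cut_bsupp.
Qed.

(** * The point mass in the limit of the regularised kernels *)

Definition away_from (x y : pt) : Prop := 0 < sq x y.

Lemma Cc_away x V g L d : (forall y, away_from x y -> ct V y) -> (forall y, ct g y) -> bsupp g L -> 0 < d ->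
  (forall y, near d x y -> g y = 0) -> Cc (fun y => V y * g y).
Proof.
intros HV Hg B Hd H. apply (Cc_margin (away_from x) V g L d); auto. split; auto.
intros y Hy z Hz. destruct (Rle_lt_or_eq_dec _ _ (sq_ge0 x z)) as [K|K]; auto.
exfalso. apply Hy, H.
replace x with z; [now apply near_sym|]. unfold sq in K.
pose proof (pow2_ge_0 (px1 z - px1 x)); pose proof (pow2_ge_0 (px2 z - px2 x));
  pose proof (pow2_ge_0 (px3 z - px3 x)).
apply pt_eq; apply Rminus_diag_uniq; apply Rsqr_0_uniq; unfold Rsqr; lra.
Qed.

Definition org : pt := mkpt 0 0 0.

Lemma sq_tr x y : sq x (tr x y) = sq org y.
Proof. unfold sq, tr, org; cbn. ring. Qed.

Lemma radial_center (h : R -> R) x : Cc (fun y => h (sq x y)) ->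
  int3 (fun y => h (sq x y)) = int3 (fun y => h (sq org y)).
Proof. intros H. rewrite <- (I_tr _ x H). apply I_ext; intros y. now rewrite sq_tr. Qed.

(** Minus the Laplacian of the regularised Newton kernel 1 / sqrt (|y - x|^2 + e^2), that is 3 e^2
    (|y - x|^2 + e^2)^(-5/2). Its positivity makes it the reference with which the oscillating
    Helmholtz sources are compared. *)
Definition delta_kernel (e : R) (x y : pt) : R := 4 * e^2 * kap2 1 0 0 (sq x y + e^2).
(* The total mass of the approximate identity [delta_kernel e]; only its positivity matters, not the value 4 pi. *)
Definition c0 : R := int3 (fun y => kap1 1 0 0 (sq org y) * (4 * sq org y * tau1 (sq org y))).

Lemma kap2_100 T : 0 < T -> kap2 1 0 0 T = 3 / (4 * sqrt T ^ 5).
Proof. intros H. assert (S := sqrt_lt_R0 _ H). unfold kap2, kP, kQ. replace (0 * sqrt T) with 0 by ring.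
  rewrite cos_0, sin_0. field. lra. Qed.

Lemma kap1_100 T : 0 < T -> kap1 1 0 0 T = - / (2 * sqrt T ^ 3).
Proof. intros H. assert (S := sqrt_lt_R0 _ H). unfold kap1, kP, kQ. replace (0 * sqrt T) with 0 by ring.
  rewrite cos_0, sin_0. field. lra. Qed.

Lemma delta_kernel_pos e x y : e <> 0 -> 0 < delta_kernel e x y.
Proof.
intros He. assert (E2 : 0 < e^2) by (apply pow2_gt_0; auto). assert (P := sq_ge0 x y).
unfold delta_kernel. rewrite kap2_100 by lra. apply Rmult_lt_0_compat; [lra|]. apply Rdiv_lt_0_compat; [lra|].
apply Rmult_lt_0_compat; [lra|]. apply pow_lt, sqrt_lt_R0; lra.
Qed.

Lemma Kf_ct A B k e x y : e <> 0 -> ct (Kf A B k e x) y /\ forall i, ct (Kg A B k e x i) y /\ ct (Kh A B k e x i) y.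
Proof.
intros He. destruct (Kf_C2 A B k e x He y Logic.I) as [H0 H1]. split; auto.
  intros i; destruct (H1 i) as [? [? [? ?]]]; auto.
Qed.

Lemma ct_kap2 A B k e x y : e <> 0 -> ct (fun y => kap2 A B k (sq x y + e^2)) y.
Proof.
intros He. assert (E2 : 0 < e^2) by (apply pow2_gt_0; auto). assert (P := sq_ge0 x y).
apply (ct_comp (kap2 A B k) (fun y => sq x y + e^2)); [ctt; apply ct_sq|apply continuous_kap2; lra].
Qed.

Lemma ct_delta_kernel e x y : e <> 0 -> ct (delta_kernel e x) y.
Proof. intros He. unfold delta_kernel. apply (ct_mult (fun _ => 4 * e^2)); [apply ct_const|now apply ct_kap2]. Qed.

Lemma tau1_sq_ct (x y : pt) : ct (fun y => 4 * sq x y * tau1 (sq x y)) y.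
Proof. ctt; [apply ct_sq|]. apply (ct_comp tau1); [apply ct_sq|apply continuous_tau1]. Qed.

Lemma sq_inbox x y : sq x y < 4 -> inbox (l1_norm x + 2) y.
Proof. intros H. apply near_inbox, near_sq; lra. Qed.

Lemma tau1_sq_bsupp x : bsupp (fun y => 4 * sq x y * tau1 (sq x y)) (l1_norm x + 2).
Proof.
intros y Hy. apply sq_inbox. destruct (Rlt_le_dec (sq x y) 4); auto. exfalso; apply Hy.
destruct (tau123_0 (sq x y)) as [-> _]; auto; ring.
Qed.

Lemma tau1_sq_near x y : near (1/2) x y -> 4 * sq x y * tau1 (sq x y) = 0.
Proof. intros H. apply sq_near in H. destruct (tau123_0 (sq x y)) as [-> _]; [lra|ring]. Qed.

Lemma ct_kap1_away A B k x y : away_from x y -> ct (fun y => kap1 A B k (sq x y)) y.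
Proof.
intros H. apply (ct_comp (kap1 A B k)); [apply ct_sq|]. apply (ex_derive_continuous (kap1 A B k)).
  eexists; now apply is_derive_kap1.
Qed.

Lemma c0_Cc x : Cc (fun y => kap1 1 0 0 (sq x y) * (4 * sq x y * tau1 (sq x y))).
Proof.
apply (Cc_away x (fun y => kap1 1 0 0 (sq x y)) (fun y => 4 * sq x y * tau1 (sq x y)) (l1_norm x + 2) (1/2)); try lra.
- intros; now apply ct_kap1_away.
- intros; apply tau1_sq_ct.
- apply tau1_sq_bsupp.
- apply tau1_sq_near.
Qed.

Lemma c0_center x : int3 (fun y => kap1 1 0 0 (sq x y) * (4 * sq x y * tau1 (sq x y))) = c0.
Proof. apply (radial_center (fun t => kap1 1 0 0 t * (4 * t * tau1 t))), c0_Cc. Qed.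

Lemma c0_pos : 0 < c0.
Proof.
refine (I_gt0 (fun y => kap1 1 0 0 (sq org y) * (4 * sq org y * tau1 (sq org y))) (mkpt (3/2) 0 0) (c0_Cc org) _ _).
- intros y. assert (P := sq_ge0 org y). assert (T := tau1_le0 (sq org y)).
  destruct (Rle_lt_or_eq_dec _ _ P) as [Q|Q].
  + rewrite kap1_100 by auto. assert (0 < / (2 * sqrt (sq org y) ^ 3)).
    { apply Rinv_0_lt_compat. apply Rmult_lt_0_compat; [lra|]. now apply pow_lt, sqrt_lt_R0. }
    assert (0 <= sq org y * - tau1 (sq org y)) by (apply Rmult_le_pos; lra). nra.
  + rewrite <- Q. lra.
- replace (sq org (mkpt (3/2) 0 0)) with (9/4) by (unfold sq, org; cbn; field).
  assert (T := tau1_neg (9/4) ltac:(lra)). rewrite kap1_100 by lra.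
  assert (0 < / (2 * sqrt (9/4) ^ 3)).
  { apply Rinv_0_lt_compat. apply Rmult_lt_0_compat; [lra|]. apply pow_lt, sqrt_lt_R0; lra. }
  nra.
Qed.

(* The mass of the approximate identity: the Laplacian of the regularised Newton kernel is moved onto the cutoff. *)
Lemma delta_mass : exists C, 0 < C /\ forall e x, e <> 0 -> Rabs (int3 (fun y => cut 1 x y * delta_kernel e x y) -
  c0) <= C * e^2.
Proof.
destruct tau_bounded as [M [HM TB]].
pose (N := kN 1 0 * (/ 1^5 + Rabs 0 / 1^4 + 0^2 / 1^3)).
assert (HN : 0 <= N). { unfold N. apply Rmult_le_pos; [apply kN_ge0|]. rewrite Rabs_R0. lra. }
(* N e^2 bounds the change of [kap1] for T >= 1, 16 M bounds 4 t tau1 t where it is nonzero, since t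
   <= 4 there, and 8 2^3 is the volume of the cube that holds the support. The added 1 only secures
   positivity. *)
exists (8 * 2 ^ 3 * (N * (16 * M)) + 1). split; [nra|]. intros e x He.
assert (E2 : 0 < e^2) by (apply pow2_gt_0; auto).
assert (T : test all (cut 1 x) (cutp 1 x) (cutq 1 x)) by (apply cut_test; [lra|intros; exact Logic.I]).
assert (G := green1 all _ _ _ _ _ _ T (Kf_C2 1 0 0 e x He)).
assert (D : forall y, grad_dot (Kg 1 0 0 e x) (cutp 1 x) y = kap1 1 0 0 (sq x y + e^2) * (4 * sq x y * tau1 (sq x
  y))).
{ intros y. unfold grad_dot, Kg, cutp; cbn [coord]. replace (sq x y / 1^2) with (sq x y) by field.
  assert (Es : sq x y = (px1 y - px1 x)^2 + (px2 y - px2 x)^2 + (px3 y - px3 x)^2) by reflexivity.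
  set (t := sq x y) in *. transitivity (kap1 1 0 0 (t + e^2) * tau1 t * (4 * ((px1 y - px1 x)^2 + (px2 y - px2 x)^2
    + (px3 y - px3 x)^2))); [field|rewrite <- Es; ring]. }
assert (L : forall y, lap (Kh 1 0 0 e x) y = - delta_kernel e x y).
{ intros y. assert (K := Kf_lap 1 0 0 e x y He). unfold delta_kernel. lra. }
rewrite (I_ext _ (fun y => kap1 1 0 0 (sq x y + e^2) * (4 * sq x y * tau1 (sq x y)) - cut 1 x y * delta_kernel e x
  y)) in G
  by (intros y; rewrite D, L; ring).
assert (C1 : Cc (fun y => cut 1 x y * delta_kernel e x y)) by (apply Cc_mult_r; [apply cut_Cc; lra|intros;
  now apply ct_delta_kernel]).
assert (C2 : Cc (fun y => kap1 1 0 0 (sq x y + e^2) * (4 * sq x y * tau1 (sq x y)))).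
{ apply (Cc_margin all (fun y => kap1 1 0 0 (sq x y + e^2)) _ (l1_norm x + 2) 1).
  - intros y _. apply (ct_comp (kap1 1 0 0) (fun y => sq x y + e^2)); [ctt; apply ct_sq|].
    apply (ex_derive_continuous (kap1 1 0 0)). assert (P := sq_ge0 x y). eexists; apply is_derive_kap1; lra.
  - intros; apply tau1_sq_ct.
  - apply tau1_sq_bsupp.
  - split; [lra|intros; exact Logic.I]. }
rewrite I_minus in G by auto.
replace (int3 (fun y => cut 1 x y * delta_kernel e x y)) with (int3 (fun y => kap1 1 0 0 (sq x y + e^2) * (4 * sq x
  y * tau1 (sq x y)))) by lra.
rewrite <- (c0_center x).
rewrite (radial_center (fun t => kap1 1 0 0 (t + e^2) * (4 * t * tau1 t)) x C2).
rewrite (radial_center (fun t => kap1 1 0 0 t * (4 * t * tau1 t)) x (c0_Cc x)).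
assert (C2' := Cc_tr _ x C2). apply (Cc_ext _ (fun y => kap1 1 0 0 (sq org y + e ^ 2) * (4 * sq org y * tau1 (sq org
  y)))) in C2'; [|intros; now rewrite sq_tr].
rewrite <- I_minus; auto using c0_Cc.
replace (8 * 2 ^ 3 * (N * (16 * M)) * e^2) with (8 * 2 ^ 3 * (N * e^2 * (16 * M))) by ring.
apply Rle_trans with (8 * 2 ^ 3 * (N * e^2 * (16 * M))); [|nra].
assert (Z : forall y, 4 * sq org y * tau1 (sq org y) = 0 -> kap1 1 0 0 (sq org y + e^2) * (4 * sq org y * tau1 (sq
  org y)) - kap1 1 0 0 (sq org y) * (4 * sq org y * tau1 (sq org y)) = 0).
{ intros y E; rewrite E; ring. }
apply I_bound; try lra.
- apply Cc_minus; auto using c0_Cc.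
- intros y Hy. replace 2 with (l1_norm org + 2) by (unfold l1_norm, org; cbn; rewrite Rabs_R0; ring).
  apply tau1_sq_bsupp.
  intros E; apply Hy, Z, E.
- intros y. rewrite <- Rmult_minus_distr_r, Rabs_mult.
  assert (Z0 : 0 <= N * e^2 * (16 * M)) by (apply Rmult_le_pos; [apply Rmult_le_pos|]; lra).
  assert (P := sq_ge0 org y).
  destruct (Rlt_le_dec (sq org y) 1) as [K|K].
  { destruct (tau123_0 (sq org y)) as [-> _]; [lra|]. rewrite Rmult_0_r, Rabs_R0, Rmult_0_r. exact Z0. }
  destruct (Rlt_le_dec 4 (sq org y)) as [K'|K'].
  { destruct (tau123_0 (sq org y)) as [-> _]; [lra|]. rewrite Rmult_0_r, Rabs_R0, Rmult_0_r. exact Z0. }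
  apply Rmult_le_compat; try apply Rabs_pos.
  + apply (kap_diff 1 0 0 (sq org y) 1 e); lra.
  + rewrite !Rabs_mult, (Rabs_right 4), (Rabs_right (sq org y)) by lra. destruct (TB (sq org y)) as [T1 _].
    pose proof (Rabs_pos (tau1 (sq org y))). nra.
Qed.

Lemma notnear_sq d x y : 0 < d -> ~ near d x y -> d^2 <= sq x y.
Proof. intros Hd H. apply Rnot_lt_le; intros K; apply H; now apply near_sq. Qed.

(** Splitting the integral at a radius d would leave the class of continuous integrands. Instead |E|
    delta is dominated by eta' cut delta plus the positive part h of the difference; h vanishes near
    x, and away from x it is O(e^2) because delta is. *)
Lemma delta_small (E : R -> pt -> R) x L M : 0 <= L -> 0 <= M ->
  (forall e, 0 < e < 1 -> Cc (E e) /\ bsupp (E e) L /\ forall y, Rabs (E e y) <= M) ->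
  (forall eta, 0 < eta -> exists d, 0 < d /\ forall e, 0 < e < d -> forall y, near d x y -> Rabs (E e y) <= eta) ->
  forall eta, 0 < eta -> exists e0, 0 < e0 /\ forall e, 0 < e < e0 ->
    Rabs (int3 (fun y => E e y * delta_kernel e x y)) <= eta.
Proof.
intros HL HM H1 H2 eta Heta. destruct delta_mass as [C [HC DM]]. assert (c0p := c0_pos).
pose (eta' := eta / (2 * (c0 + C))). assert (Q0 : 0 < eta') by (apply Rdiv_lt_0_compat; lra).
destruct (H2 eta' Q0) as [d0 [Hd0 K]].
pose (d := Rmin d0 (1/2)). assert (Hd : 0 < d /\ d <= d0 /\ d <= 1/2).
{ unfold d; repeat split; [apply Rmin_pos; lra|apply Rmin_l|apply Rmin_r]. }
pose (L' := Rmax L (l1_norm x + 2)). assert (L1 : L <= L') by apply Rmax_l.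
  assert (L2 : l1_norm x + 2 <= L') by apply Rmax_r.
pose (G := 8 * L' ^ 3 * (M * (3 / d^5))).
assert (D5 : 0 < d^5) by (apply pow_lt; lra).
assert (HG : 0 <= G). { unfold G. apply Rmult_le_pos; [apply Rmult_le_pos; [lra|apply pow_le; lra]|].
  apply Rmult_le_pos; auto. left; apply Rdiv_lt_0_compat; lra. }
pose (e0 := Rmin d (eta / (2 * (G + 1)))).
assert (P1 : 0 < eta / (2 * (G + 1))) by (apply Rdiv_lt_0_compat; lra).
assert (He0 : 0 < e0 /\ e0 <= d /\ e0 <= eta / (2 * (G + 1))).
{ unfold e0; repeat split; [apply Rmin_pos; lra|apply Rmin_l|apply Rmin_r]. }
exists e0; split; [lra|]. intros e He.
destruct (H1 e ltac:(lra)) as [E1 [E2 E3]].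
assert (N : e <> 0) by lra.
assert (CE : Cc (fun y => E e y * delta_kernel e x y)) by (apply Cc_mult_r; auto; intros; now apply ct_delta_kernel).
assert (CA : Cc (fun y => cut 1 x y * delta_kernel e x y)) by (apply Cc_mult_r; [apply cut_Cc; lra|intros;
  now apply ct_delta_kernel]).
pose (h := fun y => Rmax 0 (Rabs (E e y * delta_kernel e x y) - eta' * (cut 1 x y * delta_kernel e x y))).
assert (Ap : forall y, 0 < delta_kernel e x y) by (intros; now apply delta_kernel_pos).
assert (CA0 : forall y, 0 <= eta' * (cut 1 x y * delta_kernel e x y)).
{ intros y. apply Rmult_le_pos; [lra|]. apply Rmult_le_pos; [apply tau_bounds|left; apply Ap]. }
assert (Ch : Cc h).
{ assert (Q : Cc (fun y => Rabs (E e y * delta_kernel e x y) - eta' * (cut 1 x y * delta_kernel e x y))) by (cct;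
  now apply Cc_abs).
  split.
  - intros y. apply (ct_comp (fun s => Rmax 0 s) (fun y => Rabs (E e y * delta_kernel e x y) - eta' * (cut 1 x y *
    delta_kernel e x y))); [apply Q|apply continuous_Rmax0].
  - destruct Q as [_ [L3 B]]. exists L3. intros y Hy. apply B. intros E0; apply Hy. unfold h; rewrite E0.
    apply Rmax0_neg; lra. }
assert (Hb : bsupp h L').
{ intros y Hy. apply (inbox_le L); auto. apply E2. intros E0; apply Hy. unfold h. rewrite E0, Rmult_0_l, Rabs_R0.
  apply Rmax0_neg.
  assert (0 <= cut 1 x y) by apply tau_bounds. assert (U := CA0 y). lra. }
assert (Hh : forall y, Rabs (h y) <= M * (3 / d^5) * e^2).
{ intros y. rewrite Rabs_right by (apply Rle_ge, Rmax_l).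
  assert (0 <= M * (3 / d ^ 5) * e ^ 2) by (apply Rmult_le_pos; [apply Rmult_le_pos; auto; left;
    apply Rdiv_lt_0_compat; lra|apply pow2_ge_0]).
  apply Rmax_lub; auto.
  rewrite Rabs_mult, (Rabs_right (delta_kernel e x y)) by (left; apply Ap).
  destruct (classic (near d x y)) as [Nr|Nr].
  - rewrite cut_one; [| lra | apply sq_near in Nr; nra].
    assert (Rabs (E e y) <= eta') by (apply K; [lra|eapply near_le; [|exact Nr]; lra]).
    specialize (Ap y). nra.
  - apply notnear_sq in Nr; [|lra].
    assert (A1 : delta_kernel e x y <= 3 / d^5 * e^2).
    { unfold delta_kernel. rewrite kap2_100 by nra. assert (S : d <= sqrt (sq x y + e^2)) by (rewrite <- (sqrt_pow2
      d) by lra; apply sqrt_le_1_alt; nra).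
      pose proof (inv_pow_le _ _ 5 (conj (proj1 Hd) S)) as I5.
      replace (4 * e^2 * (3 / (4 * sqrt (sq x y + e^2)^5))) with (3 * e^2 * / sqrt (sq x y + e^2)^5) by (field; lra).
      replace (3 / d^5 * e^2) with (3 * e^2 * / d^5) by (field; lra). apply Rmult_le_compat_l; [nra|lra]. }
    assert (0 <= cut 1 x y) by apply tau_bounds.
    assert (U := CA0 y).
    specialize (E3 y). specialize (Ap y). pose proof (Rabs_pos (E e y)).
    rewrite (Rmult_assoc M). assert (Rabs (E e y) * delta_kernel e x y <= M * (3 / d^5 * e^2)) by (apply
      Rmult_le_compat; lra). lra. }
assert (B1 : Rabs (int3 (fun y => E e y * delta_kernel e x y)) <= int3 (fun y => eta' * (cut 1 x y * delta_kernel e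
  x y) + h y)).
{ apply Rabs_I_le; cct; auto. intros y. unfold h. pose proof (Rmax_r 0 (Rabs (E e y * delta_kernel e x y) - eta' *
  (cut 1 x y * delta_kernel e x y))). lra. }
rewrite I_plus, I_scal in B1; cct; auto.
assert (B2 : Rabs (int3 h) <= G * e^2).
{ replace (G * e^2) with (8 * L'^3 * (M * (3 / d^5) * e^2)) by (unfold G; ring). apply I_bound; auto; lra. }
assert (B3 := DM e x N). apply Rabs_le_between in B2, B3.
assert (E4 : e^2 <= e) by nra.
assert (eta' * int3 (fun y => cut 1 x y * delta_kernel e x y) <= eta / 2).
{ replace (eta / 2) with (eta' * (c0 + C)) by (unfold eta'; field; lra). apply Rmult_le_compat_l; nra. }
assert (G * e^2 <= eta / 2).
{ apply Rle_trans with ((G + 1) * (eta / (2 * (G + 1)))); [|right; field; lra]. nra. }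
lra.
Qed.

Lemma I_comb a b c d s : Cc a -> Cc b -> Cc c -> Cc d ->
  int3 (fun y => a y + s * (b y + c y + d y)) = int3 a + s * (int3 b + int3 c + int3 d).
Proof.
intros Ha Hb Hc Hd. assert (H1 := Cc_plus _ _ Hb Hc). assert (H2 := Cc_plus _ _ H1 Hd).
rewrite (I_plus a (fun y => s * (b y + c y + d y)) Ha (Cc_scal s _ H2)), (I_scal s _ H2), (I_plus _ _ H1 Hd),
  (I_plus _ _ Hb Hc). reflexivity.
Qed.

(** * Reproducing formula for weak solutions *)

Section Repr.
Variables A B k : R.

(** Ratio, at distance s, of the Helmholtz source to the Newton source. Its value A at s = 0 says
    that only the cosine kernel carries a point mass; the sine kernel is regular at the pole. *)
Definition kM s := kP A B k s - k * s * kQ A B k s - k^2 * s^2 * kP A B k s / 3.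

Lemma kap2_kM e x y : e <> 0 -> 4 * e^2 * kap2 A B k (sq x y + e^2) = kM (sqrt (sq x y + e^2)) * delta_kernel e x y.
Proof.
intros He. assert (E2 : 0 < e^2) by (apply pow2_gt_0; auto). assert (P := sq_ge0 x y).
assert (S : 0 < sqrt (sq x y + e^2)) by (apply sqrt_lt_R0; lra).
unfold delta_kernel. rewrite kap2_100 by lra. unfold kap2, kM. field. lra.
Qed.

Lemma continuous_kM s : continuous kM s.
Proof. apply (ex_derive_continuous kM). unfold kM, kP, kQ. auto_derive; auto. Qed.

Lemma kM_0 : kM 0 = A.
Proof. unfold kM, kP, kQ. replace (k * 0) with 0 by ring. rewrite cos_0, sin_0. field. Qed.

Lemma kM_bound s : 0 <= s -> Rabs (kM s) <= kN A B * (1 + Rabs k * s + k^2 * s^2).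
Proof.
intros Hs. unfold kM, Rminus. assert (HP := kP_bound A B k s). assert (HQ := kQ_bound A B k s).
  assert (HN := kN_ge0 A B).
eapply Rle_trans; [apply Rabs_triang|]. eapply Rle_trans; [apply Rplus_le_compat_r, Rabs_triang|].
rewrite !Rabs_Ropp. unfold Rdiv. rewrite !Rabs_mult. rewrite (Rabs_right s), (Rabs_right (/3)) by lra.
rewrite (Rabs_right (k^2)), (Rabs_right (s^2)) by (apply Rle_ge, pow2_ge_0).
assert (0 <= k^2 * s^2) by (apply Rmult_le_pos; apply pow2_ge_0). pose proof (Rabs_pos k).
  assert (0 <= Rabs k * s) by (apply Rmult_le_pos; auto).
pose proof (Rabs_pos (kP A B k s)). pose proof (Rabs_pos (kQ A B k s)).
assert (Rabs k * s * Rabs (kQ A B k s) <= Rabs k * s * kN A B) by (apply Rmult_le_compat_l; auto).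
assert (k^2 * s^2 * Rabs (kP A B k s) <= k^2 * s^2 * kN A B) by (apply Rmult_le_compat_l; auto).
assert (0 <= k^2 * s^2 * Rabs (kP A B k s)) by (apply Rmult_le_pos; auto).
lra.
Qed.

Lemma sq_inbox_bound x y L : inbox L y -> sq x y <= 3 * (L + l1_norm x)^2.
Proof.
intros [H1 [H2 H3]]. unfold sq, l1_norm. assert (P1 := Rabs_pos (px1 x)); assert (P2 := Rabs_pos (px2 x));
  assert (P3 := Rabs_pos (px3 x)).
assert (T : forall u v, Rabs u <= L -> Rabs v <= Rabs (px1 x) + Rabs (px2 x) + Rabs (px3 x) ->
  (u - v)^2 <= (L + (Rabs (px1 x) + Rabs (px2 x) + Rabs (px3 x)))^2).
{ intros u v Hu Hv. apply Rabs_le_between in Hu, Hv. apply pow_maj_Rabs. apply Rabs_le. lra. }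
assert (T1 := T (px1 y) (px1 x) H1 ltac:(lra)). assert (T2 := T (px2 y) (px2 x) H2 ltac:(lra)).
  assert (T3 := T (px3 y) (px3 x) H3 ltac:(lra)). lra.
Qed.

Lemma ct_kM e x y : e <> 0 -> ct (fun y => kM (sqrt (sq x y + e^2))) y.
Proof.
intros He. assert (E2 : 0 < e^2) by (apply pow2_gt_0; auto). assert (P := sq_ge0 x y).
apply (ct_comp (fun T => kM (sqrt T)) (fun y => sq x y + e^2)); [ctt; apply ct_sq|].
apply (continuous_comp sqrt kM); [|apply continuous_kM]. apply (ex_derive_continuous sqrt). auto_derive. lra.
Qed.

(** F times [kM] minus A F(x) times the cutoff is small near x, so [delta_small] disposes of it;
    what is left is A F(x) times the mass computed in [delta_mass]. *)
Lemma delta_lim F x : Cc F -> forall eta, 0 < eta -> exists e0, 0 < e0 /\ forall e, 0 < e < e0 ->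
  Rabs (int3 (fun y => F y * (4 * e^2 * kap2 A B k (sq x y + e^2))) - c0 * A * F x) <= eta.
Proof.
intros HF eta Heta.
destruct (Cc_bounded F HF) as [MF [HMF BF]]. destruct (Cc_box F HF) as [L [HL SF]].
pose (TM := 3 * (L + l1_norm x)^2 + 1). assert (HTM : 0 <= TM) by (unfold TM;
  pose proof (pow2_ge_0 (L + l1_norm x)); lra).
pose (N := kN A B * (1 + Rabs k * (1 + TM) + k^2 * TM)).
assert (HN : 0 <= N).
{ unfold N. apply Rmult_le_pos; [apply kN_ge0|]. pose proof (Rabs_pos k). pose proof (pow2_ge_0 k). nra. }
pose (E := fun e y => F y * kM (sqrt (sq x y + e^2)) - A * F x * cut 1 x y).
assert (CE : forall e, e <> 0 -> Cc (E e)).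
{ intros e He. unfold E. cct. apply Cc_mult_r; auto; intros; now apply ct_kM. apply cut_Cc; lra. }
pose (L' := Rmax L (l1_norm x + 2)). assert (L1 : L <= L') by apply Rmax_l.
  assert (L2 : l1_norm x + 2 <= L') by apply Rmax_r.
assert (P1 : 0 < eta / 2) by lra.
destruct (delta_small E x L' (MF * N + Rabs A * MF)) with (eta := eta/2) as [e1 [He1 K1]]; auto.
{ lra. }
{ pose proof (Rabs_pos A). assert (0 <= MF * N) by (apply Rmult_le_pos; lra).
  assert (0 <= Rabs A * MF) by (apply Rmult_le_pos; lra). lra. }
{ intros e He. assert (e <> 0) by lra. split; [now apply CE|split].
  - intros y Hy. destruct (Req_dec (F y) 0) as [Z|Z].
    + apply (inbox_le (l1_norm x + 2)); auto. replace 2 with (2 * 1) by ring. apply cut_bsupp; [lra|].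
      intros Z'; apply Hy. unfold E; rewrite Z, Z'; ring.
    + apply (inbox_le L); auto.
  - intros y. unfold E, Rminus. eapply Rle_trans; [apply Rabs_triang|]. rewrite Rabs_Ropp, !Rabs_mult.
    assert (Tb := tau_bounds (sq x y / 1^2)). fold (cut 1 x y) in Tb. rewrite (Rabs_right (cut 1 x y)) by lra.
    apply Rplus_le_compat.
    + destruct (Req_dec (F y) 0) as [Z|Z]; [rewrite Z, Rabs_R0, Rmult_0_l; apply Rmult_le_pos; lra|].
      apply Rmult_le_compat; try apply Rabs_pos; auto.
      assert (T := sq_inbox_bound x y L (SF y Z)). assert (P := sq_ge0 x y).
      assert (T2 : 0 <= sq x y + e^2 <= TM) by (unfold TM; nra).
      eapply Rle_trans; [apply kM_bound, sqrt_pos|]. unfold N. apply Rmult_le_compat_l; [apply kN_ge0|].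
      assert (Q : sqrt (sq x y + e^2)^2 = sq x y + e^2) by (rewrite pow2_sqrt; lra). rewrite Q.
      assert (Q2 : sqrt (sq x y + e^2) <= 1 + TM) by (pose proof (sqrt_pos (sq x y + e^2)); nra).
      pose proof (Rabs_pos k). pose proof (pow2_ge_0 k). nra.
    + rewrite <- (Rmult_1_r (Rabs A * MF)). pose proof (Rabs_pos A). pose proof (Rabs_pos (F x)).
      apply Rmult_le_compat; try lra; [apply Rmult_le_pos; auto|]. apply Rmult_le_compat_l; auto. }
{ intros h Hh. pose (h1 := h / (2 * (MF + 1))). pose (h2 := h / (2 * (Rabs A + 1))). pose proof (Rabs_pos A).
  assert (Hh1 : 0 < h1) by (apply Rdiv_lt_0_compat; lra). assert (Hh2 : 0 < h2) by (apply Rdiv_lt_0_compat; lra).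
  destruct (proj1 (ct_iff F x) (proj1 HF x) h2 Hh2) as [d1 [Hd1 C1]].
  destruct (proj1 (filterlim_locally kM (kM 0)) (continuous_kM 0) (mkposreal h1 Hh1)) as [[d2 Hd2] C2]. simpl in C2.
  pose (d := Rmin (Rmin d1 (d2 / 2)) (1/2)). assert (Hd : 0 < d /\ d <= d1 /\ d <= d2/2 /\ d <= 1/2).
  { unfold d; repeat split; [repeat apply Rmin_pos; lra| eapply Rle_trans;
    [apply Rmin_l|apply Rmin_l]|eapply Rle_trans; [apply Rmin_l|apply Rmin_r]|apply Rmin_r]. }
  exists d; split; [lra|]. intros e He y Hy. unfold E. rewrite cut_one; [| lra | apply sq_near in Hy; nra].
  assert (P := sq_ge0 x y). assert (Q := sq_near _ _ _ Hy).
  assert (S : Rabs (sqrt (sq x y + e^2) - 0) < d2).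
  { rewrite Rminus_0_r, Rabs_right by (apply Rle_ge, sqrt_pos). apply Rlt_le_trans with (2 * d); [|lra].
    rewrite <- (sqrt_pow2 (2 * d)) by lra. apply sqrt_lt_1_alt. nra. }
  apply C2 in S. unfold ball in S; simpl in S; unfold AbsRing_ball, abs, minus, plus, opp in S; simpl in S.
    rewrite kM_0 in S.
  assert (S2 := C1 y ltac:(eapply near_le; [|exact Hy]; lra)).
  replace (F y * kM (sqrt (sq x y + e^2)) - A * F x * 1) with (F y * (kM (sqrt (sq x y + e^2)) + - A) + A * (F y - F
    x)) by ring.
  eapply Rle_trans; [apply Rabs_triang|]. rewrite !Rabs_mult.
  assert (Rabs (F y) * Rabs (kM (sqrt (sq x y + e^2)) + - A) <= (MF + 1) * h1).
  { apply Rmult_le_compat; try apply Rabs_pos; [specialize (BF y); lra|]. left; exact S. }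
  assert (Rabs A * Rabs (F y - F x) <= (Rabs A + 1) * h2).
  { apply Rmult_le_compat; try apply Rabs_pos; lra. }
  replace h with ((MF + 1) * h1 + (Rabs A + 1) * h2) by (unfold h1, h2; field; lra). lra. }
destruct delta_mass as [C [HC DM]].
pose (Rc := Rabs (A * F x) * C). assert (HR : 0 <= Rc) by (apply Rmult_le_pos; [apply Rabs_pos|lra]).
pose (e2 := Rmin 1 (eta / (2 * (Rc + 1)))). assert (P2 : 0 < eta / (2 * (Rc + 1))) by (apply Rdiv_lt_0_compat; lra).
assert (He2 : 0 < e2 /\ e2 <= 1 /\ e2 <= eta / (2 * (Rc + 1))).
{ unfold e2; repeat split; [apply Rmin_pos; lra|apply Rmin_l|apply Rmin_r]. }
exists (Rmin e1 e2); split; [apply Rmin_pos; lra|]. intros e He.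
assert (He' : 0 < e < e1 /\ e < e2) by (pose proof (Rmin_l e1 e2); pose proof (Rmin_r e1 e2); lra).
assert (Ne : e <> 0) by lra. specialize (K1 e (proj1 He')). specialize (DM e x Ne).
assert (CA : Cc (fun y => cut 1 x y * delta_kernel e x y)) by (apply Cc_mult_r; [apply cut_Cc; lra|intros;
  now apply ct_delta_kernel]).
assert (CEA : Cc (fun y => E e y * delta_kernel e x y)) by (apply Cc_mult_r; auto; intros; now apply ct_delta_kernel).
rewrite (I_ext _ (fun y => E e y * delta_kernel e x y + A * F x * (cut 1 x y * delta_kernel e x y))).
2:{ intros y. rewrite kap2_kM by auto. unfold E. ring. }
rewrite I_plus, I_scal; auto using Cc_scal.
replace (int3 (fun y => E e y * delta_kernel e x y) + A * F x * int3 (fun y => cut 1 x y * delta_kernel e x y) - c0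
  * A * F x) with
  (int3 (fun y => E e y * delta_kernel e x y) + A * F x * (int3 (fun y => cut 1 x y * delta_kernel e x y) - c0)) by
    ring.
eapply Rle_trans; [apply Rabs_triang|]. rewrite Rabs_mult.
assert (Rabs (A * F x) * Rabs (int3 (fun y => cut 1 x y * delta_kernel e x y) - c0) <= Rc * e^2).
{ unfold Rc. rewrite Rmult_assoc. apply Rmult_le_compat_l; [apply Rabs_pos|auto]. }
assert (Rc * e^2 <= eta / 2).
{ apply Rle_trans with ((Rc + 1) * (eta / (2 * (Rc + 1)))); [|right; field; lra]. assert (e^2 <= e) by nra.
  apply Rmult_le_compat; nra. }
lra.
Qed.

(** W is paired with the commutator of the Laplacian and the cutoff f, applied to the kernel: the
    part of (Laplacian + k^2)(f K) that is not concentrated at the pole. It keeps its meaning at e =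
    0 as soon as f is constant near x. *)
Definition commutator_int (e : R) (x : pt) (W : pt -> R) (p q : nat -> pt -> R) : R :=
  int3 (fun y => W y * (Kf A B k e x y * lap q y + 2 * grad_dot p (Kg A B k e x) y)).

Lemma repr_reg S W f p q x : weak_helmholtz k S W -> test S f p q -> forall eta, 0 < eta -> exists e0,
  0 < e0 /\ forall e, 0 < e < e0 ->
  Rabs (commutator_int e x W p q - c0 * A * (W x * f x)) <= eta.
Proof.
intros [HW Hw] T eta Heta.
assert (CF : Cc (fun y => W y * f y)) by (now apply (test_Cc0 S f p q)).
destruct (delta_lim (fun y => W y * f y) x CF eta Heta) as [e0 [He0 K]].
exists e0; split; [exact He0|]. intros e He. assert (Ne : e <> 0) by lra.
assert (KC := Kf_C2 A B k e x Ne).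
assert (T2 := test_mult _ _ _ _ _ _ _ T KC).
specialize (Hw _ _ _ T2).
assert (CK : Cc (fun y => W y * f y * (4 * e^2 * kap2 A B k (sq x y + e^2)))).
{ apply Cc_mult_r; auto. intros y. apply (ct_mult (fun _ => 4 * e^2)); [apply ct_const|now apply ct_kap2]. }
assert (CR := test_Cc_lap _ _ _ _ W (k^2) T2 HW).
replace (commutator_int e x W p q) with (int3 (fun y => W y * f y * (4 * e^2 * kap2 A B k (sq x y + e^2))));
  [apply K; auto|].
unfold commutator_int.
assert (Q : forall y, W y * (Kf A B k e x y * lap q y + 2 * grad_dot p (Kg A B k e x) y) = 
  W y * (lap (fun (i : nat) (y0 : pt) => q i y0 * Kf A B k e x y0 + 2 * (p i y0 * Kg A B k e x i y0) + f y0 * Kh A B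
    k e x i y0) y + k^2 * (f y * Kf A B k e x y))
   + W y * f y * (4 * e^2 * kap2 A B k (sq x y + e^2))).
{ intros y. assert (L := Kf_lap A B k e x y Ne). unfold lap in *. unfold grad_dot.
  replace (4 * e^2 * kap2 A B k (sq x y + e^2)) with (- (Kh A B k e x 0%nat y + Kh A B k e x 1%nat y + Kh A B k e x
    2%nat y + k^2 * Kf A B k e x y)) by lra. ring. }
symmetry. exact (eq_trans (I_ext _ _ Q) (eq_trans (I_plus _ _ CR CK) (eq_trans (f_equal2 Rplus Hw eq_refl)
  (Rplus_0_l _)))).
Qed.

Lemma rad_lim (h : R -> R) g x d : (forall r, 0 < r -> exists C, 0 <= C /\ forall t e,
  r^2 <= t -> Rabs (h (t + e^2) - h t) <= C * e^2) ->
  (forall T, 0 < T -> continuous h T) -> Cc g -> 0 < d -> (forall y, near d x y -> g y = 0) ->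
  (forall e, Cc (fun y => h (sq x y + e^2) * g y)) /\
  exists C, 0 <= C /\ forall e, Rabs (int3 (fun y => h (sq x y + e^2) * g y) - int3 (fun y => h (sq x y + 0^2) * g
    y)) <= C * e^2.
Proof.
intros Hh Hc Hg Hd Hz. destruct (Cc_box g Hg) as [L [HL B0]].
assert (CC : forall e, Cc (fun y => h (sq x y + e^2) * g y)).
{ intros e. apply (Cc_away x (fun y => h (sq x y + e^2)) g L d); auto; [|apply Hg].
  intros y Hy. unfold away_from in Hy. apply (ct_comp h (fun y => sq x y + e^2)); [ctt; apply ct_sq|apply Hc].
    pose proof (pow2_ge_0 e). lra. }
split; auto. destruct (Hh d Hd) as [C [HC HD]]. assert (CA := Cc_abs g Hg).
exists (C * int3 (fun y => Rabs (g y))). assert (P : 0 <= int3 (fun y => Rabs (g y))) by (apply I_ge0; auto;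
  intros; apply Rabs_pos).
split; [now apply Rmult_le_pos|]. intros e. rewrite <- I_minus by auto.
replace (C * int3 (fun y => Rabs (g y)) * e^2) with (C * e^2 * int3 (fun y => Rabs (g y))) by ring.
  rewrite <- I_scal by auto.
apply Rabs_I_le; cct; auto. intros y. rewrite <- Rmult_minus_distr_r, Rabs_mult.
destruct (classic (near d x y)) as [N|N].
- rewrite (Hz y N), Rabs_R0; lra.
- apply Rmult_le_compat_r; [apply Rabs_pos|]. replace (sq x y + 0^2) with (sq x y) by ring. apply HD.
  now apply notnear_sq.
Qed.

Lemma kap_radial : (forall r, 0 < r -> exists C, 0 <= C /\ forall t e,
  r^2 <= t -> Rabs (kap A B k (t + e^2) - kap A B k t) <= C * e^2) /\
  (forall T, 0 < T -> continuous (kap A B k) T).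
Proof.
split.
- intros r Hr. exists (kN A B * (Rabs k / r^2 + / r^3)). split.
  + apply Rmult_le_pos; [apply kN_ge0|]. pose proof (Rabs_pos k). assert (0 < r^2) by (apply pow_lt; auto).
    assert (0 < / r^3) by (apply Rinv_0_lt_compat, pow_lt; auto).
    assert (0 <= Rabs k / r^2) by (apply Rmult_le_pos; auto; left; now apply Rinv_0_lt_compat). lra.
  + intros t e H. now apply kap_diff.
- intros T HT. apply (ex_derive_continuous (kap A B k)). eexists; now apply is_derive_kap.
Qed.

Lemma kap1_radial : (forall r, 0 < r -> exists C, 0 <= C /\ forall t e,
  r^2 <= t -> Rabs (kap1 A B k (t + e^2) - kap1 A B k t) <= C * e^2) /\
  (forall T, 0 < T -> continuous (kap1 A B k) T).
Proof.
split.
- intros r Hr. exists (kN A B * (/ r^5 + Rabs k / r^4 + k^2 / r^3)). split.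
  + apply Rmult_le_pos; [apply kN_ge0|]. pose proof (Rabs_pos k).
    assert (0 < / r^4) by (apply Rinv_0_lt_compat, pow_lt; auto).
    assert (0 < / r^3) by (apply Rinv_0_lt_compat, pow_lt; auto).
    assert (0 < / r^5) by (apply Rinv_0_lt_compat, pow_lt; auto).
    assert (0 <= Rabs k / r^4) by (apply Rmult_le_pos; lra). assert (0 <= k^2 / r^3) by (apply Rmult_le_pos;
      [apply pow2_ge_0|lra]). lra.
  + intros t e H. now apply kap_diff.
- intros T HT. apply (ex_derive_continuous (kap1 A B k)). eexists; now apply is_derive_kap1.
Qed.

Lemma Kf_lim g x d : Cc g -> 0 < d -> (forall y, near d x y -> g y = 0) ->
  (forall e, Cc (fun y => Kf A B k e x y * g y)) /\
  exists C, 0 <= C /\ forall e, Rabs (int3 (fun y => Kf A B k e x y * g y) - int3 (fun y => Kf A B k 0 x y * g y))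
    <= C * e^2.
Proof. intros. apply (rad_lim (kap A B k) g x d); auto; apply kap_radial. Qed.

Lemma Kg_lim g x d i : Cc g -> 0 < d -> (forall y, near d x y -> g y = 0) ->
  (forall e, Cc (fun y => Kg A B k e x i y * g y)) /\
  exists C, 0 <= C /\ forall e, Rabs (int3 (fun y => Kg A B k e x i y * g y) - int3 (fun y => Kg A B k 0 x i y * g
    y)) <= C * e^2.
Proof.
intros Hg Hd Hz.
destruct (rad_lim (kap1 A B k) (fun y => 2 * (coord y i - coord x i) * g y) x d) as [H1 [C [HC H2]]]; auto;
  try apply kap1_radial.
- apply Cc_mult_l; auto. intros; ctt.
- intros y Hy; rewrite Hz by auto; ring.
- assert (E : forall e y, kap1 A B k (sq x y + e^2) * (2 * (coord y i - coord x i) * g y) = Kg A B k e x i y * g y)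
  by (intros; unfold Kg; ring).
  split.
  + intros e. exact (Cc_ext (fun y => kap1 A B k (sq x y + e^2) * (2 * (coord y i - coord x i) * g y)) (fun y => Kg
    A B k e x i y * g y) (E e) (H1 e)).
  + exists C; split; [exact HC|]. intros e. specialize (H2 e). 
    rewrite (I_ext (fun y => kap1 A B k (sq x y + e^2) * (2 * (coord y i - coord x i) * g y)) (fun y => Kg A B k e x
      i y * g y) (E e)),
      (I_ext (fun y => kap1 A B k (sq x y + 0^2) * (2 * (coord y i - coord x i) * g y)) (fun y => Kg A B k 0 x i y *
        g y) (E 0)) in H2. exact H2.
Qed.

(** The weak equation is tested with f times the regularised kernel and e tends to zero. Since f is
    constant near x, its derivatives vanish there, and the singular kernel meets its pole only where
    the other factor is zero. *)
Lemma repr S W f p q x d : weak_helmholtz k S W -> test S f p q -> 0 < d -> (forall y, near d x y -> f y = f x) ->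
  commutator_int 0 x W p q = c0 * A * (W x * f x).
Proof.
intros HW T Hd Hc. assert (HW' := HW). destruct HW' as [Wc Ww].
assert (TC := T). destruct TC as [C [[L BL] [m M]]].
assert (Z : forall y, near (d/2) x y -> forall i, p i y = 0 /\ q i y = 0).
(* [dead_derivs] asks for a function that vanishes, so it is applied to f - f x. *)
{ intros y Hy i. assert (T' : C2on all (fun y => 1 * f y + - f x * 1) (fun i y => 1 * p i y + - f x * 0) (fun i y =>
  1 * q i y + - f x * 0)).
  { apply (C2on_lin all f p q (fun _ => 1) (fun _ _ => 0) (fun _ _ => 0) 1 (- f x)); auto.
    intros z _. split; [apply ct_const|]. intros j. refine (conj _ (conj _ (conj _ _))); try apply ct_const;
      apply pd_const. }
  destruct (dead_derivs _ _ _ x d T' Hd) with (z := y) (i := i) as [E1 E2]; auto.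
  - intros z Hz. rewrite Hc by auto. ring.
  - lra. }
assert (Hl : Cc (fun y => W y * lap q y)) by (apply (Cc_ext (fun y => W y * (lap q y + 0 * f y))); [intros; ring|];
  eapply test_Cc_lap; eauto).
destruct (Kf_lim (fun y => W y * lap q y) x (d/2)) as [F1 [C1 [HC1 F2]]]; auto; try lra.
{ intros y Hy. unfold lap. destruct (Z y Hy 0%nat) as [_ ->], (Z y Hy 1%nat) as [_ ->], (Z y Hy 2%nat) as [_ ->].
  ring. }
assert (G : forall i, (forall e, Cc (fun y => Kg A B k e x i y * (W y * p i y))) /\
  exists C, 0 <= C /\ forall e, Rabs (int3 (fun y => Kg A B k e x i y * (W y * p i y)) - int3 (fun y => Kg A B k 0 x
    i y * (W y * p i y))) <= C * e^2).
{ intros i. apply (Kg_lim (fun y => W y * p i y) x (d/2) i); [now apply (test_Cc1 S f p q)|lra|].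
  intros y Hy. destruct (Z y Hy i) as [-> _]. ring. }
destruct (G 0%nat) as [G0 [D0 [HD0 G0']]], (G 1%nat) as [G1 [D1 [HD1 G1']]], (G 2%nat) as [G2 [D2 [HD2 G2']]].
assert (S1 : forall e, commutator_int e x W p q = int3 (fun y => Kf A B k e x y * (W y * lap q y)) + 2 * (int3 (fun
  y => Kg A B k e x 0%nat y * (W y * p 0%nat y))
   + int3 (fun y => Kg A B k e x 1%nat y * (W y * p 1%nat y)) + int3 (fun y => Kg A B k e x 2%nat y * (W y * p 2%nat
     y)))).
{ intros e. rewrite <- (I_comb _ _ _ _ 2 (F1 e) (G0 e) (G1 e) (G2 e)). apply I_ext; intros y; unfold grad_dot; ring. }
apply Rminus_diag_uniq, NNPP; intros N. assert (Np := Rabs_pos_lt _ N).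
set (del := Rabs (commutator_int 0 x W p q - c0 * A * (W x * f x))) in *.
destruct (repr_reg S W f p q x HW T (del / 2) ltac:(lra)) as [e0 [He0 K]].
pose (Rc := C1 + 2 * (D0 + D1 + D2)). assert (HR : 0 <= Rc) by (unfold Rc; lra).
assert (P2 : 0 < del / (4 * (Rc + 1))) by (apply Rdiv_lt_0_compat; lra).
pose (e := Rmin (e0 / 2) (Rmin 1 (del / (4 * (Rc + 1))))).
assert (He : 0 < e /\ e <= e0/2 /\ e <= 1 /\ e <= del / (4 * (Rc + 1))).
{ unfold e; repeat split; [repeat apply Rmin_pos; lra|apply Rmin_l| |]; (eapply Rle_trans; [apply Rmin_r|]);
  [apply Rmin_l|apply Rmin_r]. }
specialize (K e ltac:(lra)).
assert (Q : Rabs (commutator_int e x W p q - commutator_int 0 x W p q) <= Rc * e^2).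
{ rewrite (S1 e), (S1 0). specialize (F2 e). specialize (G0' e). specialize (G1' e). specialize (G2' e).
  apply Rabs_le_between in F2, G0', G1', G2'. apply Rabs_le. unfold Rc. lra. }
assert (Rc * e^2 <= del / 4).
{ apply Rle_trans with ((Rc + 1) * (del / (4 * (Rc + 1)))); [|right; field; lra]. assert (e^2 <= e) by nra.
  apply Rmult_le_compat; nra. }
assert (del <= Rabs (commutator_int e x W p q - commutator_int 0 x W p q) + Rabs (commutator_int e x W p q - c0 * A
  * (W x * f x))).
{ unfold del. rewrite <- (Rabs_Ropp (commutator_int e x W p q - commutator_int 0 x W p q)).
  replace (commutator_int 0 x W p q - c0 * A * (W x * f x)) with (- (commutator_int e x W p q - commutator_int 0 x W
    p q) + (commutator_int e x W p q - c0 * A * (W x * f x))) by ring. apply Rabs_triang. }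
lra.
Qed.
End Repr.

(** * Interior regularity by correlation with a fixed kernel *)

Definition conv3 (V h : pt -> R) (x : pt) : R := int3 (fun y => V y * h (vsub y x)).

Lemma near_vsub d x x' y : near d x x' -> near d (vsub y x) (vsub y x').
Proof.
intros [H1 [H2 H3]]; repeat split; cbn.
- replace (px1 y - px1 x' - (px1 y - px1 x)) with (- (px1 x' - px1 x)) by ring. now rewrite Rabs_Ropp.
- replace (px2 y - px2 x' - (px2 y - px2 x)) with (- (px2 x' - px2 x)) by ring. now rewrite Rabs_Ropp.
- replace (px3 y - px3 x' - (px3 y - px3 x)) with (- (px3 x' - px3 x)) by ring. now rewrite Rabs_Ropp.
Qed.

Lemma vsub_tr x y : vsub y x = tr (vscale (-1) x) y.
Proof. apply pt_eq; cbn; ring. Qed.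

Lemma Cc_vsub h x : Cc h -> Cc (fun y => h (vsub y x)).
Proof. intros H. apply (Cc_ext (fun y => h (tr (vscale (-1) x) y))); [intros; now rewrite vsub_tr|].
  now apply Cc_tr. Qed.

Lemma conv3_Cc V h x : Cc V -> Cc h -> Cc (fun y => V y * h (vsub y x)).
Proof. intros HV Hh. apply Cc_mult_r; auto. apply Cc_vsub, Hh. Qed.

Lemma conv3_ct V h x : Cc V -> Cc h -> ct (conv3 V h) x.
Proof.
intros HV Hh. apply ct_iff. intros e He. assert (AV := Cc_abs V HV).
assert (P : 0 <= int3 (fun y => Rabs (V y))) by (apply I_ge0; auto; intros; apply Rabs_pos).
assert (Q : 0 < e / (2 * (int3 (fun y => Rabs (V y)) + 1))) by (apply Rdiv_lt_0_compat; lra).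
destruct (Cc_uc h Hh _ Q) as [d [Hd U]]. exists d; split; auto. intros x' Hx'.
unfold conv3. rewrite <- (I_minus _ _ (conv3_Cc V h x' HV Hh) (conv3_Cc V h x HV Hh)).
set (e1 := e / (2 * (int3 (fun y => Rabs (V y)) + 1))) in *.
apply Rle_lt_trans with (int3 (fun y => e1 * Rabs (V y))).
- apply Rabs_I_le.
  + apply Cc_minus; now apply conv3_Cc.
  + now apply Cc_scal.
  + intros y. rewrite <- Rmult_minus_distr_l, Rabs_mult, Rmult_comm. apply Rmult_le_compat_r; [apply Rabs_pos|].
    left. apply U, near_vsub, Hx'.
- rewrite I_scal by auto. unfold e1. apply Rle_lt_trans with (e / 2); [|lra].
  apply Rle_trans with (e1 * (int3 (fun y => Rabs (V y)) + 1)); [|right; unfold e1; field; lra]. unfold e1 in *; nra.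
Qed.

(** The kernel is taken at y - x, so that x enters with a minus sign; hence the sign of the
    derivative. Uniform continuity of the derivative of the kernel allows differentiation under the
    integral, with no regularity of V. *)
Lemma conv3_pd V h hi i x : Cc V -> Cc h -> Cc hi -> (forall y,
  pd i h y (hi y)) -> pd i (conv3 V h) x (- conv3 V hi x).
Proof.
intros HV Hh Hhi Hp. apply pd_def, is_derive_Reals. intros e He. assert (AV := Cc_abs V HV).
assert (P : 0 <= int3 (fun y => Rabs (V y))) by (apply I_ge0; auto; intros; apply Rabs_pos).
assert (Q : 0 < e / (2 * (int3 (fun y => Rabs (V y)) + 1))) by (apply Rdiv_lt_0_compat; lra).
destruct (Cc_uc hi Hhi _ Q) as [d [Hd U]]. exists (mkposreal d Hd). intros t Ht Htd. cbn in Htd.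
rewrite Rplus_0_l, shift_0.
set (e1 := e / (2 * (int3 (fun y => Rabs (V y)) + 1))) in *.
assert (C1 := conv3_Cc V h (shift x i t) HV Hh). assert (C2 := conv3_Cc V h x HV Hh).
  assert (C3 := conv3_Cc V hi x HV Hhi).
assert (C4 := Cc_scal (/ t) _ (Cc_minus _ _ C1 C2)).
replace ((conv3 V h (shift x i t) - conv3 V h x) / t - - conv3 V hi x) with
  (int3 (fun y => / t * (V y * h (vsub y (shift x i t)) - V y * h (vsub y x)) + V y * hi (vsub y x))).
2:{ rewrite (I_plus _ _ C4 C3), (I_scal _ _ (Cc_minus _ _ C1 C2)), (I_minus _ _ C1 C2). unfold conv3. field.
  exact Ht. }
apply Rle_lt_trans with (int3 (fun y => e1 * Rabs (V y))).
- apply Rabs_I_le.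
  + now apply Cc_plus.
  + now apply Cc_scal.
  + intros y. replace (vsub y (shift x i t)) with (shift (vsub y x) i (- t)).
    2:{ destruct i as [|[|i]]; apply pt_eq; cbn; ring. }
    destruct (pd_MVT i h hi (vsub y x) (- t)) as [s [Hs E]]; [intros; apply Hp|].
    replace (/ t * (V y * h (shift (vsub y x) i (- t)) - V y * h (vsub y x)) + V y * hi (vsub y x)) with
      (V y * (/ t * (h (shift (vsub y x) i (- t)) - h (vsub y x)) + hi (vsub y x))) by ring.
    rewrite E. replace (/ t * (- t * hi (shift (vsub y x) i s)) + hi (vsub y x)) with (- (hi (shift (vsub y x) i s)
      - hi (vsub y x))) by (field; auto).
    rewrite Rabs_mult, Rabs_Ropp, Rmult_comm. apply Rmult_le_compat_r; [apply Rabs_pos|]. left. apply U, near_shift.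
    apply Rabs_between_0 in Hs. rewrite Rabs_Ropp in Hs. lra.
- rewrite I_scal by auto. apply Rle_lt_trans with (e / 2); [|lra].
  apply Rle_trans with (e1 * (int3 (fun y => Rabs (V y)) + 1)); [|right; unfold e1; field; lra]. unfold e1 in *; nra.
Qed.

Lemma conv3_bound V h x d M N : Cc V -> Cc h -> 0 <= d -> bsupp h d -> (forall y, Rabs (h y) <= N) ->
  (forall y, inbox d (vsub y x) -> Rabs (V y) <= M) -> Rabs (conv3 V h x) <= 8 * d^3 * (M * N).
Proof.
intros HV Hh Hd B HN HM. unfold conv3. rewrite <- (I_tr _ x (conv3_Cc V h x HV Hh)).
assert (E : forall y, vsub (tr x y) x = y) by (intros; apply pt_eq; cbn; ring).
assert (M0 : 0 <= M).
{ eapply Rle_trans; [apply (Rabs_pos (V x))|]. apply HM. repeat split; cbn; rewrite Rminus_diag, Rabs_R0; auto. }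
apply I_bound; auto.
- apply (Cc_tr _ x (conv3_Cc V h x HV Hh)).
- intros y Hy. rewrite E in Hy. apply B. intros Z; apply Hy. rewrite Z; ring.
- intros y. rewrite E, Rabs_mult. destruct (Req_dec (h y) 0) as [Z|Z].
  + rewrite Z, Rabs_R0, Rmult_0_r. apply Rmult_le_pos; auto. eapply Rle_trans; [apply Rabs_pos|apply (HN y)].
  + apply Rmult_le_compat; try apply Rabs_pos; auto. apply HM. rewrite E. now apply B.
Qed.

Section Grad.
Variable k : R.

(* (Laplacian + k^2) of cutoff times fundamental solution away from the pole: the kernel that reproduces weak solutions. *)
Definition comm_radial (d t : R) : R := kap 1 0 k t * (6 * (tau1 (t / d^2) / d^2) + 4 * t * (tau2 (t / d^2) / d^4))
  + 8 * t * (tau1 (t / d^2) / d^2) * kap1 1 0 k t.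
Definition comm_radial1 (d t : R) : R :=
  kap1 1 0 k t * (6 * (tau1 (t / d^2) / d^2) + 4 * t * (tau2 (t / d^2) / d^4))
  + kap 1 0 k t * (10 * (tau2 (t / d^2) / d^4) + 4 * t * (tau3 (t / d^2) / d^6))
  + 8 * (tau1 (t / d^2) / d^2) * kap1 1 0 k t + 8 * t * (tau2 (t / d^2) / d^4) * kap1 1 0 k t + 8 * t * (tau1 (t /
    d^2) / d^2) * kap2 1 0 k t.

Lemma tau_div_0 d t : 0 < d -> t <= d^2 \/ 4 * d^2 <= t -> tau1 (t / d^2) = 0 /\ tau2 (t / d^2) = 0 /\ tau3 (t /
  d^2) = 0.
Proof.
intros Hd H. assert (D2 : 0 < d^2) by (apply pow_lt; auto). apply tau123_0. destruct H; [left|right].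
- apply div_le_iff; lra.
- apply Rmult_le_reg_r with (d^2); auto. unfold Rdiv; rewrite Rmult_assoc, Rinv_l; lra.
Qed.

Lemma comm_radial_0 d t : 0 < d -> t <= d^2 \/ 4 * d^2 <= t -> comm_radial d t = 0 /\ comm_radial1 d t = 0.
Proof.
intros Hd H. destruct (tau_div_0 d t Hd H) as [E1 [E2 E3]]. unfold comm_radial, comm_radial1. rewrite E1, E2, E3.
split; field; repeat split; lra.
Qed.

Lemma is_derive_comm_radial d t : 0 < d -> is_derive (comm_radial d) t (comm_radial1 d t).
Proof.
intros Hd. assert (D2 : 0 < d^2) by (apply pow_lt; auto).
destruct (Rlt_le_dec t (d^2)) as [H|H].
- destruct (comm_radial_0 d t Hd) as [_ E]; [lra|]. rewrite E.
  apply (is_derive_ext_loc (fun _ => 0)); [|apply (is_derive_const 0 t)].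
  assert (P : 0 < d^2 - t) by lra. exists (mkposreal _ P). intros u Hu.
  unfold ball in Hu; simpl in Hu; unfold AbsRing_ball, abs, minus, plus, opp in Hu; simpl in Hu.
    apply Rabs_lt_between in Hu.
  symmetry. apply comm_radial_0; auto. left. lra.
- assert (Ht : 0 < t) by lra.
  assert (K0 := is_derive_kap 1 0 k t Ht). assert (K1 := is_derive_kap1 1 0 k t Ht).
  assert (T1 := is_derive_tau1 (t / d^2)). assert (T2 := is_derive_tau2 (t / d^2)).
  unfold comm_radial. auto_derive.
  + repeat split; try lra; eexists; eassumption.
  + replace (Derive (fun x => kap 1 0 k x) t) with (kap1 1 0 k t) by (symmetry;
    apply (is_derive_unique (kap 1 0 k) t _ K0)).
    replace (Derive (fun x => kap1 1 0 k x) t) with (kap2 1 0 k t) by (symmetry;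
      apply (is_derive_unique (kap1 1 0 k) t _ K1)).
    replace (Derive (fun x => tau1 x) (t * / (d * (d * 1)))) with (tau2 (t / d^2)) by (symmetry;
      apply (is_derive_unique tau1 (t / d^2) _ T1)).
    replace (Derive (fun x => tau2 x) (t * / (d * (d * 1)))) with (tau3 (t / d^2)) by (symmetry;
      apply (is_derive_unique tau2 (t / d^2) _ T2)).
    unfold comm_radial1. simpl pow. unfold Rdiv. field. lra.
Qed.

Lemma continuous_comm_radial1 d t : 0 < d -> continuous (comm_radial1 d) t.
Proof.
intros Hd. assert (D2 : 0 < d^2) by (apply pow_lt; auto).
destruct (Rlt_le_dec t (d^2)) as [H|H].
- apply (continuous_ext_loc _ (fun _ => 0)); [|apply continuous_const].
  assert (P : 0 < d^2 - t) by lra. exists (mkposreal _ P). intros u Hu.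
  unfold ball in Hu; simpl in Hu; unfold AbsRing_ball, abs, minus, plus, opp in Hu; simpl in Hu.
    apply Rabs_lt_between in Hu.
  symmetry. apply comm_radial_0; auto. left. lra.
- assert (Ht : 0 < t) by lra.
  assert (Q : continuous (fun t => t / d^2) t) by (apply (ex_derive_continuous (fun t => t / d^2)); auto_derive; lra).
  assert (C0 : continuous (kap 1 0 k) t) by (apply (ex_derive_continuous (kap 1 0 k)); eexists;
    now apply is_derive_kap).
  assert (C1 : continuous (kap1 1 0 k) t) by (apply (ex_derive_continuous (kap1 1 0 k)); eexists;
    now apply is_derive_kap1).
  assert (C2 : continuous (kap2 1 0 k) t) by (now apply continuous_kap2).
  assert (T1 : continuous (fun t => tau1 (t / d^2)) t) by (apply (continuous_comp (fun t => t / d^2) tau1 t Q),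
    continuous_tau1).
  assert (T2 : continuous (fun t => tau2 (t / d^2)) t) by (apply (continuous_comp (fun t => t / d^2) tau2 t Q),
    continuous_tau2).
  assert (T3 : continuous (fun t => tau3 (t / d^2)) t) by (apply (continuous_comp (fun t => t / d^2) tau3 t Q),
    continuous_tau3).
  unfold comm_radial1, Rdiv.
  assert (PL : forall f g : R -> R, continuous f t -> continuous g t ->
    continuous (fun t => f t + g t) t) by (intros f g; apply (continuous_plus f g)).
  assert (MU : forall f g : R -> R, continuous f t -> continuous g t ->
    continuous (fun t => f t * g t) t) by (intros f g; apply (continuous_mult f g)).
  assert (CO : forall c : R, continuous (fun _ : R => c) t) by (intros; apply continuous_const).
  assert (ID : continuous (fun t : R => t) t) by apply continuous_id.
  repeat (cbv beta; match goal with
    | H : continuous ?f ?x |- continuous ?f ?x => exact H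
    | |- continuous (fun _ => ?c) ?x => exact (CO c)
    | |- continuous (fun u => @?f u + @?g u) ?x => refine (PL f g _ _)
    | |- continuous (fun u => @?f u * @?g u) ?x => refine (MU f g _ _) end).
Qed.

(** The kernel is of size 1 / d, two derivatives of the cutoff give d^-2, and one more derivative in
    the squared distance another d^-2. The restriction d <= 1 absorbs the terms that carry powers of
    k. *)
Lemma comm_radial_bound : exists C, 0 < C /\ forall d t, 0 < d <= 1 -> 0 <= t -> Rabs (comm_radial1 d t) <= C / d^5.
Proof.
destruct tau_bounded as [M [HM TB]]. pose (K := 1 + Rabs k + k^2). assert (Hk := Rabs_pos k).
  assert (Hk2 := pow2_ge_0 k).
exists (120 * M * K). split; [unfold K; nra|]. intros d t Hd Ht.
assert (D2 : 0 < d^2) by (apply pow_lt; lra). assert (D5 : 0 < / d^5) by (apply Rinv_0_lt_compat, pow_lt; lra).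
assert (C0 : 0 <= 120 * M * K / d^5) by (unfold K, Rdiv; apply Rmult_le_pos; nra).
destruct (Rle_dec t (d^2)) as [H|H]; [destruct (comm_radial_0 d t) as [_ ->]; [lra|lra|now rewrite Rabs_R0]|].
destruct (Rle_dec (4 * d^2) t) as [H'|H']; [destruct (comm_radial_0 d t) as [_ ->]; [lra|lra|now rewrite Rabs_R0]|].
destruct (TB (t / d^2)) as [T1 [T2 T3]].
assert (K0 := kap_bound 1 0 k t d ltac:(lra) ltac:(lra)). assert (K1 := kap1_bound 1 0 k t d ltac:(lra) ltac:(lra)).
  assert (K2 := kap2_bound 1 0 k t d ltac:(lra) ltac:(lra)).
assert (EN : kN 1 0 = 1) by (unfold kN; rewrite Rabs_R0, Rabs_right; lra). rewrite EN, Rmult_1_l in K0, K1, K2.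
(* after scaling by the right power of d every factor is bounded by K and M *)
pose (a0 := d * kap 1 0 k t). pose (a1 := d^3 * kap1 1 0 k t). pose (a2 := d^5 * kap2 1 0 k t). pose (r := t / d^2).
assert (d3 : 0 < d^3) by (apply pow_lt; lra). assert (d5 : 0 < d^5) by (apply pow_lt; lra).
assert (B0 : Rabs a0 <= K).
{ unfold a0. rewrite Rabs_mult, (Rabs_right d) by lra. apply Rle_trans with (d * / d); [apply Rmult_le_compat_l;
  lra|rewrite Rinv_r; unfold K; lra]. }
assert (B1 : Rabs a1 <= K).
{ unfold a1. rewrite Rabs_mult, (Rabs_right (d^3)) by lra. apply Rle_trans with (d^3 * (Rabs k / d^2 + / d^3));
  [apply Rmult_le_compat_l; lra|].
  replace (d^3 * (Rabs k / d^2 + / d^3)) with (Rabs k * d + 1) by (field; lra). unfold K; nra. }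
assert (B2 : Rabs a2 <= K).
{ unfold a2. rewrite Rabs_mult, (Rabs_right (d^5)) by lra. apply Rle_trans with (d^5 * (/ d^5 + Rabs k / d^4 + k^2 /
  d^3)); [apply Rmult_le_compat_l; lra|].
  replace (d^5 * (/ d^5 + Rabs k / d^4 + k^2 / d^3)) with (1 + Rabs k * d + k^2 * d^2) by (field; lra). unfold K.
    assert (d^2 <= 1) by nra. nra. }
assert (Br : 0 <= r <= 4).
{ unfold r. split; [apply Rmult_le_pos; auto; left; now apply Rinv_0_lt_compat|]. apply div_le_iff; lra. }
assert (E : comm_radial1 d t = (a1 * (6 * tau1 r + 4 * r * tau2 r) + a0 * (10 * tau2 r + 4 * r * tau3 r) + 8 * tau1
  r * a1 + 8 * r * tau2 r * a1 + 8 * r * tau1 r * a2) / d^5).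
{ assert (Et : t = r * d^2) by (unfold r; field; lra). unfold comm_radial1, a0, a1, a2. fold r.
  generalize (kap 1 0 k t) (kap1 1 0 k t) (kap2 1 0 k t). intros b0 b1 b2. clearbody r. rewrite Et. field. lra. }
assert (HK : 0 < K) by (unfold K; lra).
rewrite E. unfold Rdiv. rewrite Rabs_mult, (Rabs_right (/ d^5)) by lra. apply Rmult_le_compat_r; [lra|].
assert (pr : forall u v, Rabs u <= M -> Rabs v <= K -> Rabs (u * v) <= M * K) by (intros u v Hu Hv;
  rewrite Rabs_mult; apply Rmult_le_compat; auto; apply Rabs_pos).
assert (MK : 0 <= M * K) by (apply Rmult_le_pos; lra).
assert (pr4 : forall u v, Rabs u <= M -> Rabs v <= K -> Rabs (r * (u * v)) <= 4 * (M * K)).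
{ intros u v Hu Hv. rewrite Rabs_mult, (Rabs_right r) by lra. apply Rmult_le_compat; auto; try lra. apply Rabs_pos. }
pose proof (pr _ _ T1 B1) as P1. pose proof (pr4 _ _ T2 B1) as P2. pose proof (pr _ _ T2 B0) as P3.
  pose proof (pr4 _ _ T3 B0) as P4. pose proof (pr4 _ _ T1 B2) as P5.
fold r in P1, P2, P3, P4, P5. apply Rabs_le_between in P1, P2, P3, P4, P5. apply Rabs_le. nra.
Qed.

Definition comm_kernel (d : R) (y : pt) : R := comm_radial d (sq org y).
Definition comm_kernel1 (d : R) (i : nat) (y : pt) : R := comm_radial1 d (sq org y) * (2 * coord y i).

Lemma comm_kernel_Cc d : 0 < d -> Cc (comm_kernel d).
Proof.
intros Hd. split.
- intros y. apply (ct_comp (comm_radial d)); [apply ct_sq|]. apply (ex_derive_continuous (comm_radial d)).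
  eexists; now apply is_derive_comm_radial.
- exists (l1_norm org + 2 * d). intros y Hy. apply near_inbox, near_sq; [lra|]. apply Rnot_le_lt; intros N.
  apply Hy. apply comm_radial_0; auto. right; lra.
Qed.

Lemma comm_kernel1_bsupp d i : 0 < d -> bsupp (comm_kernel1 d i) (2 * d).
Proof.
intros Hd y Hy. replace (2 * d) with (l1_norm org + 2 * d) by (unfold l1_norm, org; cbn; rewrite Rabs_R0; ring).
apply near_inbox, near_sq; [lra|]. apply Rnot_le_lt; intros N. apply Hy. unfold comm_kernel1.
  destruct (comm_radial_0 d (sq org y) Hd) as [_ ->]; [lra|ring].
Qed.

Lemma comm_kernel1_Cc d i : 0 < d -> Cc (comm_kernel1 d i).
Proof.
intros Hd. split; [|eexists; now apply comm_kernel1_bsupp].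
intros y. unfold comm_kernel1. ctt. apply (ct_comp (comm_radial1 d)); [apply ct_sq|now apply continuous_comm_radial1].
Qed.

Lemma comm_kernel_pd d i y : 0 < d -> pd i (comm_kernel d) y (comm_kernel1 d i y).
Proof.
intros Hd. unfold comm_kernel, comm_kernel1. eapply pd_val; [|apply (pd_comp i (comm_radial d) (sq org) y _ _ (pd_sq
  i org y) (is_derive_comm_radial d _ Hd))].
cbn. destruct i as [|[|i]]; unfold org; cbn; ring.
Qed.

Lemma sq_vsub x y : sq org (vsub y x) = sq x y.
Proof. unfold sq, org, vsub; cbn. ring. Qed.

(** With the cutoff centred at x the commutator depends on y - x only, so a single kernel of compact
    support reproduces W at all points. *)
Lemma repr_comm_kernel S W x d : weak_helmholtz k S W -> 0 < d -> (forall z, near (3 * d) x z -> S z) ->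
  c0 * W x = int3 (fun y => W y * comm_kernel d (vsub y x)).
Proof.
intros HW Hd HS. assert (D2 : 0 < d^2) by (apply pow_lt; auto).
assert (T := cut_test S d x Hd HS).
assert (E := repr 1 0 k S W _ _ _ x (d/2) HW T ltac:(lra)).
rewrite (cut_one d x x) in E; auto; [|unfold sq; rewrite !Rminus_diag; lra].
replace (c0 * W x) with (c0 * 1 * (W x * 1)) by ring. rewrite <- E.
- unfold commutator_int. apply I_ext; intros y. f_equal. unfold comm_kernel, comm_radial. rewrite sq_vsub, cut_lap.
  unfold Kf, Kg, grad_dot, cutp; cbn [coord]. replace (sq x y + 0^2) with (sq x y) by ring.
  assert (Es : sq x y = (px1 y - px1 x)^2 + (px2 y - px2 x)^2 + (px3 y - px3 x)^2) by reflexivity.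
  set (t := sq x y) in *. set (a := tau1 _). set (b := tau2 _).
  replace (8 * t * (a / d^2) * kap1 1 0 k t) with (8 * ((px1 y - px1 x)^2 + (px2 y - px2 x)^2 + (px3 y - px3 x)^2) *
    (a / d^2) * kap1 1 0 k t) by (rewrite <- Es; ring).
  field. lra.
- intros y Hy. apply cut_one; auto. apply sq_near in Hy. nra.
Qed.

(** For x' near x the kernel only sees points where the wider cutoff centred at x equals 1.
    Inserting that cutoff makes the density independent of x', so that the formula can be
    differentiated in x'. The cutoff of radius 4 d requires a cube of half side 12 d, which 13 d
    contains. *)
Lemma local_repr S W x d : weak_helmholtz k S W -> 0 < d -> (forall z, near (13 * d) x z -> S z) ->
  Cc (fun y => W y * cut (4 * d) x y) /\ forall x', near d x x' ->
    W x' = / c0 * conv3 (fun y => W y * cut (4 * d) x y) (comm_kernel d) x'.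
Proof.
intros HW Hd HS.
assert (T : test S (cut (4 * d) x) (cutp (4 * d) x) (cutq (4 * d) x)) by (apply cut_test; [lra|intros z Hz;
  apply HS; eapply near_le; [|exact Hz]; lra]).
split; [apply (test_Cc0 S _ _ _ _ T), HW|].
intros x' Hx'. assert (E := repr_comm_kernel S W x' d HW Hd).
assert (P := c0_pos). apply Rmult_eq_reg_l with c0; [|lra]. rewrite <- Rmult_assoc, Rinv_r, Rmult_1_l, E;
  [|intros z Hz|lra].
- apply I_ext; intros y. destruct (Req_dec (comm_kernel d (vsub y x')) 0) as [Z|Z]; [rewrite Z; ring|].
  rewrite cut_one; [ring|lra|]. unfold comm_kernel in Z. rewrite sq_vsub in Z.
  assert (N : near (2 * d) x' y). { apply near_sq; [lra|]. apply Rnot_le_lt; intros N.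
    apply Z, comm_radial_0; auto. right; lra. }
  assert (N2 := near_trans _ _ _ _ _ Hx' N). 
  assert (Q : sq x y <= 16 * d^2); [|lra].
  (* |y - x| <= |y - x'| + |x' - x| < 2 d + sqrt 3 d *)
  assert (S1 : sq x' y < 4 * d^2) by (apply Rnot_le_lt; intros N3; apply Z, comm_radial_0; auto).
  assert (S2 := sq_near _ _ _ Hx'). unfold sq in *.
  pose proof (pow2_ge_0 ((px1 y - px1 x') - (px1 x' - px1 x))).
    pose proof (pow2_ge_0 ((px2 y - px2 x') - (px2 x' - px2 x))).
    pose proof (pow2_ge_0 ((px3 y - px3 x') - (px3 x' - px3 x))). nra.
- apply HS. eapply near_le; [|eapply near_trans; [exact Hx'|exact Hz]]. lra.
Qed.

(** Total thanks to [Derive]; the value carries information only where the corresponding [pd] has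
    been established. *)
Definition D (i : nat) (W : pt -> R) (x : pt) : R := Derive (fun t => W (shift x i t)) 0.

Lemma D_val i W x l : pd i W x l -> D i W x = l.
Proof. intros H; apply is_derive_unique; now apply pd_def. Qed.

Lemma weak_helmholtz_deriv_local S W x d i : weak_helmholtz k S W -> 0 < d -> (forall z, near (13 * d) x z -> S z) ->
  pd i W x (D i W x) /\ ct (D i W) x /\ D i W x = - / c0 * conv3 (fun y => W y * cut (4 * d) x y) (comm_kernel1 d i)
    x.
Proof.
intros HW Hd HS. destruct (local_repr S W x d HW Hd HS) as [CV E]. set (V := fun y => W y * cut (4 * d) x y) in *.
assert (P : forall x', near (d/2) x x' -> pd i W x' (- / c0 * conv3 V (comm_kernel1 d i) x')).
{ intros x' Hx'. apply (pd_ext_near i (fun x' => / c0 * conv3 V (comm_kernel d) x') W x' _ (d/2)); [lra| |].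
  - intros y Hy. symmetry; apply E. eapply near_le; [|eapply near_trans; [exact Hx'|exact Hy]]; lra.
  - eapply pd_val; [|apply pd_scal, (conv3_pd V (comm_kernel d) (comm_kernel1 d i))];
    auto using comm_kernel_Cc, comm_kernel1_Cc.
    + ring.
    + intros; now apply comm_kernel_pd. }
assert (P0 := P x (near_refl (d/2) x ltac:(lra))).
split; [|split].
- now rewrite (D_val _ _ _ _ P0).
- apply (ct_ext_near (fun x' => - / c0 * conv3 V (comm_kernel1 d i) x') _ x (d/2)); [lra| |].
  + intros y Hy. symmetry; apply D_val, P, Hy.
  + ctt. apply conv3_ct; auto using comm_kernel1_Cc.
- now apply D_val.
Qed.

Definition open3 (S : pt -> Prop) := forall x, S x -> exists r, 0 < r /\ forall z, near r x z -> S z.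

Lemma open_scale S x c : open3 S -> S x -> 0 < c -> exists d, 0 < d /\ forall z, near (c * d) x z -> S z.
Proof.
intros O Sx Hc. destruct (O x Sx) as [r [Hr H]]. exists (r / c). split; [now apply Rdiv_lt_0_compat|].
intros z Hz. apply H. replace r with (c * (r / c)) by (field; lra). exact Hz.
Qed.

Lemma weak_helmholtz_C1 S W i : open3 S -> weak_helmholtz k S W -> forall x,
  S x -> pd i W x (D i W x) /\ ct (D i W) x.
Proof.
intros O HW x Sx. destruct (open_scale S x 13 O Sx ltac:(lra)) as [d [Hd H]].
destruct (weak_helmholtz_deriv_local S W x d i HW Hd H) as [H1 [H2 _]]; auto.
Qed.

(** The differentiated kernel is O(d^-4) on a cube of volume 64 d^3, which leaves one factor 1 / d.
    The constant is independent of the solution and of the domain, so the estimate can be iterated;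
    this is the source of analyticity. *)
Lemma grad_est : exists C, 0 < C /\ forall S W x d M i, weak_helmholtz k S W -> 0 < d <= 1 -> (forall z,
  near (13 * d) x z -> S z) ->
  (forall z, near (3 * d) x z -> Rabs (W z) <= M) -> Rabs (D i W x) <= C / d * M.
Proof.
destruct comm_radial_bound as [C [HC EB]]. assert (P := c0_pos). assert (Pi := Rinv_0_lt_compat _ P).
exists (/ c0 * (64 * (4 * C))). split; [apply Rmult_lt_0_compat; lra|].
intros S W x d M i HW Hd HS HM. destruct (weak_helmholtz_deriv_local S W x d i HW (proj1 Hd) HS) as [_ [_ ->]].
destruct (local_repr S W x d HW (proj1 Hd) HS) as [CV _].
assert (M0 : 0 <= M) by (eapply Rle_trans; [apply Rabs_pos|apply (HM x), near_refl; lra]).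
assert (d4 : 0 < d^4) by (apply pow_lt; lra).
rewrite Rabs_mult, Rabs_Ropp, (Rabs_right (/ c0)) by lra.
replace (/ c0 * (64 * (4 * C)) / d * M) with (/ c0 * (8 * (2 * d)^3 * (M * (4 * C / d^4)))) by (field; lra).
apply Rmult_le_compat_l; [lra|].
apply conv3_bound; auto; try lra.
- apply comm_kernel1_Cc; lra.
- apply comm_kernel1_bsupp; lra.
- intros y. destruct (Req_dec (comm_kernel1 d i y) 0) as [Z|Z].
  { rewrite Z, Rabs_R0. unfold Rdiv. apply Rmult_le_pos; [lra|]. left; now apply Rinv_0_lt_compat. }
  destruct (comm_kernel1_bsupp d i (proj1 Hd) y Z) as [B1 [B2 B3]].
  assert (B : Rabs (coord y i) <= 2 * d) by (destruct i as [|[|i]]; auto).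
  unfold comm_kernel1. rewrite !Rabs_mult, (Rabs_right 2) by lra.
  replace (4 * C / d^4) with (C / d^5 * (4 * d)) by (field; lra).
  assert (Q := EB d (sq org y) Hd (sq_ge0 _ _)). pose proof (Rabs_pos (coord y i)).
    pose proof (Rabs_pos (comm_radial1 d (sq org y))).
  apply Rmult_le_compat; lra.
- intros y Hy. rewrite Rabs_mult. assert (Tb := tau_bounds (sq x y / (4 * d)^2)). fold (cut (4 * d) x y) in Tb.
  rewrite (Rabs_right (cut (4 * d) x y)) by lra.
  assert (Rabs (W y) <= M). { apply HM. destruct Hy as [Y1 [Y2 Y3]]. cbn in Y1, Y2, Y3. repeat split; lra. }
  pose proof (Rabs_pos (W y)). nra.
Qed.

Lemma shift_comm x i j s t : shift (shift x i s) j t = shift (shift x j t) i s.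
Proof. destruct i as [|[|i]], j as [|[|j]]; apply pt_eq; cbn; ring. Qed.

Lemma pd_shifted i f j s x l : pd i f (shift x j s) l -> pd i (fun y => f (shift y j s)) x l.
Proof.
intros H. apply pd_def. apply (is_derive_ext (fun t => f (shift (shift x j s) i t))); [|now apply pd_def].
intros t. now rewrite shift_comm.
Qed.

Lemma test_shift S f p q m s j : C2on all f p q -> (exists L, bsupp f L) -> margin S (nz f) m -> Rabs s <= m/4 ->
  test S (fun y => f (shift y j s)) (fun i y => p i (shift y j s)) (fun i y => q i (shift y j s)).
Proof.
intros C [L B] [Hm M] Hs. split; [|split].
- intros y _. destruct (C (shift y j s) Logic.I) as [C0 C1]. split; [now apply ct_shift|].
  intros i. destruct (C1 i) as [A1 [A2 [A3 A4]]].
  refine (conj (pd_shifted _ _ _ _ _ _ A1) (conj (ct_shift _ _ _ _ A2) (conj (pd_shifted _ _ _ _ _ _ A3) (ct_shift _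
    _ _ _ A4)))).
- exists (L + Rabs s). now apply bsupp_shift.
- exists (m/2). split; [lra|]. intros y Hy z Hz. apply (M _ Hy).
  eapply near_le; [|eapply near_trans; [apply near_sym, (near_shift y j s (m/2))|exact Hz]]; lra.
Qed.

(** The difference quotient of W pairs to zero with [Q], since the translation can be moved onto the
    test function as long as the step is small compared with its margin. Uniform continuity of D i W
    near the support of [Q] then removes the step. *)
Lemma weak_helmholtz_D S W i : open3 S -> weak_helmholtz k S W -> weak_helmholtz k S (D i W).
Proof.
intros O HW. assert (C1 := fun x Sx => weak_helmholtz_C1 S W i O HW x Sx).
split; [intros y Sy; now apply C1|].
intros f p q T. assert (T0 := T). destruct T0 as [C [[L B] [m M]]].
pose (Q := fun y => lap q y + k^2 * f y). change (int3 (fun y => D i W y * Q y) = 0).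
assert (QB : bsupp Q (L + 1)).
{ intros y Hy. apply NNPP; intros N. assert (Z := dead_derivs f p q y 1 C Rlt_0_1 (bsupp_dead f L y B N) y
  ltac:(apply near_refl; lra)).
  apply Hy. unfold Q, lap. destruct (Z 0%nat) as [_ ->], (Z 1%nat) as [_ ->], (Z 2%nat) as [_ ->].
  rewrite (bsupp_dead f L y B N y ltac:(apply near_refl; lra)). ring. }
assert (Hm := proj1 M).
assert (QM : margin S (nz Q) (m/2)).
{ split; [lra|]. intros y Hy z Hz. destruct (margin_dead S f m y M) as [Sy|Dd].
  - apply NNPP; intros Sz. apply Hy.
    assert (Dz : forall u, near (m/2) y u -> f u = 0).
    { intros u Hu. apply NNPP; intros E. apply Sz. apply (proj2 M u E).
      eapply near_le; [|eapply near_trans; [apply near_sym, Hu|exact Hz]]; lra. }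
    assert (Z := dead_derivs f p q y (m/2) C ltac:(lra) Dz y ltac:(apply near_refl; lra)).
    unfold Q, lap. destruct (Z 0%nat) as [_ ->], (Z 1%nat) as [_ ->], (Z 2%nat) as [_ ->].
      rewrite Dz by (apply near_refl; lra). ring.
  - exfalso. apply Hy. assert (Z := dead_derivs f p q y m C Hm Dd y ltac:(apply near_refl; lra)).
    unfold Q, lap. destruct (Z 0%nat) as [_ ->], (Z 1%nat) as [_ ->], (Z 2%nat) as [_ ->].
      rewrite Dd by (apply near_refl; lra). ring. }
assert (Qc : forall y, ct Q y) by (intros y; destruct (C y Logic.I) as [c1 c2]; unfold Q; ctt; apply ct_lap;
  intros; apply c2).
assert (CQ : Cc (fun y => D i W y * Q y)) by (apply (Cc_margin S (D i W) Q (L+1) (m/2)); auto; intros y Sy;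
  now apply C1).
assert (AQ : Cc (fun y => Rabs (Q y))) by (apply Cc_abs; split; [auto|eexists; exact QB]).
assert (P : 0 <= int3 (fun y => Rabs (Q y))) by (apply I_ge0; auto; intros; apply Rabs_pos).
apply NNPP; intros N. assert (Np := Rabs_pos_lt _ N). set (J := int3 (fun y => D i W y * Q y)) in *.
set (e := Rabs J / (2 * (int3 (fun y => Rabs (Q y)) + 1))).
assert (He : 0 < e) by (apply Rdiv_lt_0_compat; lra).
destruct (locally_uniform_cont S (nz Q) (m/2) (L+1) (D i W) QM QB (fun y Sy => proj2 (C1 y Sy)) e He) as [d [Hd U]].
pose (t := Rmin (d/2) (m/8)). assert (Ht : 0 < t /\ t <= d/2 /\ t <= m/8).
{ unfold t; repeat split; [apply Rmin_pos; lra|apply Rmin_l|apply Rmin_r]. }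
assert (At : Rabs t = t) by (apply Rabs_right; lra).
assert (CW : Cc (fun y => W y * Q y)) by (apply (Cc_margin S W Q (L+1) (m/2)); auto; apply HW).
assert (CS : Cc (fun y => W (shift y i t) * Q y)).
{ apply (Cc_margin (fun y => S (shift y i t)) (fun y => W (shift y i t)) Q (L+1) (m/4)); auto.
  - intros y Sy. apply ct_shift. now apply HW.
  - split; [lra|]. intros y Hy z Hz. apply (proj2 QM y Hy). eapply near_le; [|eapply near_trans;
    [exact Hz|apply (near_shift z i t (m/4))]]; lra. }
assert (Z1 : int3 (fun y => W y * Q y) = 0) by (apply HW in T; exact T).
assert (Z2 : int3 (fun y => W (shift y i t) * Q y) = 0).
{ assert (T2 := test_shift S f p q m (- t) i C (ex_intro _ L B) M ltac:(rewrite Rabs_Ropp; lra)).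
  apply HW in T2. rewrite <- T2. rewrite <- (I_shift _ i (-t) CS). apply I_ext; intros y.
  rewrite shift_shift. replace (- t + t) with 0 by ring. rewrite shift_0. reflexivity. }
assert (flux : Rabs (int3 (fun y => D i W y * Q y - / t * (W (shift y i t) * Q y - W y * Q y))) <= int3 (fun y => e
  * Rabs (Q y))).
{ apply Rabs_I_le; [apply Cc_minus; auto; apply Cc_scal, Cc_minus; auto|now apply Cc_scal|].
  intros y. replace (D i W y * Q y - / t * (W (shift y i t) * Q y - W y * Q y)) with ((D i W y - / t * (W (shift y i
    t) - W y)) * Q y) by ring.
  rewrite Rabs_mult. destruct (Req_dec (Q y) 0) as [E|E]; [rewrite E, Rabs_R0; lra|].
    apply Rmult_le_compat_r; [apply Rabs_pos|].
  destruct (pd_MVT i W (D i W) y t) as [s [Hs E1]].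
  - intros s Hs. apply Rabs_between_0 in Hs. apply C1. apply (proj2 QM y E). apply near_shift. lra.
  - rewrite E1. replace (D i W y - / t * (t * D i W (shift y i s))) with (- (D i W (shift y i s) - D i W y)) by
    (field; lra).
    rewrite Rabs_Ropp. left. apply U; auto. apply near_shift. apply Rabs_between_0 in Hs. lra. }
assert (EE : int3 (fun y => D i W y * Q y - / t * (W (shift y i t) * Q y - W y * Q y)) = J - / t * (0 - 0)).
{ rewrite <- Z2 at 1. rewrite <- Z1. exact (eq_trans (I_minus _ _ CQ (Cc_scal _ _ (Cc_minus _ _ CS CW))) (f_equal
  (Rminus J)
    (eq_trans (I_scal (/ t) _ (Cc_minus _ _ CS CW)) (f_equal (Rmult (/ t)) (I_minus _ _ CS CW))))). }
assert (Bd2 : Rabs (J - / t * (0 - 0)) <= e * int3 (fun y => Rabs (Q y))) by (rewrite <- EE, <- (I_scal e _ AQ);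
  exact flux).
replace (J - / t * (0 - 0)) with J in Bd2 by ring.
assert (e * (int3 (fun y => Rabs (Q y)) + 1) = Rabs J / 2) by (unfold e; field; lra). nra.
Qed.
End Grad.

(** * Unique continuation *)
Fixpoint Dn (i m : nat) (W : pt -> R) : pt -> R := match m with O => W | S m => D i (Dn i m W) end.

Lemma weak_helmholtz_Dn k S W i m : open3 S -> weak_helmholtz k S W -> weak_helmholtz k S (Dn i m W).
Proof. intros O HW; induction m as [|m IH]; [exact HW|exact (weak_helmholtz_D k S _ i O IH)]. Qed.

(** The gradient estimate is used m times, each time on a cube whose half side is smaller by rho /
    (2 m). The price is the factor m^m, which the factorial in the Taylor formula compensates. *)
Lemma Dn_bound k : exists C, 0 < C /\ forall S W x rho M i m,
  open3 S -> weak_helmholtz k S W -> 0 < rho <= 1 -> (forall z, near rho x z -> S z) ->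
  (forall z, near rho x z -> Rabs (W z) <= M) -> (0 < m)%nat -> forall y,
    near (rho/2) x y -> Rabs (Dn i m W y) <= M * (C * INR m / rho)^m.
Proof.
destruct (grad_est k) as [C [HC G]]. exists (26 * C). split; [lra|].
intros S W x rho M i m O HW Hr HS HM Hm.
assert (Pm : 0 < INR m) by (apply lt_0_INR; auto).
assert (Pm1 : 1 <= INR m) by (apply (le_INR 1); lia).
assert (K : forall j, (j <= m)%nat -> forall y, near (rho * (1 - INR j / (2 * INR m))) x y ->
  Rabs (Dn i j W y) <= M * (26 * C * INR m / rho)^j).
{ induction j; intros Hj y Hy.
  - simpl. rewrite Rmult_1_r. apply HM. eapply near_le; [|exact Hy]. simpl. unfold Rdiv. nra.
  (* With this d, the room 13 d asked for by [grad_est] is exactly the half side rho / (2 m) given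
     up in one step. *)
  - simpl Dn. pose (d := rho / (26 * INR m)).
    assert (Hd : 0 < d <= 1).
    { unfold d. split; [apply Rdiv_lt_0_compat; lra|]. apply Rmult_le_reg_r with (26 * INR m); [lra|].
      field_simplify; lra. }
    assert (IN : forall z, near (13 * d) y z -> near (rho * (1 - INR j / (2 * INR m))) x z).
    { intros z Hz. eapply near_le; [|eapply near_trans; [exact Hy|exact Hz]]. rewrite S_INR. unfold d. right.
      field. lra. }
    assert (J0 : 0 <= INR j / (2 * INR m)) by (apply Rmult_le_pos; [apply pos_INR|left; apply Rinv_0_lt_compat; lra]).
    assert (IN2 : forall z, near (rho * (1 - INR j / (2 * INR m))) x z -> near rho x z) by (intros z Hz;
      eapply near_le; [|exact Hz]; nra).
    replace (M * (26 * C * INR m / rho) ^ (Datatypes.S j)) with (C / d * (M * (26 * C * INR m / rho)^j)).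
    2:{ unfold d. simpl. field. lra. }
    apply (G S _ y d _ i (weak_helmholtz_Dn k S W i j O HW) Hd).
    + intros z Hz. apply HS, IN2, IN, Hz.
    + intros z Hz. apply IHj; [lia|]. apply IN. eapply near_le; [|exact Hz]. lra. }
intros y Hy. apply K; auto. eapply near_le; [|exact Hy]. right. field. lra.
Qed.

Lemma exp_pow_INR x n : exp x ^ n = exp (INR n * x).
Proof.
induction n; [simpl; now rewrite Rmult_0_l, exp_0|]. rewrite S_INR, Rmult_plus_distr_r, exp_plus, <- IHn,
  Rmult_1_l. simpl. ring.
Qed.

(** Induction through (1 + 1/n)^n <= exp 1; a crude half of Stirling's formula. *)
Lemma pow_fact m : INR m ^ m <= exp 1 ^ m * INR (fact m).
Proof.
induction m as [|m IH]; [simpl; lra|].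
destruct m as [|m]; [simpl; pose proof (exp_ineq1 1); lra|]. set (n := Datatypes.S m) in *.
assert (Pn : 0 < INR n) by (apply lt_0_INR; unfold n; lia).
assert (E : INR (Datatypes.S n) <= INR n * exp (/ INR n)).
{ rewrite S_INR. pose proof (exp_ineq1_le (/ INR n)). apply Rle_trans with (INR n * (1 + / INR n)); [right; field;
  lra|]. apply Rmult_le_compat_l; lra. }
assert (E2 : INR (Datatypes.S n) ^ n <= INR n ^ n * exp 1).
{ apply Rle_trans with ((INR n * exp (/ INR n))^n); [apply pow_incr; split; auto; apply pos_INR|].
  rewrite Rpow_mult_distr. right. f_equal. rewrite exp_pow_INR. f_equal. field. lra. }
rewrite fact_simpl, mult_INR, <- !tech_pow_Rmult. set (N := INR (Datatypes.S n)) in *.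
assert (0 < exp 1) by apply exp_pos. assert (0 < N) by (apply lt_0_INR; lia).
apply Rle_trans with (N * (INR n ^ n * exp 1)); [apply Rmult_le_compat_l; lra|].
apply Rle_trans with (N * ((exp 1 ^ n * INR (fact n)) * exp 1)); [|right; ring].
apply Rmult_le_compat_l; [lra|]. apply Rmult_le_compat_r; lra.
Qed.

Lemma pd_line_scaled i W x l y s t : pd i W (shift x i (s * t)) l -> y = t ->
  is_derive (fun t => W (shift x i (s * t))) y (s * l).
Proof.
intros H ->. evar_last; [apply (is_derive_comp (fun u => W (shift x i u)) (fun t => s * t)); [apply pd_shift, H|]|].
- auto_derive; auto.
- unfold scal; simpl; unfold mult; simpl. rewrite Rmult_1_r; reflexivity.
Qed.

(** Along the axis i the Taylor polynomial at x is zero, and [Dn_bound] with [pow_fact] bounds the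
    remainder of order m by M (t C e / rho)^m. For |t| <= rho eta the ratio is at most 1/2, so W
    vanishes. *)
Lemma ucp_local k : exists eta, 0 < eta <= 1/2 /\ forall S W x rho M i,
  open3 S -> weak_helmholtz k S W -> 0 < rho <= 1 -> (forall z, near rho x z -> S z) ->
  (forall z, near rho x z -> Rabs (W z) <= M) -> (forall m, Dn i m W x = 0) -> forall t,
    Rabs t <= rho * eta -> W (shift x i t) = 0.
Proof.
destruct (Dn_bound k) as [C [HC B]]. assert (Pe := exp_pos 1).
(* The bound 1/4 keeps the segment inside the cube of half side rho / 2 where the derivatives are
   estimated; the second bound makes the ratio of the remainders at most 1/2. *)
pose (eta := Rmin (1/4) (/ (2 * C * exp 1))).
assert (P0 : 0 < / (2 * C * exp 1)) by (apply Rinv_0_lt_compat; repeat apply Rmult_lt_0_compat; lra).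
assert (He : 0 < eta /\ eta <= 1/4 /\ eta <= / (2 * C * exp 1)).
{ unfold eta; repeat split; [apply Rmin_pos; lra|apply Rmin_l|apply Rmin_r]. }
exists eta. split; [lra|]. intros S W x rho M i O HW Hr HS HM HD.
assert (M0 : 0 <= M) by (eapply Rle_trans; [apply Rabs_pos|apply (HM x), near_refl; lra]).
(* [Taylor_Lagrange] expands to the right of the base point only; the sign s covers the other
   side. *)
assert (key : forall s t, (s = 1 \/ s = -1) -> 0 < t <= rho * eta -> W (shift x i (s * t)) = 0).
{ intros s t Hs Ht.
  assert (As : Rabs s = 1) by (destruct Hs as [-> | ->]; [apply Rabs_R1|rewrite Rabs_left; lra]).
  pose (g := fun t => W (shift x i (s * t))). pose (Gm := fun m t => s^m * Dn i m W (shift x i (s * t))).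
  assert (NR : forall u, Rabs u < rho / 2 -> near (rho/2) x (shift x i (s * u))).
  { intros u Hu. apply near_shift. rewrite Rabs_mult, As. lra. }
  assert (Dg : forall m u, Rabs u < rho/2 -> is_derive (Gm m) u (Gm (Datatypes.S m) u)).
  { intros m u Hu. unfold Gm. simpl. evar_last; [apply (is_derive_scal (fun t => Dn i m W (shift x i (s * t))))|].
    - apply (pd_line_scaled i _ x (D i (Dn i m W) (shift x i (s * u))) u s u); auto.
      apply (weak_helmholtz_C1 k S _ i O (weak_helmholtz_Dn k S W i m O HW)). apply HS.
        eapply near_le; [|apply NR, Hu]. lra.
    - simpl. ring. }
  assert (LOC : forall u, Rabs u < rho/2 -> locally u (fun v => Rabs v < rho/2)).
  { intros u Hu. assert (Q : 0 < rho/2 - Rabs u) by lra. exists (mkposreal _ Q). intros v Hv.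
    unfold ball in Hv; simpl in Hv; unfold AbsRing_ball, abs, minus, plus, opp in Hv; simpl in Hv.
    replace v with ((v + - u) + u) by ring. eapply Rle_lt_trans; [apply Rabs_triang|]. lra. }
  assert (DG : forall m u, Rabs u < rho/2 -> Derive_n g m u = Gm m u).
  { induction m; intros u Hu; [unfold Gm, g; simpl; ring|]. simpl.
    rewrite (Derive_ext_loc _ (Gm m)); [apply is_derive_unique, Dg, Hu|]. generalize (LOC u Hu). apply filter_imp.
      auto. }
  assert (EG : forall m u, Rabs u < rho/2 -> ex_derive_n g m u).
  { intros [|m] u Hu; [exact Logic.I|]. simpl. apply (ex_derive_ext_loc (Gm m)); [|eexists; apply Dg, Hu].
    generalize (LOC u Hu). apply filter_imp. intros v Hv; symmetry; auto. }
  assert (bnd : forall n, Rabs (g t) <= M * (/2)^(Datatypes.S n)).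
  { intros n. destruct (Taylor_Lagrange g n 0 t) as [z [Hz E]]; [lra| |].
    - intros u Hu m _. apply EG. rewrite Rabs_right; nra.
    - rewrite E. rewrite (sum_eq _ (fun _ => 0)), sum_cte, Rmult_0_l, Rplus_0_l.
      + rewrite DG by (rewrite Rabs_right; nra). unfold Gm. rewrite Rminus_0_r.
        set (m := Datatypes.S n). assert (Pm : 0 < INR m) by (apply lt_0_INR; unfold m; lia).
        rewrite !Rabs_mult, <- RPow_abs, As, pow1, Rmult_1_l. unfold Rdiv.
          rewrite Rabs_mult, Rabs_inv, (Rabs_right (INR (fact m))) by (left; apply INR_fact_lt_0).
        rewrite (Rabs_right (t^m)) by (left; apply pow_lt; lra).
        assert (Pf := INR_fact_lt_0 m). assert (Q := pow_fact m).
        assert (Bz : Rabs (Dn i m W (shift x i (s * z))) <= M * (C * INR m / rho)^m).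
        { apply (B S W x rho M i m O HW Hr HS HM); [unfold m; lia|]. apply NR. rewrite Rabs_right; nra. }
        assert (Tm : 0 < t^m) by (apply pow_lt; lra).
        apply Rle_trans with (t^m * / INR (fact m) * (M * (C * INR m / rho)^m)).
        { apply Rmult_le_compat_l; auto. apply Rmult_le_pos; [lra|left; now apply Rinv_0_lt_compat]. }
        replace ((C * INR m / rho)^m) with ((C / rho)^m * INR m ^ m) by (rewrite <- Rpow_mult_distr; f_equal;
          field; lra).
        apply Rle_trans with (t^m * / INR (fact m) * (M * ((C / rho)^m * (exp 1 ^ m * INR (fact m))))).
        { apply Rmult_le_compat_l; [apply Rmult_le_pos; [lra|left; now apply Rinv_0_lt_compat]|].
          apply Rmult_le_compat_l; auto.
          apply Rmult_le_compat_l; auto. apply pow_le. left. apply Rdiv_lt_0_compat; lra. }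
        replace (t^m * / INR (fact m) * (M * ((C / rho)^m * (exp 1 ^ m * INR (fact m))))) with (M * (t * (C / rho) *
          exp 1)^m) by (rewrite !Rpow_mult_distr; field; lra).
        apply Rmult_le_compat_l; auto. apply pow_incr.
        assert (Q1 : 0 < C / rho) by (apply Rdiv_lt_0_compat; lra).
        split; [apply Rmult_le_pos; [apply Rmult_le_pos|]; lra|].
        apply Rle_trans with (rho * / (2 * C * exp 1) * (C / rho) * exp 1); [|right; field; lra].
        apply Rmult_le_compat_r; [lra|]. apply Rmult_le_compat_r; [lra|]. apply Rle_trans with (rho * eta); [lra|].
          apply Rmult_le_compat_l; lra.
      + intros m _. rewrite DG by (rewrite Rabs_R0; lra). unfold Gm. rewrite Rmult_0_r, shift_0, HD. ring. }
  fold (g t). apply NNPP; intros N. assert (Np := Rabs_pos_lt _ N).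
  assert (L : is_lim_seq (fun n => M * (/2)^(Datatypes.S n)) (M * 0)).
  { apply (is_lim_seq_scal_l (fun n => (/2)^(Datatypes.S n)) M 0). apply (is_lim_seq_incr_1 (fun n => (/2)^n) 0).
    apply is_lim_seq_geom. rewrite Rabs_right; lra. }
  assert (Q := is_lim_seq_le _ _ (Rabs (g t)) (M * 0) bnd (is_lim_seq_const _) L). simpl in Q. lra. }
intros t Ht. destruct (Rtotal_order t 0) as [H|[H|H]].
- replace t with (-1 * - t) by ring. apply key; auto. rewrite Rabs_left in Ht; lra.
- rewrite H, shift_0. apply (HD 0%nat).
- replace t with (1 * t) by ring. apply key; auto. rewrite Rabs_right in Ht; lra.
Qed.

Lemma Dn_zero_line i x W a b o : o = 1 \/ o = -1 -> (forall s,
  a < s < b -> W (shift x i (o * s)) = 0) -> forall m s, a < s < b -> Dn i m W (shift x i (o * s)) = 0.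
Proof.
intros Ho H. induction m; intros s Hs; simpl; auto. unfold D.
rewrite (Derive_ext_loc _ (fun _ => 0)); [apply Derive_const|].
assert (P : 0 < Rmin (s - a) (b - s)) by (apply Rmin_pos; lra). exists (mkposreal _ P). intros t Ht.
unfold ball in Ht; simpl in Ht; unfold AbsRing_ball, abs, minus, plus, opp in Ht; simpl in Ht.
  rewrite Ropp_0, Rplus_0_r in Ht.
pose proof (Rmin_l (s - a) (b - s)). pose proof (Rmin_r (s - a) (b - s)). apply Rabs_lt_between in Ht.
rewrite shift_shift. replace (o * s + t) with (o * (s + o * t)) by (destruct Ho as [-> | ->]; ring). apply IHm.
  destruct Ho as [-> | ->]; lra.
Qed.

(** Supremum argument: at the last point up to which W vanishes, all derivatives along the axis are
    zero by continuity from the side already covered, and [ucp_local] goes beyond it. Only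
    derivatives along the segment enter, so vanishing on a piece of the segment is enough to
    start. *)
Lemma ucp_segment k S W x i l del o : o = 1 \/ o = -1 -> open3 S -> weak_helmholtz k S W -> 0 < l -> (forall t,
  0 <= t <= l -> S (shift x i (o * t))) ->
  0 < del -> (forall t, 0 <= t < del -> W (shift x i (o * t)) = 0) -> forall t,
    0 <= t <= l -> W (shift x i (o * t)) = 0.
Proof.
intros Ho O HW Hl HS Hd HZ. assert (Ao : Rabs o = 1) by (destruct Ho as [-> | ->];
  [apply Rabs_R1|rewrite Rabs_left; lra]). destruct (ucp_local k) as [eta [He U]].
pose (E := fun t => 0 <= t <= l /\ forall s, 0 <= s <= t -> W (shift x i (o * s)) = 0).
destruct (completeness E) as [sg [UB LUB]].
{ exists l. intros t [Ht _]; lra. }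
{ exists 0. split; [lra|]. intros s Hs. apply HZ; lra. }
assert (S0 : Rmin (del/2) l <= sg).
{ apply UB. split; [split; [left; apply Rmin_pos; lra|apply Rmin_r]|]. intros s Hs. apply HZ.
  pose proof (Rmin_l (del/2) l). lra. }
assert (P0 : 0 < Rmin (del/2) l) by (apply Rmin_pos; lra).
assert (S1 : sg <= l) by (apply LUB; intros t [Ht _]; lra).
assert (Z : forall s, 0 <= s < sg -> W (shift x i (o * s)) = 0).
{ intros s Hs. apply NNPP; intros N. assert (sg <= s); [|lra]. apply LUB. intros t [Ht Hz].
  apply Rnot_lt_le; intros K. apply N, Hz. lra. }
assert (DZ : forall m, Dn i m W (shift x i (o * sg)) = 0).
{ intros m. apply NNPP; intros N. assert (Np := Rabs_pos_lt _ N).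
  assert (Hc : ct (Dn i m W) (shift x i (o * sg))) by (apply (weak_helmholtz_Dn k S W i m O HW), HS; lra).
  destruct (proj1 (ct_iff _ _) Hc _ Np) as [d [Hd0 Q]].
  pose (s := sg - Rmin (d/2) (sg/2)). assert (0 < Rmin (d/2) (sg/2)) by (apply Rmin_pos; lra).
  pose proof (Rmin_l (d/2) (sg/2)). pose proof (Rmin_r (d/2) (sg/2)).
  assert (Q1 := Q (shift x i (o * s))). rewrite (Dn_zero_line i x W 0 sg o Ho) in Q1.
  - rewrite Rminus_0_l, Rabs_Ropp in Q1. assert (near d (shift x i (o * sg)) (shift x i (o * s)));
    [|specialize (Q1 H2); lra].
    replace (o * s) with (o * sg + o * (s - sg)) by ring. rewrite <- shift_shift. apply near_shift.
      rewrite Rabs_mult, Ao. unfold s. rewrite Rabs_left; lra.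
  - intros u Hu; apply Z; lra.
  - unfold s; lra. }
destruct (O (shift x i (o * sg)) (HS sg ltac:(lra))) as [r [Hr HN]].
assert (Wc : ct W (shift x i (o * sg))) by (apply HW, HS; lra).
destruct (proj1 (ct_iff _ _) Wc 1 Rlt_0_1) as [r2 [Hr2 Q]].
pose (rho := Rmin (Rmin r r2) 1). assert (Hrho : 0 < rho /\ rho <= r /\ rho <= r2 /\ rho <= 1).
{ unfold rho; repeat split; [repeat apply Rmin_pos; lra|eapply Rle_trans;
  [apply Rmin_l|apply Rmin_l]|eapply Rle_trans; [apply Rmin_l|apply Rmin_r]|apply Rmin_r]. }
assert (F : forall t, Rabs t <= rho * eta -> W (shift (shift x i (o * sg)) i t) = 0).
{ apply (U S W (shift x i (o * sg)) rho (Rabs (W (shift x i (o * sg))) + 1) i O HW); [lra| | |exact DZ].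
  - intros z Hz. apply HN. eapply near_le; [|exact Hz]. lra.
  - intros z Hz. assert (Q1 := Q z (near_le _ _ _ _ (proj1 (proj2 (proj2 Hrho))) Hz)).
    pose proof (Rabs_triang (W z - W (shift x i (o * sg))) (W (shift x i (o * sg)))).
      replace (W z - W (shift x i (o * sg)) + W (shift x i (o * sg))) with (W z) in H by ring. lra. }
assert (Pp : 0 < rho * eta) by (apply Rmult_lt_0_compat; lra).
assert (END : sg = l).
{ apply Rle_antisym; auto. apply Rnot_lt_le; intros K.
  assert (sg + Rmin (rho * eta) (l - sg) <= sg).
  { apply UB. assert (0 < Rmin (rho * eta) (l - sg)) by (apply Rmin_pos; lra).
    pose proof (Rmin_r (rho * eta) (l - sg)). pose proof (Rmin_l (rho * eta) (l - sg)).
    split; [lra|]. intros s Hs. destruct (Rlt_le_dec s sg); [apply Z; lra|].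
    replace (o * s) with (o * sg + o * (s - sg)) by ring. rewrite <- shift_shift. apply F.
      rewrite Rabs_mult, Ao, Rabs_right; lra. }
  assert (0 < Rmin (rho * eta) (l - sg)) by (apply Rmin_pos; lra). lra. }
intros t Ht. destruct (Rlt_le_dec t sg); [apply Z; lra|].
replace (o * t) with (o * sg + 0) by (replace t with sg by lra; ring). rewrite <- shift_shift. apply F.
  rewrite Rabs_R0; lra.
Qed.

(** * Odd reflection *)
Definition mirror_sign (i : nat) : R := match i with O => 1 | S O => 1 | _ => -1 end.

Lemma sgi2 i : mirror_sign i * mirror_sign i = 1.
Proof. destruct i as [|[|i]]; cbn; ring. Qed.

Lemma mirror_shift y i t : mirror (shift y i t) = shift (mirror y) i (mirror_sign i * t).
Proof. destruct i as [|[|i]]; apply pt_eq; cbn; ring. Qed.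

Lemma pd_mirror i f y l : pd i f (mirror y) l -> pd i (fun y => f (mirror y)) y (mirror_sign i * l).
Proof.
intros H. apply pd_def. apply (is_derive_ext (fun t => f (shift (mirror y) i (mirror_sign i * t)))).
- intros t; now rewrite mirror_shift.
- apply (pd_line_scaled i f (mirror y) l 0 (mirror_sign i) 0); auto. now rewrite Rmult_0_r, shift_0.
Qed.

Lemma C2on_mirror f p q : C2on all f p q ->
  C2on all (fun y => f (mirror y)) (fun i y => mirror_sign i * p i (mirror y)) (fun i y => q i (mirror y)).
Proof.
intros C y _. destruct (C (mirror y) Logic.I) as [C0 C1]. split; [now apply ct_mirror|].
intros i. destruct (C1 i) as [A1 [A2 [A3 A4]]]. refine (conj _ (conj _ (conj _ _))).
- now apply pd_mirror.
- ctt. now apply ct_mirror.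
- eapply pd_val; [|apply pd_scal, pd_mirror, A3]. rewrite <- Rmult_assoc, sgi2. ring.
- now apply ct_mirror.
Qed.

Lemma C2on_height (h h1 h2 : R -> R) : (forall t, is_derive h t (h1 t)) -> (forall t,
  is_derive h1 t (h2 t)) -> (forall t, continuous h2 t) ->
  C2on all (fun y => h (coord y 2)) (fun i y => h1 (coord y 2) * kronecker i 2) (fun i y => h2 (coord y 2) *
    kronecker i 2).
Proof.
intros H H1 H2 y _.
assert (c0' : continuous h (coord y 2)) by (apply (ex_derive_continuous h); eexists; now apply H).
assert (c1 : continuous h1 (coord y 2)) by (apply (ex_derive_continuous h1); eexists; now apply H1).
split; [now apply (ct_comp h (fun y => coord y 2)); [apply ct_coord|]|].
intros i. assert (Q1 : ct (fun y => h1 (coord y 2)) y) by (apply (ct_comp h1 (fun y => coord y 2));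
  [apply ct_coord|auto]).
assert (Q2 : ct (fun y => h2 (coord y 2)) y) by (apply (ct_comp h2 (fun y => coord y 2)); [apply ct_coord|auto]).
refine (conj _ (conj _ (conj _ _))); ctt.
- apply (pd_comp i h (fun y => coord y 2)); auto using pd_coord.
- eapply pd_val; [|apply (pd_mult i (fun y => h1 (coord y 2)) (fun _ => kronecker i 2));
  [apply (pd_comp i h1 (fun y => coord y 2)); auto using pd_coord|apply pd_const]].
  cbn. unfold kronecker. destruct (Nat.eqb _ _); ring.
Qed.

Section Reflection.
Variables (k : R) (S : pt -> Prop) (w : pt -> R).
Hypothesis Hsym : forall y, S y -> S (mirror y).
Definition upper (y : pt) : Prop := S y /\ 0 < px3 y.
Definition upper_part (y : pt) : R := if Rlt_dec 0 (px3 y) then w y else 0.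
Definition oddext (y : pt) : R := upper_part y - upper_part (mirror y).
Hypothesis Hw : weak_helmholtz k upper w.
Hypothesis Hb : forall y, S y -> ct upper_part y.

Lemma upper_part_low y : px3 y <= 0 -> upper_part y = 0.
Proof. intros H. unfold upper_part. destruct (Rlt_dec 0 (px3 y)); lra. Qed.

(** The equation is tested with f times a cutoff h in the height that is switched on at scale dl.
    The extra terms contain h' = O(1/dl) and f h'' with f = O(dl), on a slab of thickness 4 dl, so
    their integral stays bounded; [upper_part] is at most eta on the part of the slab that matters.
    The error is O(eta), and no derivative of w near the plane is used. *)
Lemma half_weak f p q : test S f p q -> (forall y, px3 y = 0 -> f y = 0) ->
  int3 (fun y => upper_part y * (lap q y + k^2 * f y)) = 0.
Proof.
intros T F0. assert (T0 := T). destruct T0 as [C [[L B] [m [Hm M]]]].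
assert (f0 : forall y, ct f y) by (intros y; now destruct (C y Logic.I)).
pose (K := fun y => exists z, near (m/2) y z /\ f z <> 0).
assert (MK : margin S K (m/2)).
{ split; [lra|]. intros y [u [U1 U2]] z Hz. apply (M u U2). eapply near_le; [|eapply near_trans;
  [apply near_sym, U1|exact Hz]]. lra. }
assert (BK : forall y, K y -> inbox (L + m) y).
{ intros y [u [U1 U2]]. destruct (B u U2) as [B1 [B2 B3]]. apply near_sym in U1. destruct U1 as [N1 [N2 N3]].
  unfold inbox. apply Rabs_lt_between in N1, N2, N3. rewrite !Rabs_le_between in *. lra. }
assert (DK : forall y, ~ K y -> f y = 0 /\ forall i, p i y = 0 /\ q i y = 0).
{ intros y Ny. assert (Z : forall z, near (m/2) y z -> f z = 0) by (intros z Hz; apply NNPP; intros E; apply Ny;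
  exists z; auto).
  split; [apply Z, near_refl; lra|]. apply (dead_derivs f p q y (m/2) C ltac:(lra) Z). apply near_refl; lra. }
destruct (test_Cc S f p q (fun _ => 1) T (fun y _ => ct_const 1 y)) as [_ CP].
destruct (Cc_bounded _ (proj1 (CP 2%nat))) as [B1 [HB1 PB]].
destruct (Cc_bounded _ (test_Cc_lap S f p q (fun _ => 1) (k^2) T (fun y _ => ct_const 1 y))) as [B2 [HB2 QB]].
destruct tau_bounded as [Mt [HMt TB]].
(* The support bound L may be negative; then K is empty and the integrand vanishes identically. *)
assert (L0 : 0 <= L + m \/ L + m < 0) by lra. destruct L0 as [L0|L0].
2:{ rewrite (I_ext _ (fun _ => 0)); [apply I_0|]. intros y. destruct (classic (K y)) as [Ky|Ky].
    - destruct (BK y Ky) as [Q _]. pose proof (Rabs_pos (px1 y)). lra.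
    - destruct (DK y Ky) as [E1 E2]. unfold lap. destruct (E2 0%nat) as [_ ->], (E2 1%nat) as [_ ->],
      (E2 2%nat) as [_ ->]. rewrite E1; ring. }
apply NNPP; intros N. assert (Np := Rabs_pos_lt _ N). set (J := int3 _) in *.
pose (Ct := 8 * (L + m)^3 * B2 + 6 * Mt * B1 * 4 * (2 * (L + m)) * (2 * (L + m))).
assert (HCt : 0 <= Ct).
{ assert (0 <= (L + m)^3) by (apply pow_le; auto). unfold Ct.
  apply Rplus_le_le_0_compat; repeat apply Rmult_le_pos; lra. }
pose (eta := Rabs J / (2 * (Ct + 1))). assert (He : 0 < eta) by (apply Rdiv_lt_0_compat; lra).
destruct (locally_uniform_cont S K (m/2) (L+m) upper_part MK BK Hb eta He) as [d [Hd U]].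
pose (dl := Rmin d m / 8). assert (Hdl : 0 < dl /\ 8 * dl <= d /\ 8 * dl <= m).
{ unfold dl. assert (0 < Rmin d m) by (apply Rmin_pos; lra). pose proof (Rmin_l d m). pose proof (Rmin_r d m). lra. }
assert (small : forall y, K y -> px3 y <= 4 * dl -> Rabs (upper_part y) <= eta).
{ intros y Ky Hy. destruct (Rle_dec (px3 y) 0) as [Z|Z]; [rewrite upper_part_low, Rabs_R0; lra|].
  assert (Q := U y (shift y 2 (- px3 y)) Ky ltac:(apply near_shift; rewrite Rabs_Ropp, Rabs_right; lra)).
  rewrite (upper_part_low (shift y 2 (- px3 y))), Rminus_0_l, Rabs_Ropp in Q by (cbn; lra). lra. }
(* Here [tau] is applied to the height itself, not to a squared distance, so the transition takes
   place between heights dl and 4 dl. *)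
pose (h := fun t => 1 - tau (t / dl)). pose (h1 := fun t => - (tau1 (t / dl) / dl)).
  pose (h2 := fun t => - (tau2 (t / dl) / dl^2)).
assert (Dd : forall t, is_derive (fun t => t / dl) t (/ dl)) by (intros; auto_derive; [lra|field; lra]).
assert (HC : C2on all (fun y => h (coord y 2)) (fun i y => h1 (coord y 2) * kronecker i 2) (fun i y => h2 (coord y
  2) * kronecker i 2)).
{ apply C2on_height; intros t.
  - unfold h, h1. evar_last; [apply (is_derive_minus (fun _ => 1) (fun t => tau (t / dl)) t 0);
    [apply (is_derive_const 1)|apply (is_derive_comp tau (fun t => t / dl) t _ _ (is_derive_tau _) (Dd t))]|].
    unfold minus, plus, opp, scal; simpl; unfold mult; simpl. toR. field. lra.
  - unfold h1, h2. apply (is_derive_ext (fun t => (- / dl) * tau1 (t / dl))); [intros; toR; field; lra|].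
    evar_last; [apply (is_derive_scal (fun t => tau1 (t / dl))),
      (is_derive_comp tau1 (fun t => t / dl) t _ _ (is_derive_tau1 _) (Dd t))|].
    unfold scal; simpl; unfold mult; simpl. toR. field. lra.
  - unfold h2. apply (continuous_opp (fun t => tau2 (t / dl) / dl^2)).
    apply (continuous_mult (fun t => tau2 (t / dl)) (fun _ => / dl^2)); [|apply continuous_const].
    apply (continuous_comp (fun t => t / dl) tau2); [|apply continuous_tau2].
      apply (ex_derive_continuous (fun t => t / dl)). eexists; apply Dd. }
assert (hz : forall t, t <= dl -> h t = 0 /\ h1 t = 0 /\ h2 t = 0).
{ intros t Ht. assert (Q : t / dl <= 1) by (apply div_le_iff; lra). unfold h, h1, h2.
  destruct (tau123_0 (t / dl)) as [-> [-> _]]; [lra|]. rewrite tau_low by auto. repeat split; field; lra. }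
assert (hh : forall t, 4 * dl <= t -> h t = 1 /\ h1 t = 0 /\ h2 t = 0).
{ intros t Ht. assert (Q : 4 <= t / dl) by (apply Rmult_le_reg_r with dl; [lra|]; unfold Rdiv;
  rewrite Rmult_assoc, Rinv_l; lra).
  unfold h, h1, h2. destruct (tau123_0 (t / dl)) as [-> [-> _]]; [lra|]. rewrite tau_high by auto.
    repeat split; field; lra. }
pose (P2 := fun i y => p i y * h (coord y 2) + f y * (h1 (coord y 2) * kronecker i 2)).
pose (Q2 := fun i y => q i y * h (coord y 2) + 2 * (p i y * (h1 (coord y 2) * kronecker i 2)) + f y * (h2 (coord y
  2) * kronecker i 2)).
assert (T2 : test S (fun y => f y * h (coord y 2)) P2 Q2) by exact (test_mult S f p q _ _ _ T HC).
assert (T3 : test upper (fun y => f y * h (coord y 2)) P2 Q2).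
{ destruct T2 as [T21 [T22 _]]. split; [exact T21|split; [exact T22|]]. exists dl. split; [lra|]. intros y Hy z Hz.
  assert (Fy : f y <> 0) by (intros E; apply Hy; rewrite E; ring). split.
  - apply (M y Fy). eapply near_le; [|exact Hz]. lra.
  - assert (dl < px3 y). { apply Rnot_le_lt; intros E. apply Hy. destruct (hz (coord y 2) E) as [-> _]; ring. }
    destruct Hz as [_ [_ Hz]]. apply Rabs_lt_between in Hz. lra. }
assert (Z := proj2 Hw _ _ _ T3).
assert (EQ : forall y, w y * (lap Q2 y + k^2 * (f y * h (coord y 2))) =
  upper_part y * (lap q y + k^2 * f y) - upper_part y * ((1 - h (coord y 2)) * (lap q y + k^2 * f y) - (2 * (h1
    (coord y 2) * p 2%nat y) + h2 (coord y 2) * f y))).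
{ intros y. assert (EL : lap Q2 y = h (coord y 2) * lap q y + 2 * (h1 (coord y 2) * p 2%nat y) + h2 (coord y 2) * f
  y).
  { unfold lap, Q2. unfold kronecker; cbn [Nat.min Nat.eqb]. ring. }
  rewrite EL. destruct (Rle_dec (px3 y) 0) as [E|E].
  - rewrite upper_part_low by auto. destruct (hz (coord y 2)) as [-> [-> ->]]; [cbn; lra|]. ring.
  - unfold upper_part. destruct (Rlt_dec 0 (px3 y)); [|lra]. ring. }
apply (eq_trans (eq_sym (I_ext _ _ EQ))) in Z.
assert (CJ := test_Cc_lap S f p q upper_part (k^2) T Hb).
assert (Ch : forall y, ct (fun y => h (coord y 2)) y /\ ct (fun y => h1 (coord y 2)) y /\ ct (fun y => h2 (coord y
  2)) y).
{ intros y. destruct (HC y Logic.I) as [c1 c2]. destruct (c2 2%nat) as [_ [c3 [_ c4]]]. split; [exact c1|].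
  split; [apply (ct_ext _ _ y) with (2 := c3)|apply (ct_ext _ _ y) with (2 := c4)]; intros; unfold kronecker; cbn;
    ring. }
assert (Ca : Cc (fun y => upper_part y * (lap q y + k^2 * f y) * (1 - h (coord y 2)))).
{ apply Cc_mult_r; auto. intros y. destruct (Ch y) as [? _]. ctt. }
assert (Cb : Cc (fun y => (upper_part y * p 2%nat y) * (2 * h1 (coord y 2)))).
{ apply Cc_mult_r; [now apply (test_Cc1 S f p q)|]. intros y. destruct (Ch y) as [_ [? _]]. ctt. }
assert (Cd : Cc (fun y => (upper_part y * f y) * h2 (coord y 2))).
{ apply Cc_mult_r; [now apply (test_Cc0 S f p q)|]. intros y. destruct (Ch y) as [_ [_ ?]]. ctt. }
pose (Ea := fun y => upper_part y * (lap q y + k^2 * f y) * (1 - h (coord y 2))).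
pose (Eb := fun y => (upper_part y * p 2%nat y) * (2 * h1 (coord y 2)) + (upper_part y * f y) * h2 (coord y 2)).
assert (Ceb : Cc Eb) by (apply Cc_plus; auto).
assert (JE : J = int3 Ea - int3 Eb).
{ assert (Z' : J - (int3 Ea - int3 Eb) = 0); [|lra].
  refine (eq_trans (eq_sym (eq_trans (I_minus _ _ CJ (Cc_minus Ea Eb Ca Ceb)) (f_equal (Rminus J) (I_minus Ea Eb Ca
    Ceb)))) _).
  rewrite <- Z. apply I_ext; intros y. unfold Ea, Eb. ring. }
assert (tb : forall t, Rabs (1 - h t) <= 1).
{ intros t. unfold h. replace (1 - (1 - tau (t / dl))) with (tau (t / dl)) by ring.
  pose proof (tau_bounds (t / dl)). rewrite Rabs_right; lra. }
assert (tb1 : forall t, Rabs (h1 t) <= Mt / dl).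
{ intros t. unfold h1. rewrite Rabs_Ropp. unfold Rdiv at 1. rewrite Rabs_mult, (Rabs_right (/ dl)) by (left;
  apply Rinv_0_lt_compat; lra). apply Rmult_le_compat_r; [left; apply Rinv_0_lt_compat; lra|apply TB]. }
assert (dl2 : 0 < dl^2) by (apply pow_lt; lra).
assert (tb2 : forall t, Rabs (h2 t) <= Mt / dl^2).
{ intros t. unfold h2. rewrite Rabs_Ropp. unfold Rdiv at 1. rewrite Rabs_mult, (Rabs_right (/ dl^2)) by (left;
  apply Rinv_0_lt_compat; lra). apply Rmult_le_compat_r; [left; apply Rinv_0_lt_compat; lra|apply TB]. }
assert (Hslab : forall X : pt -> R, (forall y, ~ K y -> X y = 0) -> bsupp X (L + m)).
{ intros X HX y Hy. apply BK. apply NNPP; intros E. apply Hy, HX, E. }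
assert (Ba : Rabs (int3 Ea) <= 8 * (L+m)^3 * (eta * B2)).
{ apply I_bound; auto.
  - apply Hslab. intros y Ny. destruct (DK y Ny) as [E1 E2]. unfold Ea, lap.
    destruct (E2 0%nat) as [_ ->], (E2 1%nat) as [_ ->], (E2 2%nat) as [_ ->]. rewrite E1; ring.
  - intros y. unfold Ea. destruct (classic (K y)) as [Ky|Ky].
    + destruct (Rle_dec (4 * dl) (px3 y)) as [Hy|Hy].
      { destruct (hh (coord y 2) Hy) as [-> _]. rewrite Rminus_diag, Rmult_0_r, Rabs_R0. apply Rmult_le_pos; lra. }
      rewrite !Rabs_mult. specialize (QB y). rewrite Rmult_1_l in QB.
      rewrite <- (Rmult_1_r (eta * B2)). apply Rmult_le_compat; auto; try (apply Rabs_pos); [apply Rmult_le_pos;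
        apply Rabs_pos|].
      apply Rmult_le_compat; try apply Rabs_pos; auto. apply small; auto; lra.
    + destruct (DK y Ky) as [E1 E2]. unfold lap. destruct (E2 0%nat) as [_ ->], (E2 1%nat) as [_ ->],
      (E2 2%nat) as [_ ->]. rewrite E1.
      replace (upper_part y * (0 + 0 + 0 + k^2 * 0) * (1 - h (coord y 2))) with 0 by ring. rewrite Rabs_R0.
        apply Rmult_le_pos; lra. }
assert (Bb : Rabs (int3 Eb) <= 6 * Mt * B1 * eta / dl * (4 * dl - 0) * (2 * (L+m)) * (2 * (L+m))).
{ assert (pos : 0 <= 6 * Mt * B1 * eta / dl) by (unfold Rdiv; repeat apply Rmult_le_pos; try lra; left;
  apply Rinv_0_lt_compat; lra).
  apply I_slab; auto; try lra.
  - apply Hslab. intros y Ny. destruct (DK y Ny) as [E1 E2]. unfold Eb. destruct (E2 2%nat) as [-> _].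
    rewrite E1; ring.
  - intros y Hy. split.
    + apply Rnot_lt_le; intros E. apply Hy. unfold Eb. destruct (hz (coord y 2)) as [_ [-> ->]]; [cbn; lra|ring].
    + apply Rnot_lt_le; intros E. apply Hy. unfold Eb. destruct (hh (coord y 2)) as [_ [-> ->]]; [cbn; lra|ring].
  - intros y. unfold Eb.
    destruct (classic (K y)) as [Ky|Ky].
    2:{ destruct (DK y Ky) as [E1 E2]. destruct (E2 2%nat) as [-> _]. rewrite E1.
      replace (upper_part y * 0 * (2 * h1 (coord y 2)) + upper_part y * 0 * h2 (coord y 2)) with 0 by ring.
      rewrite Rabs_R0. exact pos. }
    destruct (Rle_dec (4 * dl) (px3 y)) as [Hy|Hy].
    { destruct (hh (coord y 2) Hy) as [_ [-> ->]]. replace (upper_part y * p 2%nat y * (2 * 0) + upper_part y * f y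
      * 0) with 0 by ring. rewrite Rabs_R0. exact pos. }
    destruct (Rle_dec (px3 y) 0) as [Hy0|Hy0].
    { rewrite upper_part_low by auto. replace (0 * p 2%nat y * (2 * h1 (coord y 2)) + 0 * f y * h2 (coord y 2)) with
      0 by ring. rewrite Rabs_R0. exact pos. }
    assert (Pb : forall z, Rabs (p 2%nat z) <= B1) by (intros z; specialize (PB z); rewrite Rmult_1_l in PB;
      exact PB).
    (* f vanishes on the plane, hence is O(dl) in the strip *)
    assert (Fb : Rabs (f y) <= 4 * dl * B1).
    { destruct (pd_MVT 2 f (p 2%nat) (shift y 2 (- px3 y)) (px3 y)) as [s [Hs E]].
      - intros s _. destruct (C (shift (shift y 2 (- px3 y)) 2 s) Logic.I) as [_ c2]. apply c2.
      - rewrite shift_shift in E. replace (- px3 y + px3 y) with 0 in E by ring.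
        rewrite shift_0, (F0 (shift y 2 (- px3 y))), Rminus_0_r in E by (cbn; ring).
        rewrite E, Rabs_mult, (Rabs_right (px3 y)) by lra. apply Rmult_le_compat; try lra; try apply Rabs_pos.
          apply Pb. }
    assert (W1 := small y Ky ltac:(lra)). assert (t1 := tb1 (coord y 2)). assert (t2 := tb2 (coord y 2)).
    eapply Rle_trans; [apply Rabs_triang|]. rewrite !Rabs_mult, (Rabs_right 2) by lra.
    replace (6 * Mt * B1 * eta / dl) with (eta * B1 * (2 * (Mt / dl)) + eta * (4 * dl * B1) * (Mt / dl^2)) by
      (field; lra).
    apply Rplus_le_compat; apply Rmult_le_compat; try (apply Rmult_le_pos; try lra; apply Rabs_pos);
      try apply Rabs_pos; try lra.
    + apply Rmult_le_compat; try apply Rabs_pos; auto.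
    + apply Rmult_le_compat; try apply Rabs_pos; auto. }
assert (Rabs J <= eta * Ct).
{ rewrite JE. unfold Rminus at 1. eapply Rle_trans; [apply Rabs_triang|]. rewrite Rabs_Ropp.
  replace (eta * Ct) with (8 * (L+m)^3 * (eta * B2) + 6 * Mt * B1 * eta / dl * (4 * dl - 0) * (2 * (L+m)) * (2 *
    (L+m))) by (unfold Ct; field; lra). lra. }
assert (eta * (Ct + 1) = Rabs J / 2) by (unfold eta; field; lra). nra.
Qed.

(** Moving the mirror onto the test function turns the pairing with f into the pairing of
    [upper_part] with f minus its mirror image. That function vanishes on the plane, as [half_weak]
    demands. *)
Lemma oddext_weak_helmholtz : weak_helmholtz k S oddext.
Proof.
assert (Hb' : forall y, S y -> ct (fun y => upper_part (mirror y)) y) by (intros y Sy; apply ct_mirror, Hb, Hsym, Sy).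
split.
- intros y Sy. unfold oddext. apply ct_minus; auto.
- intros f p q T. assert (T0 := T). destruct T0 as [C [[L B] [m [Hm M]]]].
  assert (TR : test S (fun y => 1 * f y + -1 * f (mirror y)) (fun i y => 1 * p i y + -1 * (mirror_sign i * p i
    (mirror y))) (fun i y => 1 * q i y + -1 * q i (mirror y))).
  { split; [apply (C2on_lin all f p q _ _ _ 1 (-1) C (C2on_mirror f p q C))|split].
    - exists L. intros y Hy. destruct (Req_dec (f y) 0) as [E|E]; [|now apply B].
      assert (E2 : f (mirror y) <> 0) by (intros E2; apply Hy; rewrite E, E2; ring).
        destruct (B _ E2) as [b1 [b2 b3]]. cbn in b1, b2, b3. rewrite Rabs_Ropp in b3. repeat split; auto.
    - exists m. split; auto. intros y Hy z Hz. destruct (Req_dec (f y) 0) as [E|E]; [|now apply (M y E)].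
      assert (E2 : f (mirror y) <> 0) by (intros E2; apply Hy; rewrite E, E2; ring).
      rewrite <- (mirror_mirror z). apply Hsym, (M _ E2), near_mirror, Hz. }
  assert (Z := half_weak _ _ _ TR).
  assert (F0 : forall y, px3 y = 0 -> 1 * f y + -1 * f (mirror y) = 0).
  { intros y Hy. replace (mirror y) with y; [ring|]. apply pt_eq; cbn; lra. }
  specialize (Z F0).
  assert (C1 := test_Cc_lap S f p q upper_part (k^2) T Hb). assert (C2 := test_Cc_lap S f p q _ (k^2) T Hb').
  unfold oddext. rewrite (I_ext _ (fun y => upper_part y * (lap q y + k^2 * f y) - upper_part (mirror y) * (lap q y
    + k^2 * f y))) by (intros; ring).
  rewrite (I_minus _ _ C1 C2), <- (I_mirror _ C2), <- (I_minus _ _ C1 (Cc_mirror _ C2)), <- Z.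
  apply I_ext; intros y. rewrite mirror_mirror. unfold lap. ring.
Qed.
End Reflection.

(** * Weak solutions are classical *)

Lemma weak_helmholtz_C2 k S W : open3 S -> weak_helmholtz k S W -> C2on S W (fun i => D i W) (fun i => D i (D i W)).
Proof.
intros O HW y Sy. split; [now apply HW|]. intros i.
destruct (weak_helmholtz_C1 k S W i O HW y Sy) as [A1 A2]. destruct (weak_helmholtz_C1 k S (D i W) i O
  (weak_helmholtz_D k S W i O HW) y Sy) as [B1 B2].
exact (conj A1 (conj A2 (conj B1 B2))).
Qed.

(** By [green] the continuous residual of the equation is orthogonal to every test function; if it
    were positive at a point, a narrow cutoff there would give a positive integral. The same is
    applied to its negative. *)
Lemma weak_strong k S W : open3 S -> weak_helmholtz k S W -> forall y,
  S y -> lap (fun i => D i (D i W)) y + k^2 * W y = 0.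
Proof.
intros O HW x Sx. assert (HC := weak_helmholtz_C2 k S W O HW).
assert (key : forall V : pt -> R, (forall y, S y -> ct V y) -> (forall f p q,
  test S f p q -> int3 (fun y => V y * f y) = 0) -> V x <= 0).
{ intros V VC VI. apply Rnot_lt_le; intros P.
  destruct (proj1 (ct_iff _ _) (VC x Sx) (V x) P) as [r1 [Hr1 Q]]. destruct (O x Sx) as [r2 [Hr2 HS]].
  pose (d := Rmin r1 r2 / 4). assert (Hd : 0 < d /\ 4 * d <= r1 /\ 4 * d <= r2).
  { unfold d. assert (0 < Rmin r1 r2) by (apply Rmin_pos; auto). pose proof (Rmin_l r1 r2).
    pose proof (Rmin_r r1 r2). lra. }
  assert (T := cut_test S d x (proj1 Hd) (fun z Hz => HS z (near_le (3 * d) r2 x z ltac:(lra) Hz))).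
  assert (Z := VI _ _ _ T). assert (0 < int3 (fun y => V y * cut d x y)); [|lra].
  apply (I_gt0 (fun y => V y * cut d x y) x).
  - now apply (test_Cc0 S _ _ _ _ T).
  - intros y. destruct (Req_dec (cut d x y) 0) as [E|E]; [rewrite E; lra|]. apply Rmult_le_pos; [|apply tau_bounds].
    assert (N := Q y (near_le (2 * d) r1 x y ltac:(lra) (cut_nz d x y (proj1 Hd) E))). apply Rabs_lt_between in N.
      lra.
  - rewrite cut_one; [lra|lra|]. unfold sq. rewrite !Rminus_diag. assert (0 < d^2) by (apply pow_lt; lra). lra. }
assert (VC : forall y, S y -> ct (fun y => lap (fun i => D i (D i W)) y + k^2 * W y) y).
{ intros y Sy. destruct (HC y Sy) as [c0' c1]. ctt. apply ct_lap. intros i; apply c1. }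
assert (VI : forall f p q, test S f p q -> int3 (fun y => (lap (fun i => D i (D i W)) y + k^2 * W y) * f y) = 0).
{ intros f p q T. assert (W0 : forall y, S y -> ct W y) by apply HW.
  assert (L0 : forall y, S y -> ct (lap (fun i => D i (D i W))) y) by (intros y Sy; apply ct_lap; intros i;
    apply (HC y Sy)).
  assert (G := green S f p q W _ _ T HC). assert (Hw := proj2 HW f p q T).
  assert (C1 := test_Cc_lap S f p q W 0 T W0). assert (C2 := Cc_scal (k^2) _ (test_Cc0 S f p q W T W0)).
    assert (C3 := test_Cc0 S f p q _ T L0).
  rewrite (I_ext _ (fun y => lap (fun i => D i (D i W)) y * f y + k^2 * (W y * f y))) by (intros; ring).
  refine (eq_trans (I_plus _ _ C3 C2) _). rewrite <- G. rewrite <- Hw.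
  rewrite (I_ext (fun y => W y * lap q y) (fun y => W y * (lap q y + 0 * f y))) by (intros; ring).
  refine (eq_trans (eq_sym (I_plus _ _ C1 C2)) _). apply I_ext; intros; ring. }
apply Rle_antisym; [now apply (key _ VC)|].
assert (N : - (lap (fun i => D i (D i W)) x + k^2 * W x) <= 0); [|lra].
apply (key (fun y => - (lap (fun i => D i (D i W)) y + k^2 * W y))).
- intros y Sy. apply ct_opp, VC, Sy.
- intros f p q T. assert (CV := test_Cc0 S f p q _ T VC).
  rewrite (I_ext _ (fun y => -1 * ((lap (fun i => D i (D i W)) y + k^2 * W y) * f y))) by (intros; ring).
  refine (eq_trans (I_scal (-1) _ CV) _). rewrite (VI f p q T). ring.
Qed.

(** Schwarz's theorem, needed to cancel the mixed second derivatives in the virial identity. *)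
Lemma D_sym k S W i j y : open3 S -> weak_helmholtz k S W -> S y -> D j (D i W) y = D i (D j W) y.
Proof.
intros O HW Sy. destruct (O y Sy) as [r [Hr HS]].
assert (P : forall u v, Rabs u < r/2 -> Rabs v < r/2 -> S (shift (shift y i u) j v)).
{ intros u v Hu Hv. apply HS. replace r with (r/2 + r/2) by field. eapply near_trans; apply near_shift; eassumption. }
assert (C1 := fun i z Sz => weak_helmholtz_C1 k S W i O HW z Sz).
assert (C2 := fun i j z Sz => weak_helmholtz_C1 k S (D i W) j O (weak_helmholtz_D k S W i O HW) z Sz).
pose (f := fun u v => W (shift (shift y i u) j v)).
assert (F1 : forall u v, Rabs u < r/2 -> Rabs v < r/2 -> is_derive (fun t => f u t) v (D j W (shift (shift y i u) j
  v))).
{ intros u v Hu Hv. apply (pd_shift j W (shift y i u)). apply C1, P; auto. }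
assert (F2 : forall u v, Rabs u < r/2 -> Rabs v < r/2 -> is_derive (fun t => f t v) u (D i W (shift (shift y i u) j
  v))).
{ intros u v Hu Hv. apply (is_derive_ext (fun t => W (shift (shift y j v) i t))); [intros; unfold f;
  now rewrite shift_comm|].
  rewrite shift_comm. apply (pd_shift i W (shift y j v)). apply C1. rewrite <- shift_comm. apply P; auto. }
assert (LOC : forall u, Rabs u < r/2 -> locally u (fun v => Rabs v < r/2)).
{ intros u Hu. assert (Q : 0 < r/2 - Rabs u) by lra. exists (mkposreal _ Q). intros v Hv.
  unfold ball in Hv; simpl in Hv; unfold AbsRing_ball, abs, minus, plus, opp in Hv; simpl in Hv.
  replace v with ((v + - u) + u) by ring. eapply Rle_lt_trans; [apply Rabs_triang|]. lra. }
assert (G1 : forall u v, Rabs u < r/2 -> Rabs v < r/2 -> is_derive (fun z => Derive (fun t => f z t) v) u (D i (D j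
  W) (shift (shift y i u) j v))).
{ intros u v Hu Hv. apply (is_derive_ext_loc (fun z => D j W (shift (shift y j v) i z))).
  - generalize (LOC u Hu). apply filter_imp. intros z Hz. rewrite shift_comm. symmetry.
    apply is_derive_unique, F1; auto.
  - rewrite shift_comm. apply (pd_shift i (D j W) (shift y j v)). apply C2. rewrite <- shift_comm. apply P; auto. }
assert (G2 : forall u v, Rabs u < r/2 -> Rabs v < r/2 -> is_derive (fun z => Derive (fun t => f t z) u) v (D j (D i
  W) (shift (shift y i u) j v))).
{ intros u v Hu Hv. apply (is_derive_ext_loc (fun z => D i W (shift (shift y i u) j z))).
  - generalize (LOC v Hv). apply filter_imp. intros z Hz. symmetry. apply is_derive_unique, F2; auto.
  - apply (pd_shift j (D i W) (shift y i u)). apply C2, P; auto. }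
assert (Z0 : Rabs 0 < r/2) by (rewrite Rabs_R0; lra).
assert (c2d : forall V, ct V y -> forall g, (forall u v, Rabs u < r/2 -> Rabs v < r/2 ->
  g u v = V (shift (shift y i u) j v)) -> continuity_2d_pt g 0 0).
{ intros V HV g Hg eps. destruct (proj1 (ct_iff _ _) HV eps (cond_pos eps)) as [d [Hd Q]].
  assert (Pp : 0 < Rmin (d/2) (r/2)) by (apply Rmin_pos; lra). exists (mkposreal _ Pp). intros u v Hu Hv.
    simpl in Hu, Hv. rewrite Rminus_0_r in Hu, Hv.
  pose proof (Rmin_l (d/2) (r/2)). pose proof (Rmin_r (d/2) (r/2)).
  rewrite !Hg by lra. rewrite !shift_0. apply Q. replace d with (d/2 + d/2) by field.
    eapply near_trans; apply near_shift; lra. }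
assert (E1 := is_derive_unique _ _ _ (G1 0 0 Z0 Z0)). assert (E2 := is_derive_unique _ _ _ (G2 0 0 Z0 Z0)).
rewrite !shift_0 in E1, E2. refine (eq_trans (eq_sym E2) (eq_trans (eq_sym _) E1)).
apply (Schwarz f 0 0).
- assert (Pp : 0 < r/2) by lra. exists (mkposreal _ Pp). intros u v Hu Hv. simpl in Hu, Hv.
  rewrite Rminus_0_r in Hu, Hv.
  repeat split; eexists; [apply F2|apply F1|apply G1|apply G2]; auto.
- apply (c2d (D i (D j W))); [apply C2; auto|]. intros u v Hu Hv. apply is_derive_unique, G1; auto.
- apply (c2d (D j (D i W))); [apply C2; auto|]. intros u v Hu Hv. apply is_derive_unique, G2; auto.
Qed.

Definition ray (x v : pt) (t : R) : pt := mkpt (px1 x + t * px1 v) (px2 x + t * px2 v) (px3 x + t * px3 v).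

(** Only partial derivatives along the axes are known. The increment along an oblique ray is split
    into three axis-parallel steps, each handled by the mean value theorem and by continuity of the
    partial derivatives. *)
Lemma ray_derive S f p x v : open3 S -> S x -> (forall y, S y -> forall i, pd i f y (p i y) /\ ct (p i) y) ->
  is_derive (fun t => f (ray x v t)) 0 (px1 v * p 0%nat x + px2 v * p 1%nat x + px3 v * p 2%nat x).
Proof.
intros O Sx H. apply is_derive_Reals. intros e He. destruct (O x Sx) as [r [Hr HS]].
pose (N := 1 + l1_norm v). assert (V1 := Rabs_pos (px1 v)). assert (V2 := Rabs_pos (px2 v)).
  assert (V3 := Rabs_pos (px3 v)).
assert (HN : 1 <= N) by (unfold N, l1_norm; lra).
assert (Pe : 0 < e / (4 * N)) by (apply Rdiv_lt_0_compat; lra).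
assert (cc : forall i, exists d, 0 < d /\ forall y, near d x y -> Rabs (p i y - p i x) < e / (4 * N)) by (intros i;
  apply ct_iff; auto; apply H, Sx).
destruct (cc 0%nat) as [d0 [D0 Q0]], (cc 1%nat) as [d1 [D1 Q1]], (cc 2%nat) as [d2 [D2 Q2]].
pose (d := Rmin (Rmin d0 d1) (Rmin d2 r)). assert (Hd : 0 < d /\ d <= d0 /\ d <= d1 /\ d <= d2 /\ d <= r).
{ unfold d. pose proof (Rmin_l (Rmin d0 d1) (Rmin d2 r)). pose proof (Rmin_r (Rmin d0 d1) (Rmin d2 r)).
  pose proof (Rmin_l d0 d1). pose proof (Rmin_r d0 d1). pose proof (Rmin_l d2 r). pose proof (Rmin_r d2 r).
    split; [repeat apply Rmin_pos; auto|lra]. }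
assert (Hdn : 0 < d / (4 * N)) by (apply Rdiv_lt_0_compat; lra).
exists (mkposreal _ Hdn). intros t Ht Htd. simpl in Htd. rewrite Rplus_0_l.
assert (T0 : 0 < Rabs t) by (now apply Rabs_pos_lt).
assert (T1 : Rabs t * N <= d / 4).
{ replace (d / 4) with (d / (4 * N) * N) by (field; lra). apply Rmult_le_compat_r; lra. }
assert (sm : forall u s, Rabs u <= N -> Rmin 0 (t * u) <= s <= Rmax 0 (t * u) -> Rabs s <= d / 4).
{ intros u s Hu Hs. apply Rabs_between_0 in Hs. rewrite Rabs_mult in Hs.
  assert (Rabs t * Rabs u <= Rabs t * N) by (apply Rmult_le_compat_l; lra). lra. }
assert (b1 : Rabs (px1 v) <= N) by (unfold N, l1_norm; lra). assert (b2 : Rabs (px2 v) <= N) by (unfold N, l1_norm;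
  lra). assert (b3 : Rabs (px3 v) <= N) by (unfold N, l1_norm; lra).
pose (x1 := shift x 0 (t * px1 v)). pose (x2 := shift x1 1 (t * px2 v)).
assert (n1 : near (d/3) x x1) by (apply near_shift; assert (Q := sm (px1 v) (t * px1 v) b1 (conj (Rmin_r _ _)
  (Rmax_r _ _))); lra).
assert (n2 : near (2*(d/3)) x x2).
{ replace (2 * (d/3)) with (d/3 + d/3) by ring. eapply near_trans; [exact n1|]. apply near_shift.
  assert (Q := sm (px2 v) (t * px2 v) b2 (conj (Rmin_r _ _) (Rmax_r _ _))). lra. }
assert (st : forall i z c u, near c x z -> c + d/3 <= d -> Rabs u <= N -> exists w,
  near d x w /\ f (shift z i (t * u)) - f z = t * u * p i w).
{ intros i z c u Hz Hc Hu. destruct (pd_MVT i f (p i) z (t * u)) as [s [Hs E]].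
  - intros s Hs. apply H, HS. eapply near_le; [|eapply near_trans; [exact Hz|apply (near_shift z i s (d/3))]];
    [lra|]. assert (Q := sm u s Hu Hs). lra.
  - exists (shift z i s). split; auto. eapply near_le; [exact Hc|]. eapply near_trans; [exact Hz|].
    apply near_shift. assert (Q := sm u s Hu Hs). lra. }
destruct (st 0%nat x (d/3) (px1 v)) as [w1 [N1 E1]]; auto; [apply near_refl; lra|lra|].
destruct (st 1%nat x1 (d/3) (px2 v)) as [w2 [N2 E2]]; auto; [lra|].
destruct (st 2%nat x2 (2*(d/3)) (px3 v)) as [w3 [N3 E3]]; auto; [lra|]. fold x1 in E1. fold x2 in E2.
replace (ray x v t) with (shift x2 2 (t * px3 v)) by (apply pt_eq; reflexivity).
replace (ray x v 0) with x by (apply pt_eq; cbn; ring).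
replace ((f (shift x2 2 (t * px3 v)) - f x) / t - (px1 v * p 0%nat x + px2 v * p 1%nat x + px3 v * p 2%nat x)) with
  (px1 v * (p 0%nat w1 - p 0%nat x) + px2 v * (p 1%nat w2 - p 1%nat x) + px3 v * (p 2%nat w3 - p 2%nat x)).
2:{ replace (f (shift x2 2 (t * px3 v)) - f x) with (t * px1 v * p 0%nat w1 + t * px2 v * p 1%nat w2 + t * px3 v * p
  2%nat w3) by lra. field. auto. }
eapply Rle_lt_trans; [apply Rabs_triang|]. eapply Rle_lt_trans; [apply Rplus_le_compat_r, Rabs_triang|].
  rewrite !Rabs_mult.
assert (K : forall u w i dd, Rabs u <= N -> near d x w -> (forall y,
  near dd x y -> Rabs (p i y - p i x) < e / (4 * N)) -> d <= dd -> Rabs u * Rabs (p i w - p i x) <= e / 4).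
{ intros u w i dd Hu Hw Q Hdd. assert (Z := Q w (near_le _ _ _ _ Hdd Hw)).
  replace (e / 4) with (N * (e / (4 * N))) by (field; lra).
  apply Rmult_le_compat; try apply Rabs_pos; lra. }
assert (K1 := K _ _ _ _ b1 N1 Q0 ltac:(lra)). assert (K2 := K _ _ _ _ b2 N2 Q1 ltac:(lra)).
  assert (K3 := K _ _ _ _ b3 N3 Q2 ltac:(lra)). lra.
Qed.

Definition ext (r : R) (y : pt) : Prop := r^2 < sq org y.

Lemma sqo y : sq org y = px1 y ^ 2 + px2 y ^ 2 + px3 y ^ 2.
Proof. unfold sq, org; cbn. ring. Qed.

(** Changing each coordinate of a point of the ball of radius R by less than m raises the squared
    norm by at most 6 R m + 3 m^2; with m <= 1 this is below (6 R + 4) m, hence the denominator. *)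
Lemma ext_margin R l : 0 <= R < l -> margin (ext R) (fun y => l^2 <= sq org y) (Rmin 1 ((l^2 - R^2) / (6 * R + 4))).
Proof.
intros H. assert (H2 : 0 < l^2 - R^2) by nra. set (m := Rmin _ _).
assert (Hm : 0 < m /\ m <= 1 /\ m * (6 * R + 4) <= l^2 - R^2).
{ unfold m. split; [apply Rmin_pos; [lra|apply Rdiv_lt_0_compat; lra]|]. split; [apply Rmin_l|].
  apply Rle_trans with ((l^2 - R^2) / (6 * R + 4) * (6 * R + 4)); [apply Rmult_le_compat_r;
    [lra|apply Rmin_r]|right; field; lra]. }
split; [lra|]. intros y Hy z [N1 [N2 N3]]. unfold ext. apply Rnot_le_lt; intros K.
rewrite sqo in Hy, K. apply Rabs_lt_between in N1, N2, N3.
assert (B : forall a, a^2 <= R^2 -> Rabs a <= R) by (intros a Ha; apply Rabs_le; split; nra).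
pose proof (pow2_ge_0 (px1 z)); pose proof (pow2_ge_0 (px2 z)); pose proof (pow2_ge_0 (px3 z)).
assert (st : forall a b, Rabs b <= R -> - m < b - a < m -> a^2 <= b^2 + 2 * R * m + m^2).
{ intros a b Hb Hab. apply Rabs_le_between in Hb. nra. }
assert (Z1 := st (px1 y) (px1 z) (B (px1 z) ltac:(lra)) N1). assert (Z2 := st (px2 y) (px2 z) (B (px2 z) ltac:(lra))
  N2). assert (Z3 := st (px3 y) (px3 z) (B (px3 z) ltac:(lra)) N3).
assert (m^2 <= m) by nra. lra.
Qed.

Lemma ext_open r : 0 <= r -> open3 (ext r).
Proof.
intros Hr x Hx. unfold ext in Hx. pose (l := sqrt (sq org x)).
assert (L2 : l^2 = sq org x) by (apply pow2_sqrt, sq_ge0).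
assert (HL : r < l) by (unfold l; rewrite <- (sqrt_pow2 r) by auto; apply sqrt_lt_1_alt; split;
  [apply pow2_ge_0|auto]).
destruct (ext_margin r l (conj Hr HL)) as [H1 H2]. exists (Rmin 1 ((l^2 - r^2) / (6 * r + 4))). split; auto.
  apply H2. lra.
Qed.

(** * The virial argument *)

(* [shell_avg f l] averages [f] over the shell l < |y| < 2 l with a smooth radial weight; working with shells rather
   than spheres avoids surface integrals. *)
Definition phi (y : pt) : R := - tau1 (sq org y).
Definition shell_avg (f : pt -> R) (l : R) : R := int3 (fun y => phi y * f (vscale l y)).

Lemma phi_ge0 y : 0 <= phi y.
Proof. unfold phi. pose proof (tau1_le0 (sq org y)). lra. Qed.

Lemma phi_0 y : sq org y <= 1 \/ 4 <= sq org y -> phi y = 0.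
Proof. intros H. unfold phi. destruct (tau123_0 _ H) as [-> _]. ring. Qed.

Lemma phi_nz y : phi y <> 0 -> 1 < sq org y < 4.
Proof. intros H. apply NNPP; intros N. apply H, phi_0. lra. Qed.

Lemma phi_ct y : ct phi y.
Proof. unfold phi. apply ct_opp. apply (ct_comp tau1); [apply ct_sq|apply continuous_tau1]. Qed.

Lemma phi_inbox y : phi y <> 0 -> inbox 2 y.
Proof.
intros H. apply phi_nz in H. rewrite sqo in H. assert (B : forall a, a^2 <= 4 -> Rabs a <= 2) by (intros a Ha;
  apply Rabs_le; split; nra).
pose proof (pow2_ge_0 (px1 y)); pose proof (pow2_ge_0 (px2 y)); pose proof (pow2_ge_0 (px3 y)).
repeat split; apply B; lra.
Qed.

Lemma phi_Cc : Cc phi.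
Proof. split; [exact phi_ct|]. exists 2. exact phi_inbox. Qed.

Lemma phi_pd j y : pd j phi y (- (tau2 (sq org y) * (2 * coord y j))).
Proof.
apply (pd_ext j (fun y => -1 * tau1 (sq org y))); [intros; unfold phi; ring|].
eapply pd_val; [|apply pd_scal, (pd_comp j tau1 (sq org) y _ _ (pd_sq j org y) (is_derive_tau1 _))].
cbn. destruct j as [|[|j]]; unfold org; cbn; ring.
Qed.

Lemma sq_vscale l y : sq org (vscale l y) = l^2 * sq org y.
Proof. rewrite !sqo; cbn. ring. Qed.

Lemma ct_vscale f l x : 0 < l -> ct f (vscale l x) -> ct (fun y => f (vscale l y)) x.
Proof.
rewrite !ct_iff; intros Hl H e He; destruct (H e He) as [d [Hd K]]; exists (d / l); split;
  [now apply Rdiv_lt_0_compat|].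
intros y [N1 [N2 N3]]. apply K.
assert (B : forall a b, Rabs (a - b) < d / l -> Rabs (l * a - l * b) < d).
{ intros a b Hab. rewrite <- Rmult_minus_distr_l, Rabs_mult, (Rabs_right l) by lra.
  replace d with (l * (d / l)) by (field; lra). apply Rmult_lt_compat_l; auto. }
repeat split; cbn; auto.
Qed.

Lemma scaled_region R l y : 0 <= R < l -> ext R (vscale l y) \/ exists d, 0 < d /\ forall z, near d y z -> phi z = 0.
Proof.
intros H. destruct (Rlt_le_dec (R^2) (sq org (vscale l y))) as [K|K]; [left; exact K|right].
rewrite sq_vscale in K. assert (Q : sq org y < 1) by nra.
assert (P : 0 < 1 - sq org y) by lra.
destruct (proj1 (ct_iff _ _) (ct_sq org y) _ P) as [d [Hd N]]. exists d; split; auto. intros z Hz. apply phi_0.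
specialize (N z Hz). apply Rabs_lt_between in N. lra.
Qed.

Lemma phi_ext R l y : 0 <= R < l -> phi y <> 0 -> ext R (vscale l y).
Proof. intros H Hy. apply phi_nz in Hy. unfold ext. rewrite sq_vscale. nra. Qed.

Lemma shell_avg_Cc R f l : (forall y, ext R y -> ct f y) -> 0 <= R < l -> Cc (fun y => phi y * f (vscale l y)).
Proof.
intros Hf H. split.
- intros y. destruct (scaled_region R l y H) as [K|[d [Hd K]]].
  + apply ct_mult; [apply phi_ct|]. apply ct_vscale; [lra|auto].
  + apply (ct_ext_near (fun _ => 0) _ y d Hd); [|apply ct_const]. intros z Hz. rewrite K by auto. ring.
- exists 2. intros y Hy. apply phi_inbox. intros E; apply Hy; rewrite E; ring.
Qed.

Lemma shell_avg_lin R f g a b l : (forall y, ext R y -> ct f y) -> (forall y, ext R y -> ct g y) -> 0 <= R < l ->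
  shell_avg (fun x => a * f x + b * g x) l = a * shell_avg f l + b * shell_avg g l.
Proof.
intros Hf Hg H. assert (C1 := shell_avg_Cc R f l Hf H). assert (C2 := shell_avg_Cc R g l Hg H). unfold shell_avg.
rewrite (I_ext _ (fun y => a * (phi y * f (vscale l y)) + b * (phi y * g (vscale l y)))) by (intros; ring).
  exact (I_lin _ _ a b C1 C2).
Qed.

Lemma shell_avg_ext R f g l : (forall y, ext R y -> f y = g y) -> 0 <= R < l -> shell_avg f l = shell_avg g l.
Proof.
intros E H. apply I_ext; intros y. destruct (Req_dec (phi y) 0) as [Z|Z]; [rewrite Z; ring|]. rewrite E; auto.
  now apply phi_ext.
Qed.

Lemma shell_avg_le R f g l : (forall y, ext R y -> ct f y) -> (forall y, ext R y -> ct g y) -> 0 <= R < l ->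
  (forall y, l^2 <= sq org y <= 4 * l^2 -> f y <= g y) -> shell_avg f l <= shell_avg g l.
Proof.
intros Hf Hg H K. apply I_le; [now apply (shell_avg_Cc R)|now apply (shell_avg_Cc R)|]. intros y.
destruct (Req_dec (phi y) 0) as [Z|Z]; [rewrite Z; lra|]. apply Rmult_le_compat_l; [apply phi_ge0|]. apply K.
apply phi_nz in Z. rewrite sq_vscale. nra.
Qed.

Definition C1on (S : pt -> Prop) (f : pt -> R) (p : nat -> pt -> R) : Prop :=
  forall y, S y -> ct f y /\ forall i, pd i f y (p i y) /\ ct (p i) y.

Definition xdot (p : nat -> pt -> R) (x : pt) : R := px1 x * p 0%nat x + px2 x * p 1%nat x + px3 x * p 2%nat x.

Lemma ct_xdot p x : (forall i, ct (p i) x) -> ct (xdot p) x.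
Proof. intros H. unfold xdot. ctt; apply H. Qed.

Lemma near_vscale s t y : phi y <> 0 -> forall d, 2 * Rabs (s - t) < d -> near d (vscale t y) (vscale s y).
Proof.
intros Hy d Hd. destruct (phi_inbox y Hy) as [B1 [B2 B3]]. assert (P := Rabs_pos (s - t)).
assert (B : forall a, Rabs a <= 2 -> Rabs (s * a - t * a) < d).
{ intros a Ha. rewrite <- Rmult_minus_distr_r, Rabs_mult. pose proof (Rabs_pos a). nra. }
repeat split; cbn; auto.
Qed.

(** Differentiation under the integral: the derivative in l of f (l y) is y . grad f (l y), which is
    1 / l times x . grad f at x = l y. The gradient is uniformly continuous near the shell because
    the shell keeps a margin to the ball of radius R. *)
Lemma shell_avg_derive R f p l : C1on (ext R) f p -> 0 <= R < l ->
  is_derive (shell_avg f) l (/ l * shell_avg (xdot p) l).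
Proof.
intros C H. apply is_derive_Reals. intros e He.
pose (l1 := (R + l) / 2). assert (Hl1 : 0 <= R < l1) by (unfold l1; lra).
pose (K := fun y => l1^2 <= sq org y <= 4 * (2 * l)^2).
assert (MK : margin (ext R) K (Rmin 1 ((l1^2 - R^2) / (6 * R + 4)))).
{ destruct (ext_margin R l1 Hl1) as [A1 A2]. split; auto. intros y [Hy _]. now apply A2. }
assert (BK : forall y, K y -> inbox (4 * l) y).
{ intros y [_ Hy]. rewrite sqo in Hy. assert (B : forall a, a^2 <= 4 * (2 * l)^2 ->
  Rabs a <= 4 * l) by (intros a Ha; apply Rabs_le; split; nra).
  pose proof (pow2_ge_0 (px1 y)); pose proof (pow2_ge_0 (px2 y)); pose proof (pow2_ge_0 (px3 y)).
    repeat split; apply B; lra. }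
assert (P := I_ge0 phi phi_Cc phi_ge0).
pose (e1 := e / (6 * (int3 phi + 1))). assert (He1 : 0 < e1) by (apply Rdiv_lt_0_compat; lra).
assert (unif_cont : forall i, exists d, 0 < d /\ forall y z, K y -> near d y z -> Rabs (p i z - p i y) < e1).
{ intros i. apply (locally_uniform_cont (ext R) K _ (4 * l) (p i) MK BK); auto. intros y Hy. apply C, Hy. }
destruct (unif_cont 0%nat) as [d0 [D0 Q0]], (unif_cont 1%nat) as [d1 [D1 Q1]], (unif_cont 2%nat) as [d2 [D2 Q2]].
pose (d := Rmin (Rmin d0 d1) (Rmin d2 ((l - R) / 2))). assert (Hd : 0 < d /\ d <= d0 /\ d <= d1 /\ d <= d2 /\ d <=
  (l - R)/2).
{ unfold d. pose proof (Rmin_l (Rmin d0 d1) (Rmin d2 ((l-R)/2))).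
  pose proof (Rmin_r (Rmin d0 d1) (Rmin d2 ((l-R)/2))).
  pose proof (Rmin_l d0 d1). pose proof (Rmin_r d0 d1). pose proof (Rmin_l d2 ((l-R)/2)).
    pose proof (Rmin_r d2 ((l-R)/2)). split; [repeat apply Rmin_pos; lra|lra]. }
assert (Pd : 0 < d / 4) by lra. exists (mkposreal _ Pd). intros t Ht Htd. simpl in Htd.
assert (T := Htd). apply Rabs_lt_between in T.
assert (Cf : forall y, ext R y -> ct f y) by (intros y Hy; apply C, Hy).
assert (Cp : forall i y, ext R y -> ct (p i) y) by (intros i y Hy; apply C, Hy).
assert (Cx : forall y, ext R y -> ct (xdot p) y) by (intros y Hy; apply ct_xdot; intros; now apply Cp).
assert (C1 := shell_avg_Cc R f (l + t) Cf ltac:(lra)). assert (C2 := shell_avg_Cc R f l Cf H).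
  assert (C3 := shell_avg_Cc R _ l Cx H).
assert (C4 := Cc_scal (/ t) _ (Cc_minus _ _ C1 C2)). assert (C5 := Cc_scal (/ l) _ C3).
replace ((shell_avg f (l + t) - shell_avg f l) / t - / l * shell_avg (xdot p) l) with
  (int3 (fun y => / t * (phi y * f (vscale (l + t) y) - phi y * f (vscale l y)) - / l * (phi y * xdot p (vscale l
    y)))).
2:{ refine (eq_trans (I_minus _ _ C4 C5) _). refine (eq_trans (f_equal2 Rminus (eq_trans (I_scal (/ t) _ (Cc_minus _
  _ C1 C2)) (f_equal (Rmult (/ t)) (I_minus _ _ C1 C2))) (I_scal (/ l) _ C3)) _). unfold shell_avg. field.
  split; lra. }
apply Rle_lt_trans with (int3 (fun y => 6 * e1 * phi y)).
- apply Rabs_I_le; [now apply Cc_minus|apply Cc_scal, phi_Cc|]. intros y.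
  replace (/ t * (phi y * f (vscale (l + t) y) - phi y * f (vscale l y)) - / l * (phi y * xdot p (vscale l y))) with
    (phi y * (/ t * (f (vscale (l + t) y) - f (vscale l y)) - / l * xdot p (vscale l y))) by ring.
  rewrite Rabs_mult, (Rabs_right (phi y)) by (apply Rle_ge, phi_ge0). rewrite (Rmult_comm (6 * e1)).
  destruct (Req_dec (phi y) 0) as [Z|Z]; [rewrite Z; lra|]. apply Rmult_le_compat_l; [apply phi_ge0|].
  assert (Zn := phi_nz y Z). destruct (phi_inbox y Z) as [B1 [B2 B3]].
  pose (dg := fun s => px1 y * p 0%nat (vscale s y) + px2 y * p 1%nat (vscale s y) + px3 y * p 2%nat (vscale s y)).
  assert (DV : forall s, R < s -> is_derive (fun s => f (vscale s y)) s (dg s)).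
  { intros s Hs. assert (E : ext R (vscale s y)) by (apply phi_ext; auto; lra).
    assert (Q := ray_derive (ext R) f p (vscale s y) y (ext_open R (proj1 H)) E (fun z Hz => proj2 (C z Hz))).
    apply (is_derive_ext (fun u => f (ray (vscale s y) y (u - s)))).
    - intros u. f_equal. apply pt_eq; cbn; ring.
    - evar_last; [apply (is_derive_comp (fun u => f (ray (vscale s y) y u)) (fun u => u - s));
      [rewrite Rminus_diag; exact Q|auto_derive; auto]|].
      unfold scal; simpl; unfold mult; simpl. apply Rmult_1_l. }
  destruct (MVT_gen (fun s => f (vscale s y)) l (l + t) dg) as [c [Hc E]].
  + intros s Hs. apply DV. unfold Rmin in Hs. destruct (Rle_dec l (l + t)); lra.
  + intros s Hs. apply derivable_continuous_pt. exists (dg s). apply is_derive_Reals, DV. unfold Rmin in Hs.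
    destruct (Rle_dec l (l + t)); lra.
  + rewrite E. replace (l + t - l) with t by ring.
    assert (Cl : Rabs (c - l) <= Rabs t).
    { unfold Rmin, Rmax in Hc. unfold Rabs. destruct (Rle_dec l (l + t)), (Rcase_abs (c - l)), (Rcase_abs t); lra. }
    assert (KY : K (vscale l y)). { unfold K. rewrite sq_vscale. unfold l1.
      assert (0 < l^2) by (apply pow_lt; lra). split; nra. }
    assert (N : near d (vscale l y) (vscale c y)) by (apply near_vscale; auto; lra).
    assert (q0 := Q0 _ _ KY (near_le _ _ _ _ (proj1 (proj2 Hd)) N)).
    assert (q1 := Q1 _ _ KY (near_le _ _ _ _ (proj1 (proj2 (proj2 Hd))) N)).
    assert (q2 := Q2 _ _ KY (near_le _ _ _ _ (proj1 (proj2 (proj2 (proj2 Hd)))) N)).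
    replace (/ t * (dg c * t) - / l * xdot p (vscale l y)) with (px1 y * (p 0%nat (vscale c y) - p 0%nat (vscale l
      y)) +
       px2 y * (p 1%nat (vscale c y) - p 1%nat (vscale l y)) + px3 y * (p 2%nat (vscale c y) - p 2%nat (vscale l y))).
    2:{ unfold dg, xdot. cbn [vscale px1 px2 px3 mkpt fst snd]. change (px1 (vscale l y)) with (l * px1 y).
      change (px2 (vscale l y)) with (l * px2 y). change (px3 (vscale l y)) with (l * px3 y). field. split; lra. }
    eapply Rle_trans; [apply Rabs_triang|]. eapply Rle_trans; [apply Rplus_le_compat_r, Rabs_triang|].
      rewrite !Rabs_mult.
    assert (M : forall a b, Rabs a <= 2 -> Rabs b < e1 -> Rabs a * Rabs b <= 2 * e1) by (intros a b Ha Hb;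
      apply Rmult_le_compat; try apply Rabs_pos; lra).
    assert (m1 := M _ _ B1 q0). assert (m2 := M _ _ B2 q1). assert (m3 := M _ _ B3 q2). lra.
- rewrite (I_scal _ _ phi_Cc). assert (6 * e1 * (int3 phi + 1) = e) by (unfold e1; field; lra). nra.
Qed.

Lemma pd_vscale j f l y d : pd j f (vscale l y) d -> pd j (fun y => f (vscale l y)) y (l * d).
Proof.
intros H. apply pd_def. apply (is_derive_ext (fun t => f (shift (vscale l y) j (l * t)))).
- intros t. f_equal. destruct j as [|[|j]]; apply pt_eq; cbn; ring.
- apply (pd_line_scaled j f (vscale l y) d 0 l 0); auto. now rewrite Rmult_0_r, shift_0.
Qed.

(* A tangential field has no flux through spheres, so the average of its divergence vanishes. *)
Lemma shell_avg_div R T dT l : (forall j y, ext R y -> ct (T j) y /\ pd j (T j) y (dT j y) /\ ct (dT j) y) ->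
  0 <= R < l ->
  (forall y, ext R y -> xdot T y = 0) -> shell_avg (lap dT) l = 0.
Proof.
intros HT H HX.
pose (Fp := fun j y => - (tau2 (sq org y) * (2 * coord y j)) * T j (vscale l y) + phi y * (l * dT j (vscale l y))).
assert (dead : forall y d, 0 < d -> (forall z, near d y z -> phi z = 0) -> forall z,
  near d y z -> tau2 (sq org z) = 0).
{ intros y d Hd Hz z Nz. specialize (Hz z Nz). unfold phi in Hz.
  destruct (Rlt_le_dec 1 (sq org z)) as [K1|K1]; [|apply tau123_0; lra].
    destruct (Rlt_le_dec (sq org z) 4) as [K2|K2]; [|apply tau123_0; lra].
  assert (Q := tau1_neg (sq org z) ltac:(lra)). lra. }
assert (CF : forall j, Cc (Fp j)).
{ intros j. split.
  - intros y. destruct (scaled_region R l y H) as [K|[d [Hd K]]].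
    + destruct (HT j _ K) as [a1 [_ a3]]. apply (ct_vscale _ l y ltac:(lra)) in a1.
      apply (ct_vscale _ l y ltac:(lra)) in a3.
      assert (b := phi_ct y). assert (b2 : ct (fun y => tau2 (sq org y)) y) by (apply (ct_comp tau2);
        [apply ct_sq|apply continuous_tau2]).
      unfold Fp. ctt.
    + apply (ct_ext_near (fun _ => 0) _ y d Hd); [|apply ct_const]. intros z Hz. unfold Fp.
      rewrite K, (dead y d Hd K z Hz) by auto. ring.
  - exists 2. intros y Hy. destruct (Rlt_le_dec 1 (sq org y)) as [K1|K1];
    [destruct (Rlt_le_dec (sq org y) 4) as [K2|K2]|].
    + apply phi_inbox. unfold phi. assert (Q := tau1_neg (sq org y) ltac:(lra)). lra.
    + exfalso. apply Hy. unfold Fp. rewrite phi_0 by lra. destruct (tau123_0 (sq org y)) as [_ [-> _]]; [lra|ring].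
    + exfalso. apply Hy. unfold Fp. rewrite phi_0 by lra. destruct (tau123_0 (sq org y)) as [_ [-> _]]; [lra|ring]. }
assert (Z : forall j, int3 (Fp j) = 0).
{ intros j. apply (I_pd j (fun y => phi y * T j (vscale l y))); auto.
  - apply (shell_avg_Cc R); auto. intros y Hy; apply (HT j y Hy).
  - intros y. destruct (scaled_region R l y H) as [K|[d [Hd K]]].
    + apply (pd_mult j phi (fun y => T j (vscale l y)) y _ _ (phi_pd j y)). apply pd_vscale, (HT j _ K).
    + apply (pd_ext_near j (fun _ => 0) _ y _ d Hd).
      * intros z Hz. rewrite K by auto. ring.
      * eapply pd_val; [|apply pd_const]. unfold Fp. rewrite (K y), (dead y d Hd K y) by (apply near_refl; auto).
        ring. }
assert (CL : Cc (fun y => phi y * lap dT (vscale l y))) by (apply (shell_avg_Cc R); auto; intros y Hy;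
  apply ct_lap; intros j; apply (HT j y Hy)).
assert (Q : l * shell_avg (lap dT) l = 0); [|apply Rmult_integral in Q; lra].
unfold shell_avg. refine (eq_trans (eq_sym (I_scal l _ CL)) _).
rewrite (I_ext _ (fun y => Fp 0%nat y + Fp 1%nat y + Fp 2%nat y)).
- refine (eq_trans (I_plus _ _ (Cc_plus _ _ (CF 0%nat) (CF 1%nat)) (CF 2%nat)) _).
  rewrite (I_plus _ _ (CF 0%nat) (CF 1%nat)), !Z. ring.
- intros y. unfold Fp, lap. destruct (Req_dec (tau2 (sq org y)) 0) as [E|E]; [rewrite E; ring|].
  assert (X : xdot T (vscale l y) = 0).
  { apply HX. unfold ext. rewrite sq_vscale. assert (1 < sq org y); [|nra]. apply Rnot_le_lt; intros K. apply E.
    apply tau123_0; lra. }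
  unfold xdot in X. change (px1 (vscale l y)) with (l * px1 y) in X.
    change (px2 (vscale l y)) with (l * px2 y) in X. change (px3 (vscale l y)) with (l * px3 y) in X.
  assert (X' : px1 y * T 0%nat (vscale l y) + px2 y * T 1%nat (vscale l y) + px3 y * T 2%nat (vscale l y) = 0).
  { apply Rmult_eq_reg_l with l; [lra|lra]. }
  cbn [coord]. transitivity (phi y * (l * dT 0%nat (vscale l y)) + phi y * (l * dT 1%nat (vscale l y)) + phi y * (l
    * dT 2%nat (vscale l y))
     - 2 * tau2 (sq org y) * (px1 y * T 0%nat (vscale l y) + px2 y * T 1%nat (vscale l y) + px3 y * T 2%nat (vscale
       l y))); [rewrite X'; ring|ring].
Qed.

Lemma C1_mult S f p g q : C1on S f p -> C1on S g q -> C1on S (fun y => f y * g y) (fun j y => p j y * g y + f y * q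
  j y).
Proof.
intros F G y Sy. destruct (F y Sy) as [F0 F1], (G y Sy) as [G0 G1]. split; [now apply ct_mult|].
intros j. destruct (F1 j), (G1 j). split; [now apply pd_mult|ctt].
Qed.
Lemma C1_plus S f p g q : C1on S f p -> C1on S g q -> C1on S (fun y => f y + g y) (fun j y => p j y + q j y).
Proof.
intros F G y Sy. destruct (F y Sy) as [F0 F1], (G y Sy) as [G0 G1]. split; [now apply ct_plus|].
intros j. destruct (F1 j), (G1 j). split; [now apply pd_plus|ctt].
Qed.
Lemma C1_minus S f p g q : C1on S f p -> C1on S g q -> C1on S (fun y => f y - g y) (fun j y => p j y - q j y).
Proof.
intros F G y Sy. destruct (F y Sy) as [F0 F1], (G y Sy) as [G0 G1]. split; [now apply ct_minus|].
intros j. destruct (F1 j), (G1 j). split; [now apply pd_minus|ctt].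
Qed.
Lemma C1_const S c : C1on S (fun _ => c) (fun _ _ => 0).
Proof. intros y _. split; [apply ct_const|]. intros j. split; [apply pd_const|apply ct_const]. Qed.
Lemma C1_coord S i : C1on S (fun y => coord y i) (fun j _ => kronecker j i).
Proof. intros y _. split; [apply ct_coord|]. intros j. split; [apply pd_coord|apply ct_const]. Qed.
Lemma C1_r2 S : C1on S (sq org) (fun j y => 2 * coord y j).
Proof.
intros y _. split; [apply ct_sq|]. intros j. split; [|ctt].
eapply pd_val; [|apply pd_sq]. destruct j as [|[|j]]; unfold org; cbn; ring.
Qed.

Section Kato.
Variables (k R : R) (W : pt -> Stdlib.Reals.Rdefinitions.R).
Hypothesis Hk : 0 < k.
Hypothesis HR : 0 <= R.
Hypothesis HW : weak_helmholtz k (ext R) W.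
Notation S := (ext R).

Let g i := D i W.
Let h i j := D j (D i W).

Lemma C1_W : C1on S W g.
Proof. intros y Sy. split; [now apply HW|]. intros i. exact (weak_helmholtz_C1 k S W i (ext_open R HR) HW y Sy). Qed.
Lemma C1_g i : C1on S (g i) (h i).
Proof.
intros y Sy. split; [apply (weak_helmholtz_C1 k S W i (ext_open R HR) HW y Sy)|].
intros j. exact (weak_helmholtz_C1 k S (D i W) j (ext_open R HR) (weak_helmholtz_D k S W i (ext_open R HR) HW) y Sy).
Qed.

(** This is x . grad W, that is r d_r W; the factor r is kept so that everything stays polynomial in
    the coordinates. *)
Definition Xr (y : pt) : Stdlib.Reals.Rdefinitions.R := coord y 0 * g 0%nat y + coord y 1 * g 1%nat y + coord y 2 *
  g 2%nat y.
Definition Gr (y : pt) : Stdlib.Reals.Rdefinitions.R := g 0%nat y * g 0%nat y + g 1%nat y * g 1%nat y + g 2%nat y *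
  g 2%nat y.

(** These proofs are definitions without a stated type on purpose: the inferred types record the
    gradients, and [virial] reads them off by matching instead of having them written out. *)
Definition C1_X := C1_plus S _ _ _ _ (C1_plus S _ _ _ _ (C1_mult S _ _ _ _ (C1_coord S 0) (C1_g 0)) (C1_mult S _ _ _
  _ (C1_coord S 1) (C1_g 1)))
    (C1_mult S _ _ _ _ (C1_coord S 2) (C1_g 2)).
Definition C1_G := C1_plus S _ _ _ _ (C1_plus S _ _ _ _ (C1_mult S _ _ _ _ (C1_g 0) (C1_g 0)) (C1_mult S _ _ _ _
  (C1_g 1) (C1_g 1)))
    (C1_mult S _ _ _ _ (C1_g 2) (C1_g 2)).

(** The squared length of the tangential gradient, times r^2; its nonnegativity is Lagrange's
    identity for the cross product. *)
Definition angular_energy (y : pt) := sq org y * Gr y - Xr y * Xr y.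
(* For U = r^m W this is, up to the factor r^(2m-2), (d_r U)^2 + (k^2 + m (m-1) / r^2) U^2 minus the squared tangential
   gradient of U. *)
Definition virial_density (m : Stdlib.Reals.Rdefinitions.R) (y : pt) := (Xr y + m * W y) * (Xr y + m * W y) + (k^2 *
  sq org y + m * (m - 1)) * (W y * W y) - (sq org y * Gr y - Xr y * Xr y).
Definition C1_Y m := C1_plus S _ _ _ _ C1_X (C1_mult S _ _ _ _ (C1_const S m) C1_W).
Definition C1_WW := C1_mult S _ _ _ _ C1_W C1_W.
Definition C1_virial_density m := C1_minus S _ _ _ _
   (C1_plus S _ _ _ _ (C1_mult S _ _ _ _ (C1_Y m) (C1_Y m))
      (C1_mult S _ _ _ _ (C1_plus S _ _ _ _ (C1_mult S _ _ _ _ (C1_const S (k^2)) (C1_r2 S)) (C1_const S (m * (m -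
        1)))) C1_WW))
   (C1_minus S _ _ _ _ (C1_mult S _ _ _ _ (C1_r2 S) C1_G) (C1_mult S _ _ _ _ C1_X C1_X)).
(** The field Z = r^2 grad W - x (x . grad W) is r^2 times the tangential gradient. Its products
    with x . grad W and with W, formed next, are the tangential fields whose divergences average to
    zero. *)
Definition C1_Z j := C1_minus S _ _ _ _ (C1_mult S _ _ _ _ (C1_r2 S) (C1_g j)) (C1_mult S _ _ _ _ (C1_coord S j)
  C1_X).
Definition C1_TX j := C1_mult S _ _ _ _ C1_X (C1_Z j).
Definition C1_TW j := C1_mult S _ _ _ _ C1_W (C1_Z j).

Lemma angular_energy_ge0 y : 0 <= angular_energy y.
Proof.
unfold angular_energy, Gr, Xr. rewrite sqo. cbn [coord]. generalize (g 0%nat y) (g 1%nat y) (g 2%nat y) (px1 y) (px2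
  y) (px3 y). intros a b c x1 x2 x3.
replace ((x1^2 + x2^2 + x3^2) * (a * a + b * b + c * c) - (x1 * a + x2 * b + x3 * c) * (x1 * a + x2 * b + x3 * c))
  with
  ((x1 * b - x2 * a)^2 + (x1 * c - x3 * a)^2 + (x2 * c - x3 * b)^2) by ring.
pose proof (pow2_ge_0 (x1 * b - x2 * a)); pose proof (pow2_ge_0 (x1 * c - x3 * a));
  pose proof (pow2_ge_0 (x2 * c - x3 * b)). lra.
Qed.

(** With X = x . grad W, adding 2 div (X Z) + 2 m div (W Z) to the left-hand integrand gives the
    right-hand integrand pointwise, by the Helmholtz equation and the symmetry of second
    derivatives. Both divergences have zero average by [shell_avg_div]. *)
Lemma virial m : exists p, C1on S (virial_density m) p /\ forall l, R < l ->
  shell_avg (xdot p) l + 2 * m * shell_avg (virial_density m) l = shell_avg (fun y => 2 * (2 * m - 1) * ((Xr y + m *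
    W y) * (Xr y + m * W y)) + 2 * k^2 * sq org y * (W y * W y)) l.
Proof.
eexists. split; [exact (C1_virial_density m)|]. intros l Hl. assert (Hl' : 0 <= R < l) by lra.
match type of (C1_virial_density m) with C1on _ _ ?p => set (pp := p) end.
match type of C1_TX with forall j, C1on _ (@?t j) (@?d j) => pose (TX := t); pose (dX := fun j => d j j) end.
match type of C1_TW with forall j, C1on _ (@?t j) (@?d j) => pose (TW := t); pose (dW := fun j => d j j) end.
assert (EX : shell_avg (lap dX) l = 0).
{ apply (shell_avg_div R TX dX l); auto.
  - intros j y Sy. destruct (C1_TX j y Sy) as [A1 A2]. destruct (A2 j) as [A3 A4]. exact (conj A1 (conj A3 A4)).
  - intros y Sy. unfold xdot, TX. rewrite sqo. cbn [coord]. ring. }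
assert (EW : shell_avg (lap dW) l = 0).
{ apply (shell_avg_div R TW dW l); auto.
  - intros j y Sy. destruct (C1_TW j y Sy) as [A1 A2]. destruct (A2 j) as [A3 A4]. exact (conj A1 (conj A3 A4)).
  - intros y Sy. unfold xdot, TW. rewrite sqo. cbn [coord]. ring. }
assert (cX : forall y, S y -> ct Xr y) by (intros y Sy; apply (C1_X y Sy)).
assert (cW : forall y, S y -> ct W y) by (intros y Sy; apply (C1_W y Sy)).
assert (cp : forall y, S y -> ct (xdot pp) y) by (intros y Sy; apply ct_xdot; intros j;
  apply (C1_virial_density m y Sy)).
assert (cf : forall y, S y -> ct (virial_density m) y) by (intros y Sy; apply (C1_virial_density m y Sy)).
assert (cdX : forall y, S y -> ct (lap dX) y) by (intros y Sy; apply ct_lap; intros j; apply (C1_TX j y Sy)).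
assert (cdW : forall y, S y -> ct (lap dW) y) by (intros y Sy; apply ct_lap; intros j; apply (C1_TW j y Sy)).
assert (c1 : forall y, S y -> ct (fun y => 1 * xdot pp y + (2 * m) * virial_density m y) y) by (intros y Sy;
  specialize (cp y Sy); specialize (cf y Sy); ctt).
assert (c2 : forall y, S y -> ct (fun y => (2) * lap dX y + (2 * m) * lap dW y) y) by (intros y Sy;
  specialize (cdX y Sy); specialize (cdW y Sy); ctt).
assert (L1 := shell_avg_lin R _ _ 1 (2 * m) l cp cf Hl'). assert (L2 := shell_avg_lin R _ _ 2 (2 * m) l cdX cdW
  Hl'). assert (L3 := shell_avg_lin R _ _ 1 1 l c1 c2 Hl').
rewrite EX, EW in L2. rewrite L1, L2 in L3.
replace (shell_avg (xdot pp) l + 2 * m * shell_avg (virial_density m) l) with (1 * (1 * shell_avg (xdot pp) l + 2 *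
  m * shell_avg (virial_density m) l) + 1 * (2 * 0 + 2 * m * 0)) by ring.
refine (eq_trans (eq_sym L3) _). apply (shell_avg_ext R); auto. intros y Sy.
assert (PDE := weak_strong k S W (ext_open R HR) HW y Sy). unfold lap in PDE.
assert (s01 := D_sym k S W 0 1 y (ext_open R HR) HW Sy). assert (s02 := D_sym k S W 0 2 y (ext_open R HR) HW Sy).
  assert (s12 := D_sym k S W 1 2 y (ext_open R HR) HW Sy).
unfold xdot, lap, virial_density, pp, dX, dW, kronecker, Xr, Gr, h, g. rewrite sqo. cbn [coord Nat.min Nat.eqb].
fold (D 0 W) (D 1 W) (D 2 W) in *.
rewrite s01, s02, s12.
assert (P2 : D 2 (D 2 W) y = - D 0 (D 0 W) y - D 1 (D 1 W) y - k^2 * W y) by lra. rewrite P2.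
ring.
Qed.
End Kato.

Lemma deriv_mono (f f' : R -> R) a b : a < b -> (forall x, a <= x <= b -> is_derive f x (f' x)) -> (forall x,
  a <= x <= b -> 0 <= f' x) -> f a <= f b.
Proof.
intros H Hf H0. destruct (MVT_gen f a b f') as [c [Hc E]].
- intros x Hx. rewrite Rmin_left, Rmax_right in Hx by lra. apply Hf; lra.
- intros x Hx. rewrite Rmin_left, Rmax_right in Hx by lra. apply derivable_continuous_pt. exists (f' x).
  apply is_derive_Reals, Hf; lra.
- rewrite Rmin_left, Rmax_right in Hc by lra. specialize (H0 c Hc). nra.
Qed.

Lemma deriv_strict (f f' : R -> R) a b : a < b -> (forall x, a <= x <= b -> is_derive f x (f' x)) -> (forall x,
  a <= x <= b -> 0 < f' x) -> f a < f b.
Proof.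
intros H Hf H0. destruct (MVT_gen f a b f') as [c [Hc E]].
- intros x Hx. rewrite Rmin_left, Rmax_right in Hx by lra. apply Hf; lra.
- intros x Hx. rewrite Rmin_left, Rmax_right in Hx by lra. apply derivable_continuous_pt. exists (f' x).
  apply is_derive_Reals, Hf; lra.
- rewrite Rmin_left, Rmax_right in Hc by lra. specialize (H0 c Hc). nra.
Qed.

(** * Solutions of decay O(|x|^-2) vanish near infinity *)

Section Kato2.
Variables (k R C : R) (W : pt -> Stdlib.Reals.Rdefinitions.R).
Hypothesis Hk : 0 < k.
Hypothesis HR : 1 <= R.
Hypothesis HRk : 1 <= k * R.
Hypothesis HW : weak_helmholtz k (ext R) W.
Hypothesis HC : 0 <= C.
Hypothesis dec0 : forall x, ext R x -> Rabs (W x) <= C / sq org x.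
Hypothesis dec1 : forall x i, ext R x -> Rabs (D i W x) <= C / sq org x.
Notation S := (ext R).
Notation X := (Xr W).
Notation RR := Stdlib.Reals.Rdefinitions.R.

Let R0 : 0 <= R. Proof. lra. Qed.
Let cW : forall y, S y -> ct W y. Proof. intros y Sy; apply (C1_W k R W R0 HW y Sy). Qed.
Let cX : forall y, S y -> ct X y. Proof. intros y Sy; apply (C1_X k R W R0 HW y Sy). Qed.
Let cWW : forall y, S y -> ct (fun y => W y * W y) y. Proof. intros y Sy; apply (C1_WW k R W R0 HW y Sy). Qed.
Let cWX : forall y, S y -> ct (fun y => W y * X y) y. Proof. intros y Sy; specialize (cW y Sy);
  specialize (cX y Sy); ctt. Qed.
Let cr : forall y : pt, ct (sq org) y. Proof. intros; apply ct_sq. Qed.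
Let cG : forall y, S y -> ct (Gr W) y. Proof. intros y Sy; apply (C1_G k R W R0 HW y Sy). Qed.
Let cang : forall y, S y -> ct (angular_energy W) y. Proof. intros y Sy. specialize (cG y Sy).
  specialize (cX y Sy). specialize (cr y). unfold angular_energy. ctt. Qed.
Let cf1 m : forall y, S y -> ct (virial_density k W m) y. Proof.
  intros y Sy; apply (C1_virial_density k R W R0 HW m y Sy). Qed.

Definition avg_WW := shell_avg (fun y => W y * W y).
Definition avg_WX := shell_avg (fun y => W y * X y).

Lemma avg_WW_ge0 l : R < l -> 0 <= avg_WW l.
Proof.
intros H. apply I_ge0; [apply (shell_avg_Cc R (fun y => W y * W y)); auto; lra|]. intros y.
  apply Rmult_le_pos; [apply phi_ge0|]. apply Rle_0_sqr.
Qed.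

Lemma avg_WW_derive l : R < l -> is_derive avg_WW l (2 * avg_WX l / l).
Proof.
intros H. assert (H' : 0 <= R < l) by lra.
evar_last; [exact (shell_avg_derive R _ _ l (C1_WW k R W R0 HW) H')|].
assert (E : shell_avg (xdot (fun j y => D j W y * W y + W y * D j W y)) l = shell_avg (fun y => 2 * (W y * X y) + 0
  * (W y * W y)) l).
{ apply (shell_avg_ext R); auto. intros y Sy. unfold xdot, Xr. cbn [coord]. ring. }
refine (eq_trans (f_equal (Rmult (/ l)) E) _). rewrite (shell_avg_lin R _ _ 2 0 l cWX cWW H'). unfold avg_WX.
  field. lra.
Qed.

(** The subtracted term, used with b = k, grows linearly in l relative to the mass. It will outweigh
    the constant, depending on m only, that appears when the densities for m and for 1 are
    compared. *)
Definition virial_energy (m b l : RR) := shell_avg (virial_density k W m) l - b * l * avg_WW l.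

Lemma virial_energy_derive m b l : R < l -> exists d, is_derive (virial_energy m b) l d /\
  l * d + 2 * m * virial_energy m b l = shell_avg (fun y => 2 * (2 * m - 1) * ((X y + m * W y) * (X y + m * W y)) +
    2 * k^2 * sq org y * (W y * W y)) l
     - b * l * (2 * m + 1) * avg_WW l - 2 * b * l * avg_WX l.
Proof.
intros H. assert (H' : 0 <= R < l) by lra.
destruct (virial k R W R0 HW m) as [p [Cp V]]. specialize (V l H).
exists (/ l * shell_avg (xdot p) l - b * (avg_WW l + l * (2 * avg_WX l / l))). split.
- unfold virial_energy. apply (is_derive_minus (shell_avg (virial_density k W m)) (fun l => b * l * avg_WW l)).
  + exact (shell_avg_derive R _ _ l Cp H').
  + evar_last; [apply (is_derive_mult (fun l => b * l) avg_WW l b (2 * avg_WX l / l)); [auto_derive; auto;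
    ring|now apply avg_WW_derive|intros; apply Rmult_comm]|].
    unfold plus, mult; simpl. ring.
- rewrite <- V. unfold virial_energy. field. lra.
Qed.

(* Positivity is propagated outwards: (l^(2m) virial_energy)' >= 0. *)
Lemma virial_energy_growth (n : nat) l : (1 <= n)%nat -> R < l -> exists d,
  is_derive (virial_energy (INR n) k) l d /\ 0 <= l * d + 2 * INR n * virial_energy (INR n) k l.
Proof.
intros Hn H. assert (H' : 0 <= R < l) by lra. assert (Hm : 1 <= INR n) by (apply (le_INR 1); auto).
destruct (virial_energy_derive (INR n) k l H) as [d [D1 D2]]. exists d. split; auto. rewrite D2.
  set (m := INR n) in *.
pose (q := fun y => 2 * (2 * m - 1) * ((X y + m * W y) * (X y + m * W y)) + 2 * k^2 * sq org y * (W y * W y)). fold q.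
assert (cq : forall y, S y -> ct q y).
{ intros y Sy. specialize (cW y Sy). specialize (cX y Sy). specialize (cr y). unfold q. ctt. }
assert (c2 : forall y, S y -> ct (fun y => - k * l * (2 * m + 1) * (W y * W y) + - (2 * k * l) * (W y * X y)) y).
{ intros y Sy. specialize (cW y Sy). specialize (cX y Sy). ctt. }
assert (E : shell_avg (fun y => 1 * q y + 1 * (- k * l * (2 * m + 1) * (W y * W y) + - (2 * k * l) * (W y * X y))) l =
  shell_avg q l - k * l * (2 * m + 1) * avg_WW l - 2 * k * l * avg_WX l).
{ rewrite (shell_avg_lin R q _ 1 1 l cq c2 H'), (shell_avg_lin R _ _ (- k * l * (2 * m + 1)) (- (2 * k * l)) l cWW
  cWX H'). unfold avg_WW, avg_WX. ring. }
rewrite <- E.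
assert (Z : shell_avg (fun y => 0 * W y + 0 * W y) l = 0) by (rewrite (shell_avg_lin R W W 0 0 l cW cW H'); ring).
rewrite <- Z. apply (shell_avg_le R); auto.
- intros y Sy. specialize (cW y Sy). ctt.
- intros y Sy. specialize (cq y Sy). specialize (c2 y Sy). ctt.
- intros y Hy. unfold q. set (w := W y). set (x := X y). set (r := sq org y) in *.
  assert (kl : 1 <= k * l) by nra.
  (* After completing squares every term is nonnegative separately, because m >= 1, r >= l^2 on the
     shell, and k l >= 1. *)
  replace (1 * (2 * (2 * m - 1) * ((x + m * w) * (x + m * w)) + 2 * k^2 * r * (w * w)) + 1 * (- k * l * (2 * m + 1)
    * (w * w) + - (2 * k * l) * (w * x))) with
    ((4 * m - 3) * (x + m * w)^2 + ((x + m * w) - k * l * w)^2 + 2 * k^2 * (r - l^2) * w^2 + k * l * (k * l - 1) *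
      w^2) by ring.
  pose proof (pow2_ge_0 (x + m * w)). pose proof (pow2_ge_0 (x + m * w - k * l * w)). pose proof (pow2_ge_0 w).
    pose proof (pow2_ge_0 k).
  assert (0 <= (4 * m - 3) * (x + m * w)^2) by (apply Rmult_le_pos; lra).
  assert (0 <= 2 * k^2 * (r - l^2) * w^2) by (apply Rmult_le_pos; [apply Rmult_le_pos|]; lra).
  assert (0 <= k * l * (k * l - 1) * w^2) by (apply Rmult_le_pos; [apply Rmult_le_pos|]; lra). lra.
Qed.

Lemma virial_energy_forward n l1 l2 : (1 <= n)%nat -> R < l1 < l2 -> 0 < virial_energy (INR n) k l1 ->
  0 < virial_energy (INR n) k l2.
Proof.
intros Hn H P.
destruct (functional_choice (fun l d => R < l -> is_derive (virial_energy (INR n) k) l d /\ 0 <= l * d + 2 * INR n *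
  virial_energy (INR n) k l)) as [d Hd].
{ intros l. destruct (Rlt_dec R l) as [L|L]; [destruct (virial_energy_growth n l Hn L) as [d Hd]; exists d;
  auto|exists 0; lra]. }
pose (F := fun l => l^(2 * n) * virial_energy (INR n) k l).
assert (Q : F l1 <= F l2).
{ apply (deriv_mono F (fun l => INR (2 * n) * l^(pred (2 * n)) * virial_energy (INR n) k l + l^(2 * n) * d l));
  [lra| |].
  - intros l Hl. destruct (Hd l ltac:(lra)) as [A1 _]. unfold F.
    evar_last; [apply (is_derive_mult (fun l => l^(2 * n)) (virial_energy (INR n) k) l (INR (2 * n) * l^(pred (2 *
      n))) (d l)); [|exact A1|intros; apply Rmult_comm]|reflexivity].
    evar_last; [apply is_derive_pow, is_derive_id|]. unfold one; simpl. ring.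
  - intros l Hl. destruct (Hd l ltac:(lra)) as [_ A2].
    replace (l^(2 * n)) with (l * l^(pred (2 * n))) by (rewrite tech_pow_Rmult; f_equal; lia).
    rewrite mult_INR. replace (INR 2) with 2 by reflexivity.
    replace (2 * INR n * l^(pred (2 * n)) * virial_energy (INR n) k l + l * l^(pred (2 * n)) * d l) with (l^(pred (2
      * n)) * (l * d l + 2 * INR n * virial_energy (INR n) k l)) by ring.
    apply Rmult_le_pos; auto. apply pow_le; lra. }
unfold F in Q. assert (0 < l1^(2*n)) by (apply pow_lt; lra). assert (0 < l2^(2*n)) by (apply pow_lt; lra).
assert (0 < l1^(2*n) * virial_energy (INR n) k l1) by (apply Rmult_lt_0_compat; auto). apply Rnot_le_lt; intros K.
  nra.
Qed.

(** The angular part enters with a minus sign and is dropped. The decay hypotheses give |X| <= 6 C /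
    l and |W| <= C / l, whence 49 = 7^2, and the potential term gives 4 k^2 C^2. Decay faster than 1
    / r is essential: for cos (k r) / r the energy is of order one. *)
Lemma F1_bound l : R < l -> virial_energy 1 0 l <= (49 * C^2 + 4 * k^2 * C^2) * int3 phi / l^2.
Proof.
intros H. assert (H' : 0 <= R < l) by lra. unfold virial_energy. replace (0 * l * avg_WW l) with 0 by ring.
  rewrite Rminus_0_r.
assert (L2 : 0 < l^2) by (apply pow_lt; lra).
apply Rle_trans with (shell_avg (fun _ => (49 * C^2 + 4 * k^2 * C^2) / l^2) l).
- apply (shell_avg_le R); auto; [intros; apply ct_const|]. intros y Hy.
  assert (Sy : S y) by (unfold ext; nra).
  assert (A := angular_energy_ge0 W y). unfold angular_energy in A. unfold virial_density.
  assert (D0 := dec0 y Sy). assert (D1 := fun i => dec1 y i Sy).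
  assert (E : C / sq org y <= C / l^2) by (apply Rmult_le_compat_l; auto; apply Rinv_le_contravar; lra).
  assert (xb : forall i, Rabs (coord y i) <= 2 * l).
  { assert (B : forall a, a^2 <= 4 * l^2 -> Rabs a <= 2 * l) by (intros a Ha; apply Rabs_le; split; nra).
    rewrite sqo in Hy.
    pose proof (pow2_ge_0 (px1 y)); pose proof (pow2_ge_0 (px2 y)); pose proof (pow2_ge_0 (px3 y)).
      intros [|[|i]]; cbn; apply B; lra. }
  assert (gx : forall i, Rabs (coord y i * D i W y) <= 2 * C / l).
  { intros i. rewrite Rabs_mult. replace (2 * C / l) with (2 * l * (C / l^2)) by (field; lra). specialize (D1 i).
    apply Rmult_le_compat; try apply Rabs_pos; auto; lra. }
  assert (Xb : Rabs (X y) <= 6 * C / l).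
  { unfold Xr. eapply Rle_trans; [apply Rabs_triang|]. eapply Rle_trans; [apply Rplus_le_compat_r, Rabs_triang|].
    assert (g0 := gx 0%nat). assert (g1 := gx 1%nat). assert (g2 := gx 2%nat). lra. }
  assert (Wb : Rabs (W y) <= C / l).
  { eapply Rle_trans; [exact D0|]. apply Rle_trans with (C / l^2); auto. apply Rmult_le_compat_l; auto.
    apply Rinv_le_contravar; nra. }
  assert (Wb2 : W y * W y <= (C / l^2)^2).
  { replace (W y * W y) with (Rabs (W y) ^ 2) by (rewrite pow2_abs; ring). apply pow_incr.
    split; [apply Rabs_pos|lra]. }
  assert (Y2 : (X y + 1 * W y) * (X y + 1 * W y) <= (7 * (C / l))^2).
  { replace ((X y + 1 * W y) * (X y + 1 * W y)) with (Rabs (X y + W y)^2) by (rewrite pow2_abs; ring).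
    apply pow_incr. split; [apply Rabs_pos|].
    eapply Rle_trans; [apply Rabs_triang|]. unfold Rdiv in *. lra. }
  replace ((49 * C^2 + 4 * k^2 * C^2) / l^2) with ((7 * (C / l))^2 + k^2 * (4 * l^2) * (C / l^2)^2) by (field; lra).
  assert (0 <= W y * W y) by apply Rle_0_sqr.
  assert ((k^2 * sq org y + 1 * (1 - 1)) * (W y * W y) <= k^2 * (4 * l^2) * (C / l^2)^2).
  { apply Rmult_le_compat; auto; pose proof (pow2_ge_0 k); pose proof (sq_ge0 org y).
    - assert (0 <= k^2 * sq org y) by (apply Rmult_le_pos; auto). lra.
    - assert (k^2 * sq org y <= k^2 * (4 * l^2)) by (apply Rmult_le_compat_l; lra). lra. }
  lra.
- unfold shell_avg. right. rewrite (I_ext _ (fun y => (49 * C^2 + 4 * k^2 * C^2) / l^2 * phi y)) by (intros; ring).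
  rewrite (I_scal _ _ phi_Cc). field. lra.
Qed.

Lemma avg_WW_bound l : R < l -> avg_WW l <= C^2 * int3 phi / l^2.
Proof.
intros H. assert (H' : 0 <= R < l) by lra. assert (L2 : 0 < l^2) by (apply pow_lt; lra).
apply Rle_trans with (shell_avg (fun _ => C^2 / l^2) l).
- apply (shell_avg_le R); auto; [intros; apply ct_const|]. intros y Hy.
  assert (Sy : S y) by (unfold ext; nra). assert (D0 := dec0 y Sy).
  assert (E : C / sq org y <= C / l^2) by (apply Rmult_le_compat_l; auto; apply Rinv_le_contravar; lra).
  assert (E2 : C / l^2 <= C / l) by (apply Rmult_le_compat_l; auto; apply Rinv_le_contravar; nra).
  replace (W y * W y) with (Rabs (W y) ^ 2) by (rewrite pow2_abs; ring).
    replace (C^2 / l^2) with ((C / l)^2) by (field; lra).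
  apply pow_incr. split; [apply Rabs_pos|lra].
- unfold shell_avg. right. rewrite (I_ext _ (fun y => C^2 / l^2 * phi y)) by (intros; ring).
  rewrite (I_scal _ _ phi_Cc). field. lra.
Qed.

Lemma to_zero (B v l0 : RR) : 0 <= B -> (forall l, l0 < l -> R < l -> v <= B / l^2) -> v <= 0.
Proof.
intros HB H. apply Rnot_lt_le; intros P.
pose (l := Rmax (Rmax (l0 + 1) (R + 1)) (B / v + 1)).
assert (L1 : l0 + 1 <= l) by (eapply Rle_trans; [apply Rmax_l|apply Rmax_l]).
  assert (L2 : R + 1 <= l) by (eapply Rle_trans; [apply Rmax_r|apply Rmax_l]).
assert (L3 : B / v + 1 <= l) by apply Rmax_r.
specialize (H l ltac:(lra) ltac:(lra)).
assert (l2 : 0 < l^2) by (apply pow_lt; lra).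
assert (v * l^2 <= B). { apply (Rmult_le_compat_r (l^2)) in H; [|lra].
  replace (B / l^2 * l^2) with B in H by (field; lra). exact H. }
assert (B <= v * (l - 1)). { replace B with (v * (B / v)) by (field; lra). apply Rmult_le_compat_l; lra. }
assert (l <= l^2) by nra. nra.
Qed.

Lemma phi_int : 0 <= int3 phi.
Proof. apply I_ge0; [exact phi_Cc|exact phi_ge0]. Qed.

(** For m = 1 and b = 0 the virial identity reduces to l F' = 2 times the average of the angular
    energy. So F is nondecreasing, while [F1_bound] makes it at most O(l^-2); it can never be
    positive. *)
Lemma F1_le0 l : R < l -> virial_energy 1 0 l <= 0.
Proof.
intros H. assert (K := phi_int). assert (c2 := pow2_ge_0 C). assert (k2 := pow2_ge_0 k).
apply (to_zero ((49 * C^2 + 4 * k^2 * C^2) * int3 phi) _ l).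
- apply Rmult_le_pos; auto. assert (0 <= k^2 * C^2) by (apply Rmult_le_pos; auto). lra.
- intros l' Hl' Hr. apply Rle_trans with (virial_energy 1 0 l'); [|now apply F1_bound].
  destruct (functional_choice (fun l d => R < l -> is_derive (virial_energy 1 0) l d /\ 0 <= d)) as [d Hd].
  { intros u. destruct (Rlt_dec R u) as [L|L]; [|exists 0; lra].
    destruct (virial_energy_derive 1 0 u L) as [d [D1 D2]]. exists d. intros _. split; auto.
    assert (Hu : 0 <= R < u) by lra.
    assert (E : shell_avg (fun y => 2 * (2 * 1 - 1) * ((X y + 1 * W y) * (X y + 1 * W y)) + 2 * k^2 * sq org y * (W
      y * W y)) u = shell_avg (fun y => 2 * virial_density k W 1 y + 2 * angular_energy W y) u).
    { apply (shell_avg_ext R); auto. intros y Sy. unfold virial_density, angular_energy. ring. }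
    rewrite E, (shell_avg_lin R _ _ 2 2 u (cf1 1) cang Hu) in D2. unfold virial_energy in D2 at 1.
    assert (0 <= shell_avg (angular_energy W) u). { apply I_ge0; [apply (shell_avg_Cc R (angular_energy W));
      auto|]. intros y. apply Rmult_le_pos; [apply phi_ge0|apply angular_energy_ge0]. }
    assert (Q : u * d = 2 * shell_avg (angular_energy W) u) by lra. apply Rmult_le_reg_l with u; lra. }
  apply (deriv_mono (virial_energy 1 0) d); auto; intros u Hu; apply Hd; lra.
Qed.

(** If the mass at l1 were positive, the energy for a large m would be positive at l1 and hence at
    all larger radii. Subtracting the nonpositive energy for m = 1 makes the average of W x . grad W
    positive far out, so the mass increases there, against its O(l^-2) bound. *)
Lemma avg_WW_zero l1 : R < l1 -> avg_WW l1 = 0.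
Proof.
intros H. apply NNPP; intros Nz. assert (N0 := avg_WW_ge0 l1 H). assert (P : 0 < avg_WW l1) by lra.
pose (Sg := shell_avg (angular_energy W) l1).
assert (S0 : 0 <= Sg). { apply I_ge0; [apply (shell_avg_Cc R (angular_energy W)); auto; lra|]. intros y.
  apply Rmult_le_pos; [apply phi_ge0|apply angular_energy_ge0]. }
(* Chosen so that m (m - 1) times the mass exceeds the angular energy at l1 together with the
   subtracted term k l1 times the mass. *)
destruct (INR_unbounded (Sg / avg_WW l1 + k * l1 + 2)) as [n Hn].
assert (Q0 : 0 <= Sg / avg_WW l1) by (apply Rmult_le_pos; auto; left; now apply Rinv_0_lt_compat).
assert (kl : 0 < k * l1) by (apply Rmult_lt_0_compat; lra).
set (m := INR n) in *. assert (Hm : 2 < m) by lra.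
assert (Hn1 : (1 <= n)%nat) by (apply INR_le; simpl; fold m; lra).
assert (E1 : 0 < virial_energy m k l1).
{ assert (Hl : 0 <= R < l1) by lra.
  assert (K : (m * (m - 1)) * avg_WW l1 + - 1 * Sg <= shell_avg (virial_density k W m) l1).
  { unfold Sg, avg_WW. rewrite <- (shell_avg_lin R _ _ (m * (m - 1)) (-1) l1 cWW cang Hl).
    apply (shell_avg_le R); auto.
    - intros y Sy. specialize (cWW y Sy). specialize (cang y Sy). apply ct_plus; apply ct_mult; auto; apply ct_const.
    - intros y Hy. unfold virial_density, angular_energy. assert (0 <= (X y + m * W y) * (X y + m * W y)) by apply
      Rle_0_sqr.
      assert (0 <= k^2 * sq org y * (W y * W y)) by (apply Rmult_le_pos; [apply Rmult_le_pos;
        [apply pow2_ge_0|apply sq_ge0]|apply Rle_0_sqr]). lra. }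
  unfold virial_energy. assert (m <= m * (m - 1)) by nra.
  assert ((Sg / avg_WW l1 + k * l1 + 2) * avg_WW l1 <= m * (m - 1) * avg_WW l1) by (apply Rmult_le_compat_r; lra).
  replace ((Sg / avg_WW l1 + k * l1 + 2) * avg_WW l1) with (Sg + k * l1 * avg_WW l1 + 2 * avg_WW l1) in H1 by
    (field; lra). lra. }
(* The coefficient of W^2 in the difference of the virial densities for m and for 1; the remaining
   term is 2 (m - 1) W x . grad W. *)
pose (c := m^2 - 1 + m * (m - 1)).
assert (Mpos : forall l, l1 < l -> c <= k * l -> 0 < avg_WX l).
{ intros l Hl Hc. assert (Hl' : 0 <= R < l) by lra.
  assert (E2 := virial_energy_forward n l1 l Hn1 ltac:(lra) E1). fold m in E2. assert (F := F1_le0 l ltac:(lra)).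
  assert (Z : shell_avg (virial_density k W m) l - shell_avg (virial_density k W 1) l = 2 * (m - 1) * avg_WX l + c *
    avg_WW l).
  { unfold avg_WX, avg_WW. rewrite <- (shell_avg_lin R _ _ (2 * (m - 1)) c l cWX cWW Hl').
    replace (shell_avg (virial_density k W m) l - shell_avg (virial_density k W 1) l) with (1 * shell_avg
      (virial_density k W m) l + -1 * shell_avg (virial_density k W 1) l) by ring.
    rewrite <- (shell_avg_lin R _ _ 1 (-1) l (cf1 m) (cf1 1) Hl'). apply (shell_avg_ext R); auto. intros y Sy.
      unfold virial_density, c. ring. }
  unfold virial_energy in E2, F. assert (Nl := avg_WW_ge0 l ltac:(lra)).
    assert (c * avg_WW l <= k * l * avg_WW l) by (apply Rmult_le_compat_r; auto). apply Rnot_le_lt; intros K. nra. }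
pose (L := Rmax (l1 + 1) (c / k)). assert (La : l1 + 1 <= L) by apply Rmax_l.
  assert (Lb : c / k <= L) by apply Rmax_r.
assert (Lc : forall l, L <= l -> c <= k * l). { intros l Hl. replace c with (k * (c / k)) by (field; lra).
  apply Rmult_le_compat_l; lra. }
assert (inc : forall a b, L <= a -> a < b -> avg_WW a < avg_WW b).
{ intros a b Ha Hb. apply (deriv_strict avg_WW (fun l => 2 * avg_WX l / l)); auto; intros x Hx.
  - apply avg_WW_derive; lra.
  - assert (0 < avg_WX x) by (apply Mpos; [lra|apply Lc; lra]). apply Rdiv_lt_0_compat; lra. }
assert (Z : avg_WW (L + 1) <= 0).
{ apply (to_zero (C^2 * int3 phi) _ (L + 1)); [apply Rmult_le_pos; [apply pow2_ge_0|apply phi_int]|]. intros l Hl Hr.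
  apply Rle_trans with (avg_WW l); [left; apply inc; lra|]. now apply avg_WW_bound. }
assert (I1 := inc L (L + 1) ltac:(lra) ltac:(lra)). assert (I2 := avg_WW_ge0 L ltac:(lra)). lra.
Qed.

Theorem kato_zero x : 4 * R^2 < sq org x -> W x = 0.
Proof.
intros H. pose (l := sqrt (sq org x) * (2/3)).
assert (l2 : l^2 = sq org x * (4/9)) by (unfold l; rewrite Rpow_mult_distr, pow2_sqrt by apply sq_ge0; field).
assert (Hl : R < l).
{ assert (0 <= l) by (unfold l; apply Rmult_le_pos; [apply sqrt_pos|lra]). nra. }
assert (Z := avg_WW_zero l Hl). apply NNPP; intros N.
assert (l0 : 0 < l) by lra.
assert (0 < avg_WW l); [|lra]. apply (I_gt0 (fun y => phi y * (W (vscale l y) * W (vscale l y))) (vscale (/ l) x)).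
- apply (shell_avg_Cc R (fun y => W y * W y)); auto; lra.
- intros y. apply Rmult_le_pos; [apply phi_ge0|apply Rle_0_sqr].
- replace (vscale l (vscale (/ l) x)) with x by (apply pt_eq; cbn; field; lra).
  apply Rmult_lt_0_compat; [|now apply Rsqr_pos_lt].
  unfold phi. rewrite sq_vscale.
  assert (Q : (/ l)^2 * sq org x = 9/4). { replace (sq org x) with (l^2 * (9/4)) by lra. field. lra. }
  rewrite Q. pose proof (tau1_neg (9/4) ltac:(lra)). lra.
Qed.
End Kato2.

Definition wronskian (a b : pt -> R) (da db : nat -> pt -> R) (i : nat) (y : pt) : R := a y * db i y - b y * da i y.

(** The divergence of a grad b - b grad a is a times the Laplacian of b minus b times that of a; f
    takes the place of the indicator function of a region and its gradient that of the boundary. *)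
Lemma green_flux S f p q a a1 a2 b b1 b2 : test S f p q -> C2on S a a1 a2 -> C2on S b b1 b2 ->
  int3 (fun y => (a y * lap b2 y - b y * lap a2 y) * f y) = - int3 (fun y => grad_dot (wronskian a b a1 b1) p y).
Proof.
intros T HA HB. assert (T' := T). destruct T' as [C [[L B] [m M]]].
assert (A0 : forall y, S y -> ct a y) by (intros y Sy; now destruct (HA y Sy)).
assert (A1 : forall i y, S y -> ct (a1 i) y) by (intros i y Sy; destruct (HA y Sy) as [_ H]; apply H).
assert (A2 : forall i y, S y -> ct (a2 i) y) by (intros i y Sy; destruct (HA y Sy) as [_ H]; apply H).
assert (B0 : forall y, S y -> ct b y) by (intros y Sy; now destruct (HB y Sy)).
assert (B1 : forall i y, S y -> ct (b1 i) y) by (intros i y Sy; destruct (HB y Sy) as [_ H]; apply H).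
assert (B2 : forall i y, S y -> ct (b2 i) y) by (intros i y Sy; destruct (HB y Sy) as [_ H]; apply H).
assert (V0 : forall i y, S y -> ct (wronskian a b a1 b1 i) y).
{ intros i y Sy. specialize (A0 y Sy). specialize (B0 y Sy). specialize (A1 i y Sy). specialize (B1 i y Sy).
  unfold wronskian. ctt. }
pose (v := fun i y => a y * b2 i y - b y * a2 i y).
assert (V1 : forall i y, S y -> ct (v i) y).
{ intros i y Sy. specialize (A0 y Sy). specialize (B0 y Sy). specialize (A2 i y Sy). specialize (B2 i y Sy).
  unfold v. ctt. }
assert (CV : forall i, Cc (fun y => v i y * f y)) by (intros i; apply (test_Cc0 S f p q); auto).
assert (CW : forall i, Cc (fun y => wronskian a b a1 b1 i y * p i y)) by (intros i; apply (test_Cc1 S f p q); auto).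
assert (K : forall i, int3 (fun y => v i y * f y) = - int3 (fun y => wronskian a b a1 b1 i y * p i y)).
{ intros i. assert (Z : int3 (fun y => v i y * f y + wronskian a b a1 b1 i y * p i y) = 0).
  { apply (I_pd i (fun y => wronskian a b a1 b1 i y * f y)).
    - apply (test_Cc0 S f p q); auto.
    - apply Cc_plus; auto.
    - intros y. destruct (margin_dead _ _ _ y M) as [Sy|D].
      + destruct (HA y Sy) as [_ H], (HB y Sy) as [_ H1], (C y Logic.I) as [_ H2].
        destruct (H i) as [p1 [p2 [p3 p4]]], (H1 i) as [q1 [q2 [q3 q4]]], (H2 i) as [r1 _].
        eapply pd_val; [|apply (pd_mult i (wronskian a b a1 b1 i) f y _ _ (pd_minus i _ _ y _ _ (pd_mult i a (b1 i)
          y _ _ p1 q3) (pd_mult i b (a1 i) y _ _ q1 p3)) r1)].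
        unfold wronskian, v. ring.
      + assert (Hm := proj1 M). destruct (dead_derivs _ _ _ _ _ C (proj1 M) D y (near_refl (m/2) y ltac:(lra)) i) as
        [E1 E2].
        rewrite E1, D by (apply near_refl, M). apply (pd_ext_near i (fun _ => 0) _ y _ m); [lra| |].
        * intros z Hz. rewrite D; [ring|]. exact Hz.
        * eapply pd_val; [|apply pd_const]. ring. }
  rewrite (I_plus _ _ (CV i) (CW i)) in Z. lra. }
rewrite (I_ext _ (fun y => v 0%nat y * f y + v 1%nat y * f y + v 2%nat y * f y)) by (intros; unfold lap, v; ring).
refine (eq_trans (I_plus _ _ (Cc_plus _ _ (CV 0%nat) (CV 1%nat)) (CV 2%nat)) _).
  rewrite (I_plus _ _ (CV 0%nat) (CV 1%nat)), !K.
rewrite (I_ext (fun y => grad_dot (wronskian a b a1 b1) p y) (fun y => wronskian a b a1 b1 0%nat y * p 0%nat y +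
  wronskian a b a1 b1 1%nat y * p 1%nat y + wronskian a b a1 b1 2%nat y * p 2%nat y)) by (intros; reflexivity).
rewrite (I_plus _ _ (Cc_plus _ _ (CW 0%nat) (CW 1%nat)) (CW 2%nat)), (I_plus _ _ (CW 0%nat) (CW 1%nat)). ring.
Qed.

(** * Radiating pairs: representation at infinity and decay *)
(** Times y, this is minus the gradient of the cutoff of radius rho at the origin. Integrating the
    weight against y . V is the flux of V through a sphere smeared over rho < |y| < 2 rho. *)
Definition shell_weight (rho : R) (y : pt) : R := - 2 * tau1 (sq org y / rho^2) / rho^2.

Lemma shell_weight_ge0 rho y : 0 < rho -> 0 <= shell_weight rho y.
Proof.
intros H. unfold shell_weight, Rdiv. assert (T := tau1_le0 (sq org y * / rho^2)). apply Rmult_le_pos; [lra|].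
  left; apply Rinv_0_lt_compat, pow_lt; auto.
Qed.

Lemma shell_weight_nz rho y : 0 < rho -> shell_weight rho y <> 0 -> rho^2 < sq org y < 4 * rho^2.
Proof.
intros H N. assert (D2 : 0 < rho^2) by (apply pow_lt; auto). apply NNPP; intros K. apply N. unfold shell_weight.
destruct (tau_div_0 rho (sq org y) H) as [-> _]; [lra|field; lra].
Qed.

Lemma shell_weight_ct rho y : 0 < rho -> ct (shell_weight rho) y.
Proof.
intros H. assert (D2 : 0 < rho^2) by (apply pow_lt; auto). unfold shell_weight.
apply (ct_comp (fun t => -2 * tau1 (t / rho^2) / rho^2) (sq org)); [apply ct_sq|].
apply (ex_derive_continuous (fun t => -2 * tau1 (t / rho^2) / rho^2)).
  assert (T := is_derive_tau1 (sq org y / rho^2)).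
auto_derive. repeat split; try lra. eexists; exact T.
Qed.

Lemma shell_weight_bsupp rho : 0 < rho -> bsupp (shell_weight rho) (2 * rho).
Proof.
intros H y Hy. apply (shell_weight_nz rho y H) in Hy. rewrite sqo in Hy.
assert (B : forall a, a^2 <= 4 * rho^2 -> Rabs a <= 2 * rho) by (intros a Ha; apply Rabs_le; split; nra).
pose proof (pow2_ge_0 (px1 y)); pose proof (pow2_ge_0 (px2 y)); pose proof (pow2_ge_0 (px3 y)).
  repeat split; apply B; lra.
Qed.

Lemma shell_weight_Cc rho : 0 < rho -> Cc (shell_weight rho).
Proof. intros H. split; [intros; now apply shell_weight_ct|]. eexists; now apply shell_weight_bsupp. Qed.

Lemma shell_weight_mass : exists C, 0 < C /\ forall rho, 0 < rho -> int3 (shell_weight rho) <= C * rho.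
Proof.
destruct tau_bounded as [M [HM TB]]. exists (128 * M). split; [lra|]. intros rho H.
assert (D2 : 0 < rho^2) by (apply pow_lt; auto).
eapply Rle_trans; [apply Rle_abs|]. replace (128 * M * rho) with (8 * (2 * rho)^3 * (2 * M / rho^2)) by (field; lra).
apply I_bound; [now apply shell_weight_Cc|now apply shell_weight_bsupp|lra|].
intros y. unfold shell_weight, Rdiv. rewrite !Rabs_mult, Rabs_inv, (Rabs_right (rho^2)) by lra.
apply Rmult_le_compat_r; [left; now apply Rinv_0_lt_compat|]. destruct (TB (sq org y * / rho^2)) as [T _].
  rewrite (Rabs_left (-2)) by lra. lra.
Qed.

Lemma grad_dot_cut rho (V : nat -> pt -> R) y : 0 < rho -> grad_dot V (cutp rho org) y = - (shell_weight rho y *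
  xdot V y).
Proof. intros H. unfold grad_dot, cutp, shell_weight, xdot, org; cbn [coord]. cbn. field. lra. Qed.

(* The Cc function [shell_weight * V] is meaningful even though V is only defined outside a ball. *)
Lemma shell_weight_prod_Cc R V rho : 0 <= R < rho -> (forall y,
  ext R y -> ct V y) -> Cc (fun y => shell_weight rho y * V y).
Proof.
intros H HV. apply (Cc_ext (fun y => V y * shell_weight rho y)); [intros; ring|].
destruct (ext_margin R rho H) as [A1 A2].
apply (Cc_margin (ext R) V (shell_weight rho) (2 * rho) (Rmin 1 ((rho^2 - R^2) / (6 * R + 4)))); auto.
- intros; apply shell_weight_ct; lra.
- apply shell_weight_bsupp; lra.
- split; auto. intros y Hy. apply A2. apply shell_weight_nz in Hy; lra.
Qed.

Lemma annulus_test R r1 r2 : 0 <= R < r1 -> r1 <= r2 -> test (ext R) (fun y => cut r2 org y - cut r1 org y)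
  (fun i y => cutp r2 org i y - cutp r1 org i y) (fun i y => cutq r2 org i y - cutq r1 org i y).
Proof.
intros H1 H2. split; [|split].
- intros y Hy. destruct (cut_C2 r1 org ltac:(lra) y Hy) as [a0 a1], (cut_C2 r2 org ltac:(lra) y Hy) as [b0 b1].
  split; [now apply ct_minus|].
  intros i. destruct (a1 i) as [p1 [p2 [p3 p4]]], (b1 i) as [q1 [q2 [q3 q4]]].
  refine (conj _ (conj _ (conj _ _))); try (now apply pd_minus); now apply ct_minus.
- exists (l1_norm org + 2 * r2). intros y Hy. destruct (Req_dec (cut r2 org y) 0) as [E|E]; [|apply cut_bsupp;
  auto; lra].
  apply (inbox_le (l1_norm org + 2 * r1)); [lra|]. apply cut_bsupp; [lra|]. intros E'. apply Hy. rewrite E, E'. ring.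
- destruct (ext_margin R r1 H1) as [A1 A2]. exists (Rmin 1 ((r1^2 - R^2) / (6 * R + 4))). split; auto. intros y Hy.
  apply A2.
  apply Rnot_lt_le; intros K. apply Hy. rewrite !cut_one; [ring|lra|lra|lra|nra].
Qed.

Section Radiating.
Variables (k R : R).
Hypothesis Hk : 0 < k.
Hypothesis HR : 0 < R.
Notation RR := Stdlib.Reals.Rdefinitions.R.

(* The Sommerfeld condition for a + i b, split into real and imaginary parts. *)
Definition radpair (a b : pt -> RR) : Prop := weak_helmholtz k (ext R) a /\ weak_helmholtz k (ext R) b /\
  forall eps, 0 < eps -> exists r1, forall x, ext r1 x -> Rabs (Xr a x + k * sqrt (sq org x) * b x) <= eps /\ Rabs
    (Xr b x - k * sqrt (sq org x) * a x) <= eps.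

Definition flux (rho : RR) (a b : pt -> RR) (da db : nat -> pt ->
  RR) : RR := int3 (fun y => shell_weight rho y * xdot (wronskian a b da db) y).

Lemma flux_diff a a1 a2 b b1 b2 r1 r2 : C2on (ext R) a a1 a2 -> C2on (ext R) b b1 b2 -> R < r1 -> r1 <= r2 ->
  int3 (fun y => (a y * lap b2 y - b y * lap a2 y) * (cut r2 org y - cut r1 org y)) = flux r2 a b a1 b1 - flux r1 a
    b a1 b1.
Proof.
intros HA HB H1 H2.
rewrite (green_flux (ext R) _ _ _ a a1 a2 b b1 b2 (annulus_test R r1 r2 ltac:(lra) H2) HA HB).
assert (V : forall y, ext R y -> ct (xdot (wronskian a b a1 b1)) y).
{ intros y Sy. apply ct_xdot. intros i. destruct (HA y Sy) as [c1 c2], (HB y Sy) as [c3 c4].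
  destruct (c2 i) as [_ [c5 _]], (c4 i) as [_ [c6 _]]. unfold wronskian. ctt. }
assert (C1 := shell_weight_prod_Cc R _ r1 ltac:(lra) V). assert (C2 := shell_weight_prod_Cc R _ r2 ltac:(lra) V).
unfold flux. rewrite <- (I_minus _ _ C2 C1).
rewrite (I_ext _ (fun y => -1 * (shell_weight r2 y * xdot (wronskian a b a1 b1) y - shell_weight r1 y * xdot
  (wronskian a b a1 b1) y))).
- rewrite (I_scal (-1) _ (Cc_minus _ _ C2 C1)). ring.
- intros y. assert (D1 := grad_dot_cut r1 (wronskian a b a1 b1) y ltac:(lra)).
  assert (D2 := grad_dot_cut r2 (wronskian a b a1 b1) y ltac:(lra)).
  unfold grad_dot in *. lra.
Qed.

Lemma C2_of a : weak_helmholtz k (ext R) a -> C2on (ext R) a (fun i => D i a) (fun i => D i (D i a)).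
Proof. apply weak_helmholtz_C2, ext_open. lra. Qed.

Lemma ext_le r1 r2 x : 0 <= r1 <= r2 -> ext r2 x -> ext r1 x.
Proof. unfold ext. intros; nra. Qed.

Lemma shell_weight_sqrt rho y : 0 < rho -> shell_weight rho y <> 0 -> rho < sqrt (sq org y) < 2 * rho.
Proof.
intros H N. apply shell_weight_nz in N; auto. split.
- rewrite <- (sqrt_pow2 rho) by lra. apply sqrt_lt_1_alt. nra.
- rewrite <- (sqrt_pow2 (2 * rho)) by lra. apply sqrt_lt_1_alt. pose proof (sq_ge0 org y). nra.
Qed.

(* Conservation of the energy flux bounds the L2 mass on shells. *)
Lemma shell_bound a b : radpair a b -> exists C r0, 0 < C /\ R < r0 /\ forall rho,
  r0 <= rho -> int3 (fun y => shell_weight rho y * (a y * a y + b y * b y)) <= C / rho.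
Proof.
intros [Ha [Hb Hr]]. destruct (Hr 1 Rlt_0_1) as [r1 H1]. destruct shell_weight_mass as [Cm [HCm WM]].
pose (r0 := Rmax (R + 1) (Rabs r1 + 1)). assert (A1 : R + 1 <= r0) by apply Rmax_l.
  assert (A2 : Rabs r1 + 1 <= r0) by apply Rmax_r.
assert (CA := C2_of a Ha). assert (CB := C2_of b Hb).
pose (J := flux r0 a b (fun i => D i a) (fun i => D i b)).
exists (2 / k * (Rabs J + Cm / k) + 1), r0.
assert (P1 : 0 <= Cm / k) by (left; apply Rdiv_lt_0_compat; lra). assert (Jp := Rabs_pos J).
assert (P2 : 0 < 2 / k) by (apply Rdiv_lt_0_compat; lra).
split; [assert (0 <= 2 / k * (Rabs J + Cm / k)) by (apply Rmult_le_pos; lra); lra|]. split; [lra|]. intros rho Hrho.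
assert (Hp : 0 < rho) by (pose proof (Rabs_pos r1); lra).
assert (Z := flux_diff a _ _ b _ _ r0 rho CA CB ltac:(lra) Hrho).
assert (Z0 : int3 (fun y => (a y * lap (fun i => D i (D i b)) y - b y * lap (fun i => D i (D i a)) y) * (cut rho org
  y - cut r0 org y)) = 0).
{ rewrite (I_ext _ (fun _ => 0)); [apply I_0|]. intros y. destruct (Rlt_le_dec (R^2) (sq org y)) as [Sy|Sy].
  - assert (E1 := weak_strong k (ext R) a (ext_open R ltac:(lra)) Ha y Sy).
    assert (E2 := weak_strong k (ext R) b (ext_open R ltac:(lra)) Hb y Sy).
    replace (lap (fun i => D i (D i a)) y) with (- (k^2 * a y)) by lra.
      replace (lap (fun i => D i (D i b)) y) with (- (k^2 * b y)) by lra. ring.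
  - rewrite !cut_one; [ring|lra|nra|lra|nra]. }
rewrite Z0 in Z. fold J in Z.
assert (ca : forall y, ext R y -> ct a y) by apply Ha. assert (cb : forall y, ext R y -> ct b y) by apply Hb.
assert (V : forall y, ext R y -> ct (xdot (wronskian a b (fun i => D i a) (fun i => D i b))) y).
{ intros y Sy. apply ct_xdot. intros i. destruct (CA y Sy) as [c1 c2], (CB y Sy) as [c3 c4].
  destruct (c2 i) as [_ [c5 _]], (c4 i) as [_ [c6 _]]. unfold wronskian. ctt. }
assert (ab : forall y, ext R y -> ct (fun y => a y * a y + b y * b y) y) by (intros y Sy; specialize (ca y Sy);
  specialize (cb y Sy); ctt).
assert (C1 := shell_weight_prod_Cc R _ rho ltac:(lra) V). assert (C2 := shell_weight_prod_Cc R _ rho ltac:(lra) ab).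
  assert (C3 := shell_weight_Cc rho Hp).
assert (B : int3 (fun y => (k * rho / 2) * (shell_weight rho y * (a y * a y + b y * b y))) <= int3 (fun y =>
  shell_weight rho y * xdot (wronskian a b (fun i => D i a) (fun i => D i b)) y + (/ (k * rho)) * shell_weight rho
  y)).
{ apply I_le; [now apply Cc_scal|apply Cc_plus; auto; now apply Cc_scal|]. intros y.
  destruct (Req_dec (shell_weight rho y) 0) as [E|E]; [rewrite E; lra|]. assert (W0 := shell_weight_ge0 rho y Hp).
    assert (SR := shell_weight_sqrt rho y Hp E).
  assert (Ey : ext r1 y). { apply shell_weight_nz in E; auto. unfold ext.
    assert (r1^2 = Rabs r1 ^2) by (rewrite pow2_abs; ring). pose proof (Rabs_pos r1). nra. }
  destruct (H1 y Ey) as [e1' e2']. set (r := sqrt (sq org y)) in *.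
  replace (k * rho / 2 * (shell_weight rho y * (a y * a y + b y * b y))) with (shell_weight rho y * (k * rho / 2 *
    (a y * a y + b y * b y))) by ring.
  replace (shell_weight rho y * xdot (wronskian a b (fun i => D i a) (fun i => D i b)) y + / (k * rho) *
    shell_weight rho y) with (shell_weight rho y * (xdot (wronskian a b (fun i => D i a) (fun i => D i b)) y + / (k
    * rho))) by ring.
  apply Rmult_le_compat_l; auto.
  assert (EX : xdot (wronskian a b (fun i => D i a) (fun i => D i b)) y = k * r * (a y * a y + b y * b y) + a y *
    (Xr b y - k * r * a y) - b y * (Xr a y + k * r * b y)).
  { unfold xdot, wronskian, Xr. cbn [coord]. ring. }
  rewrite EX. assert (kr : 0 < k * rho) by (apply Rmult_lt_0_compat; lra).
    assert (kr2 : k * rho <= k * r) by (apply Rmult_le_compat_l; lra).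
  (* Young's inequality: the error of the Sommerfeld condition, at most 1 after multiplication by r,
     is absorbed by half of the main term k r (a^2 + b^2), at a cost of order 1 / (k rho). *)
  assert (am : forall u v, Rabs v <= 1 -> - (k * rho / 2 * (u * u)) - / (2 * (k * rho)) <= u * v).
  { intros u v Hv. apply Rabs_le_between in Hv.
    assert (0 <= (k * rho * u + v)^2) by apply pow2_ge_0. assert (v^2 <= 1) by nra.
    apply Rmult_le_reg_l with (2 * (k * rho)); [lra|]. field_simplify; [|lra]. nra. }
  assert (m1 := am (a y) _ e2'). assert (m2 := am (- b y) _ e1').
  assert (/ (2 * (k * rho)) + / (2 * (k * rho)) = / (k * rho)) by (field; split; lra).
  assert (sa := Rle_0_sqr (a y)). assert (sb := Rle_0_sqr (b y)). unfold Rsqr in sa, sb.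
  assert (k * rho * (a y * a y + b y * b y) <= k * r * (a y * a y + b y * b y)) by (apply Rmult_le_compat_r; lra).
    lra. }
assert (ER := eq_trans (I_plus _ _ C1 (Cc_scal (/ (k * rho)) _ C3)) (f_equal (Rplus _) (I_scal (/ (k * rho)) _ C3))).
assert (B' : k * rho / 2 * int3 (fun y => shell_weight rho y * (a y * a y + b y * b y)) <= flux rho a b (fun i => D
  i a) (fun i => D i b) + / (k * rho) * int3 (shell_weight rho))
  by exact (Rle_trans _ _ _ (Req_le _ _ (eq_sym (I_scal (k * rho / 2) _ C2))) (Rle_trans _ _ _ B (Req_le _ _ ER))).
assert (Wm := WM rho Hp).
replace (flux rho a b (fun i => D i a) (fun i => D i b)) with J in B' by lra.
assert (kr : 0 < k * rho) by (apply Rmult_lt_0_compat; lra).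
assert (/ (k * rho) * int3 (shell_weight rho) <= Cm / k).
{ replace (Cm / k) with (/ (k * rho) * (Cm * rho)) by (field; split; lra). apply Rmult_le_compat_l; auto.
  left; now apply Rinv_0_lt_compat. }
assert (J <= Rabs J) by apply Rle_abs.
apply Rmult_le_reg_l with (k * rho / 2); [lra|].
replace (k * rho / 2 * ((2 / k * (Rabs J + Cm / k) + 1) / rho)) with (Rabs J + Cm / k + k / 2) by (field; split; lra).
lra.
Qed.
End Radiating.

Definition nrm (x : pt) : R := sqrt (sq org x).

Lemma nrm2 x : nrm x ^ 2 = sq org x.
Proof. unfold nrm. apply pow2_sqrt, sq_ge0. Qed.
Lemma nrm_ge0 x : 0 <= nrm x.
Proof. apply sqrt_pos. Qed.

Lemma dot_bound x y : Rabs (dot x y) <= nrm x * nrm y.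
Proof.
rewrite <- (Rabs_right (nrm x * nrm y)) by (apply Rle_ge, Rmult_le_pos; apply nrm_ge0).
apply Rsqr_le_abs_0. unfold Rsqr. replace (nrm x * nrm y * (nrm x * nrm y)) with (nrm x ^ 2 * nrm y ^ 2) by ring.
  rewrite !nrm2, !sqo. unfold dot.
pose proof (pow2_ge_0 (px1 x * px2 y - px2 x * px1 y)). pose proof (pow2_ge_0 (px1 x * px3 y - px3 x * px1 y)).
  pose proof (pow2_ge_0 (px2 x * px3 y - px3 x * px2 y)). lra.
Qed.

Lemma sq_expand x y : sq x y = sq org y - 2 * dot y x + sq org x.
Proof. rewrite !sqo. unfold sq, dot. ring. Qed.

Definition Xk (A B k e : R) (x y : pt) : R := xdot (Kg A B k e x) y.

(** The pair cos (k s) / s, sin (k s) / s satisfies the Sommerfeld condition with rate 1 / |y|,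
    uniformly in the regularisation e <= 1. *)
Lemma kernel_rad k e x y : 0 < k -> 0 < e <= 1 -> 2 * nrm x + 2 <= nrm y ->
  Rabs (Kf 1 0 k e x y) <= 2 / nrm y /\ Rabs (Kf 0 1 k e x y) <= 2 / nrm y /\
  Rabs (Xk 1 0 k e x y + k * nrm y * Kf 0 1 k e x y) <= (4 * k * (nrm x + 1)^2 + 16) / nrm y /\
  Rabs (Xk 0 1 k e x y - k * nrm y * Kf 1 0 k e x y) <= (4 * k * (nrm x + 1)^2 + 16) / nrm y.
Proof.
intros Hk He Hy. set (r := nrm y) in *. set (N := nrm x) in *. assert (N0 : 0 <= N) by apply nrm_ge0.
pose (s := sqrt (sq x y + e^2)). assert (e2 : 0 < e^2 <= 1) by nra.
assert (s2 : s^2 = sq x y + e^2) by (apply pow2_sqrt; pose proof (sq_ge0 x y); lra).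
assert (s0 : 0 <= s) by apply sqrt_pos.
pose (n := dot y x). assert (Hn : Rabs n <= r * N) by apply dot_bound. apply Rabs_le_between in Hn.
assert (E : sq x y = r^2 - 2 * n + N^2) by (unfold r, N, n; rewrite !nrm2; apply sq_expand).
assert (S1 : r - N <= s) by (apply Rnot_lt_le; intros K; assert (s * s < (r - N) * (r - N)) by nra; nra).
assert (S2 : s <= r + N + 1) by (apply Rnot_lt_le; intros K; assert ((r + N + 1) * (r + N + 1) < s * s) by nra; nra).
assert (sr : r / 2 <= s) by lra. assert (rp : 2 <= r) by lra.
assert (YX : xdot (fun i y => 2 * (coord y i - coord x i)) y = 2 * (r^2 - n)).
{ unfold r, n. rewrite nrm2, sqo. unfold xdot, dot. cbn [coord]. ring. }
assert (XK : forall A B, Xk A B k e x y = kap1 A B k (sq x y + e^2) * (2 * (r^2 - n))).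
{ intros A B. rewrite <- YX. unfold Xk, xdot, Kg. ring. }
assert (i1 : 0 < / s <= 2 / r).
{ split; [apply Rinv_0_lt_compat; lra|]. replace (2 / r) with (/ (r / 2)) by (field; lra).
  apply Rinv_le_contravar; lra. }
assert (c1 : Rabs (cos (k * s)) <= 1) by (apply Rabs_le, COS_bound).
  assert (c2 : Rabs (sin (k * s)) <= 1) by (apply Rabs_le, SIN_bound).
assert (KC : Kf 1 0 k e x y = cos (k * s) * / s) by (unfold Kf, kap, kP; fold s; field; lra).
assert (KS : Kf 0 1 k e x y = sin (k * s) * / s) by (unfold Kf, kap, kP; fold s; field; lra).
assert (X1 : Xk 1 0 k e x y = (- k * sin (k * s) * / s * / s - cos (k * s) * / s * / s * / s) * (r^2 - n)) by
  (rewrite XK; unfold kap1, kP, kQ; fold s; field; lra).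
assert (X2 : Xk 0 1 k e x y = (k * cos (k * s) * / s * / s - sin (k * s) * / s * / s * / s) * (r^2 - n)) by (rewrite
  XK; unfold kap1, kP, kQ; fold s; field; lra).
pose (al := (r * s - (r^2 - n)) * / s * / s). pose (be := (r^2 - n) * / s * / s * / s).
assert (bp : forall u v, Rabs u <= 1 -> Rabs v <= 2 / r -> Rabs (u * v) <= 2 / r).
{ intros u v Hu Hv. rewrite Rabs_mult. rewrite <- (Rmult_1_l (2 / r)). apply Rmult_le_compat; auto; apply Rabs_pos. }
assert (Ai : Rabs (/ s) <= 2 / r) by (rewrite Rabs_right; lra).
(* Both r s and y . (y - x) are of size r^2, but their difference is -(r - s)^2 / 2 + (N^2 + e^2) /
   2, which stays bounded because |r - s| <= N + 1. *)
assert (Bal : Rabs al <= 4 * (N + 1)^2 / r).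
{ assert (Q : r * s - (r^2 - n) = - (r - s)^2 / 2 + (N^2 + e^2) / 2) by lra.
  assert (Q2 : Rabs (r * s - (r^2 - n)) <= (N + 1)^2) by (rewrite Q; apply Rabs_le;
    assert (-(N+1) <= r - s <= N + 1) by lra; assert (0 <= (r - s)^2 <= (N+1)^2) by (split;
    [apply pow2_ge_0|apply pow_maj_Rabs, Rabs_le; lra]); pose proof (pow2_ge_0 N); lra).
  unfold al. rewrite !Rabs_mult. apply Rle_trans with ((N + 1)^2 * (2 / r) * (2 / r)).
  - apply Rmult_le_compat; auto; try apply Rabs_pos; [apply Rmult_le_pos; apply Rabs_pos|].
    apply Rmult_le_compat; auto; apply Rabs_pos.
  - replace ((N + 1)^2 * (2 / r) * (2 / r)) with (4 * (N + 1)^2 / r * / r) by (field; lra).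
    rewrite <- (Rmult_1_r (4 * (N + 1)^2 / r)) at 2. apply Rmult_le_compat_l; [|rewrite <- Rinv_1;
      apply Rinv_le_contravar; lra].
    apply Rmult_le_pos; [pose proof (pow2_ge_0 (N + 1)); lra|left; apply Rinv_0_lt_compat; lra]. }
assert (Bbe : Rabs be <= 16 / r).
{ assert (Q : Rabs (r^2 - n) <= 2 * r^2) by (apply Rabs_le; nra).
  unfold be. rewrite !Rabs_mult. apply Rle_trans with (2 * r^2 * (2 / r) * (2 / r) * (2 / r)); [|right; field; lra].
  repeat (apply Rmult_le_compat; auto; try apply Rabs_pos; try (repeat apply Rmult_le_pos; apply Rabs_pos)). }
assert (one : forall u v, Rabs u <= 1 -> Rabs (u * v) <= Rabs v).
{ intros u v Hu. rewrite Rabs_mult. rewrite <- (Rmult_1_l (Rabs v)) at 2.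
  apply Rmult_le_compat_r; auto; apply Rabs_pos. }
split; [rewrite KC; auto|split; [rewrite KS; auto|split]].
- rewrite X1, KS. replace ((- k * sin (k * s) * / s * / s - cos (k * s) * / s * / s * / s) * (r^2 - n) + k * r *
  (sin (k * s) * / s)) with
    (k * (sin (k * s) * al) + - (cos (k * s) * be)) by (unfold al, be; field; lra).
  eapply Rle_trans; [apply Rabs_triang|]. rewrite Rabs_Ropp, Rabs_mult, (Rabs_right k) by lra.
  assert (o1 := one _ al c2). assert (o2 := one _ be c1).
  replace ((4 * k * (N + 1)^2 + 16) / r) with (k * (4 * (N + 1)^2 / r) + 16 / r) by (field; lra).
  assert (k * Rabs (sin (k * s) * al) <= k * (4 * (N + 1)^2 / r)) by (apply Rmult_le_compat_l; lra). lra.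
- rewrite X2, KC. replace ((k * cos (k * s) * / s * / s - sin (k * s) * / s * / s * / s) * (r^2 - n) - k * r * (cos
  (k * s) * / s)) with
    (- (k * (cos (k * s) * al) + sin (k * s) * be)) by (unfold al, be; field; lra).
  rewrite Rabs_Ropp. eapply Rle_trans; [apply Rabs_triang|]. rewrite Rabs_mult, (Rabs_right k) by lra.
  assert (o1 := one _ al c1). assert (o2 := one _ be c2).
  replace ((4 * k * (N + 1)^2 + 16) / r) with (k * (4 * (N + 1)^2 / r) + 16 / r) by (field; lra).
  assert (k * Rabs (cos (k * s) * al) <= k * (4 * (N + 1)^2 / r)) by (apply Rmult_le_compat_l; lra). lra.
Qed.

Lemma I_comb2 a b s t : Cc a -> Cc b -> int3 (fun y => s * a y + t * b y) = s * int3 a + t * int3 b.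
Proof. intros Ha Hb. exact (I_lin a b s t Ha Hb). Qed.

Section Outer.
Variables (k R : R).
Hypothesis Hk : 0 < k.
Hypothesis HR : 0 < R.
Notation RR := Stdlib.Reals.Rdefinitions.R.

Lemma xdot_wronskian a b da db y : xdot (wronskian a b da db) y = a y * xdot db y - b y * xdot da y.
Proof. unfold xdot, wronskian. ring. Qed.

Lemma Xr_xdot a y : xdot (fun i => D i a) y = Xr a y.
Proof. unfold xdot, Xr. cbn [coord]. reflexivity. Qed.

Lemma C2K A B e x : e <> 0 -> C2on (ext R) (Kf A B k e x) (Kg A B k e x) (Kh A B k e x).
Proof. intros He. apply (C2on_sub all); [intros; exact Logic.I|]. now apply Kf_C2. Qed.

Lemma flux_Cc a da d2a b db d2b rho : C2on (ext R) a da d2a -> C2on (ext R) b db d2b -> R < rho ->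
  Cc (fun y => shell_weight rho y * xdot (wronskian a b da db) y).
Proof.
intros HA HB H. apply (shell_weight_prod_Cc R); [lra|]. intros y Sy. apply ct_xdot. intros i.
destruct (HA y Sy) as [c1 c2], (HB y Sy) as [c3 c4]. destruct (c2 i) as [_ [c5 _]], (c4 i) as [_ [c6 _]].
  unfold wronskian. ctt.
Qed.

(** The two fluxes only tend to zero in this combination: it is the real part of the flux between a
    + i b and e^(iks) / s. The remainders of the Sommerfeld condition are paired with O(1/r) kernels
    or, for those of the kernel, with the L^2 bound of [shell_bound]. *)
Lemma outer_small a b x : radpair k R a b -> forall eta, 0 < eta -> exists r1, R < r1 /\ forall rho e,
  r1 <= rho -> 0 < e <= 1 ->
  Rabs (flux rho a (Kf 1 0 k e x) (fun i => D i a) (Kg 1 0 k e x) - flux rho b (Kf 0 1 k e x) (fun i => D i b) (Kg 0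
    1 k e x)) <= eta.
Proof.
intros Hab eta Heta. assert (Hab' := Hab). destruct Hab' as [Ha [Hb Hr]].
destruct (shell_bound k R Hk HR a b Hab) as [C1 [r0 [HC1 [Hr0 SB]]]]. destruct shell_weight_mass as [Cm [HCm WM]].
pose (eps := eta / (8 * Cm)). assert (He : 0 < eps) by (apply Rdiv_lt_0_compat; lra).
destruct (Hr eps He) as [re Hre].
pose (N := nrm x). assert (N0 : 0 <= N) by apply nrm_ge0. pose (Kx := 4 * k * (N + 1)^2 + 16).
assert (HKx : 0 < Kx) by (unfold Kx; pose proof (pow2_ge_0 (N + 1)); nra).
pose (r1 := r0 + Rabs re + 2 * N + 3 + Kx * (C1 + 2 * Cm) / eta).
assert (P1 : 0 <= Kx * (C1 + 2 * Cm) / eta) by (unfold Rdiv; apply Rmult_le_pos; [apply Rmult_le_pos; lra|left;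
  now apply Rinv_0_lt_compat]).
assert (P2 := Rabs_pos re). exists r1. split; [unfold r1; lra|]. intros rho e Hrho He1.
assert (Hp : 0 < rho) by (unfold r1 in Hrho; lra). assert (ne : e <> 0) by lra.
assert (CA := C2_of k R HR a Ha). assert (CB := C2_of k R HR b Hb).
assert (D1 := flux_Cc _ _ _ _ _ _ rho CA (C2K 1 0 e x ne) ltac:(unfold r1 in Hrho; lra)).
assert (D2 := flux_Cc _ _ _ _ _ _ rho CB (C2K 0 1 e x ne) ltac:(unfold r1 in Hrho; lra)).
unfold flux. rewrite <- (I_minus _ _ D1 D2).
assert (ca : forall y, ext R y -> ct a y) by apply Ha. assert (cb : forall y, ext R y -> ct b y) by apply Hb.
assert (ab : forall y, ext R y -> ct (fun y => a y * a y + b y * b y) y) by (intros y Sy; specialize (ca y Sy);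
  specialize (cb y Sy); ctt).
assert (C2 := shell_weight_prod_Cc R _ rho ltac:(unfold r1 in Hrho; lra) ab). assert (C3 := shell_weight_Cc rho Hp).
pose (c1 := Kx / 2). pose (c2 := Kx / (rho * rho) + 4 * eps / rho).
apply Rle_trans with (int3 (fun y => c1 * (shell_weight rho y * (a y * a y + b y * b y)) + c2 * shell_weight rho y)).
- apply Rabs_I_le; [now apply Cc_minus|apply Cc_plus; now apply Cc_scal|]. intros y.
  rewrite <- Rmult_minus_distr_l, Rabs_mult.
  assert (W0 := shell_weight_ge0 rho y Hp). rewrite (Rabs_right (shell_weight rho y)) by lra.
  replace (c1 * (shell_weight rho y * (a y * a y + b y * b y)) + c2 * shell_weight rho y) with (shell_weight rho y *
    (c1 * (a y * a y + b y * b y) + c2)) by ring.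
  destruct (Req_dec (shell_weight rho y) 0) as [E|E]; [rewrite E; lra|]. apply Rmult_le_compat_l; auto.
  assert (SR := shell_weight_sqrt rho y Hp E). fold (nrm y) in SR.
  assert (Ey : ext re y). { apply shell_weight_nz in E; auto. unfold ext.
    assert (re^2 = Rabs re ^2) by (rewrite pow2_abs; ring). unfold r1 in Hrho. nra. }
  destruct (Hre y Ey) as [q1 q2]. fold (nrm y) in q1, q2.
  destruct (kernel_rad k e x y Hk He1) as [k1 [k2 [k3 k4]]]; [fold N; unfold r1 in Hrho; lra|]. fold N in k3, k4.
    fold Kx in k3, k4.
  rewrite !xdot_wronskian, !Xr_xdot. change (xdot (Kg 1 0 k e x) y) with (Xk 1 0 k e x y).
    change (xdot (Kg 0 1 k e x) y) with (Xk 0 1 k e x y).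
  set (r := nrm y) in *. set (cc := Kf 1 0 k e x y) in *. set (ss := Kf 0 1 k e x y) in *.
  (* The added products with k r cancel in pairs, so each summand contains a remainder of the
     Sommerfeld condition of one of the two pairs. *)
  replace (a y * Xk 1 0 k e x y - cc * Xr a y - (b y * Xk 0 1 k e x y - ss * Xr b y)) with
    (a y * (Xk 1 0 k e x y + k * r * ss) + - b y * (Xk 0 1 k e x y - k * r * cc) + - cc * (Xr a y + k * r * b y) +
      ss * (Xr b y - k * r * a y)) by ring.
  assert (ir : 0 < / r <= / rho) by (split; [apply Rinv_0_lt_compat; lra|apply Rinv_le_contravar; lra]).
  assert (am : forall u v, Rabs v <= Kx / r -> Rabs (u * v) <= c1 * (u * u) + Kx / (2 * (rho * rho))).
  { intros u v Hv. rewrite Rabs_mult. assert (V : Rabs v <= Kx * / rho) by (eapply Rle_trans; [exact Hv|];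
    apply Rmult_le_compat_l; lra).
    apply Rle_trans with (Rabs u * (Kx * / rho)); [apply Rmult_le_compat_l; [apply Rabs_pos|auto]|].
    assert (0 <= (Rabs u - / rho)^2) by apply pow2_ge_0. assert (Rabs u * Rabs u = u * u) by (rewrite <- Rabs_mult;
      apply Rabs_right, Rle_ge, Rle_0_sqr).
    replace (c1 * (u * u) + Kx / (2 * (rho * rho))) with (Kx * ((u * u + / rho * / rho) / 2)) by (unfold c1; field;
      lra).
    replace (Rabs u * (Kx * / rho)) with (Kx * (Rabs u * / rho)) by ring. apply Rmult_le_compat_l; [lra|]. nra. }
  assert (eb : forall u v, Rabs u <= 2 / r -> Rabs v <= eps -> Rabs (u * v) <= 2 * eps / rho).
  { intros u v Hu Hv. rewrite Rabs_mult. replace (2 * eps / rho) with (2 / rho * eps) by (field; lra).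
    apply Rmult_le_compat; try apply Rabs_pos; auto.
    eapply Rle_trans; [exact Hu|]. apply Rmult_le_compat_l; lra. }
  assert (b1 := am (a y) _ k3). assert (b2 := am (- b y) _ k4). rewrite <- (Rabs_Ropp cc) in k1.
    assert (b3 := eb _ _ k1 q1). assert (b4 := eb _ _ k2 q2).
  eapply Rle_trans; [apply Rabs_triang|]. eapply Rle_trans; [apply Rplus_le_compat_r, Rabs_triang|].
    eapply Rle_trans; [apply Rplus_le_compat_r, Rplus_le_compat_r, Rabs_triang|].
  replace (c1 * (a y * a y + b y * b y) + c2) with (c1 * (a y * a y) + Kx / (2 * (rho * rho)) + (c1 * (- b y * - b
    y) + Kx / (2 * (rho * rho))) + 2 * eps / rho + 2 * eps / rho) by (unfold c2; field; lra).
  lra.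
- rewrite (I_comb2 _ _ c1 c2 C2 C3).
  assert (B1 := SB rho ltac:(unfold r1 in Hrho; lra)). assert (B2 := WM rho Hp).
  assert (c1p : 0 <= c1) by (unfold c1; lra).
  assert (c2p : 0 <= c2) by (unfold c2; apply Rplus_le_le_0_compat; (apply Rmult_le_pos; [lra|left;
    apply Rinv_0_lt_compat]); nra).
  assert (Z1 : c1 * int3 (fun y => shell_weight rho y * (a y * a y + b y * b y)) <= c1 * (C1 / rho)) by (apply
    Rmult_le_compat_l; auto).
  assert (Z2 : c2 * int3 (shell_weight rho) <= c2 * (Cm * rho)) by (apply Rmult_le_compat_l; auto).
  assert (Z3 : c1 * (C1 / rho) + c2 * (Cm * rho) = Kx * (C1 + 2 * Cm) / rho / 2 + eta / 2).
  { unfold c1, c2, eps. field. split; lra. }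
  assert (Z4 : Kx * (C1 + 2 * Cm) / rho <= eta).
  { apply div_le_iff; auto. apply Rle_trans with (eta * (Kx * (C1 + 2 * Cm) / eta)); [right; field; lra|].
    apply Rmult_le_compat_l; [lra|]. unfold r1 in Hrho. lra. }
  lra.
Qed.

(** The commutator of the Laplacian with the cutoff of radius r2, applied to a: a volume density
    between the radii r2 and 2 r2 that takes the place of the two surface densities in Green's
    formula. *)
Definition source (r2 : RR) (a : pt -> RR) (y : pt) : RR := 2 * grad_dot (fun i => D i a) (cutp r2 org) y + a y *
  lap (cutq r2 org) y.

Lemma cutpq_dead r2 y : 0 < r2 -> sq org y <= r2^2 \/ 4 * r2^2 <= sq org y -> (forall i,
  cutp r2 org i y = 0) /\ forall i, cutq r2 org i y = 0.
Proof.
intros H K. destruct (tau_div_0 r2 (sq org y) H K) as [E1 [E2 _]]. unfold cutp, cutq. rewrite E1, E2.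
  split; intros i; field; lra.
Qed.

Lemma cut_margin r2 : R < r2 -> exists m, forall X : pt -> RR, (forall y,
  sq org y <= r2^2 -> X y = 0) -> margin (ext R) (nz X) m.
Proof.
intros H. destruct (ext_margin R r2 ltac:(lra)) as [A1 A2]. eexists. intros X HX. split; [exact A1|]. intros y Hy.
  apply A2.
apply Rnot_lt_le; intros K. apply Hy, HX. lra.
Qed.

Lemma cut_term_Cc r2 (V : pt -> RR) : R < r2 -> (forall y, ext R y -> ct V y) -> (forall i,
  Cc (fun y => V y * cutp r2 org i y)) /\ forall i, Cc (fun y => V y * cutq r2 org i y).
Proof.
intros H HV. destruct (cut_margin r2 H) as [m Hm]. assert (H0 : 0 < r2) by lra.
assert (CC := cut_C2 r2 org H0).
assert (BS : forall X : pt -> RR, (forall y, 4 * r2^2 <= sq org y -> X y = 0) -> bsupp X (l1_norm org + 2 * r2)).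
{ intros X HX y Hy. apply near_inbox, near_sq; [lra|]. apply Rnot_le_lt; intros K. apply Hy, HX. lra. }
split; intros i.
- apply (Cc_margin (ext R) V (cutp r2 org i) (l1_norm org + 2 * r2) m); auto.
  + intros y. destruct (CC y Logic.I) as [_ c]. apply c.
  + apply BS. intros y K. now apply cutpq_dead; [|right].
  + apply Hm. intros y K. now apply cutpq_dead; [|left].
- apply (Cc_margin (ext R) V (cutq r2 org i) (l1_norm org + 2 * r2) m); auto.
  + intros y. destruct (CC y Logic.I) as [_ c]. apply c.
  + apply BS. intros y K. now apply cutpq_dead; [|right].
  + apply Hm. intros y K. now apply cutpq_dead; [|left].
Qed.

Lemma source_Cc r2 a : R < r2 -> weak_helmholtz k (ext R) a -> Cc (source r2 a).
Proof.
intros H Ha. assert (CA := C2_of k R HR a Ha).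
destruct (cut_term_Cc r2 a H) as [_ Q]; [apply Ha|].
assert (P : forall i, Cc (fun y => D i a y * cutp r2 org i y)).
{ intros i. apply (cut_term_Cc r2 (D i a) H). intros y Sy. destruct (CA y Sy) as [_ c]. apply c. }
apply (Cc_ext (fun y => 2 * (D 0 a y * cutp r2 org 0 y) + 2 * (D 1 a y * cutp r2 org 1 y) + 2 * (D 2 a y * cutp r2
  org 2 y) + a y * cutq r2 org 0 y + a y * cutq r2 org 1 y + a y * cutq r2 org 2 y)).
- intros y. unfold source, grad_dot, lap. ring.
- repeat apply Cc_plus; try apply Cc_scal; auto.
Qed.

(** Integrating by parts once more removes the derivative from the kernel. Afterwards both the limit
    e = 0 and the far-field expansion are needed for the kernel itself only. *)
Lemma inner_term r2 a A B e x : R < r2 -> weak_helmholtz k (ext R) a -> e <> 0 ->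
  flux r2 a (Kf A B k e x) (fun i => D i a) (Kg A B k e x) = int3 (fun y => Kf A B k e x y * source r2 a y).
Proof.
intros H Ha ne. assert (CA := C2_of k R HR a Ha). assert (CK := C2K A B e x ne). assert (H0 : 0 < r2) by lra.
assert (ca : forall y, ext R y -> ct a y) by apply Ha.
assert (cD : forall i y, ext R y -> ct (D i a) y) by (intros i y Sy; destruct (CA y Sy) as [_ c]; apply c).
assert (kf : forall y, ct (Kf A B k e x) y) by (intros; now apply Kf_ct).
assert (kg : forall i y, ct (Kg A B k e x i) y) by (intros i y; destruct (Kf_ct A B k e x y ne) as [_ q]; apply q).
assert (Ta : forall i, Cc (fun y => a y * cutp r2 org i y * Kf A B k e x y)) by (intros i; apply Cc_mult_r; auto;
  apply (cut_term_Cc r2 a H ca)).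
assert (T1 : forall i, Cc (fun y => a y * cutp r2 org i y * Kg A B k e x i y)) by (intros i; apply Cc_mult_r; auto;
  apply (cut_term_Cc r2 a H ca)).
assert (T2 : forall i, Cc (fun y => D i a y * cutp r2 org i y * Kf A B k e x y)) by (intros i; apply Cc_mult_r;
  auto; apply (cut_term_Cc r2 (D i a) H (cD i))).
assert (T3 : forall i, Cc (fun y => a y * cutq r2 org i y * Kf A B k e x y)) by (intros i; apply Cc_mult_r; auto;
  apply (cut_term_Cc r2 a H ca)).
assert (Z : forall i, int3 (fun y => D i a y * cutp r2 org i y * Kf A B k e x y + a y * cutq r2 org i y * Kf A B k e
  x y + a y * cutp r2 org i y * Kg A B k e x i y) = 0).
{ intros i. apply (I_pd i (fun y => a y * cutp r2 org i y * Kf A B k e x y)); auto.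
  - apply Cc_plus; auto. apply Cc_plus; auto.
  - intros y. destruct (Rlt_le_dec (R^2) (sq org y)) as [Sy|Sy].
    + destruct (CA y Sy) as [_ c1]. destruct (cut_C2 r2 org H0 y Logic.I) as [_ c2]. destruct (CK y Sy) as [_ c3].
      destruct (c1 i) as [p1 _], (c2 i) as [_ [_ [p2 _]]], (c3 i) as [p3 _].
      eapply pd_val; [|exact (pd_mult i (fun y => a y * cutp r2 org i y) (Kf A B k e x) y _ _ (pd_mult i a (cutp r2
        org i) y _ _ p1 p2) p3)]. cbv beta. ring.
    + assert (P : 0 < r2^2 - sq org y) by nra.
      destruct (proj1 (ct_iff _ _) (ct_sq org y) _ P) as [d [Hd Nd]].
      assert (dz : forall z, near d y z -> sq org z <= r2^2) by (intros z Hz; specialize (Nd z Hz);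
        apply Rabs_lt_between in Nd; lra).
      apply (pd_ext_near i (fun _ => 0) _ y _ d Hd).
      * intros z Hz. destruct (cutpq_dead r2 z H0 (or_introl (dz z Hz))) as [-> _]. ring.
      * eapply pd_val; [|apply pd_const]. destruct (cutpq_dead r2 y H0 (or_introl (dz y (near_refl d y Hd)))) as [q1
        q2]. rewrite q1, q2. ring. }
assert (Z' : forall i, int3 (fun y => a y * cutp r2 org i y * Kg A B k e x i y) = - (int3 (fun y => D i a y * cutp
  r2 org i y * Kf A B k e x y) + int3 (fun y => a y * cutq r2 org i y * Kf A B k e x y))).
{ intros i. assert (Zi := Z i). rewrite (I_plus _ _ (Cc_plus _ _ (T2 i) (T3 i)) (T1 i)),
  (I_plus _ _ (T2 i) (T3 i)) in Zi. lra. }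
unfold flux.
rewrite (I_ext _ (fun y => (D 0 a y * cutp r2 org 0 y * Kf A B k e x y + D 1 a y * cutp r2 org 1 y * Kf A B k e x y
  + D 2 a y * cutp r2 org 2 y * Kf A B k e x y)
   - (a y * cutp r2 org 0 y * Kg A B k e x 0 y + a y * cutp r2 org 1 y * Kg A B k e x 1 y + a y * cutp r2 org 2 y *
     Kg A B k e x 2 y))).
2:{ intros y. transitivity (- grad_dot (wronskian a (Kf A B k e x) (fun i => D i a) (Kg A B k e x)) (cutp r2 org)
  y); [rewrite grad_dot_cut by auto; ring|unfold grad_dot, wronskian; ring]. }
rewrite (I_ext (fun y => Kf A B k e x y * source r2 a y) (fun y => 2 * (D 0 a y * cutp r2 org 0 y * Kf A B k e x y +
  D 1 a y * cutp r2 org 1 y * Kf A B k e x y + D 2 a y * cutp r2 org 2 y * Kf A B k e x y)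
   + 1 * (a y * cutq r2 org 0 y * Kf A B k e x y + a y * cutq r2 org 1 y * Kf A B k e x y + a y * cutq r2 org 2 y *
     Kf A B k e x y))).
2:{ intros y. unfold source, grad_dot, lap. ring. }
assert (S3 : forall f : nat -> pt -> RR, (forall i, Cc (f i)) ->
  int3 (fun y => f 0%nat y + f 1%nat y + f 2%nat y) = int3 (f 0%nat) + int3 (f 1%nat) + int3 (f 2%nat)).
{ intros f Hf. rewrite (I_plus _ _ (Cc_plus _ _ (Hf 0%nat) (Hf 1%nat)) (Hf 2%nat)),
  (I_plus _ _ (Hf 0%nat) (Hf 1%nat)). reflexivity. }
assert (CP : forall f : nat -> pt -> RR, (forall i, Cc (f i)) ->
  Cc (fun y => f 0%nat y + f 1%nat y + f 2%nat y)) by (intros f Hf; apply Cc_plus; auto; apply Cc_plus; auto).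
assert (L1 := I_minus _ _ (CP _ T2) (CP _ T1)). assert (L2 := I_lin _ _ 2 1 (CP _ T2) (CP _ T3)).
refine (eq_trans L1 (eq_trans _ (eq_sym L2))).
assert (s1 := S3 _ T1). assert (s2 := S3 _ T2). assert (s3 := S3 _ T3). assert (z0 := Z' 0%nat).
  assert (z1 := Z' 1%nat). assert (z2 := Z' 2%nat). cbv beta in *. lra.
Qed.
End Outer.

(** * Representation outside a ball and expansion along rays *)

Section Infinity.
Variables (k R : R).
Hypothesis Hk : 0 < k.
Hypothesis HR : 0 < R.
Notation RR := Stdlib.Reals.Rdefinitions.R.

Lemma outside_near r x : r^2 < sq org x -> exists d, 0 < d /\ forall y, near d x y -> r^2 < sq org y.
Proof.
intros H. assert (P : 0 < sq org x - r^2) by lra. destruct (proj1 (ct_iff _ _) (ct_sq org x) _ P) as [d [Hd Q]].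
exists d; split; auto. intros y Hy. specialize (Q y Hy). apply Rabs_lt_between in Q. lra.
Qed.

Lemma source_dead r2 a y : 0 < r2 -> 4 * r2^2 <= sq org y -> source r2 a y = 0.
Proof.
intros H K. destruct (cutpq_dead r2 y H (or_intror K)) as [E1 E2]. unfold source, grad_dot, lap. rewrite !E1, !E2.
  ring.
Qed.

Lemma flux_rep r2 rho a A B e x : R < r2 -> r2 <= rho -> weak_helmholtz k (ext R) a -> e <> 0 ->
  int3 (fun y => a y * (cut rho org y - cut r2 org y) * (4 * e^2 * kap2 A B k (sq x y + e^2))) =
  int3 (fun y => Kf A B k e x y * source r2 a y) - flux rho a (Kf A B k e x) (fun i => D i a) (Kg A B k e x).
Proof.
intros H1 H2 Ha ne. assert (Z := flux_diff R HR a _ _ _ _ _ r2 rho (C2_of k R HR a Ha) (C2K k R A B e x ne) H1 H2).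
rewrite (inner_term k R HR r2 a A B e x H1 Ha ne) in Z.
assert (T := annulus_test R r2 rho ltac:(lra) H2).
assert (CF : Cc (fun y => a y * (cut rho org y - cut r2 org y) * (4 * e^2 * kap2 A B k (sq x y + e^2)))).
{ apply Cc_mult_r; [apply (test_Cc0 _ _ _ _ a T), Ha|]. intros y.
  apply (ct_mult (fun _ => 4 * e^2)); [apply ct_const|now apply ct_kap2]. }
assert (E : forall y, (a y * lap (Kh A B k e x) y - Kf A B k e x y * lap (fun i => D i (D i a)) y) * (cut rho org y
  - cut r2 org y) =
   -1 * (a y * (cut rho org y - cut r2 org y) * (4 * e^2 * kap2 A B k (sq x y + e^2)))).
{ intros y. destruct (Rlt_le_dec (R^2) (sq org y)) as [Sy|Sy].
  - assert (E1 := weak_strong k (ext R) a (ext_open R ltac:(lra)) Ha y Sy). assert (E2 := Kf_lap A B k e x y ne).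
    replace (lap (fun i => D i (D i a)) y) with (- (k^2 * a y)) by lra.
      replace (lap (Kh A B k e x) y) with (- (4 * e^2 * kap2 A B k (sq x y + e^2)) - k^2 * Kf A B k e x y) by lra.
      ring.
  - rewrite !cut_one; [ring|lra|nra|lra|nra]. }
assert (Z2 := eq_trans (eq_sym (eq_trans (I_ext _ _ E) (I_scal (-1) _ CF))) Z). lra.
Qed.

(** Real part of the representation of a + i b by e^(iks) / s. The sine kernel contributes no point
    mass, and subtracting its formula for b is what makes the outer flux disappear. *)
Lemma repr_infinity r2 a b x : radpair k R a b -> R < r2 -> 4 * r2^2 < sq org x ->
  c0 * a x = int3 (fun y => Kf 1 0 k 0 x y * source r2 a y) - int3 (fun y => Kf 0 1 k 0 x y * source r2 b y).
Proof.
intros Hab H2 Hx. assert (Hab' := Hab). destruct Hab' as [Ha [Hb _]]. assert (r2p : 0 < r2) by lra.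
destruct (outside_near (2 * r2) x ltac:(lra)) as [d [Hd Nd]].
assert (dead : forall a y, near d x y -> source r2 a y = 0) by (intros a' y Hy; apply source_dead; auto;
  specialize (Nd y Hy); lra).
destruct (Kf_lim 1 0 k (source r2 a) x d (source_Cc k R HR r2 a H2 Ha) Hd (dead a)) as [F1 [C1 [HC1 L1]]].
destruct (Kf_lim 0 1 k (source r2 b) x d (source_Cc k R HR r2 b H2 Hb) Hd (dead b)) as [F2 [C2 [HC2 L2]]].
apply Rminus_diag_uniq, NNPP; intros N. assert (Np := Rabs_pos_lt _ N).
set (I1 := int3 (fun y => Kf 1 0 k 0 x y * source r2 a y)) in *.
  set (I2 := int3 (fun y => Kf 0 1 k 0 x y * source r2 b y)) in *.
(* Five errors of size eta add up: two from the point masses, one from the outer flux, two from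
   removing the regularisation. A sixth share leaves the contradiction. *)
pose (eta := Rabs (c0 * a x - (I1 - I2)) / 6). assert (He : 0 < eta) by (unfold eta; lra).
destruct (outer_small k R Hk HR a b x Hab eta He) as [r1 [Hr1 Ob]].
pose (rho := Rmax r1 (Rmax r2 (nrm x))). assert (h1 : r1 <= rho) by apply Rmax_l.
assert (h2 : r2 <= rho) by (eapply Rle_trans; [apply Rmax_l|apply Rmax_r]).
  assert (h3 : nrm x <= rho) by (eapply Rle_trans; [apply Rmax_r|apply Rmax_r]).
assert (T := annulus_test R r2 rho ltac:(lra) h2).
assert (om : cut rho org x - cut r2 org x = 1).
{ rewrite (cut_one rho), (cut_zero r2); try lra. rewrite <- nrm2. pose proof (nrm_ge0 x). nra. }
destruct (delta_lim 1 0 k _ x (test_Cc0 _ _ _ _ a T (proj1 Ha)) eta He) as [e1' [P1 D1]].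
destruct (delta_lim 0 1 k _ x (test_Cc0 _ _ _ _ b T (proj1 Hb)) eta He) as [e2' [P2 D2]].
pose (e := Rmin (Rmin (e1' / 2) (e2' / 2)) (Rmin 1 (Rmin (eta / (C1 + 1)) (eta / (C2 + 1))))).
assert (Q1 : 0 < eta / (C1 + 1)) by (apply Rdiv_lt_0_compat; lra).
  assert (Q2 : 0 < eta / (C2 + 1)) by (apply Rdiv_lt_0_compat; lra).
assert (Hee : 0 < e /\ e <= e1'/2 /\ e <= e2'/2 /\ e <= 1 /\ e <= eta / (C1 + 1) /\ e <= eta / (C2 + 1)).
{ unfold e. pose proof (Rmin_l (Rmin (e1' / 2) (e2' / 2)) (Rmin 1 (Rmin (eta / (C1 + 1)) (eta / (C2 + 1))))).
  pose proof (Rmin_r (Rmin (e1' / 2) (e2' / 2)) (Rmin 1 (Rmin (eta / (C1 + 1)) (eta / (C2 + 1))))).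
  pose proof (Rmin_l (e1' / 2) (e2' / 2)). pose proof (Rmin_r (e1' / 2) (e2' / 2)).
    pose proof (Rmin_l 1 (Rmin (eta / (C1 + 1)) (eta / (C2 + 1)))).
    pose proof (Rmin_r 1 (Rmin (eta / (C1 + 1)) (eta / (C2 + 1)))).
  pose proof (Rmin_l (eta / (C1 + 1)) (eta / (C2 + 1))). pose proof (Rmin_r (eta / (C1 + 1)) (eta / (C2 + 1))).
    split; [repeat apply Rmin_pos; lra|lra]. }
assert (ne : e <> 0) by lra.
specialize (D1 e ltac:(lra)). specialize (D2 e ltac:(lra)). specialize (Ob rho e h1 ltac:(lra)). specialize (L1 e).
  specialize (L2 e). fold I1 in L1. fold I2 in L2.
cbv beta in D1, D2. rewrite om in D1, D2.
assert (R1 := flux_rep r2 rho a 1 0 e x H2 h2 Ha ne). assert (R2 := flux_rep r2 rho b 0 1 e x H2 h2 Hb ne).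
assert (D1' := eq_ind _ (fun z => Rabs (z - c0 * 1 * (a x * 1)) <= eta) D1 _ R1).
  assert (D2' := eq_ind _ (fun z => Rabs (z - c0 * 0 * (b x * 1)) <= eta) D2 _ R2).
cbv beta in D1', D2'.
assert (small : forall C, 0 <= C -> e <= eta / (C + 1) -> C * e^2 <= eta).
{ intros C HC Q. assert (e^2 <= e) by (clear - Hee; nra). apply Rle_trans with (C * e);
  [now apply Rmult_le_compat_l|].
  apply Rle_trans with ((C + 1) * e); [nra|]. apply Rle_trans with ((C + 1) * (eta / (C + 1)));
    [apply Rmult_le_compat_l; lra|right; field; lra]. }
assert (s1 := small C1 HC1 ltac:(lra)). assert (s2 := small C2 HC2 ltac:(lra)).
apply Rabs_le_between in D1', D2', Ob, L1, L2.
assert (Rabs (c0 * a x - (I1 - I2)) <= 5 * eta) by (apply Rabs_le; lra). unfold eta in *. lra.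
Qed.

(** Multiplication of a + i b by -i. It yields every statement about the imaginary part from the one
    about the real part. *)
Lemma radpair_swap a b : radpair k R a b -> radpair k R b (fun y => - a y).
Proof.
intros [Ha [Hb H]]. split; [auto|split].
- assert (Q := weak_helmholtz_lin k (ext R) a a (-1) 0 Ha Ha).
  replace (fun y => - a y) with (fun y => -1 * a y + 0 * a y); auto.
  apply functional_extensionality; intros; ring.
- intros eps He. destruct (H eps He) as [r1 H1]. exists r1. intros x Hx. destruct (H1 x Hx) as [q1 q2].
  assert (E : Xr (fun y => - a y) x = - Xr a x). { unfold Xr, D. rewrite !Derive_opp. ring. }
  split.
  + replace (Xr b x + k * sqrt (sq org x) * - a x) with (Xr b x - k * sqrt (sq org x) * a x) by ring. exact q2.
  + rewrite E. replace (- Xr a x - k * sqrt (sq org x) * b x) with (- (Xr a x + k * sqrt (sq org x) * b x)) by ring.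
    now rewrite Rabs_Ropp.
Qed.

Lemma source_opp r2 a y : source r2 (fun y => - a y) y = - source r2 a y.
Proof. unfold source, grad_dot, D. rewrite !Derive_opp. ring. Qed.

Lemma cos_lip u v : Rabs (cos u - cos v) <= Rabs (u - v).
Proof.
destruct (MVT_gen cos v u (fun x => - sin x)) as [c [_ E]].
- intros; apply is_derive_cos.
- intros; apply continuity_cos.
- rewrite E, Rabs_mult, Rabs_Ropp. rewrite <- (Rmult_1_l (Rabs (u - v))) at 2.
  apply Rmult_le_compat_r; [apply Rabs_pos|]. apply Rabs_le, SIN_bound.
Qed.
Lemma sin_lip u v : Rabs (sin u - sin v) <= Rabs (u - v).
Proof.
destruct (MVT_gen sin v u cos) as [c [_ E]].
- intros; apply is_derive_sin.
- intros; apply continuity_sin.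
- rewrite E, Rabs_mult. rewrite <- (Rmult_1_l (Rabs (u - v))) at 2. apply Rmult_le_compat_r; [apply Rabs_pos|].
  apply Rabs_le, COS_bound.
Qed.

(** With q = |x - y| = r - xh . y + O(1/r), rotating by the phase k r leaves (r / q) cos (k (q - r))
    and its sine analogue, and r / q = 1 + O(1/r). The error depends on y only through the bound Y,
    and not on the direction. *)
Lemma kernel_far r Y xh y : sq org xh = 1 -> 0 <= Y -> nrm y <= Y -> 2 * Y + 1 <= r ->
  let x := vscale r xh in let q := sqrt (sq x y) in
  Rabs (r * (cos (k * r) * Kf 1 0 k 0 x y + sin (k * r) * Kf 0 1 k 0 x y) - cos (k * dot xh y)) <= (2 * Y + k * Y^2)
    / r /\
  Rabs (r * (sin (k * r) * Kf 1 0 k 0 x y - cos (k * r) * Kf 0 1 k 0 x y) - sin (k * dot xh y)) <= (2 * Y + k * Y^2)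
    / r.
Proof.
intros Hxh HY Hy Hr x q. pose (p := dot xh y). fold p.
assert (Hp : Rabs p <= Y).
{ eapply Rle_trans; [apply dot_bound|]. unfold nrm at 1. rewrite Hxh, sqrt_1, Rmult_1_l. exact Hy. }
assert (y2 : sq org y <= Y^2) by (rewrite <- nrm2; pose proof (nrm_ge0 y); nra).
assert (p2 : p^2 <= sq org y).
{ assert (Q := dot_bound xh y). unfold nrm at 1 in Q. rewrite Hxh, sqrt_1, Rmult_1_l in Q. fold p in Q.
  rewrite <- nrm2. rewrite <- (pow2_abs p). apply pow_incr. split; [apply Rabs_pos|auto]. }
apply Rabs_le_between in Hp.
assert (q2 : q^2 = (r - p)^2 + (sq org y - p^2)).
{ unfold q. rewrite pow2_sqrt by apply sq_ge0. rewrite sq_expand. unfold x. rewrite sq_vscale, Hxh.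
  replace (dot y (vscale r xh)) with (r * p) by (unfold p, dot; cbn; ring). ring. }
assert (q0 : 0 <= q) by apply sqrt_pos.
assert (ql : r - p <= q) by (apply Rnot_lt_le; intros K; nra).
assert (qp : r / 2 <= q) by lra.
assert (dq : Rabs (q - r + p) <= Y^2 / r).
{ rewrite Rabs_right by lra. apply Rmult_le_reg_r with r; [lra|]. unfold Rdiv.
  rewrite Rmult_assoc, Rinv_l, Rmult_1_r by lra.
  assert ((q - r + p) * (q + (r - p)) = sq org y - p^2) by (ring_simplify; lra).
    assert (0 <= p^2) by apply pow2_ge_0. nra. }
assert (rq : Rabs (r / q - 1) <= 2 * Y / r).
{ assert (qr : Rabs (r - q) <= Y).
  { apply Rabs_le. split; [|lra]. assert (q <= r + Y); [|lra]. apply Rnot_lt_le; intros K.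
    assert ((r + Y) * (r + Y) < q * q) by nra. nra. }
  replace (r / q - 1) with ((r - q) * / q) by (field; lra). rewrite Rabs_mult.
  assert (0 < / q <= 2 / r). { split; [apply Rinv_0_lt_compat; lra|].
    replace (2 / r) with (/ (r / 2)) by (field; lra). apply Rinv_le_contravar; lra. }
  rewrite (Rabs_right (/ q)) by lra. replace (2 * Y / r) with (Y * (2 / r)) by (field; lra).
    apply Rmult_le_compat; try apply Rabs_pos; lra. }
assert (SQ : sqrt (sq x y + 0^2) = q) by (unfold q; f_equal; ring).
assert (KC : Kf 1 0 k 0 x y = cos (k * q) / q) by (unfold Kf, kap, kP; rewrite SQ; field; lra).
assert (KS : Kf 0 1 k 0 x y = sin (k * q) / q) by (unfold Kf, kap, kP; rewrite SQ; field; lra).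
rewrite KC, KS.
replace (r * (cos (k * r) * (cos (k * q) / q) + sin (k * r) * (sin (k * q) / q))) with (r / q * cos (k * (q - r))).
2:{ replace (k * (q - r)) with (k * q - k * r) by ring. rewrite cos_minus. field. lra. }
replace (r * (sin (k * r) * (cos (k * q) / q) - cos (k * r) * (sin (k * q) / q))) with (r / q * - sin (k * (q - r))).
2:{ replace (k * (q - r)) with (k * q - k * r) by ring. rewrite sin_minus. field. lra. }
assert (kd : Rabs (k * (q - r) - - (k * p)) <= k * Y^2 / r).
{ replace (k * (q - r) - - (k * p)) with (k * (q - r + p)) by ring. rewrite Rabs_mult, (Rabs_right k) by lra.
  replace (k * Y^2 / r) with (k * (Y^2 / r)) by (field; lra). apply Rmult_le_compat_l; lra. }
replace ((2 * Y + k * Y ^ 2) / r) with (2 * Y / r + k * Y^2 / r) by (field; lra).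
split.
- replace (r / q * cos (k * (q - r)) - cos (k * p)) with ((r / q - 1) * cos (k * (q - r)) + (cos (k * (q - r)) - cos
  (k * p))) by ring.
  eapply Rle_trans; [apply Rabs_triang|]. apply Rplus_le_compat.
  + rewrite Rabs_mult. rewrite <- (Rmult_1_r (2 * Y / r)). apply Rmult_le_compat; try apply Rabs_pos; auto.
    apply Rabs_le, COS_bound.
  + rewrite <- (cos_neg (k * p)). eapply Rle_trans; [apply cos_lip|exact kd].
- replace (r / q * - sin (k * (q - r)) - sin (k * p)) with ((r / q - 1) * - sin (k * (q - r)) + - (sin (k * (q - r))
  - sin (- (k * p)))) by (rewrite sin_neg; ring).
  eapply Rle_trans; [apply Rabs_triang|]. apply Rplus_le_compat.
  + rewrite Rabs_mult, Rabs_Ropp. rewrite <- (Rmult_1_r (2 * Y / r)).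
    apply Rmult_le_compat; try apply Rabs_pos; auto. apply Rabs_le, SIN_bound.
  + rewrite Rabs_Ropp. eapply Rle_trans; [apply sin_lip|exact kd].
Qed.

(** A vanishing far field in its weakest form: along each ray, without a rate and without uniformity
    in the direction. *)
Definition rayzero (a b : pt -> RR) : Prop := forall xh, sq org xh = 1 -> forall eta, 0 < eta -> exists r0,
  forall r, r0 < r ->
  Rabs (r * a (vscale r xh)) <= eta /\ Rabs (r * b (vscale r xh)) <= eta.

Lemma source_supp r2 a y : 0 < r2 -> source r2 a y <> 0 -> nrm y <= 2 * r2.
Proof.
intros H N. unfold nrm. rewrite <- (sqrt_pow2 (2 * r2)) by lra. apply sqrt_le_1_alt. apply Rnot_lt_le; intros K.
  apply N, source_dead; lra.
Qed.

(** By [kernel_far] the rotated and rescaled field differs from an amplitude [Fa], constant along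
    the ray, by O(1/r) with a constant common to all directions. The qualitative hypothesis forces
    [Fa] = 0, and what remains is a uniform rate. *)
Lemma half_decay a b : radpair k R a b -> rayzero a b -> exists C r1, 0 <= C /\ R < r1 /\ forall xh r,
  sq org xh = 1 -> r1 < r ->
  Rabs (r * (cos (k * r) * (c0 * a (vscale r xh)) + sin (k * r) * (c0 * b (vscale r xh)))) <= C / r.
Proof.
intros Hab Hz. assert (Hab' := Hab). destruct Hab' as [Ha [Hb _]].
pose (r2 := R + 1). assert (H2 : R < r2) by (unfold r2; lra). assert (r2p : 0 < r2) by lra.
pose (Y := 2 * r2). assert (HY : 0 <= Y) by (unfold Y; lra).
assert (Ga := source_Cc k R HR r2 a H2 Ha). assert (Gb := source_Cc k R HR r2 b H2 Hb).
  assert (AGa := Cc_abs _ Ga). assert (AGb := Cc_abs _ Gb).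
pose (Kc := 2 * Y + k * Y^2). assert (HKc : 0 <= Kc) by (unfold Kc; assert (0 <= k * Y^2) by (apply Rmult_le_pos;
  [lra|apply pow2_ge_0]); lra).
pose (M := int3 (fun y => Rabs (source r2 a y)) + int3 (fun y => Rabs (source r2 b y))).
assert (HM : 0 <= M) by (apply Rplus_le_le_0_compat; apply I_ge0; auto; intros; apply Rabs_pos).
pose (r1 := 2 * Y + 1). exists (Kc * M), r1. split; [now apply Rmult_le_pos|]. split; [unfold r1, Y, r2; lra|].
intros xh r Hxh Hr0.
pose (U := fun r => r * (cos (k * r) * (c0 * a (vscale r xh)) + sin (k * r) * (c0 * b (vscale r xh)))). fold (U r).
pose (Fa := int3 (fun y => cos (k * dot xh y) * source r2 a y + sin (k * dot xh y) * source r2 b y)).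
assert (cd : forall y, ct (fun y => dot xh y) y) by (intros; unfold dot; ctt).
assert (cc : forall y, ct (fun y => cos (k * dot xh y)) y).
{ intros y. apply (ct_comp (fun t => cos (k * t)) (fun y => dot xh y)); auto.
  apply (ex_derive_continuous (fun t => cos (k * t))). auto_derive; auto. }
assert (cs : forall y, ct (fun y => sin (k * dot xh y)) y).
{ intros y. apply (ct_comp (fun t => sin (k * t)) (fun y => dot xh y)); auto.
  apply (ex_derive_continuous (fun t => sin (k * t))). auto_derive; auto. }
assert (CF : Cc (fun y => cos (k * dot xh y) * source r2 a y + sin (k * dot xh y) * source r2 b y)) by (apply
  Cc_plus; apply Cc_mult_l; auto).
assert (key : forall s, r1 < s -> Rabs (U s - Fa) <= Kc * M / s).
{ intros s Hs. pose (x := vscale s xh). assert (s0 : 0 < s) by (unfold r1 in Hs; lra).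
  assert (sx : 4 * r2^2 < sq org x). { unfold x. rewrite sq_vscale, Hxh, Rmult_1_r. unfold r1, Y in Hs. nra. }
  destruct (outside_near (2 * r2) x ltac:(lra)) as [d [Hd Nd]].
  assert (dead : forall a y, near d x y -> source r2 a y = 0) by (intros a' y Hy; apply source_dead; auto;
    specialize (Nd y Hy); lra).
  assert (F1 := proj1 (Kf_lim 1 0 k (source r2 a) x d Ga Hd (dead a)) 0).
    assert (F2 := proj1 (Kf_lim 0 1 k (source r2 a) x d Ga Hd (dead a)) 0).
  assert (F3 := proj1 (Kf_lim 1 0 k (source r2 b) x d Gb Hd (dead b)) 0).
    assert (F4 := proj1 (Kf_lim 0 1 k (source r2 b) x d Gb Hd (dead b)) 0).
  assert (Ea := repr_infinity r2 a b x Hab H2 sx). assert (Eb := repr_infinity r2 b _ x (radpair_swap a b Hab) H2 sx).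
  rewrite (I_ext (fun y => Kf 0 1 k 0 x y * source r2 (fun y0 => - a y0) y) (fun y => -1 * (Kf 0 1 k 0 x y * source
    r2 a y))) in Eb by (intros; rewrite source_opp; ring).
  rewrite (I_scal (-1) _ F2) in Eb.
  assert (UE : U s = int3 (fun y => (s * cos (k * s)) * (Kf 1 0 k 0 x y * source r2 a y) + (s * sin (k * s)) * (Kf 0
    1 k 0 x y * source r2 a y)
     + ((s * sin (k * s)) * (Kf 1 0 k 0 x y * source r2 b y) + - (s * cos (k * s)) * (Kf 0 1 k 0 x y * source r2 b
       y)))).
  { assert (L1 := I_lin _ _ (s * cos (k * s)) (s * sin (k * s)) F1 F2).
    assert (L2 := I_lin _ _ (s * sin (k * s)) (- (s * cos (k * s))) F3 F4).
    assert (L3 := I_plus _ _ (Cc_plus _ _ (Cc_scal (s * cos (k * s)) _ F1) (Cc_scal (s * sin (k * s)) _ F2))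
      (Cc_plus _ _ (Cc_scal (s * sin (k * s)) _ F3) (Cc_scal (- (s * cos (k * s))) _ F4))).
    refine (eq_trans _ (eq_sym (eq_trans L3 (f_equal2 Rplus L1 L2)))). unfold U. fold x. rewrite Ea, Eb. ring. }
  assert (CU : Cc (fun y => (s * cos (k * s)) * (Kf 1 0 k 0 x y * source r2 a y) + (s * sin (k * s)) * (Kf 0 1 k 0 x
    y * source r2 a y)
     + ((s * sin (k * s)) * (Kf 1 0 k 0 x y * source r2 b y) + - (s * cos (k * s)) * (Kf 0 1 k 0 x y * source r2 b
       y)))) by (repeat apply Cc_plus; apply Cc_scal; assumption).
  rewrite UE. unfold Fa. rewrite <- (I_minus _ _ CU CF).
  apply Rle_trans with (int3 (fun y => (Kc / s) * Rabs (source r2 a y) + (Kc / s) * Rabs (source r2 b y))).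
  - apply Rabs_I_le; [now apply Cc_minus|apply Cc_plus; now apply Cc_scal|]. intros y.
    destruct (classic (source r2 a y = 0 /\ source r2 b y = 0)) as [[z1 z2]|nzz].
    { rewrite z1, z2. rewrite !Rabs_R0. match goal with |- Rabs ?u <= _ => replace u with 0 by ring end.
      rewrite Rabs_R0. lra. }
    assert (Hy : nrm y <= Y). { unfold Y. destruct (Req_dec (source r2 a y) 0) as [z|z]; [|eapply source_supp;
      eauto]. destruct (Req_dec (source r2 b y) 0) as [z'|z']; [tauto|eapply source_supp; eauto]. }
    destruct (kernel_far s Y xh y Hxh HY Hy ltac:(unfold r1 in Hs; lra)) as [q1 q2]. fold x in q1, q2.
      fold Kc in q1, q2.
    match goal with |- Rabs ?u <= _ => replace u with
      ((s * (cos (k * s) * Kf 1 0 k 0 x y + sin (k * s) * Kf 0 1 k 0 x y) - cos (k * dot xh y)) * source r2 a y +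
       (s * (sin (k * s) * Kf 1 0 k 0 x y - cos (k * s) * Kf 0 1 k 0 x y) - sin (k * dot xh y)) * source r2 b y) by
         ring end.
    eapply Rle_trans; [apply Rabs_triang|]. rewrite !(Rabs_mult _ (source r2 _ y)).
    apply Rplus_le_compat; apply Rmult_le_compat_r; auto; apply Rabs_pos.
  - right. refine (eq_trans (I_lin _ _ (Kc / s) (Kc / s) AGa AGb) _). unfold M. field. lra. }
assert (F0 : Fa = 0).
{ apply NNPP; intros N. assert (Np := Rabs_pos_lt _ N). assert (c0p := c0_pos).
  pose (eta := Rabs Fa / (8 * c0)). assert (He : 0 < eta) by (apply Rdiv_lt_0_compat; lra).
  destruct (Hz xh Hxh eta He) as [r0 Hr].
  pose (s := Rabs r0 + r1 + 4 * Kc * M / Rabs Fa + 1). assert (P0 : 0 <= 4 * Kc * M / Rabs Fa).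
  { unfold Rdiv. apply Rmult_le_pos; [apply Rmult_le_pos; [lra|auto]|left; now apply Rinv_0_lt_compat]. }
  assert (r1p : 0 < r1) by (unfold r1; lra). pose proof (Rabs_pos r0). pose proof (Rle_abs r0).
  destruct (Hr s ltac:(unfold s; lra)) as [q1 q2]. assert (K := key s ltac:(unfold s; lra)).
  assert (s0 : 0 < s) by (unfold s; lra).
  assert (K2 : Kc * M / s <= Rabs Fa / 4).
  { apply div_le_iff; auto. apply Rle_trans with (Rabs Fa / 4 * (4 * Kc * M / Rabs Fa)); [right; field; lra|].
    apply Rmult_le_compat_l; [lra|unfold s; lra]. }
  assert (K3 : Rabs (U s) <= Rabs Fa / 4).
  { unfold U. replace (s * (cos (k * s) * (c0 * a (vscale s xh)) + sin (k * s) * (c0 * b (vscale s xh)))) with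
      (c0 * (cos (k * s) * (s * a (vscale s xh)) + sin (k * s) * (s * b (vscale s xh)))) by ring.
    rewrite Rabs_mult, (Rabs_right c0) by lra. apply Rle_trans with (c0 * (eta + eta)); [|right; unfold eta; field;
      lra].
    apply Rmult_le_compat_l; [lra|]. eapply Rle_trans; [apply Rabs_triang|].
      rewrite !(Rabs_mult (cos _)), !(Rabs_mult (sin _)).
    assert (c1 : Rabs (cos (k * s)) <= 1) by (apply Rabs_le, COS_bound).
      assert (c2 : Rabs (sin (k * s)) <= 1) by (apply Rabs_le, SIN_bound).
    apply Rplus_le_compat; rewrite <- (Rmult_1_l eta); apply Rmult_le_compat; try apply Rabs_pos; auto. }
  assert (Rabs Fa <= Rabs (U s) + Rabs (U s - Fa)).
  { rewrite <- (Rabs_Ropp (U s - Fa)). replace Fa with (U s + - (U s - Fa)) at 1 by ring. apply Rabs_triang. }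
  lra. }
assert (Q := key r Hr0). rewrite F0, Rminus_0_r in Q. exact Q.
Qed.

(** [half_decay] for the pair and for its multiple by -i bounds both components of the rotated
    field; rotating back by the phase k r bounds a and b. *)
Lemma decay a b : radpair k R a b -> rayzero a b -> exists C r1, 0 <= C /\ R < r1 /\ forall x,
  ext r1 x -> Rabs (a x) <= C / sq org x /\ Rabs (b x) <= C / sq org x.
Proof.
intros Hab Hz. destruct (half_decay a b Hab Hz) as [C1 [r1 [HC1 [Hr1 H1]]]].
assert (Hz' : rayzero b (fun y => - a y)).
{ intros xh Hxh eta He. destruct (Hz xh Hxh eta He) as [r0 Hr]. exists r0. intros r Hr'. destruct (Hr r Hr').
  split; auto. now rewrite Ropp_mult_distr_r_reverse, Rabs_Ropp. }
destruct (half_decay b _ (radpair_swap a b Hab) Hz') as [C2 [r2 [HC2 [Hr2 H2]]]].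
assert (c0p := c0_pos).
exists ((C1 + C2) / c0), (Rmax r1 r2). split; [apply Rmult_le_pos; [lra|left; now apply Rinv_0_lt_compat]|].
assert (M1 := Rmax_l r1 r2). assert (M2 := Rmax_r r1 r2). split; [lra|]. intros x Hx. unfold ext in Hx.
pose (r := nrm x). assert (rr : r^2 = sq org x) by apply nrm2.
assert (rl : Rmax r1 r2 < r). { unfold r, nrm. rewrite <- (sqrt_pow2 (Rmax r1 r2)) by lra. apply sqrt_lt_1_alt.
  split; [apply pow2_ge_0|auto]. }
pose (xh := vscale (/ r) x). assert (xr : vscale r xh = x) by (apply pt_eq; cbn; field; lra).
assert (Hxh : sq org xh = 1) by (unfold xh; rewrite sq_vscale, <- rr; field; lra).
assert (K1 := H1 xh r Hxh ltac:(lra)). assert (K2 := H2 xh r Hxh ltac:(lra)). rewrite xr in K1, K2.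
set (U := r * (cos (k * r) * (c0 * a x) + sin (k * r) * (c0 * b x))) in *.
  set (V := r * (cos (k * r) * (c0 * b x) + sin (k * r) * (c0 * - a x))) in *.
assert (cs := sin2_cos2 (k * r)). unfold Rsqr in cs.
assert (Ea : c0 * r * a x = cos (k * r) * U - sin (k * r) * V).
{ replace (cos (k * r) * U - sin (k * r) * V) with (c0 * r * a x * (sin (k * r) * sin (k * r) + cos (k * r) * cos (k
  * r))) by (unfold U, V; ring). rewrite cs; ring. }
assert (Eb : c0 * r * b x = sin (k * r) * U + cos (k * r) * V).
{ replace (sin (k * r) * U + cos (k * r) * V) with (c0 * r * b x * (sin (k * r) * sin (k * r) + cos (k * r) * cos (k
  * r))) by (unfold U, V; ring). rewrite cs; ring. }
assert (c1 : Rabs (cos (k * r)) <= 1) by (apply Rabs_le, COS_bound).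
  assert (c2 : Rabs (sin (k * r)) <= 1) by (apply Rabs_le, SIN_bound).
assert (fin : forall v t, c0 * r * v = t -> Rabs t <= C1 / r + C2 / r -> Rabs v <= (C1 + C2) / c0 / sq org x).
{ intros v t Et Bt. rewrite <- Et, !Rabs_mult, (Rabs_right c0), (Rabs_right r) in Bt by lra. rewrite <- rr.
  apply Rmult_le_reg_l with (c0 * r); [apply Rmult_lt_0_compat; lra|]. eapply Rle_trans; [exact Bt|]. right. field.
    lra. }
assert (one : forall u v C, Rabs u <= 1 -> Rabs v <= C -> Rabs (u * v) <= C).
{ intros u v C' Hu Hv. rewrite Rabs_mult. rewrite <- (Rmult_1_l C'). apply Rmult_le_compat; auto; apply Rabs_pos. }
split; [apply (fin _ _ Ea)|apply (fin _ _ Eb)].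
- unfold Rminus. eapply Rle_trans; [apply Rabs_triang|]. rewrite Rabs_Ropp. apply Rplus_le_compat; apply one; auto.
- eapply Rle_trans; [apply Rabs_triang|]. apply Rplus_le_compat; apply one; auto.
Qed.

Theorem rellich a b : radpair k R a b -> rayzero a b -> exists r, R < r /\ forall x, ext r x -> a x = 0 /\ b x = 0.
Proof.
intros Hab Hz. assert (Hab' := Hab). destruct Hab' as [Ha [Hb _]].
  destruct (decay a b Hab Hz) as [C [r1 [HC [Hr1 H]]]].
destruct (grad_est k) as [G [HG GE]].
(* With d = 1/13 the gradient estimate uses the unit cube. The 8 in Rs keeps such cubes outside the
   ball of radius r1 with comparable norms, and / k gives the condition k Rs >= 1 of the virial
   argument. *)
pose (d := 1 / 13). pose (Rs := r1 + 8 + / k). assert (ik : 0 < / k) by (now apply Rinv_0_lt_compat).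
pose (Cs := C + G / d * (4 * C)).
assert (Gd : 0 < G / d) by (apply Rdiv_lt_0_compat; unfold d; lra).
assert (HCs : 0 <= Cs) by (unfold Cs; assert (0 <= G / d * (4 * C)) by (apply Rmult_le_pos; lra); lra).
assert (nearb : forall x z, Rs^2 < sq org x -> near 1 x z -> r1^2 < sq org z /\ sq org x <= 4 * sq org z).
{ intros x z Hx Hz0. assert (S := sq_near _ _ _ Hz0).
  assert (E : sq org x <= 2 * sq org z + 2 * sq x z).
  { rewrite !sqo. unfold sq. pose proof (pow2_ge_0 (2 * px1 z - px1 x));
    pose proof (pow2_ge_0 (2 * px2 z - px2 x)); pose proof (pow2_ge_0 (2 * px3 z - px3 x)). nra. }
  assert (big : 64 + 2 * r1^2 <= Rs^2 + r1^2) by (unfold Rs; nra).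
  assert (r1 ^ 2 + 16 * r1 + 64 <= Rs^2) by (unfold Rs; nra).
  assert (E3 : r1^2 < sq org z).
  { apply Rnot_le_lt; intros K.
    assert (nz : nrm z <= r1). { unfold nrm. rewrite <- (sqrt_pow2 r1) by lra. now apply sqrt_le_1_alt. }
    assert (DB := dot_bound z (vsub x z)). assert (nv : nrm (vsub x z) <= 2).
    { unfold nrm. rewrite <- (sqrt_pow2 2) by lra. apply sqrt_le_1_alt.
      replace (sq org (vsub x z)) with (sq x z); [lra|]. unfold sq, org, vsub; cbn; ring. }
    assert (X : sq org x = sq org z + 2 * dot z (vsub x z) + sq x z) by (rewrite !sqo; unfold sq, dot, vsub; cbn;
      ring).
    apply Rabs_le_between in DB. assert (nrm z * nrm (vsub x z) <= r1 * 2) by (apply Rmult_le_compat; auto;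
      apply nrm_ge0). nra. }
  split; auto. pose proof (pow2_ge_0 r1). lra. }
assert (main : forall W, weak_helmholtz k (ext R) W -> (forall x,
  ext r1 x -> Rabs (W x) <= C / sq org x) -> forall x, 4 * Rs^2 < sq org x -> W x = 0).
{ intros W HW HB. assert (HW' : weak_helmholtz k (ext Rs) W).
  { apply (weak_helmholtz_sub k (ext R)); auto. intros y Hy. apply (ext_le R Rs); auto. unfold Rs; lra. }
  apply (kato_zero k Rs Cs W); auto.
  - unfold Rs; lra.
  - unfold Rs. assert (k * / k = 1) by (field; lra). nra.
  - intros x Hx. assert (Ex : ext r1 x) by (apply (ext_le r1 Rs); auto; unfold Rs; lra).
    eapply Rle_trans; [apply HB, Ex|].
    unfold ext in Hx. apply Rmult_le_compat_r; [left; apply Rinv_0_lt_compat; pose proof (pow2_ge_0 Rs); lra|].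
      unfold Cs. assert (0 <= G / d * (4 * C)) by (apply Rmult_le_pos; lra). lra.
  - intros x i Hx. unfold ext in Hx. assert (x0 : 0 < sq org x) by (pose proof (pow2_ge_0 Rs); lra).
    apply Rle_trans with (G / d * (4 * C / sq org x)).
    + apply (GE (ext R) W x d _ i HW); [unfold d; lra| |].
      * intros z Hz0. apply (ext_le R r1); [lra|]. apply (nearb x z); auto. eapply near_le; [|exact Hz0].
        unfold d; lra.
      * intros z Hz0. destruct (nearb x z Hx) as [q1 q2]; [eapply near_le; [|exact Hz0]; unfold d; lra|].
        eapply Rle_trans; [apply HB, q1|]. assert (0 < sq org z) by (pose proof (pow2_ge_0 r1); lra).
        apply Rmult_le_reg_r with (sq org z * sq org x); [now apply Rmult_lt_0_compat|].
        replace (C / sq org z * (sq org z * sq org x)) with (C * sq org x) by (field; lra).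
          replace (4 * C / sq org x * (sq org z * sq org x)) with (C * (4 * sq org z)) by (field; lra).
          apply Rmult_le_compat_l; auto.
    + replace (G / d * (4 * C / sq org x)) with (G / d * (4 * C) / sq org x) by (field; unfold d; lra).
      apply Rmult_le_compat_r; [left; now apply Rinv_0_lt_compat|]. unfold Cs; lra. }
exists (2 * Rs). split; [unfold Rs; lra|]. intros x Hx. unfold ext in Hx.
  split; [apply (main a Ha)|apply (main b Hb)]; try lra; intros y Hy; now apply H.
Qed.
End Infinity.

(** * Bounds on Dirichlet eigenfunctions *)
Lemma le_small a b z : (forall e, 0 < e -> a <= b + e * z) -> a <= b.
Proof.
intros H. apply Rnot_lt_le; intros N. pose proof (Rabs_pos z). pose proof (Rle_abs z).
specialize (H ((a - b) / (2 * (Rabs z + 1))) ltac:(apply Rdiv_lt_0_compat; lra)).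
assert ((a - b) / (2 * (Rabs z + 1)) * z <= (a - b) / (2 * (Rabs z + 1)) * (Rabs z + 1)) by (apply
  Rmult_le_compat_l; [left; apply Rdiv_lt_0_compat; lra|lra]).
replace ((a - b) / (2 * (Rabs z + 1)) * (Rabs z + 1)) with ((a - b) / 2) in * by (field; lra). lra.
Qed.

Lemma kernel_comm_bound A B k d : 0 < d -> exists C, 0 < C /\ forall e x y,
  Rabs (Kf A B k e x y * lap (cutq d x) y + 2 * grad_dot (cutp d x) (Kg A B k e x) y) <= C.
Proof.
intros Hd. destruct tau_bounded as [M [HM B1]]. assert (N := kN_ge0 A B).
assert (id : 0 < / d) by now apply Rinv_0_lt_compat. assert (d2 : 0 < d^2) by (apply pow_lt; lra).
assert (i2 : 0 < / d^2) by now apply Rinv_0_lt_compat. assert (i3 : 0 < / d^3) by (apply Rinv_0_lt_compat, pow_lt;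
  lra).
pose (K0 := kN A B * / d). pose (K1 := kN A B * (Rabs k / d^2 + / d^3)).
assert (k0 : 0 <= K0) by (apply Rmult_le_pos; lra).
assert (k1 : 0 <= K1). { apply Rmult_le_pos; auto. apply Rplus_le_le_0_compat; [|lra].
  apply Rmult_le_pos; [apply Rabs_pos|lra]. }
(* On the transition layer t <= 4, so that 6 |tau1| + 4 t |tau2| <= 22 M. The regularisation e
   enlarges the argument of the kernel and therefore does not enter the bound. *)
exists (K0 * (22 * M / d^2) + 2 * (16 * M * K1) + 1).
assert (q1 : 0 <= 22 * M / d^2) by (apply Rmult_le_pos; lra).
assert (Q0 : 0 <= K0 * (22 * M / d^2)) by (apply Rmult_le_pos; auto).
  assert (Q1 : 0 <= M * K1) by (apply Rmult_le_pos; lra).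
split; [lra|]. intros e x y. set (t := sq x y / d^2).
assert (Ed : grad_dot (cutp d x) (Kg A B k e x) y = 4 * (tau1 t * kap1 A B k (sq x y + e^2) * t)).
{ unfold grad_dot, cutp, Kg. fold t. replace (4 * (tau1 t * kap1 A B k (sq x y + e ^ 2) * t)) with (4 * tau1 t / d^2
  * kap1 A B k (sq x y + e^2) * sq x y) by (unfold t; field; lra). unfold sq at 5. cbn [coord]. field. lra. }
rewrite Ed, cut_lap. fold t.
destruct (Rle_lt_dec t 1) as [H1|H1]; [destruct (tau123_0 t) as [z1 [z2 _]]; [lra|]; rewrite z1, z2;
  match goal with |- Rabs ?u <= _ => replace u with 0 by (field; lra) end; rewrite Rabs_R0; lra|].
destruct (Rle_lt_dec 4 t) as [H4|H4]; [destruct (tau123_0 t) as [z1 [z2 _]]; [lra|]; rewrite z1, z2;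
  match goal with |- Rabs ?u <= _ => replace u with 0 by (field; lra) end; rewrite Rabs_R0; lra|].
assert (T : d^2 <= sq x y + e^2). { assert (sq x y = t * d^2) by (unfold t; field; lra). pose proof (pow2_ge_0 e).
  nra. }
assert (b0 := kap_bound A B k _ d Hd T). assert (b1 := kap1_bound A B k _ d Hd T). fold K0 in b0. fold K1 in b1.
  unfold Kf.
destruct (B1 t) as [t1 [t2 _]].
replace (6 * (tau1 t / d ^ 2) + 4 * sq x y * (tau2 t / d ^ 4)) with ((6 * tau1 t + 4 * t * tau2 t) * / d^2) by
  (unfold t; field; lra).
eapply Rle_trans; [apply Rabs_triang|]. apply Rle_trans with (K0 * (22 * M / d ^ 2) + 2 * (16 * M * K1)); [|lra].
  apply Rplus_le_compat.
- rewrite Rabs_mult. apply Rmult_le_compat; auto; try apply Rabs_pos.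
  rewrite Rabs_mult, (Rabs_right (/ d^2)) by lra. apply Rmult_le_compat_r; [lra|].
  eapply Rle_trans; [apply Rabs_triang|]. rewrite !Rabs_mult, (Rabs_right 6), (Rabs_right 4), (Rabs_right t) by lra.
  assert (t * Rabs (tau2 t) <= 4 * M) by (apply Rmult_le_compat; try lra; apply Rabs_pos). lra.
- rewrite !Rabs_mult, (Rabs_right 2), (Rabs_right 4), (Rabs_right t) by lra.
  assert (Rabs (tau1 t) * Rabs (kap1 A B k (sq x y + e ^ 2)) * t <= M * K1 * 4) by (apply Rmult_le_compat; try lra;
    [apply Rmult_le_pos; apply Rabs_pos|apply Rmult_le_compat; auto; apply Rabs_pos]). lra.
Qed.

(** A Dirichlet eigenfunction with eigenvalue k^2, encoded through its zero extension: the boundary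
    condition is continuity of the extension on R^3, which makes sense for any open set. *)
Definition mode (k : R) (O : pt -> Prop) (v : pt -> R) : Prop := weak_helmholtz k O v /\ Cc v /\ forall y,
  ~ O y -> v y = 0.

Lemma mode_lin k O v w a b : mode k O v -> mode k O w -> mode k O (fun y => a * v y + b * w y).
Proof.
intros [H1 [H2 H3]] [K1 [K2 K3]]. split; [now apply weak_helmholtz_lin|split; [apply Cc_plus; now apply Cc_scal|]].
intros y Hy. rewrite H3, K3 by auto. ring.
Qed.

Section Truncation.
Variables (k : R) (O : pt -> Prop) (v : pt -> R).
Hypothesis HO : open3 O.
Hypothesis Hv : mode k O v.
Notation RR := Stdlib.Reals.Rdefinitions.R.

Definition excess (e : RR) (y : pt) : RR := Rmax 0 (v y ^ 2 - e).
Definition excess1 (e : RR) (i : nat) (y : pt) : RR := 3 * excess e y ^ 2 * (2 * (v y * D i v y)).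
Definition excess2 (e : RR) (i : nat) (y : pt) : RR :=
  6 * excess e y * (2 * (v y * D i v y))^2 + 3 * excess e y ^ 2 * (2 * (D i v y ^ 2 + v y * D i (D i v) y)).

Lemma ct_excess e y : ct (excess e) y.
Proof.
apply (ct_comp (fun s => Rmax 0 s) (fun y => v y ^ 2 - e)); [|apply continuous_Rmax0].
apply ct_minus; [apply ct_pow, Hv|apply ct_const].
Qed.

(** Where v^2 < e the truncation is zero nearby; where v^2 >= e the point lies in O, and v is C^2
    there. The two cases overlap enough to cover R^3, so the boundary of O is never examined. *)
Lemma excess_C2 e : 0 < e -> C2on all (fun y => excess e y ^ 3) (excess1 e) (excess2 e).
Proof.
intros He y _. split; [apply ct_pow, ct_excess|]. intros i.
destruct (Rlt_le_dec (v y ^ 2) e) as [L|L].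
- assert (P : 0 < e - v y ^ 2) by lra. destruct (proj1 (ct_iff _ _) (ct_pow v 2 y (proj1 (proj1 (proj2 Hv)) y)) _ P)
  as [d [Hd N]].
  assert (Z : forall z, near d y z -> excess e z = 0). { intros z Hz. apply Rmax0_neg. specialize (N z Hz).
    apply Rabs_lt_between in N. lra. }
  assert (y0 := Z y (near_refl d y Hd)).
  assert (Z0 : forall z, near d y z -> 0 = excess e z ^ 3) by (intros z Hz; rewrite (Z z Hz); ring).
  assert (Z1 : forall z, near d y z -> 0 = excess1 e i z) by (intros z Hz; unfold excess1; rewrite (Z z Hz); ring).
  assert (Z2 : forall z, near d y z -> 0 = excess2 e i z) by (intros z Hz; unfold excess2; rewrite (Z z Hz); ring).
  refine (conj _ (conj _ (conj _ _))).
  + rewrite <- (Z1 y (near_refl d y Hd)). apply (pd_ext_near i (fun _ => 0) _ y 0 d Hd Z0), pd_const.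
  + apply (ct_ext_near (fun _ => 0) _ y d Hd Z1), ct_const.
  + rewrite <- (Z2 y (near_refl d y Hd)). apply (pd_ext_near i (fun _ => 0) _ y 0 d Hd Z1), pd_const.
  + apply (ct_ext_near (fun _ => 0) _ y d Hd Z2), ct_const.
- assert (Oy : O y). { apply NNPP; intros N. rewrite (proj2 (proj2 Hv) y N) in L. lra. }
  destruct (weak_helmholtz_C2 k O v HO (proj1 Hv) y Oy) as [c0' Hi]. destruct (Hi i) as [p1 [c1 [p2 c2]]].
  assert (pe : pd i (fun y => v y ^ 2 - e) y (2 * (v y * D i v y))).
  { apply (pd_ext i (fun y => v y * v y - e)); [intros; ring|].
    eapply pd_val; [|apply pd_minus; [apply pd_mult; eassumption|apply pd_const]]. ring. }
  assert (q3 : pd i (fun y => excess e y ^ 3) y (excess1 e i y)).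
  { eapply pd_val; [|exact (pd_comp i (fun s => Rmax 0 s ^ 3) _ y _ _ pe (is_derive_Rmax_pow 1 _))].
    unfold excess1, excess. simpl INR. ring. }
  assert (q2 : pd i (fun y => excess e y ^ 2) y (2 * excess e y * (2 * (v y * D i v y)))).
  { eapply pd_val; [|exact (pd_comp i (fun s => Rmax 0 s ^ 2) _ y _ _ pe (is_derive_Rmax_pow 0 _))]. unfold excess.
    simpl INR. ring. }
  assert (ce := ct_excess e y).
  refine (conj q3 (conj _ (conj _ _))).
  + unfold excess1. ctt.
  + eapply pd_val; [|apply (pd_mult i (fun y => 3 * excess e y ^ 2) (fun y => 2 * (v y * D i v y)));
    [apply pd_scal, q2|apply pd_scal, pd_mult; eassumption]]. unfold excess2. ring.
  + unfold excess2. ctt.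
Qed.

(** For w = v^2 - e > 0 the Laplacian of w^3 consists of nonnegative gradient terms and of -6 k^2
    w^2 v^2; writing v^2 = w + e separates -6 k^2 w^3 from an error with the factor e. This is where
    the wave number sqrt 6 k comes from. *)
Lemma excess_lap e y : 0 < e -> - (6 * k^2 * e) * excess e y ^ 2 <= lap (excess2 e) y + 6 * k^2 * excess e y ^ 3.
Proof.
intros He. destruct (Rle_lt_dec (v y ^ 2) e) as [L|L].
- assert (Z : excess e y = 0) by (apply Rmax0_neg; lra). unfold lap, excess2. rewrite Z. lra.
- assert (Oy : O y). { apply NNPP; intros N. rewrite (proj2 (proj2 Hv) y N) in L. lra. }
  assert (E := weak_strong k O v HO (proj1 Hv) y Oy). unfold lap in E.
  assert (Z : excess e y = v y ^ 2 - e) by (apply Rmax0_pos; lra). set (m := excess e y) in *.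
  assert (m0 : 0 < m) by lra.
  assert (lap (excess2 e) y = 24 * m * (v y)^2 * (D 0 v y ^ 2 + D 1 v y ^ 2 + D 2 v y ^ 2) + 6 * m^2 * (D 0 v y ^ 2
    + D 1 v y ^ 2 + D 2 v y ^ 2)
     + 6 * m^2 * v y * (D 0 (D 0 v) y + D 1 (D 1 v) y + D 2 (D 2 v) y)) by (unfold lap, excess2; fold m; ring).
  replace (D 0 (D 0 v) y + D 1 (D 1 v) y + D 2 (D 2 v) y) with (- (k^2 * v y)) in * by lra.
  assert (P : 0 <= D 0 v y ^ 2 + D 1 v y ^ 2 + D 2 v y ^ 2) by (pose proof (pow2_ge_0 (D 0 v y));
    pose proof (pow2_ge_0 (D 1 v y)); pose proof (pow2_ge_0 (D 2 v y)); lra).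
  assert (P1 : 0 <= 24 * m * (v y)^2 * (D 0 v y ^ 2 + D 1 v y ^ 2 + D 2 v y ^ 2)) by (apply Rmult_le_pos; auto;
    apply Rmult_le_pos; [lra|apply pow2_ge_0]).
  assert (P2 : 0 <= 6 * m^2 * (D 0 v y ^ 2 + D 1 v y ^ 2 + D 2 v y ^ 2)) by (apply Rmult_le_pos; auto;
    apply Rmult_le_pos; [lra|apply pow2_ge_0]).
  replace (6 * m^2 * v y * - (k^2 * v y)) with (- (6 * k^2 * m^2 * v y ^ 2)) in * by ring.
    replace (v y ^ 2) with (m + e) in * by lra.
  replace (6 * k ^ 2 * m ^ 2 * (m + e)) with (6 * k^2 * e * m^2 + 6 * k^2 * m^3) in * by ring. lra.
Qed.

Lemma excess_bounds e y : 0 < e -> 0 <= excess e y /\ excess e y <= v y ^ 2 /\ v y ^ 2 - excess e y <= e.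
Proof.
intros He. pose proof (pow2_ge_0 (v y)). unfold excess. destruct (Rle_lt_dec (v y ^ 2) e).
- rewrite Rmax0_neg by lra. lra.
- rewrite Rmax0_pos by lra. lra.
Qed.

Lemma Cc_vpow n : Cc (fun y => v y ^ (S n)).
Proof. apply (Cc_ext (fun y => v y * v y ^ n)); [intros; reflexivity|]. apply Cc_mult_r; [apply Hv|].
  intros; apply ct_pow, Hv. Qed.

Lemma Cc_excess e n : 0 < e -> Cc (fun y => excess e y ^ (S n)).
Proof.
intros He. split; [intros; apply ct_pow, ct_excess|]. destruct (proj1 (proj2 Hv)) as [_ [L HL]]. exists L.
  intros y Hy. apply HL. intros Z. apply Hy.
destruct (excess_bounds e y He) as [q1 [q2 _]]. rewrite Z in q2. replace (excess e y) with 0 by lra. simpl; ring.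
Qed.

(** Green's identity between the truncated cube and cutoff times kernel at wave number sqrt 6 k.
    Nonnegativity of that product allows the subsolution inequality to be integrated; the commutator
    term is at most C times the integral of v^6. *)
Lemma trunc_ineq d x e ep C : 0 < d -> 0 < e -> ep <> 0 -> 0 <= C ->
  (forall y, 0 <= cut d x y * Kf 1 0 (sqrt 6 * k) ep x y) ->
  (forall y, Rabs (Kf 1 0 (sqrt 6 * k) ep x y * lap (cutq d x) y + 2 * grad_dot (cutp d x) (Kg 1 0 (sqrt 6 * k) ep
    x) y) <= C) ->
  int3 (fun y => excess e y ^ 3 * (cut d x y * (4 * ep^2 * kap2 1 0 (sqrt 6 * k) (sq x y + ep^2)))) <=
  C * int3 (fun y => v y ^ 6) + e * int3 (fun y => 6 * k^2 * (v y ^ 4 * (cut d x y * Kf 1 0 (sqrt 6 * k) ep x y))).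
Proof.
intros Hd He ne HC Hpos HB. set (kk := sqrt 6 * k) in *. assert (k6 : kk^2 = 6 * k^2) by (unfold kk;
  rewrite Rpow_mult_distr, pow2_sqrt by lra; ring).
assert (T0 := cut_test all d x Hd (fun _ _ => Logic.I)). assert (K2 := Kf_C2 1 0 kk ep x ne).
assert (T := test_mult all _ _ _ _ _ _ T0 K2). assert (X2 := excess_C2 e He).
  assert (G := green all _ _ _ _ _ _ T X2).
assert (c3 := Cc_excess e 2 He).
assert (cK := fun y => proj1 (Kf_ct 1 0 kk ep x y ne)). assert (ccut := proj1 (cut_Cc d x Hd)).
assert (cphi : forall y, ct (fun y => cut d x y * Kf 1 0 kk ep x y) y) by (intros; apply ct_mult; auto).
assert (cG : forall y, ct (fun y => cut d x y * (4 * ep ^ 2 * kap2 1 0 kk (sq x y + ep ^ 2))) y) by (intros;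
  apply ct_mult; [auto|apply (ct_mult (fun _ => 4 * ep^2)); [apply ct_const|now apply ct_kap2]]).
assert (cH : forall y, ct (fun y => Kf 1 0 kk ep x y * lap (cutq d x) y + 2 * grad_dot (cutp d x) (Kg 1 0 kk ep x)
  y) y).
{ intros y. destruct (cut_C2 d x Hd y Logic.I) as [_ q]. destruct (Kf_ct 1 0 kk ep x y ne) as [_ q'].
  assert (ct (lap (cutq d x)) y) by (apply ct_lap; intros; apply q).
    assert (forall i, ct (cutp d x i) y) by (intros; apply q).
    assert (forall i, ct (Kg 1 0 kk ep x i) y) by (intros; apply q').
  unfold grad_dot. ctt; auto. }
assert (cL : forall y, ct (lap (excess2 e)) y) by (intros y; apply ct_lap; intros i; apply (X2 y Logic.I)).
pose (A1 := fun y => excess e y ^ 3 * (cut d x y * (4 * ep ^ 2 * kap2 1 0 kk (sq x y + ep ^ 2)))).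
pose (A2 := fun y => excess e y ^ 3 * (Kf 1 0 kk ep x y * lap (cutq d x) y + 2 * grad_dot (cutp d x) (Kg 1 0 kk ep
  x) y)).
pose (A4 := fun y => lap (excess2 e) y * (cut d x y * Kf 1 0 kk ep x y)).
pose (A5 := fun y => kk^2 * (excess e y ^ 3 * (cut d x y * Kf 1 0 kk ep x y))).
pose (A6 := fun y => 6 * k^2 * (v y ^ 4 * (cut d x y * Kf 1 0 kk ep x y))).
assert (C1 : Cc A1) by (apply Cc_mult_r; auto). assert (C2 : Cc A2) by (apply Cc_mult_r; auto).
assert (C4 : Cc A4) by (apply Cc_mult_l; [apply Cc_mult_r; [now apply cut_Cc|auto]|auto]).
assert (C5 : Cc A5) by (apply Cc_scal, Cc_mult_r; auto).
assert (C6 : Cc A6) by (apply Cc_scal, Cc_mult_r; [apply (Cc_vpow 3)|auto]).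
assert (E : int3 A4 = int3 (fun y => (A2 y - A1 y) - A5 y)).
{ refine (eq_trans (eq_sym G) _). apply I_ext. intros y. unfold A1, A2, A5. assert (Q := Kf_lap 1 0 kk ep x y ne).
  replace (4 * ep ^ 2 * kap2 1 0 kk (sq x y + ep ^ 2)) with (- (lap (Kh 1 0 kk ep x) y + kk^2 * Kf 1 0 kk ep x y))
    by lra. unfold lap, grad_dot. ring. }
assert (E' := eq_trans E (eq_trans (I_minus _ _ (Cc_minus _ _ C2 C1) C5) (f_equal (fun z => z - int3 A5) (I_minus _
  _ C2 C1)))). cbv beta in E'.
assert (B2 : int3 A2 <= C * int3 (fun y => v y ^ 6)).
{ eapply Rle_trans; [apply (I_le A2 (fun y => C * v y ^ 6)); [auto|apply Cc_scal, (Cc_vpow 5)|]|right;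
  apply I_scal, (Cc_vpow 5)].
  intros y. unfold A2. destruct (excess_bounds e y He) as [q1 [q2 _]]. specialize (HB y).
  assert (excess e y ^ 3 <= v y ^ 6) by (replace (v y ^ 6) with ((v y ^ 2)^3) by ring; apply pow_incr; lra).
  assert (0 <= excess e y ^ 3) by (apply pow_le; auto). apply Rabs_le_between in HB.
  apply Rle_trans with (excess e y ^ 3 * C); [apply Rmult_le_compat_l; lra|rewrite Rmult_comm;
    apply Rmult_le_compat_l; lra]. }
assert (B3 : - e * int3 A6 <= int3 A4 + int3 A5).
{ refine (Rle_trans _ _ _ (Req_le _ _ (eq_sym (I_scal (- e) A6 C6))) (Rle_trans _ _ _ (I_le _ _ (Cc_scal (- e) A6
  C6) (Cc_plus _ _ C4 C5) _) (Req_le _ _ (I_plus _ _ C4 C5)))).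
  intros y. unfold A4, A5, A6. rewrite k6. specialize (Hpos y). set (p := cut d x y * Kf 1 0 kk ep x y) in *.
  assert (Q := excess_lap e y He). destruct (excess_bounds e y He) as [q1 [q2 _]].
  assert (m2 : excess e y ^ 2 <= v y ^ 4) by (replace (v y ^ 4) with ((v y ^ 2)^2) by ring; apply pow_incr; lra).
  assert (k0 : 0 <= 6 * k^2 * e) by (apply Rmult_le_pos; [pose proof (pow2_ge_0 k)|]; lra).
  assert (Q2 : - (6 * k^2 * e) * v y ^ 4 <= lap (excess2 e) y + 6 * k^2 * excess e y ^ 3) by nra.
  assert (Q3 := Rmult_le_compat_r p _ _ Hpos Q2). lra. }
change (int3 A1 <= C * int3 (fun y => v y ^ 6) + e * int3 A6). lra.
Qed.

(** As e tends to zero the truncated cube tends to v^6 at the rate 3 e v^4, from t^3 - m^3 = (t -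
    m)(t^2 + t m + m^2). The regularisation ep of the kernel stays fixed here. *)
Lemma trunc_limit d x ep C : 0 < d -> ep <> 0 -> 0 <= C ->
  (forall y, 0 <= cut d x y * Kf 1 0 (sqrt 6 * k) ep x y) ->
  (forall y, Rabs (Kf 1 0 (sqrt 6 * k) ep x y * lap (cutq d x) y + 2 * grad_dot (cutp d x) (Kg 1 0 (sqrt 6 * k) ep
    x) y) <= C) ->
  int3 (fun y => v y ^ 6 * cut d x y * (4 * ep^2 * kap2 1 0 (sqrt 6 * k) (sq x y + ep^2))) <= C * int3 (fun y => v y
    ^ 6).
Proof.
intros Hd ne HC Hpos HB. set (kk := sqrt 6 * k) in *.
assert (ccut := proj1 (cut_Cc d x Hd)).
assert (cG : forall y, ct (fun y => cut d x y * (4 * ep ^ 2 * kap2 1 0 kk (sq x y + ep ^ 2))) y) by (intros;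
  apply ct_mult; [auto|apply (ct_mult (fun _ => 4 * ep^2)); [apply ct_const|now apply ct_kap2]]).
set (g := fun y => cut d x y * (4 * ep ^ 2 * kap2 1 0 kk (sq x y + ep ^ 2))) in *.
rewrite (I_ext _ (fun y => v y ^ 6 * g y)) by (intros; unfold g; ring).
pose (Z := fun y => 3 * (v y ^ 4 * Rabs (g y))).
assert (CZ : Cc Z) by (apply Cc_scal, Cc_mult_r; [apply (Cc_vpow 3)|intros; apply ct_abs; auto]).
apply (le_small _ _ (int3 (fun y => 6 * k^2 * (v y ^ 4 * (cut d x y * Kf 1 0 kk ep x y))) + int3 Z)). intros e He.
assert (T := trunc_ineq d x e ep C Hd He ne HC Hpos HB). fold kk in T.
  change (int3 (fun y => excess e y ^ 3 * g y) <= C * int3 (fun y => v y ^ 6) + e * int3 (fun y => 6 * k^2 * (v y ^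
  4 * (cut d x y * Kf 1 0 kk ep x y)))) in T.
assert (C1 : Cc (fun y => excess e y ^ 3 * g y)) by (apply Cc_mult_r; [now apply (Cc_excess e 2)|auto]).
assert (C0 : Cc (fun y => v y ^ 6 * g y)) by (apply Cc_mult_r; [apply (Cc_vpow 5)|auto]).
assert (S1 : int3 (fun y => v y ^ 6 * g y) <= int3 (fun y => excess e y ^ 3 * g y) + e * int3 Z).
{ refine (Rle_trans _ _ _ (I_le _ (fun y => excess e y ^ 3 * g y + e * Z y) C0 (Cc_plus _ _ C1 (Cc_scal e _ CZ)) _)
  (Req_le _ _ (eq_trans (I_plus _ _ C1 (Cc_scal e _ CZ)) (f_equal (fun z => _ + z) (I_scal e _ CZ))))).
  intros y. unfold Z. destruct (excess_bounds e y He) as [q1 [q2 q3]].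
  assert (b : 0 <= v y ^ 6 - excess e y ^ 3 <= e * (3 * v y ^ 4)).
  { replace (v y ^ 6) with ((v y ^ 2)^3) by ring. replace (v y ^ 4) with ((v y^2)^2) by ring.
    set (t := v y ^ 2) in *. set (m := excess e y) in *.
    replace (t^3 - m^3) with ((t - m) * (t^2 + t * m + m^2)) by ring.
      assert (0 <= t^2 + t * m + m^2 <= 3 * t^2) by (clear - q1 q2; nra).
    split; [apply Rmult_le_pos; lra|apply Rmult_le_compat; lra]. }
  assert ((v y ^ 6 - excess e y ^ 3) * g y <= e * (3 * v y ^ 4) * Rabs (g y)).
  { eapply Rle_trans; [apply Rmult_le_compat_l; [apply b|apply Rle_abs]|].
    apply Rmult_le_compat_r; [apply Rabs_pos|apply b]. }
  lra. }
lra.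
Qed.
End Truncation.

Lemma sixth_power_bound k : 0 < k -> exists C, 0 < C /\ forall O v, open3 O -> mode k O v -> forall x,
  c0 * v x ^ 6 <= C * int3 (fun y => v y ^ 6).
Proof.
intros Hk. pose (kk := sqrt 6 * k). assert (s6 : 0 < sqrt 6) by (apply sqrt_lt_R0; lra).
  assert (kk0 : 0 < kk) by (apply Rmult_lt_0_compat; lra).
(* Within distance 2 d of x, and with regularisation at most d, the argument of the cosine is at
   most 3 d kk = 1 < PI / 2; hence the kernel is nonnegative on the support of the cutoff. *)
pose (d := / (3 * kk)). assert (Hd : 0 < d) by (apply Rinv_0_lt_compat; lra).
destruct (kernel_comm_bound 1 0 kk d Hd) as [C [HC HB]]. exists C. split; auto. intros O v HO Hv x.
apply (le_small _ _ 1). intros eta He.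
assert (cF : Cc (fun y => v y ^ 6 * cut d x y)) by (apply Cc_mult_r; [apply (Cc_vpow k O v Hv 5)|apply cut_Cc, Hd]).
destruct (delta_lim 1 0 kk _ x cF eta He) as [e0 [He0 DL]].
pose (e := Rmin (e0 / 2) d). assert (e1 := Rmin_l (e0/2) d). assert (e2 := Rmin_r (e0/2) d). fold e in e1, e2.
assert (e3 : 0 < e) by (unfold e; apply Rmin_pos; lra).
specialize (DL e ltac:(lra)). cbv beta in DL. rewrite (cut_one d x x Hd) in DL by (unfold sq; nra).
assert (T := trunc_limit k O v HO Hv d x e C Hd ltac:(lra) ltac:(lra)). fold kk in T.
assert (T' : int3 (fun y => v y ^ 6 * cut d x y * (4 * e ^ 2 * kap2 1 0 kk (sq x y + e ^ 2))) <= C * int3 (fun y =>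
  v y ^ 6)).
{ apply T; auto. intros y. destruct (Rle_lt_dec (4 * d^2) (sq x y)) as [L|L]; [rewrite cut_zero by auto; lra|].
  apply Rmult_le_pos; [apply tau_bounds|]. unfold Kf, kap, kP.
  assert (0 < sq x y + e^2) by (pose proof (sq_ge0 x y); nra).
    assert (sp : 0 < sqrt (sq x y + e ^ 2)) by now apply sqrt_lt_R0.
  assert (sb : sqrt (sq x y + e^2) <= 3 * d) by (rewrite <- (sqrt_pow2 (3 * d)) by lra; apply sqrt_le_1_alt; nra).
  assert (kb : kk * sqrt (sq x y + e^2) <= 1). { apply Rle_trans with (kk * (3 * d)); [apply Rmult_le_compat_l;
    lra|]. right. unfold d. field. lra. }
  assert (0 <= kk * sqrt (sq x y + e^2)) by (apply Rmult_le_pos; lra).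
  apply Rmult_le_pos; [|left; now apply Rinv_0_lt_compat]. pose proof PI2_1.
    assert (0 <= cos (kk * sqrt (sq x y + e^2))) by (apply cos_ge_0; lra). lra. }
apply Rabs_le_between in DL. lra.
Qed.

(** With m the supremum of v^2, the integral of v^6 is at most m^2 times that of v^2. At a point
    where v^2 > m / 2, [sixth_power_bound] gives c0 m^3 / 8 <= C m^2 times the integral of v^2, and
    m^2 cancels. The bound involves neither O nor v. *)
Lemma sup_bound k : 0 < k -> exists C, 0 < C /\ forall O v, open3 O -> mode k O v -> forall x,
  v x ^ 2 <= C * int3 (fun y => v y ^ 2).
Proof.
intros Hk. destruct (sixth_power_bound k Hk) as [C [HC H]]. assert (P := c0_pos). exists (8 * C / c0).
  assert (Pc : 0 < 8 * C / c0) by (apply Rdiv_lt_0_compat; lra). split; [auto|].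
intros O v HO Hv x. assert (c2 := Cc_vpow k O v Hv 1). assert (c6 := Cc_vpow k O v Hv 5).
set (I2 := int3 (fun y => v y ^ 2)). assert (I0 : 0 <= I2) by (apply I_ge0; auto; intros; apply pow2_ge_0).
destruct (Cc_bounded _ c2) as [B [HB flux]].
destruct (completeness (fun t => exists y, t = v y ^ 2)) as [m [U Lu]].
{ exists B. intros t [y ->]. eapply Rle_trans; [apply Rle_abs|apply flux]. } { now exists (v x ^ 2), x. }
apply Rle_trans with m; [apply U; now exists x|].
assert (m0 : 0 <= m) by (eapply Rle_trans; [apply (pow2_ge_0 (v x))|apply U; now exists x]).
apply Rnot_lt_le; intros N.
assert (mp : 0 < m) by (eapply Rle_lt_trans; [|exact N]; apply Rmult_le_pos; lra).
assert (Z : exists y, m / 2 < v y ^ 2).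
{ apply NNPP; intros Q. assert (m <= m / 2); [|lra]. apply Lu. intros t [y ->]. apply Rnot_lt_le; intros K.
  apply Q. now exists y. }
destruct Z as [y Hy]. assert (Q := H O v HO Hv y).
assert (I6 : int3 (fun y => v y ^ 6) <= m^2 * I2).
{ refine (Rle_trans _ _ _ (I_le _ (fun y => m^2 * v y ^ 2) c6 (Cc_scal (m^2) _ c2) _) (Req_le _ _ (I_scal (m^2) _
  c2))).
  intros z. assert (v z ^ 2 <= m) by (apply U; now exists z). pose proof (pow2_ge_0 (v z)).
    replace (v z ^ 6) with ((v z ^ 2)^2 * v z ^ 2) by ring. apply Rmult_le_compat_r; auto. apply pow_incr; lra. }
assert (L : (m/2)^3 <= v y ^ 6) by (replace (v y ^ 6) with ((v y ^ 2)^3) by ring; apply pow_incr; lra).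
assert (R1 : c0 * (m/2)^3 <= C * (m^2 * I2)).
{ apply Rle_trans with (c0 * v y ^ 6); [apply Rmult_le_compat_l; lra|]. eapply Rle_trans; [exact Q|].
  apply Rmult_le_compat_l; lra. }
assert (R2 : m^2 * (c0 * m / 8) <= m^2 * (C * I2)) by lra. apply Rmult_le_reg_l in R2; [|apply pow_lt; auto].
fold I2 in N. assert (8 * C / c0 * I2 * c0 < m * c0) by (apply Rmult_lt_compat_r; auto).
  replace (8 * C / c0 * I2 * c0) with (8 * (C * I2)) in * by (field; lra). lra.
Qed.

(** * Finiteness of orthonormal families *)
Fixpoint comb (c : nat -> R) (vs : nat -> pt -> R) (n : nat) (y : pt) : R :=
  match n with 0%nat => 0 | S m => comb c vs m y + c m * vs m y end.
Definition ip (f g : pt -> R) : R := int3 (fun y => f y * g y).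
Definition in_span (vs : nat -> pt -> R) (n : nat) (w : pt -> R) : Prop := exists c, forall y, w y = comb c vs n y.

Lemma comb_ext c c' vs vs' n y : (forall j, (j < n)%nat -> c j * vs j y = c' j * vs' j y) ->
  comb c vs n y = comb c' vs' n y.
Proof. induction n as [|n IH]; intros H; simpl; auto. rewrite IH by (intros; apply H; lia).
  now rewrite (H n) by lia. Qed.
Lemma comb_lin c c' vs n s t y : comb (fun j => s * c j + t * c' j) vs n y = s * comb c vs n y + t * comb c' vs n y.
Proof. induction n as [|n IH]; simpl; [ring|rewrite IH; ring]. Qed.
Lemma span_lin vs n f g s t : in_span vs n f -> in_span vs n g -> in_span vs n (fun y => s * f y + t * g y).
Proof. intros [c Hc] [c' Hc']. exists (fun j => s * c j + t * c' j). intros y. now rewrite comb_lin, Hc, Hc'. Qed.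
Lemma span_S vs n f : in_span vs n f -> in_span vs (S n) f.
Proof.
intros [c Hc]. exists (fun j => if Nat.ltb j n then c j else 0). intros y. simpl. rewrite Nat.ltb_irrefl, Hc.
rewrite (comb_ext c (fun j => if Nat.ltb j n then c j else 0) vs vs n y); [ring|]. intros j Hj.
  apply Nat.ltb_lt in Hj. now rewrite Hj.
Qed.
Lemma span_last vs n : in_span vs (S n) (vs n).
Proof.
exists (fun j => if Nat.ltb j n then 0 else 1). intros y. simpl. rewrite Nat.ltb_irrefl.
enough (E : forall m, (m <= n)%nat -> comb (fun j => if Nat.ltb j n then 0 else 1) vs m y = 0) by (rewrite E by lia;
  ring).
induction m as [|m IH]; intros Hm; simpl; auto. rewrite IH by lia.
  replace (Nat.ltb m n) with true by (symmetry; apply Nat.ltb_lt; lia). ring.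
Qed.
Lemma span_0 vs n : in_span vs n (fun _ => 0).
Proof. exists (fun _ => 0). intros y. induction n as [|n IH]; simpl; auto. rewrite <- IH; ring. Qed.
Lemma span_ext vs n f g : (forall y, f y = g y) -> in_span vs n f -> in_span vs n g.
Proof. intros E [c Hc]. exists c. intros y. now rewrite <- E. Qed.
Lemma span_comb vs n c ph m : (forall j, (j < m)%nat -> in_span vs n (ph j)) -> in_span vs n (comb c ph m).
Proof.
induction m as [|m IH]; intros H; [apply span_0|].
apply (span_ext _ _ (fun y => 1 * comb c ph m y + c m * ph m y)); [intros; simpl; ring|].
  apply span_lin; [apply IH; intros; apply H; lia|apply H; lia].
Qed.

Lemma Cc_prod f g : Cc f -> Cc g -> Cc (fun y => f y * g y).
Proof. intros Hf Hg. apply Cc_mult_r; [auto|apply Hg]. Qed.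
Lemma ip_lin f g h s t : Cc f -> Cc g -> Cc h -> ip (fun y => s * f y + t * g y) h = s * ip f h + t * ip g h.
Proof.
intros Hf Hg Hh. unfold ip. rewrite (I_ext _ (fun y => s * (f y * h y) + t * (g y * h y))) by (intros; ring).
exact (I_lin _ _ s t (Cc_prod f h Hf Hh) (Cc_prod g h Hg Hh)).
Qed.
Lemma ip_sym f g : ip f g = ip g f.
Proof. unfold ip. apply I_ext. intros; ring. Qed.
Lemma ip_ext f g h : (forall y, f y = g y) -> ip f h = ip g h.
Proof. intros E. unfold ip. apply I_ext. intros y. now rewrite E. Qed.

Lemma ip_square f g h c : Cc f -> Cc g -> (forall y, h y = 1 * f y + c * g y) ->
  ip h h = ip f f + 2 * c * ip f g + c^2 * ip g g.
Proof.
intros Hf Hg E. assert (Hh : Cc h) by (apply (Cc_ext (fun y => 1 * f y + c * g y)); [intros;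
  now rewrite E|apply Cc_plus; now apply Cc_scal]).
assert (E1 := eq_trans (ip_ext h _ h E) (ip_lin f g h 1 c Hf Hg Hh)).
assert (E2 := eq_trans (ip_sym f h) (eq_trans (ip_ext h _ f E) (ip_lin f g f 1 c Hf Hg Hf))).
assert (E3 := eq_trans (ip_sym g h) (eq_trans (ip_ext h _ g E) (ip_lin f g g 1 c Hf Hg Hg))).
rewrite E1, E2, E3, (ip_sym g f). ring.
Qed.

Lemma mode_ext k O f g : (forall y, f y = g y) -> mode k O f -> mode k O g.
Proof. intros E H. replace g with f; auto. apply functional_extensionality; auto. Qed.

Section FiniteDim.
Variables (k : R) (O : pt -> Prop) (L : R) (vs : nat -> pt -> R).
Hypothesis Hk : 0 < k.
Hypothesis HO : open3 O.
Hypothesis HL : 0 <= L.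
Hypothesis Hvs : forall j, mode k O (vs j).
Hypothesis Hsupp : forall j, bsupp (vs j) L.

Lemma mode_comb c ph n : (forall j, (j < n)%nat -> mode k O (ph j)) -> mode k O (comb c ph n).
Proof.
induction n as [|n IH]; intros H.
- apply (mode_ext _ _ (fun y => 0 * vs 0%nat y + 0 * vs 0%nat y)); [intros; simpl; ring|]. now apply mode_lin.
- apply (mode_ext _ _ (fun y => 1 * comb c ph n y + c n * ph n y)); [intros; simpl; ring|].
  apply mode_lin; [apply IH; intros; apply H; lia|apply H; lia].
Qed.
Lemma span_mode n f : in_span vs n f -> mode k O f.
Proof. intros [c Hc]. apply (mode_ext _ _ (comb c vs n)); [intros; now rewrite Hc|]. apply mode_comb; auto. Qed.
Lemma comb_zero c n y : (forall j, vs j y = 0) -> comb c vs n y = 0.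
Proof. intros H. induction n as [|n IH]; simpl; auto. rewrite IH, H. ring. Qed.
Lemma span_supp n f : in_span vs n f -> bsupp f L.
Proof.
intros [c Hc] y Hy. apply NNPP; intros N. apply Hy. rewrite Hc. apply comb_zero. intros j. apply NNPP; intros Q.
  now apply N, (Hsupp j).
Qed.

Definition orthonormal (ph : nat -> pt -> R) (n : nat) : Prop :=
  (forall j, (j < n)%nat -> in_span vs n (ph j)) /\
  forall i j, (i < n)%nat -> (j < n)%nat -> ip (ph i) (ph j) = if Nat.eqb i j then 1 else 0.

Lemma ip_comb c ph n N m : orthonormal ph N -> (n <= N)%nat -> (m < N)%nat ->
  ip (comb c ph n) (ph m) = if Nat.ltb m n then c m else 0.
Proof.
intros [Hs Ho] Hn Hm. assert (M := fun j Hj => span_mode N (ph j) (Hs j Hj)).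
  assert (avg_WX := proj1 (proj2 (M m Hm))).
induction n as [|n IH].
- unfold ip. rewrite (I_ext _ (fun _ => 0)) by (intros; simpl; ring). apply I_0.
- assert (Mn := proj1 (proj2 (mode_comb c ph n (fun j Hj => M j ltac:(lia))))).
  rewrite (ip_ext _ (fun y => 1 * comb c ph n y + c n * ph n y)) by (intros; simpl; ring).
  rewrite (ip_lin _ _ _ _ _ Mn (proj1 (proj2 (M n ltac:(lia)))) avg_WX), IH, Ho by lia.
  destruct (Nat.eqb_spec n m) as [->|E].
  + rewrite Nat.ltb_irrefl. replace (Nat.ltb m (S m)) with true by (symmetry; apply Nat.ltb_lt; lia). ring.
  + destruct (Nat.ltb_spec m n).
    * replace (Nat.ltb m (S n)) with true by (symmetry; apply Nat.ltb_lt; lia). ring.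
    * replace (Nat.ltb m (S n)) with false by (symmetry; apply Nat.ltb_ge; lia). ring.
Qed.

(** Parseval's identity. The right-hand side is the sum of the squares of the c j, written as a
    combination of constant functions evaluated at the arbitrary point [org]. *)
Lemma ip_comb_self c ph n N : orthonormal ph N -> (n <= N)%nat ->
  ip (comb c ph n) (comb c ph n) = comb c (fun j _ => c j) n org.
Proof.
intros HN. induction n as [|n IH]; intros Hn.
- unfold ip. rewrite (I_ext _ (fun _ => 0)) by (intros; simpl; ring). apply I_0.
- destruct (HN) as [Hs Ho]. assert (M := fun j Hj => span_mode N (ph j) (Hs j Hj)).
  assert (Mn := proj1 (proj2 (mode_comb c ph n (fun j Hj => M j ltac:(lia))))).
    assert (Mp := proj1 (proj2 (M n ltac:(lia)))).
  assert (E : forall y, comb c ph (S n) y = 1 * comb c ph n y + c n * ph n y) by (intros; simpl; ring).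
  refine (eq_trans (ip_square _ _ _ _ Mn Mp E) _).
  rewrite (ip_comb c ph n N n HN), IH, (Ho n n), Nat.ltb_irrefl, Nat.eqb_refl by lia.
  simpl. ring.
Qed.

Lemma gram_schmidt : (forall n c, exists y, vs n y + comb c vs n y <> 0) -> forall n, exists ph, orthonormal ph n.
Proof.
intros Hind. induction n as [|n [ph HN]].
- exists (fun _ _ => 0). split; intros; lia.
- destruct (HN) as [Hs Ho]. assert (M := fun j Hj => span_mode n (ph j) (Hs j Hj)).
  pose (g := fun j => - ip (vs n) (ph j)). pose (u := fun y => 1 * vs n y + 1 * comb g ph n y).
  assert (Sc : in_span vs n (comb g ph n)) by (apply span_comb; auto).
  assert (Su : in_span vs (S n) u) by (apply span_lin; [apply span_last|now apply span_S]).
  assert (Mu := proj1 (proj2 (span_mode _ _ Su))). assert (Mv := proj1 (proj2 (Hvs n))).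
    assert (Mc := proj1 (proj2 (span_mode _ _ Sc))).
  assert (Ou : forall m, (m < n)%nat -> ip u (ph m) = 0).
  { intros m Hm. unfold u. rewrite (ip_lin _ _ _ _ _ Mv Mc (proj1 (proj2 (M m Hm)))), (ip_comb g ph n n m HN) by lia.
    replace (Nat.ltb m n) with true by (symmetry; apply Nat.ltb_lt; lia). unfold g. ring. }
  assert (Pu : 0 < ip u u).
  { destruct Sc as [c Hc]. destruct (Hind n c) as [y Hy]. apply (I_gt0 (fun y => u y * u y) y).
    - now apply Cc_prod.
    - intros z. apply Rle_0_sqr.
    - assert (u y <> 0) by (unfold u; rewrite Hc; intros Z; apply Hy; lra). now apply Rsqr_pos_lt. }
  set (s := sqrt (ip u u)). assert (sp : 0 < s) by now apply sqrt_lt_R0.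
    assert (ss : s * s = ip u u) by (apply sqrt_sqrt; lra).
  exists (fun j => if Nat.eqb j n then (fun y => / s * u y + 0 * u y) else ph j). split.
  + intros j Hj. destruct (Nat.eqb_spec j n); [now apply span_lin|apply span_S, Hs; lia].
  + intros i j Hi Hj. destruct (Nat.eqb_spec i n) as [Ei|Ei]; destruct (Nat.eqb_spec j n) as [Ej|Ej].
    * subst i j. rewrite Nat.eqb_refl, (ip_lin u u _ _ _ Mu Mu) by (apply Cc_plus; now apply Cc_scal).
      rewrite (ip_sym u), (ip_lin u u _ _ _ Mu Mu Mu), <- ss. field. lra.
    * subst i. replace (Nat.eqb n j) with false by (symmetry; apply Nat.eqb_neq; lia).
      assert (Hj' : (j < n)%nat) by lia.
      rewrite (ip_lin u u _ _ _ Mu Mu (proj1 (proj2 (M j Hj')))), (Ou j Hj'). ring.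
    * subst j. replace (Nat.eqb i n) with false by (symmetry; apply Nat.eqb_neq; lia).
      assert (Hi' : (i < n)%nat) by lia.
      rewrite ip_sym, (ip_lin u u _ _ _ Mu Mu (proj1 (proj2 (M i Hi')))), (Ou i Hi'). ring.
    * apply Ho; lia.
Qed.

Fixpoint sqsum (ph : nat -> pt -> R) (n : nat) (y : pt) : R := match n with 0%nat => 0 | S m => sqsum ph m y + ph m
  y * ph m y end.

(* The sup bound caps the number of orthonormal modes. *)
Theorem modes_dependent : exists n c, forall y, vs n y + comb c vs n y = 0.
Proof.
apply NNPP; intros N.
assert (Hind : forall n c, exists y, vs n y + comb c vs n y <> 0).
{ intros n c. apply NNPP; intros Q. apply N. exists n, c. intros y. apply NNPP; intros Q'. apply Q. now exists y. }
destruct (sup_bound k Hk) as [C [HC SB]].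
assert (main : forall n, INR n <= 8 * L^3 * C).
{ intros n. destruct (gram_schmidt Hind n) as [ph HN]. destruct (HN) as [Hs Ho].
  assert (M := fun j Hj => span_mode n (ph j) (Hs j Hj)).
  assert (flux : forall x, 0 <= sqsum ph n x <= C).
  { intros x. assert (P0 : 0 <= sqsum ph n x) by (clear; induction n as [|n IH]; simpl;
    [lra|pose proof (Rle_0_sqr (ph n x)); unfold Rsqr in *; lra]).
    (* The sup bound is applied at x to the combination with coefficients ph j x. Its value at x and
       its squared L^2 norm both equal S = [sqsum ph n x], so S^2 <= C S and S <= C. Integrating S
       over the box of volume 8 L^3 bounds n. *)
    split; auto. assert (Q := SB O _ HO (mode_comb (fun j => ph j x) ph n M) x).
    assert (E1 : forall m, comb (fun j => ph j x) ph m x = sqsum ph m x) by (induction m as [|m IH]; simpl;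
      [auto|now rewrite IH]).
    assert (E2 : forall m, comb (fun j => ph j x) (fun j _ => ph j x) m org = sqsum ph m x) by (induction m as [|m
      IH]; simpl; [auto|now rewrite IH]).
    assert (E3 : int3 (fun y => comb (fun j => ph j x) ph n y ^ 2) = sqsum ph n x).
    { rewrite <- E2, <- (ip_comb_self _ ph n n HN) by lia. unfold ip. apply I_ext. intros; ring. }
    rewrite E1 in Q. assert (Q' := eq_ind _ (fun z => sqsum ph n x ^ 2 <= C * z) Q _ E3). cbv beta in Q'.
    destruct (Req_dec (sqsum ph n x) 0) as [Z|Z]; [rewrite Z; lra|]. apply Rmult_le_reg_l with (sqsum ph n x); lra. }
  assert (IS : forall m, (m <= n)%nat -> Cc (sqsum ph m) /\ bsupp (sqsum ph m) L /\ int3 (sqsum ph m) = INR m).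
  { induction m as [|m IH]; intros Hm.
    - split; [apply Cc_0|split; [intros y Hy; now elim Hy|apply I_0]].
    - destruct IH as [c1 [b1 i1]]; [lia|]. assert (Hm' : (m < n)%nat) by lia.
      assert (avg_WX := proj1 (proj2 (M m Hm'))). assert (c2 := Cc_prod _ _ avg_WX avg_WX).
      split; [now apply Cc_plus|split].
      + intros y Hy. apply NNPP; intros Q. apply Hy. simpl. replace (ph m y) with 0; [|symmetry; apply NNPP;
        intros Z; apply Q, (span_supp n (ph m) (Hs m Hm') y Z)].
        replace (sqsum ph m y) with 0; [ring|symmetry; apply NNPP; intros Z; apply Q, (b1 y Z)].
      + refine (eq_trans (I_plus _ _ c1 c2) _). fold (ip (ph m) (ph m)).
        rewrite i1, Ho, Nat.eqb_refl, S_INR by lia. ring. }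
  destruct (IS n (le_n n)) as [c1 [b1 i1]]. rewrite <- i1. eapply Rle_trans; [apply Rle_abs|].
    apply (I_bound _ L C); auto.
  intros y. rewrite Rabs_right; [apply flux|apply Rle_ge, flux]. }
destruct (archimed (8 * L^3 * C)) as [ar _]. assert (P : 0 <= 8 * L^3 * C) by (apply (main 0%nat)).
specialize (main (Z.to_nat (up (8 * L^3 * C)))). rewrite INR_IZR_INZ, Z2Nat.id in main; [lra|]. apply le_IZR. lra.
Qed.
End FiniteDim.

(** * Scattering: agreement of the fields *)
Lemma norm3_nrm x : norm3 x = nrm x.
Proof. unfold norm3, nrm. f_equal. unfold dot, sq, org. cbn. ring. Qed.
Lemma norm3_sub x y : norm3 (vsub y x) = sqrt (sq x y).
Proof. unfold norm3. f_equal. unfold dot, sq, vsub. cbn. ring. Qed.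
Lemma norm3_near x y d : near (d / 2) x y -> 0 < d -> norm3 (vsub y x) < d.
Proof.
intros H Hd. rewrite norm3_sub, <- (sqrt_pow2 d) by lra. apply sqrt_lt_1_alt. split; [apply sq_ge0|].
  assert (Q := sq_near _ _ _ H). nra.
Qed.

Lemma cont_near S g x eps : cont_on S g -> S x -> 0 < eps -> exists d, 0 < d /\ forall y,
  S y -> near d x y -> Rabs (g y - g x) < eps.
Proof.
intros H Sx He. destruct (H x Sx eps He) as [d [Hd Q]]. exists (d / 2). split; [lra|]. intros y Sy Hy.
  apply Q; auto. now apply norm3_near.
Qed.
Lemma cont_ct S g x : open3 S -> cont_on S g -> S x -> ct g x.
Proof.
intros O H Sx. apply ct_iff. intros e He. destruct (cont_near S g x e H Sx He) as [d [Hd Q]].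
  destruct (O x Sx) as [r [Hr N]].
exists (Rmin d r). assert (m1 := Rmin_l d r). assert (m2 := Rmin_r d r). split; [now apply Rmin_pos|]. intros y Hy.
  apply Q; [apply N|]; eapply near_le; eauto.
Qed.
Lemma ct_cont S g : (forall x, S x -> ct g x) -> cont_on S g.
Proof.
intros H x Sx e He. destruct (proj1 (ct_iff _ _) (H x Sx) e He) as [d [Hd Q]]. exists d. split; auto.
  intros y _ Hy. apply Q. apply near_sq; auto.
rewrite norm3_sub in Hy. rewrite <- (pow2_sqrt (sq x y)) by apply sq_ge0.
  assert (0 <= sqrt (sq x y)) by apply sqrt_pos. nra.
Qed.
Lemma cont_plus S f g : cont_on S f -> cont_on S g -> cont_on S (fun x => f x + g x).
Proof.
intros Hf Hg x Sx e He. destruct (Hf x Sx (e/2) ltac:(lra)) as [d1 [H1 Q1]].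
  destruct (Hg x Sx (e/2) ltac:(lra)) as [d2 [H2 Q2]].
exists (Rmin d1 d2). assert (m1 := Rmin_l d1 d2). assert (m2 := Rmin_r d1 d2). split; [apply Rmin_Rgt_r; lra|].
  intros y Sy Hy.
specialize (Q1 y Sy ltac:(lra)). specialize (Q2 y Sy ltac:(lra)). apply Rabs_lt_between in Q1, Q2.
  apply Rabs_lt_between. lra.
Qed.
Lemma partial_pd S g i dg x : partial_on S g i dg -> S x -> pd i g x (dg x).
Proof. intros H Sx. apply pd_def, is_derive_Reals, H, Sx. Qed.
Lemma pd_min i f x l : pd (Nat.min i 2) f x l -> pd i f x l.
Proof. intros H. now destruct i as [|[|i]]. Qed.
(** The given derivatives are specified for indices below 3, whereas [C2on] quantifies over all of
    them; [Nat.min i 2] makes every larger index mean the third coordinate. *)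
Lemma helmholtz_weak k S g : open3 S -> helmholtz_real k S g -> weak_helmholtz k S g.
Proof.
intros O [D1 [D2 [[c0' [H1 H2]] E]]]. apply (strong_weak k S g (fun i => D1 (Nat.min i 2)) (fun i => D2 (Nat.min i
  2) (Nat.min i 2))); [|intros y Sy; apply E, Sy].
intros y Sy. split; [eapply cont_ct; eauto|]. intros i. assert (Hi : (Nat.min i 2 < 3)%nat) by lia.
destruct (H1 _ Hi) as [p1 q1]. destruct (H2 _ _ Hi Hi) as [p2 q2].
refine (conj _ (conj _ (conj _ _))); try (eapply cont_ct; eassumption); apply pd_min; eapply partial_pd; eassumption.
Qed.

Lemma lipschitz_near f : lipschitz2 f -> exists K, 0 < K /\ forall x y r,
  near r x y -> Rabs (f (px1 y) (px2 y) - f (px1 x) (px2 x)) <= K * r.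
Proof.
intros [L H]. exists (2 * Rabs L + 1). pose proof (Rabs_pos L). split; [lra|]. intros x y r [h1 [h2 h3]].
assert (r0 : 0 < r) by (pose proof (Rabs_pos (px1 y - px1 x)); lra). apply Rabs_lt_between in h1, h2.
eapply Rle_trans; [apply H|]. assert (s : sqrt ((px1 y - px1 x)^2 + (px2 y - px2 x)^2) <= 2 * r) by (rewrite <-
  (sqrt_pow2 (2 * r)) by lra; apply sqrt_le_1_alt; nra).
pose proof (sqrt_pos ((px1 y - px1 x)^2 + (px2 y - px2 x)^2)). pose proof (Rle_abs L).
apply Rle_trans with (Rabs L * (2 * r)); [|nra]. eapply Rle_trans; [apply Rmult_le_compat_r;
  [auto|exact H2]|apply Rmult_le_compat_l; auto].
Qed.
Lemma Omega_open f : lipschitz2 f -> open3 (Omega f).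
Proof.
intros Hf x Hx. destruct (lipschitz_near f Hf) as [K [HK Q]]. unfold Omega in *.
  set (h := px3 x - f (px1 x) (px2 x)). exists (h / (K + 1)). assert (hp : 0 < h) by (unfold h; lra).
split; [apply Rdiv_lt_0_compat; lra|]. intros z Hz. assert (Z := Q x z _ Hz). destruct Hz as [_ [_ Hz]].
assert (h / (K + 1) + K * (h / (K + 1)) = h) by (field; lra). apply Rabs_le_between in Z.
  apply Rabs_lt_between in Hz. unfold h in *. lra.
Qed.
Lemma below_open f : lipschitz2 f -> open3 (fun x => px3 x < f (px1 x) (px2 x)).
Proof.
intros Hf x Hx. destruct (lipschitz_near f Hf) as [K [HK Q]]. set (h := f (px1 x) (px2 x) - px3 x).
  exists (h / (K + 1)). assert (hp : 0 < h) by (unfold h; lra).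
split; [apply Rdiv_lt_0_compat; lra|]. intros z Hz. assert (Z := Q x z _ Hz). destruct Hz as [_ [_ Hz]].
assert (h / (K + 1) + K * (h / (K + 1)) = h) by (field; lra). apply Rabs_le_between in Z.
  apply Rabs_lt_between in Hz. unfold h in *. lra.
Qed.
Lemma open_and S T : open3 S -> open3 T -> open3 (fun x => S x /\ T x).
Proof.
intros HS HT x [Sx Tx]. destruct (HS x Sx) as [r [Hr N]]. destruct (HT x Tx) as [s [Hs M]]. exists (Rmin r s).
  assert (m1 := Rmin_l r s). assert (m2 := Rmin_r r s).
split; [now apply Rmin_pos|]. intros z Hz. split; [apply N|apply M]; eapply near_le; eauto.
Qed.
Lemma weak_helmholtz_ext k S V W : open3 S -> (forall y, S y -> V y = W y) -> weak_helmholtz k S V ->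
  weak_helmholtz k S W.
Proof.
intros O E H. apply (strong_weak k S W (fun i => D i V) (fun i => D i (D i V))).
- intros y Sy. destruct (O y Sy) as [r [Hr N]]. destruct (weak_helmholtz_C2 k S V O H y Sy) as [c1 H1].
  assert (E' : forall z, near r y z -> V z = W z) by (intros z Hz; apply E, N, Hz).
  split; [now apply (ct_ext_near V W y r)|]. intros i. destruct (H1 i) as [p1 [q1 [p2 q2]]].
  refine (conj _ (conj q1 (conj p2 q2))). now apply (pd_ext_near i V W y _ r).
- intros y Sy. rewrite <- E by auto. now apply (weak_strong k S V).
Qed.

Lemma cabs_fst z : Rabs (fst z) <= cabs z.
Proof. unfold cabs. rewrite <- sqrt_Rsqr_abs. apply sqrt_le_1_alt. unfold Rsqr. pose proof (pow2_ge_0 (snd z)).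
  lra. Qed.
Lemma cabs_snd z : Rabs (snd z) <= cabs z.
Proof. unfold cabs. rewrite <- sqrt_Rsqr_abs. apply sqrt_le_1_alt. unfold Rsqr. pose proof (pow2_ge_0 (fst z)).
  lra. Qed.
Lemma cabs_rotate t z : cabs (cmul (cexpi t) z) = cabs z.
Proof.
unfold cabs. f_equal. destruct z as [a b]. cbn. assert (Q := sin2_cos2 t). unfold Rsqr in Q.
replace ((cos t * a - sin t * b) * ((cos t * a - sin t * b) * 1) + (cos t * b + sin t * a) * ((cos t * b + sin t *
  a) * 1)) with ((sin t * sin t + cos t * cos t) * (a * a + b * b)) by ring.
rewrite Q. ring.
Qed.

Lemma Xr_mirror f x : (forall i, exists l, pd i f x l) -> (forall y,
  f (mirror y) = - f y) -> Xr f (mirror x) = - Xr f x.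
Proof.
intros Hf E. assert (HD : forall i, D i f (mirror x) = - (mirror_sign i * D i f x)).
{ intros i. destruct (Hf i) as [l Hl]. rewrite (D_val i f x l Hl).
  assert (f = fun y => -1 * f (mirror y)) as Ef by (apply functional_extensionality; intros y; rewrite E; ring).
  apply D_val. rewrite Ef. eapply pd_val; [|apply pd_scal, pd_mirror; rewrite mirror_mirror; exact Hl]. ring. }
unfold Xr. rewrite !HD. unfold mirror, mirror_sign. cbn. ring.
Qed.
Lemma Xr_plane f x : px3 x = 0 -> (forall y, px3 y = 0 -> f y = 0) -> Xr f x = 0.
Proof.
intros Hx E. assert (HD : forall i, (i < 2)%nat -> D i f x = 0).
{ intros i Hi. unfold D. rewrite (Derive_ext _ (fun _ => 0)); [apply Derive_const|]. intros t. apply E.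
  destruct i as [|[|i]]; [exact Hx|exact Hx|lia]. }
unfold Xr. rewrite !HD by lia. simpl. rewrite Hx. ring.
Qed.
Lemma oddext_mirror w y : oddext w (mirror y) = - oddext w y.
Proof. unfold oddext. rewrite mirror_mirror. ring. Qed.
Lemma oddext_up w y : 0 < px3 y -> oddext w y = w y.
Proof.
intros H. unfold oddext. rewrite (upper_part_low w (mirror y)) by (cbn; lra). unfold upper_part.
  destruct (Rlt_dec 0 (px3 y)); [ring|lra].
Qed.
Lemma oddext_plane w y : px3 y = 0 -> oddext w y = 0.
Proof. intros H. unfold oddext. rewrite !upper_part_low; [ring|cbn; lra|lra]. Qed.
Lemma sq_org_mirror y : sq org (mirror y) = sq org y.
Proof. unfold sq, mirror, org. cbn. ring. Qed.

Lemma locally_perturbed_radius f : locally_perturbed f -> exists R, 0 < R /\ (forall a b, Rabs (f a b) < R) /\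
  (forall x, ext R x -> 0 < px3 x -> Omega f x) /\ (forall x, ext R x -> px3 x = 0 -> f (px1 x) (px2 x) = 0) /\
  forall a b, R < Rabs a \/ R < Rabs b -> f a b = 0.
Proof.
intros [_ [R0 [H1 H2]]]. assert (P : 0 < R0) by (eapply Rle_lt_trans; [apply Rabs_pos|apply (H2 0 0)]).
assert (big : forall a b, R0^2 < a^2 + b^2 -> f a b = 0).
{ intros a b H. apply H1. rewrite <- (sqrt_pow2 R0) by lra. apply sqrt_lt_1_alt. pose proof (pow2_ge_0 R0). lra. }
(* If |x| > 2 R0, either the horizontal part exceeds R0, where f = 0, or the height exceeds R0 in
   absolute value, hence exceeds |f|. *)
exists (2 * R0). split; [lra|split; [intros a b; specialize (H2 a b); lra|]].
split; [|split].
- intros x Hx H3. unfold ext in Hx. rewrite sqo in Hx. unfold Omega.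
  destruct (Rlt_le_dec (R0^2) (px1 x ^ 2 + px2 x ^ 2)) as [L|L]; [rewrite big by auto; lra|].
  assert (R0 < px3 x) by (apply Rnot_le_lt; intros K; assert (px3 x ^ 2 <= R0^2) by (apply pow_incr; lra); nra).
    pose proof (Rle_abs (f (px1 x) (px2 x))). specialize (H2 (px1 x) (px2 x)). lra.
- intros x Hx H3. unfold ext in Hx. rewrite sqo, H3 in Hx. apply big. nra.
- intros a b H. apply big. assert (S : forall t, 2 * R0 < Rabs t -> R0^2 < t^2) by (intros t Ht;
  rewrite <- (pow2_abs t); nra).
  pose proof (pow2_ge_0 a). pose proof (pow2_ge_0 b). destruct H as [H|H]; apply S in H; lra.
Qed.

Lemma ct_upper_part R w : 0 <= R -> (forall y, ext R y -> 0 < px3 y -> ct w y) ->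
  (forall y, ext R y -> px3 y = 0 -> forall e, 0 < e -> exists d, 0 < d /\ forall z,
    near d y z -> 0 < px3 z -> Rabs (w z) < e) ->
  forall y, ext R y -> ct (upper_part w) y.
Proof.
intros HR H1 H2 y Hy. destruct (Rtotal_order (px3 y) 0) as [L|[L|L]].
- apply (ct_ext_near (fun _ => 0) _ y (- px3 y)); [lra| |apply ct_const]. intros z [_ [_ Hz]].
  apply Rabs_lt_between in Hz. symmetry. apply upper_part_low. lra.
- apply ct_iff. intros e He. destruct (H2 y Hy L e He) as [d [Hd Q]]. exists d. split; auto. intros z Hz.
  rewrite (upper_part_low w y) by lra. rewrite Rminus_0_r.
  unfold upper_part. destruct (Rlt_dec 0 (px3 z)); [now apply Q|rewrite Rabs_R0; lra].
- apply (ct_ext_near w _ y (px3 y)); [lra| |now apply H1]. intros z [_ [_ Hz]]. apply Rabs_lt_between in Hz.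
  unfold upper_part. destruct (Rlt_dec 0 (px3 z)); [auto|lra].
Qed.

Lemma radiating_components k f v : radiating k f v -> exists G : nat -> pt -> Cx,
  (forall i, (i < 3)%nat -> partial_on (Omega f) (fun x => fst (v x)) i (fun x => fst (G i x)) /\ partial_on (Omega
    f) (fun x => snd (v x)) i (fun x => snd (G i x))) /\
  forall eps, 0 < eps -> exists R0, forall x, Omega f x -> R0 < nrm x ->
   Rabs (px1 x * fst (G 0%nat x) + px2 x * fst (G 1%nat x) + px3 x * fst (G 2%nat x) + k * nrm x * snd (v x)) < eps /\
   Rabs (px1 x * snd (G 0%nat x) + px2 x * snd (G 1%nat x) + px3 x * snd (G 2%nat x) - k * nrm x * fst (v x)) < eps.
Proof.
intros [G [H1 H2]]. exists G. split; auto. intros eps He. destruct (H2 eps He) as [R0 Q]. exists (Rmax R0 0).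
  intros x Ox Hx.
pose proof (Rmax_l R0 0). pose proof (Rmax_r R0 0). specialize (Q x Ox ltac:(rewrite norm3_nrm; lra)).
  cbv zeta in Q. rewrite norm3_nrm in Q.
split.
- eapply Rle_lt_trans; [|exact Q]. eapply Rle_trans; [|apply cabs_fst]. right. f_equal. cbn. field. lra.
- eapply Rle_lt_trans; [|exact Q]. eapply Rle_trans; [|apply cabs_snd]. right. f_equal. cbn. field. lra.
Qed.

Lemma far_field_small k f v F xh : far_field k f v F -> S2plus xh -> exists M r0, forall r,
  r0 < r -> Omega f (vscale r xh) ->
  cabs (csub (cscale r (v (vscale r xh))) (cmul (cexpi (k * r)) (F xh))) <= M / r.
Proof.
intros H Hx. destruct (H xh Hx) as [M [r0 Q]]. exists M, r0. intros r Hr Ox. specialize (Q r ltac:(lra) Ox).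
  eapply Rle_trans; [|exact Q]. right.
rewrite <- (cabs_rotate (k * r) (csub (cscale r (cmul (cexpi (- (k * r))) (v (vscale r xh)))) (F xh))). f_equal.
destruct (v (vscale r xh)) as [a b]. destruct (F xh) as [p q]. unfold csub, cscale, cmul, cexpi. cbn.
  rewrite cos_neg, sin_neg.
assert (E := sin2_cos2 (k * r)). unfold Rsqr in E. f_equal.
- replace (r * a) with (r * a * (sin (k * r) * sin (k * r) + cos (k * r) * cos (k * r))) by (rewrite E; ring). ring.
- replace (r * b) with (r * b * (sin (k * r) * sin (k * r) + cos (k * r) * cos (k * r))) by (rewrite E; ring). ring.
Qed.

(** * The difference of two scattered fields for one incident direction *)

Section Direction.
Variables (k : R) (f1 f2 : R -> R -> R) (d : pt) (v1 v2 F1 F2 : pt -> Cx).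
Hypothesis Hk : 0 < k.
Hypothesis P1 : locally_perturbed f1.
Hypothesis P2 : locally_perturbed f2.
Hypothesis S1 : dirichlet_scattered k f1 d v1.
Hypothesis S2 : dirichlet_scattered k f2 d v2.
Hypothesis FF1 : far_field k f1 v1 F1.
Hypothesis FF2 : far_field k f2 v2 F2.
Hypothesis FE : forall xh, S2plus xh -> F1 xh = F2 xh.
Notation RR := Stdlib.Reals.Rdefinitions.R.

Let both (x : pt) : Prop := Omega f1 x /\ Omega f2 x.
Let diff_re (x : pt) : RR := fst (v1 x) - fst (v2 x).
Let diff_im (x : pt) : RR := snd (v1 x) - snd (v2 x).

Lemma both_open : open3 both.
Proof. apply open_and; apply Omega_open; [apply P1|apply P2]. Qed.

(** Only the total fields are given as solutions; the incident and reflected waves cancel in their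
    difference. *)
Lemma difference_weak : weak_helmholtz k both diff_re /\ weak_helmholtz k both diff_im.
Proof.
destruct S1 as [[A1 B1] _]. destruct S2 as [[A2 B2] _].
assert (s1 : forall y, both y -> Omega f1 y) by (intros y Hy; apply Hy).
  assert (s2 : forall y, both y -> Omega f2 y) by (intros y Hy; apply Hy).
assert (O1 := Omega_open f1 (proj1 P1)). assert (O2 := Omega_open f2 (proj1 P2)).
split.
- apply (weak_helmholtz_ext k both (fun y => 1 * fst (cadd (cadd (u_in k d y) (u_re_D k d y)) (v1 y)) + -1 * fst
  (cadd (cadd (u_in k d y) (u_re_D k d y)) (v2 y)))).
  + apply both_open.
  + intros y _. unfold diff_re. cbn. ring.
  + apply weak_helmholtz_lin; [apply (weak_helmholtz_sub k (Omega f1) both _ s1)|apply (weak_helmholtz_sub k (Omega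
    f2) both _ s2)]; now apply helmholtz_weak.
- apply (weak_helmholtz_ext k both (fun y => 1 * snd (cadd (cadd (u_in k d y) (u_re_D k d y)) (v1 y)) + -1 * snd
  (cadd (cadd (u_in k d y) (u_re_D k d y)) (v2 y)))).
  + apply both_open.
  + intros y _. unfold diff_im. cbn. ring.
  + apply weak_helmholtz_lin; [apply (weak_helmholtz_sub k (Omega f1) both _ s1)|apply (weak_helmholtz_sub k (Omega
    f2) both _ s2)]; now apply helmholtz_weak.
Qed.

Lemma difference_surface a b : f1 a b = f2 a b -> v1 (mkpt a b (f1 a b)) = v2 (mkpt a b (f1 a b)).
Proof.
intros E. destruct S1 as [_ [_ [_ [B1 _]]]]. destruct S2 as [_ [_ [_ [B2 _]]]]. specialize (B1 a b).
  specialize (B2 a b). rewrite <- E in B2.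
set (x := mkpt a b (f1 a b)) in *. unfold cadd in B1, B2. injection B1 as e1 e2. injection B2 as e3 e4.
  destruct (v1 x), (v2 x). cbn in *. f_equal; lra.
Qed.

Lemma cont_difference (g1 g2 : pt -> RR) x : cont_on (Omega_bar f1) g1 -> cont_on (Omega_bar f2) g2 ->
  Omega_bar f1 x -> Omega_bar f2 x -> g1 x = g2 x ->
  forall e, 0 < e -> exists d, 0 < d /\ forall z, near d x z -> both z -> Rabs (g1 z - g2 z) < e.
Proof.
intros C1 C2 X1 X2 E e He. destruct (cont_near _ _ x (e/2) C1 X1 ltac:(lra)) as [d1 [D1 Q1]].
  destruct (cont_near _ _ x (e/2) C2 X2 ltac:(lra)) as [d2 [D2 Q2]].
exists (Rmin d1 d2). assert (m1 := Rmin_l d1 d2). assert (m2 := Rmin_r d1 d2). split; [now apply Rmin_pos|].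
  intros z Hz [Z1 Z2].
specialize (Q1 z ltac:(unfold Omega, Omega_bar in *; lra) ltac:(eapply near_le; eauto)).
  specialize (Q2 z ltac:(unfold Omega, Omega_bar in *; lra) ltac:(eapply near_le; eauto)).
apply Rabs_lt_between in Q1, Q2. apply Rabs_lt_between. lra.
Qed.

Lemma radius2 : exists R, 0 < R /\ (forall a b, Rabs (f1 a b) < R /\ Rabs (f2 a b) < R) /\ (forall x,
  ext R x -> 0 < px3 x -> both x) /\
  forall x, ext R x -> px3 x = 0 -> f1 (px1 x) (px2 x) = 0 /\ f2 (px1 x) (px2 x) = 0.
Proof.
destruct (locally_perturbed_radius f1 P1) as [R1 [r1 [a1 [b1 [c1 _]]]]].
  destruct (locally_perturbed_radius f2 P2) as [R2 [r2 [a2 [b2 [c2 _]]]]].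
exists (Rmax R1 R2). assert (m1 := Rmax_l R1 R2). assert (m2 := Rmax_r R1 R2). split; [lra|split; [|split]].
- intros a b. specialize (a1 a b). specialize (a2 a b). lra.
- intros x Hx H. split; [apply b1|apply b2]; auto; apply (ext_le _ (Rmax R1 R2)); auto; lra.
- intros x Hx H. split; [apply c1|apply c2]; auto; apply (ext_le _ (Rmax R1 R2)); auto; lra.
Qed.

Section Radius.
Variable R : RR.
Hypothesis HR : 0 < R.
Hypothesis Rup : forall x, ext R x -> 0 < px3 x -> both x.
Hypothesis Rpl : forall x, ext R x -> px3 x = 0 -> f1 (px1 x) (px2 x) = 0 /\ f2 (px1 x) (px2 x) = 0.

Lemma ext_mirror y : ext R y -> ext R (mirror y).
Proof. unfold ext. now rewrite sq_org_mirror. Qed.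

(** Outside the ball the plane belongs to both surfaces, and the Dirichlet conditions make the
    difference vanish on it. Continuity up to that boundary is all that the reflection asks for. *)
Lemma odd_weak (g1 g2 : pt -> RR) : weak_helmholtz k both (fun y => g1 y - g2 y) -> cont_on (Omega_bar f1) g1 ->
  cont_on (Omega_bar f2) g2 ->
  (forall y, v1 y = v2 y -> g1 y = g2 y) -> weak_helmholtz k (ext R) (oddext (fun y => g1 y - g2 y)).
Proof.
intros W A1 A2 E. assert (U : forall y, upper (ext R) y -> both y) by (intros y [H1 H2]; auto).
apply (oddext_weak_helmholtz k (ext R) _ ext_mirror (weak_helmholtz_sub k both (upper (ext R)) _ U W)).
  apply ct_upper_part; [lra| |].
- intros y Hy H. apply W; auto.
- intros y Hy H e He. destruct (Rpl y Hy H) as [e1 e2].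
  assert (s3 := difference_surface (px1 y) (px2 y) ltac:(lra)).
    replace (mkpt (px1 y) (px2 y) (f1 (px1 y) (px2 y))) with y in s3 by (apply pt_eq; cbn; auto; lra).
  destruct (cont_difference g1 g2 y A1 A2) with (e := e) as [r [Hr Q]]; auto; try (unfold Omega_bar; lra).
  destruct (ext_open R ltac:(lra) y Hy) as [r' [Hr' Q']].
  exists (Rmin r r'). assert (m1 := Rmin_l r r'). assert (m2 := Rmin_r r r'). split; [now apply Rmin_pos|].
    intros z Hz Hz3. apply Q; [eapply near_le; eauto|]. apply Rup; auto. apply Q'. eapply near_le; eauto.
Qed.

Lemma odd_difference_weak : weak_helmholtz k (ext R) (oddext diff_re) /\ weak_helmholtz k (ext R) (oddext diff_im).
Proof.
destruct difference_weak as [W1 W2]. destruct S1 as [_ [A1 [B1 _]]]. destruct S2 as [_ [A2 [B2 _]]].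
split; [apply (odd_weak _ _ W1 A1 A2)|apply (odd_weak _ _ W2 B1 B2)]; now intros y ->.
Qed.

Lemma pd_odd (g1 g2 : pt -> RR) i dg1 dg2 x : both x -> 0 < px3 x -> partial_on (Omega f1) g1 i dg1 ->
  partial_on (Omega f2) g2 i dg2 ->
  D i (oddext (fun y => g1 y - g2 y)) x = dg1 x - dg2 x.
Proof.
intros [X1 X2] H Q1 Q2. apply D_val. apply (pd_ext_near i (fun y => g1 y - g2 y) _ x _ (px3 x) H).
- intros z [_ [_ Hz]]. apply Rabs_lt_between in Hz. rewrite oddext_up by lra. reflexivity.
- apply pd_minus; eapply partial_pd; eassumption.
Qed.

(** The Sommerfeld condition is given above the surfaces only. Below the plane it follows from
    antisymmetry; on the plane x . grad is a tangential derivative of a function that vanishes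
    there. *)
Lemma odd_difference_radpair : radpair k R (oddext diff_re) (oddext diff_im).
Proof.
destruct odd_difference_weak as [Wr Wi]. split; [auto|split; [auto|]]. intros eps He.
destruct S1 as [_ [_ [_ [_ R1]]]]. destruct S2 as [_ [_ [_ [_ R2]]]].
destruct (radiating_components k f1 v1 R1) as [G1 [p1 q1]]. destruct (radiating_components k f2 v2 R2) as [G2 [p2
  q2]].
destruct (q1 (eps/2) ltac:(lra)) as [r1 Q1]. destruct (q2 (eps/2) ltac:(lra)) as [r2 Q2].
pose (r := Rmax R (Rmax r1 r2)). assert (m1 : R <= r) by apply Rmax_l.
  assert (m2 : r1 <= r) by (eapply Rle_trans; [apply Rmax_l|apply Rmax_r]).
  assert (m3 : r2 <= r) by (eapply Rle_trans; [apply Rmax_r|apply Rmax_r]).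
exists r.
assert (up : forall x, ext r x -> 0 < px3 x -> Rabs (Xr (oddext diff_re) x + k * sqrt (sq org x) * oddext diff_im x)
  <= eps /\ Rabs (Xr (oddext diff_im) x - k * sqrt (sq org x) * oddext diff_re x) <= eps).
{ intros x Hx H. assert (B : both x) by (apply Rup; auto; apply (ext_le R r); auto; lra).
  assert (nx : r < nrm x). { unfold nrm. rewrite <- (sqrt_pow2 r) by lra. apply sqrt_lt_1_alt.
    split; [apply pow2_ge_0|exact Hx]. }
  destruct (Q1 x (proj1 B) ltac:(lra)) as [t1 t2]. destruct (Q2 x (proj2 B) ltac:(lra)) as [t3 t4].
  assert (Dr : forall i, (i < 3)%nat -> D i (oddext diff_re) x = fst (G1 i x) - fst (G2 i x)) by (intros i Hi;
    apply (pd_odd _ _ i _ _ x B H (proj1 (p1 i Hi)) (proj1 (p2 i Hi)))).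
  assert (Di : forall i, (i < 3)%nat -> D i (oddext diff_im) x = snd (G1 i x) - snd (G2 i x)) by (intros i Hi;
    apply (pd_odd _ _ i _ _ x B H (proj2 (p1 i Hi)) (proj2 (p2 i Hi)))).
  unfold Xr. rewrite !Dr, !Di by lia. rewrite !oddext_up by auto. unfold diff_re, diff_im. cbn [coord].
    fold (nrm x). apply Rabs_lt_between in t1, t2, t3, t4. split; apply Rabs_le; lra. }
intros x Hx. destruct (Rtotal_order (px3 x) 0) as [L|[L|L]]; [| |now apply up].
- assert (Hm : ext r (mirror x)) by (unfold ext; rewrite sq_org_mirror; exact Hx).
  destruct (up (mirror x) Hm ltac:(cbn; lra)) as [u1 u2].
  assert (O := ext_open R ltac:(lra)). assert (Ex : ext R x) by (apply (ext_le R r); auto; lra).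
  assert (Er := Xr_mirror (oddext diff_re) x (fun i => ex_intro _ _ (proj1 (weak_helmholtz_C1 k (ext R) _ i O Wr x
    Ex))) (oddext_mirror diff_re)).
  assert (Ei := Xr_mirror (oddext diff_im) x (fun i => ex_intro _ _ (proj1 (weak_helmholtz_C1 k (ext R) _ i O Wi x
    Ex))) (oddext_mirror diff_im)).
  rewrite Er, sq_org_mirror, (oddext_mirror diff_im) in u1. rewrite Ei, sq_org_mirror, (oddext_mirror diff_re) in u2.
  split; [rewrite <- Rabs_Ropp; eapply Rle_trans; [right|exact u1]; f_equal; ring|rewrite <- Rabs_Ropp;
    eapply Rle_trans; [right|exact u2]; f_equal; ring].
- rewrite !oddext_plane, !Xr_plane by (auto; intros; now apply oddext_plane).
  rewrite Rmult_0_r, Rplus_0_r, Rminus_0_r, Rabs_R0. lra.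
Qed.

Lemma odd_difference_rayzero : rayzero (oddext diff_re) (oddext diff_im).
Proof.
assert (up : forall xh, sq org xh = 1 -> 0 < px3 xh -> forall eta, 0 < eta -> exists r0, forall r, r0 < r ->
   0 < r /\ Rabs (r * oddext diff_re (vscale r xh)) <= eta /\ Rabs (r * oddext diff_im (vscale r xh)) <= eta).
{ intros xh Hx H eta He. assert (SP : S2plus xh). { split; [|lra]. rewrite norm3_nrm. unfold nrm.
  now rewrite Hx, sqrt_1. }
  destruct (far_field_small k f1 v1 F1 xh FF1 SP) as [M1 [r1 Q1]].
    destruct (far_field_small k f2 v2 F2 xh FF2 SP) as [M2 [r2 Q2]].
  pose (r0 := Rabs r1 + Rabs r2 + R + (Rabs M1 + Rabs M2) / eta). pose proof (Rabs_pos r1).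
    pose proof (Rabs_pos r2). pose proof (Rabs_pos M1). pose proof (Rabs_pos M2).
  assert (P : 0 <= (Rabs M1 + Rabs M2) / eta) by (apply Rmult_le_pos; [lra|left; now apply Rinv_0_lt_compat]).
  exists r0. intros r Hr. pose proof (Rle_abs r1). pose proof (Rle_abs r2). pose proof (Rle_abs M1).
    pose proof (Rle_abs M2). assert (rp : 0 < r) by (unfold r0 in Hr; lra). split; auto.
  assert (px : 0 < px3 (vscale r xh)) by (cbn; now apply Rmult_lt_0_compat).
  assert (B : both (vscale r xh)). { apply Rup; auto. unfold ext. rewrite sq_vscale, Hx. unfold r0 in Hr.
    assert (R < r) by lra. nra. }
  specialize (Q1 r ltac:(unfold r0 in Hr; lra) (proj1 B)). specialize (Q2 r ltac:(unfold r0 in Hr; lra) (proj2 B)).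
    rewrite FE in Q1 by auto.
  assert (S : M1 / r + M2 / r <= eta).
  { apply Rle_trans with ((Rabs M1 + Rabs M2) * / r); [unfold Rdiv; rewrite <- Rmult_plus_distr_r;
    apply Rmult_le_compat_r; [left; now apply Rinv_0_lt_compat|lra]|].
    apply div_le_iff; auto. apply Rle_trans with (eta * ((Rabs M1 + Rabs M2) / eta)); [right; field; lra|].
      apply Rmult_le_compat_l; [lra|unfold r0 in Hr; lra]. }
  rewrite !oddext_up by auto. unfold diff_re, diff_im.
  assert (a1 := Rle_trans _ _ _ (cabs_fst _) Q1). assert (a2 := Rle_trans _ _ _ (cabs_fst _) Q2).
    assert (b1 := Rle_trans _ _ _ (cabs_snd _) Q1). assert (b2 := Rle_trans _ _ _ (cabs_snd _) Q2).
  cbn in a1, a2, b1, b2. apply Rabs_le_between in a1, a2, b1, b2. split; apply Rabs_le; lra. }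
intros xh Hx eta He. destruct (Rtotal_order (px3 xh) 0) as [L|[L|L]].
- destruct (up (mirror xh) ltac:(now rewrite sq_org_mirror) ltac:(cbn; lra) eta He) as [r0 Q]. exists r0.
  intros r Hr. destruct (Q r Hr) as [_ [q1 q2]].
  replace (vscale r (mirror xh)) with (mirror (vscale r xh)) in q1, q2 by (apply pt_eq; cbn; ring).
    rewrite oddext_mirror, Ropp_mult_distr_r_reverse, Rabs_Ropp in q1, q2. auto.
- exists 0. intros r Hr. rewrite !oddext_plane by (cbn; rewrite L; ring). rewrite Rmult_0_r, Rabs_R0. lra.
- destruct (up xh Hx L eta He) as [r0 Q]. exists r0. intros r Hr. apply (Q r Hr).
Qed.
End Radius.

Lemma ext_height r x : 0 <= r -> r < px3 x -> ext r x.
Proof. intros H1 H2. unfold ext. rewrite sqo. pose proof (pow2_ge_0 (px1 x)). pose proof (pow2_ge_0 (px2 x)). nra.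
  Qed.

Theorem fields_agree x : Omega f1 x -> Omega f2 x -> v1 x = v2 x.
Proof.
intros X1 X2. destruct radius2 as [R [HR [Hf [Rup Rpl]]]].
destruct (rellich k R Hk HR _ _ (odd_difference_radpair R HR Rup Rpl) (odd_difference_rayzero R HR Rup)) as [r [Hr
  Q]].
(* The vertical segment of length l starts above height r + 1, where the difference is already zero,
   and ends at x. It stays in both domains because they are regions above graphs, so no
   connectedness argument is needed. *)
pose (l := Rabs (px3 x) + r + 2). pose proof (Rabs_pos (px3 x)). pose proof (Rle_abs (px3 x)).
  pose proof (Rle_abs (- px3 x)) as q. rewrite Rabs_Ropp in q.
pose (top := shift x 2 l). assert (l0 : 0 < l) by (unfold l; lra).
assert (E : shift top 2 (-1 * l) = x) by (unfold top; rewrite shift_shift; replace (l + -1 * l) with 0 by ring;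
  apply shift_0).
assert (Sb : forall t, 0 <= t <= l -> both (shift top 2 (-1 * t))) by (intros t Ht; unfold both, Omega, top in *;
  cbn in *; split; lra).
assert (Z : forall t, 0 <= t < 1 -> diff_re (shift top 2 (-1 * t)) = 0 /\ diff_im (shift top 2 (-1 * t)) = 0).
{ intros t Ht. assert (h : r < px3 (shift top 2 (-1 * t))) by (unfold top, l; cbn; lra).
  destruct (Q _ (ext_height r _ ltac:(lra) h)) as [z1 z2].
  rewrite !oddext_up in z1, z2 by lra. auto. }
destruct difference_weak as [W1 W2].
assert (E1 := ucp_segment k both diff_re top 2 l 1 (-1) (or_intror eq_refl) both_open W1 l0 Sb Rlt_0_1 (fun t Ht =>
  proj1 (Z t Ht)) l ltac:(lra)).
assert (E2 := ucp_segment k both diff_im top 2 l 1 (-1) (or_intror eq_refl) both_open W2 l0 Sb Rlt_0_1 (fun t Ht =>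
  proj2 (Z t Ht)) l ltac:(lra)).
rewrite E in E1, E2. unfold diff_re, diff_im in *. destruct (v1 x), (v2 x). cbn in *. f_equal; lra.
Qed.
End Direction.

(** * The region between two surfaces *)
Lemma ct_sin_dot k d y : ct (fun x => sin (k * dot x d)) y.
Proof.
apply (ct_comp (fun t => sin (k * t)) (fun x => dot x d)).
- unfold dot. ctt.
- apply (ex_derive_continuous (fun t => sin (k * t))). auto_derive; auto.
Qed.

Lemma ucp_line k S W x i r : open3 S -> weak_helmholtz k S W -> (forall t, S (shift x i t)) -> 0 < r ->
  (forall t, Rabs t < r -> W (shift x i t) = 0) -> forall t, W (shift x i t) = 0.
Proof.
intros O HW HS Hr H t. pose proof (Rabs_pos t).
assert (Q : forall o, o = 1 \/ o = -1 -> W (shift x i (o * Rabs t)) = 0).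
{ intros o Ho. apply (ucp_segment k S W x i (Rabs t + 1) r o Ho O HW); [lra|auto|auto| |lra].
  intros s Hs. apply H. rewrite Rabs_mult, (Rabs_right s) by lra. replace (Rabs o) with 1; [lra|].
    destruct Ho as [->| ->]; unfold Rabs; destruct Rcase_abs; lra. }
destruct (Rle_lt_dec 0 t) as [L|L].
- specialize (Q 1 (or_introl eq_refl)). rewrite Rabs_right in Q by lra. now rewrite Rmult_1_l in Q.
- specialize (Q (-1) (or_intror eq_refl)). rewrite Rabs_left in Q by lra. now replace (-1 * - t) with t in Q by ring.
Qed.

Lemma weak_helmholtz_comb k (O : pt -> Prop) c U n : open3 O -> (forall j,
  weak_helmholtz k O (U j)) -> weak_helmholtz k O (comb c U n).
Proof.
intros HO H. induction n as [|n IH].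
- refine (weak_helmholtz_ext k O (fun y => 0 * U 0%nat y + 0 * U 0%nat y) (comb c U 0) HO (fun y _ => _)
  (weak_helmholtz_lin k O _ _ 0 0 (H 0%nat) (H 0%nat))). simpl; ring.
- refine (weak_helmholtz_ext k O (fun y => 1 * comb c U n y + c n * U n y) (comb c U (S n)) HO (fun y _ => _)
  (weak_helmholtz_lin k O _ _ 1 (c n) IH (H n))). simpl; ring.
Qed.

Lemma sin_pow2_zero x m : sin x = 0 -> sin (2^m * x) = 0.
Proof.
intros H. induction m as [|m IH]; [simpl; now rewrite Rmult_1_l|].
  replace (2 ^ S m * x) with (2 * (2^m * x)) by (simpl; ring). rewrite sin_2a, IH. ring.
Qed.

(** A common boundary point is approached vertically from above, a path that lies in both
    domains. *)
Lemma closure_agree f1 f2 (g1 g2 : pt -> R) y : cont_on (Omega_bar f1) g1 -> cont_on (Omega_bar f2) g2 ->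
  (forall x, Omega f1 x -> Omega f2 x -> g1 x = g2 x) -> Omega_bar f1 y -> Omega_bar f2 y -> g1 y = g2 y.
Proof.
intros C1 C2 E Y1 Y2. apply Rminus_diag_uniq, NNPP. intros N. assert (P := Rabs_pos_lt _ N).
  set (e := Rabs (g1 y - g2 y)) in *.
destruct (cont_near _ _ y (e/2) C1 Y1 ltac:(lra)) as [d1 [D1 Q1]].
  destruct (cont_near _ _ y (e/2) C2 Y2 ltac:(lra)) as [d2 [D2 Q2]].
pose (t := Rmin d1 d2 / 2). assert (m1 := Rmin_l d1 d2). assert (m2 := Rmin_r d1 d2).
  assert (t0 : 0 < t) by (unfold t; assert (0 < Rmin d1 d2) by (now apply Rmin_pos); lra).
pose (z := shift y 2 t). assert (Z1 : Omega f1 z) by (unfold Omega, Omega_bar, z in *; cbn; lra).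
  assert (Z2 : Omega f2 z) by (unfold Omega, Omega_bar, z in *; cbn; lra).
specialize (E z Z1 Z2). specialize (Q1 z ltac:(unfold Omega, Omega_bar in *; lra) ltac:(apply near_shift;
  rewrite Rabs_right; unfold t in *; lra)).
specialize (Q2 z ltac:(unfold Omega, Omega_bar in *; lra) ltac:(apply near_shift; rewrite Rabs_right;
  unfold t in *; lra)).
rewrite E in Q1. assert (e < e); [|lra]. unfold e at 1. apply Rabs_lt_between in Q1, Q2. apply Rabs_lt_between. lra.
Qed.

Definition gam (j : nat) : R := (1/2)^(S j).
Definition dir (j : nat) : pt := mkpt (sqrt (1 - gam j ^ 2)) 0 (- gam j).
Lemma gam_range j : 0 < gam j < 1.
Proof.
unfold gam. assert (Q : 0 < (1/2)^j <= 1) by (induction j as [|j IH]; simpl; lra). simpl. lra.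
Qed.
Lemma dir_minus j : S2minus (dir j).
Proof.
pose proof (gam_range j). split; [|change (- gam j < 0); lra]. unfold norm3, dot, dir. cbn [px1 px2 px3 mkpt fst snd].
rewrite sqrt_sqrt by nra. replace (1 - gam j ^ 2 + 0 * 0 + - gam j * - gam j) with 1 by ring. apply sqrt_1.
Qed.

(** * The modes of the cavity and their linear relation *)

Section Ordering.
Variables (k : R) (f1 f2 : R -> R -> R) (v1 v2 F1 F2 : pt -> pt -> Cx).
Hypothesis Hk : 0 < k.
Hypothesis P1 : locally_perturbed f1.
Hypothesis P2 : locally_perturbed f2.
Hypothesis S1 : forall d, S2minus d -> dirichlet_scattered k f1 d (v1 d).
Hypothesis S2 : forall d, S2minus d -> dirichlet_scattered k f2 d (v2 d).
Hypothesis FF1 : forall d, S2minus d -> far_field k f1 (v1 d) (F1 d).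
Hypothesis FF2 : forall d, S2minus d -> far_field k f2 (v2 d) (F2 d).
Hypothesis FE : forall xh d, S2plus xh -> S2minus d -> F1 d xh = F2 d xh.
Notation RR := Stdlib.Reals.Rdefinitions.R.

(** The imaginary part is taken because on the axis the incident wave minus its mirror image has
    real part zero and imaginary part -2 sin (k gam_j r). *)
Definition utot (v : pt -> pt -> Cx) (j : nat) (x : pt) : RR := snd (cadd (cadd (u_in k (dir j) x) (u_re_D k (dir j)
  x)) (v (dir j) x)).

Lemma utot_cont f v j : cont_on (Omega_bar f) (fun x => snd (v (dir j) x)) -> cont_on (Omega_bar f) (utot v j).
Proof.
intros H. unfold utot. cbn. apply (cont_plus _ (fun x => sin (k * dot x (dir j)) + - sin (k * (sqrt (1 - gam j ^ 2)
  * px1 x + 0 * px2 x + - - gam j * px3 x)))); auto.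
apply ct_cont. intros x _. apply ct_plus; [apply ct_sin_dot|apply ct_opp].
apply (ct_ext (fun x => sin (k * dot x (mkpt (sqrt (1 - gam j ^ 2)) 0 (- - gam j))))); [intros; f_equal;
  unfold dot; cbn; ring|apply ct_sin_dot].
Qed.

Let O (y : pt) : Prop := Omega f2 y /\ px3 y < f1 (px1 y) (px2 y).
Lemma O_open : open3 O.
Proof. apply open_and; [apply Omega_open, P2|apply below_open, P1]. Qed.

(** On the lower surface this is the boundary condition of u_2. On the upper one u_1 vanishes, and
    u_1 = u_2 there because the two fields agree above both surfaces and are continuous up to
    them. *)
Lemma utot_closure_zero j y : Omega_bar f2 y -> px3 y <= f1 (px1 y) (px2 y) -> ~ O y -> utot v2 j y = 0.
Proof.
intros Y2 Y1 NO. assert (y0 : forall t, px3 y = t -> mkpt (px1 y) (px2 y) t = y) by (intros t <-; apply pt_eta).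
destruct (S1 _ (dir_minus j)) as [_ [_ [C1 [B1 _]]]]. destruct (S2 _ (dir_minus j)) as [_ [_ [C2 [B2 _]]]].
  unfold Omega_bar in Y2.
destruct (Req_dec (px3 y) (f2 (px1 y) (px2 y))) as [E|E].
- specialize (B2 (px1 y) (px2 y)). rewrite (y0 _ E) in B2. unfold utot. now rewrite B2.
- assert (E1 : px3 y = f1 (px1 y) (px2 y)). { apply Rle_antisym; auto. apply Rnot_lt_le. intros L. apply NO.
  split; auto. unfold Omega. lra. }
  specialize (B1 (px1 y) (px2 y)). rewrite (y0 _ E1) in B1.
  assert (Ev : snd (v1 (dir j) y) = snd (v2 (dir j) y)).
  { apply (closure_agree f1 f2 _ _ y C1 C2); [|unfold Omega_bar; lra|exact Y2]. intros x X1 X2. f_equal.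
    apply (fields_agree k f1 f2 (dir j) _ _ (F1 (dir j)) (F2 (dir j)) Hk P1 P2); auto using dir_minus. }
  apply (f_equal snd) in B1. unfold utot. cbn in *. lra.
Qed.

Definition cavity_mode (j : nat) (y : pt) : RR :=
  if Rlt_dec (f2 (px1 y) (px2 y)) (px3 y) then if Rlt_dec (px3 y) (f1 (px1 y) (px2 y)) then utot v2 j y else 0 else 0.
Lemma cavity_in j y : O y -> cavity_mode j y = utot v2 j y.
Proof. intros [H1 H2]. unfold cavity_mode, Omega in *. destruct Rlt_dec; [|lra]. destruct Rlt_dec; [auto|lra]. Qed.
Lemma cavity_out j y : ~ O y -> cavity_mode j y = 0.
Proof. intros H. unfold cavity_mode, O, Omega in *. destruct Rlt_dec; auto. destruct Rlt_dec; auto. exfalso.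
  apply H. split; lra. Qed.

Lemma utot_weak j : weak_helmholtz k (Omega f2) (utot v2 j).
Proof. destruct (S2 _ (dir_minus j)) as [[_ H] _]. exact (helmholtz_weak k (Omega f2) _ (Omega_open f2 (proj1 P2))
  H). Qed.

Lemma cavity_bsupp : exists L, 0 < L /\ (forall a b, Rabs (f1 a b) < L /\ Rabs (f2 a b) < L) /\ forall j,
  bsupp (cavity_mode j) L.
Proof.
destruct (locally_perturbed_radius f1 P1) as [R1 [r1 [a1 [_ [_ c1]]]]].
  destruct (locally_perturbed_radius f2 P2) as [R2 [r2 [a2 [_ [_ c2]]]]].
exists (Rmax R1 R2). assert (m1 := Rmax_l R1 R2). assert (m2 := Rmax_r R1 R2). split; [lra|].
  assert (B : forall a b, Rabs (f1 a b) < Rmax R1 R2 /\ Rabs (f2 a b) < Rmax R1 R2) by (intros a b;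
  specialize (a1 a b); specialize (a2 a b); lra).
split; auto. intros j y Hy. destruct (classic (O y)) as [[H1 H2]|N]; [|now elim Hy; apply cavity_out].
  unfold Omega in H1. destruct (B (px1 y) (px2 y)) as [b1 b2].
assert (Z : forall t, (t = px1 y \/ t = px2 y) -> Rabs t <= Rmax R1 R2).
{ intros t Ht. apply Rnot_lt_le. intros L. rewrite c1, c2 in * by (destruct Ht; subst t; lra). lra. }
split; [apply Z; auto|split; [apply Z; auto|]]. apply Rabs_lt_between in b1, b2. apply Rabs_le. lra.
Qed.

(** Continuity is the point. Strictly below the lower or above the upper surface the extension is
    locally zero; at the remaining points outside O it is compared with [utot], which is continuous
    there and vanishes. *)
Lemma cavity_is_mode j : mode k O (cavity_mode j).
Proof.
split; [|split; [split|intros; now apply cavity_out]].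
- apply (weak_helmholtz_ext k O (utot v2 j)); [apply O_open|intros; symmetry; now apply cavity_in|].
  apply (weak_helmholtz_sub k (Omega f2) O _ (fun y Hy => proj1 Hy)), utot_weak.
- intros y. destruct (classic (O y)) as [Oy|NO].
  + destruct (O_open y Oy) as [r [Hr N]]. apply (ct_ext_near (utot v2 j) _ y r Hr); [intros z Hz; symmetry;
    apply cavity_in, N, Hz|]. apply utot_weak, Oy.
  + destruct (Rlt_le_dec (px3 y) (f2 (px1 y) (px2 y))) as [L|L].
    { destruct (below_open f2 (proj1 P2) y L) as [r [Hr N]]. apply (ct_ext_near (fun _ => 0) _ y r Hr);
      [|apply ct_const]. intros z Hz. symmetry. apply cavity_out. intros [Q _]. specialize (N z Hz).
      unfold Omega in Q. cbv beta in N. lra. }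
    destruct (Rlt_le_dec (f1 (px1 y) (px2 y)) (px3 y)) as [L1|L1].
    { destruct (Omega_open f1 (proj1 P1) y L1) as [r [Hr N]].
      apply (ct_ext_near (fun _ => 0) _ y r Hr); [|apply ct_const]. intros z Hz. symmetry. apply cavity_out.
      intros [_ Q]. specialize (N z Hz). unfold Omega in N. lra. }
    assert (U0 := utot_closure_zero j y ltac:(unfold Omega_bar; lra) L1 NO).
    destruct (S2 _ (dir_minus j)) as [_ [_ [C2 _]]]. apply ct_iff. intros e He.
    destruct (cont_near _ _ y e (utot_cont f2 v2 j C2) ltac:(unfold Omega_bar; lra) He) as [r [Hr N]]. exists r.
      split; auto. intros z Hz. rewrite (cavity_out j y NO), Rminus_0_r.
    destruct (classic (O z)) as [Oz|NOz]; [|rewrite cavity_out by auto; rewrite Rabs_R0; lra].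
      rewrite cavity_in by auto. specialize (N z ltac:(destruct Oz as [Q _]; unfold Omega, Omega_bar in *;
      lra) Hz). now rewrite U0, Rminus_0_r in N.
- destruct cavity_bsupp as [L [_ [_ H]]]. now exists L.
Qed.

(** Unique continuation works along coordinate segments only. From a cube in the cavity one goes
    straight up to the height T, and then along the two horizontal axes; for T > L the whole
    horizontal plane lies above f2, so these lines meet no obstacle. *)
Lemma combination_vanishes n c a0 b0 L : f2 a0 b0 < f1 a0 b0 -> (forall a b,
  Rabs (f1 a b) < L /\ Rabs (f2 a b) < L) ->
  (forall y, cavity_mode n y + comb c cavity_mode n y = 0) -> forall T,
    L < T -> utot v2 n (mkpt 0 0 T) + comb c (utot v2) n (mkpt 0 0 T) = 0.
Proof.
intros Hlt HL HZ T HT. set (W := fun y => 1 * utot v2 n y + 1 * comb c (utot v2) n y).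
assert (O2 := Omega_open f2 (proj1 P2)).
assert (HW : weak_helmholtz k (Omega f2) W) by (apply weak_helmholtz_lin;
  [apply utot_weak|apply (weak_helmholtz_comb k _ c _ n O2 utot_weak)]).
assert (WO : forall y, O y -> W y = 0).
{ intros y Oy. unfold W. rewrite <- (HZ y), (cavity_in n y Oy), !Rmult_1_l. f_equal. apply comb_ext. intros j _.
  now rewrite cavity_in. }
pose (h := (f1 a0 b0 + f2 a0 b0) / 2). pose (p0 := mkpt a0 b0 h).
assert (Op : O p0) by (unfold O, Omega, p0, h; cbn; lra). destruct (O_open p0 Op) as [r [Hr N]].
assert (hT : h < T). { destruct (HL a0 b0) as [b1 b2]. apply Rabs_lt_between in b1, b2. unfold h. lra. }
assert (high : forall y, px3 y = T -> Omega f2 y) by (intros y Hy; unfold Omega; rewrite Hy;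
  destruct (HL (px1 y) (px2 y)) as [_ b2]; apply Rabs_lt_between in b2; lra).
assert (up : forall s s', Rabs s < r -> Rabs s' < r -> W (mkpt (a0 + s) (b0 + s') T) = 0).
{ intros s s' Hs Hs'. pose (x := mkpt (a0 + s) (b0 + s') h).
  assert (nx : forall t, 0 <= t < r -> near r p0 (shift x 2 (1 * t))).
  { intros t Ht. unfold near, p0, x. cbn. split; [now replace (a0 + s - a0) with s by ring|split;
    [now replace (b0 + s' - b0) with s' by ring|]]. replace (h + 1 * t - h) with t by ring. rewrite Rabs_right; lra. }
  assert (x0 : O x) by (apply N; specialize (nx 0 ltac:(lra)); now rewrite Rmult_0_r, shift_0 in nx).
  replace (mkpt (a0 + s) (b0 + s') T) with (shift x 2 (1 * (T - h))) by (apply pt_eq; cbn; ring).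
  apply (ucp_segment k (Omega f2) W x 2 (T - h) r 1 (or_introl eq_refl) O2 HW); [lra| |auto| |lra].
  - intros t Ht. destruct x0 as [x0 _]. unfold Omega in *. cbn in *. lra.
  - intros t Ht. apply WO, N, nx, Ht. }
assert (line1 : forall X s', Rabs s' < r -> W (mkpt X (b0 + s') T) = 0).
{ intros X s' Hs'. replace (mkpt X (b0 + s') T) with (shift (mkpt a0 (b0 + s') T) 0 (X - a0)) by (apply pt_eq; cbn;
  ring).
  apply (ucp_line k (Omega f2) W _ 0 r O2 HW); auto. intros t Ht. apply (up t s' Ht Hs'). }
assert (line2 : forall X Y, W (mkpt X Y T) = 0).
{ intros X Y. replace (mkpt X Y T) with (shift (mkpt X b0 T) 1 (Y - b0)) by (apply pt_eq; cbn; ring).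
  apply (ucp_line k (Omega f2) W _ 1 r O2 HW); auto. intros t Ht. apply (line1 X t Ht). }
assert (Z := line2 0 0). unfold W in Z. lra.
Qed.

(** The incident and reflected waves contribute exactly -2 sin (k gam_j r) on the axis; the
    scattered field is O(1/r) by its far-field expansion. *)
Lemma utot_axis j eta : 0 < eta -> exists r0, forall r, r0 < r ->
  Rabs (utot v2 j (mkpt 0 0 r) + 2 * sin (k * gam j * r)) <= eta.
Proof.
intros He. pose (e3 := mkpt 0 0 1). assert (E3 : S2plus e3). { split; [|cbn; lra]. unfold norm3, dot, e3. cbn.
  replace (0 * 0 + 0 * 0 + 1 * 1) with 1 by ring. apply sqrt_1. }
destruct (far_field_small k f2 _ _ e3 (FF2 _ (dir_minus j)) E3) as [M [r1 Q]].
  destruct (locally_perturbed_radius f2 P2) as [L [L0 [HL _]]].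
set (B := cabs (F2 (dir j) e3)) in *. assert (B0 : 0 <= B) by apply sqrt_pos. pose proof (Rabs_pos M).
  pose proof (Rle_abs M).
assert (P : 0 <= (Rabs M + B) / eta) by (apply Rmult_le_pos; [lra|left; now apply Rinv_0_lt_compat]).
exists (Rabs r1 + L + 1 + (Rabs M + B) / eta). pose proof (Rle_abs r1). pose proof (Rabs_pos r1). intros r Hr.
assert (rE : vscale r e3 = mkpt 0 0 r) by (apply pt_eq; cbn; ring).
assert (Or : Omega f2 (mkpt 0 0 r)) by (unfold Omega; cbn; pose proof (Rle_abs (f2 0 0)); specialize (HL 0 0); lra).
specialize (Q r ltac:(lra)). rewrite rE in Q. specialize (Q Or). assert (Q2 := Rle_trans _ _ _ (cabs_snd _) Q).
assert (Z := cabs_snd (cmul (cexpi (k * r)) (F2 (dir j) e3))). rewrite cabs_rotate in Z. fold B in Z.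
assert (Ev : utot v2 j (mkpt 0 0 r) + 2 * sin (k * gam j * r) = snd (v2 (dir j) (mkpt 0 0 r))).
{ unfold utot, u_in, u_re_D, cadd, copp, cexpi, dot, dir. cbn [px1 px2 px3 mkpt fst snd].
  replace (k * (0 * sqrt (1 - gam j ^ 2) + 0 * 0 + r * - gam j)) with (- (k * gam j * r)) by ring.
    replace (k * (sqrt (1 - gam j ^ 2) * 0 + 0 * 0 + - - gam j * r)) with (k * gam j * r) by ring. rewrite sin_neg.
    ring. }
rewrite Ev. set (t := snd (v2 (dir j) (mkpt 0 0 r))) in *. unfold csub, cscale in Q2. cbn [fst snd] in Q2.
  fold t in Q2. set (w := snd (cmul (cexpi (k * r)) (F2 (dir j) e3))) in *.
assert (T1 : r * Rabs t <= Rabs M + B).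
{ rewrite <- (Rabs_right r) at 1 by lra. rewrite <- Rabs_mult. replace (r * t) with ((r * t - w) + w) by ring.
  eapply Rle_trans; [apply Rabs_triang|]. apply Rplus_le_compat; auto.
  eapply Rle_trans; [exact Q2|]. apply div_le_iff; [lra|]. apply Rle_trans with (Rabs M * 1); [lra|].
    apply Rmult_le_compat_l; lra. }
apply Rmult_le_reg_l with r; [lra|]. eapply Rle_trans; [exact T1|].
  apply Rle_trans with ((Rabs M + B) / eta * eta); [right; field; lra|]. apply Rmult_le_compat_r; lra.
Qed.

(* Along the axis the j-th field oscillates like sin (k gam_j r); at [r = 2^(n+1) s / k] with [s] in [pi/2 + 2 pi N]
   the frequencies gam_j, j < n, give zero and gam_n gives one. *)
Definition special (n : nat) (m : nat) : RR := 2^(S n) * (PI / 2 + 2 * INR m * PI) / k.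
Lemma special_n n m : sin (k * gam n * special n m) = 1.
Proof.
replace (k * gam n * special n m) with (PI / 2 + 2 * INR m * PI); [rewrite sin_period; apply sin_PI2|].
unfold special, gam. assert (E : (1/2)^(S n) * 2^(S n) = 1) by (rewrite <- Rpow_mult_distr;
  replace (1/2*2) with 1 by lra; apply pow1).
replace (k * (1 / 2) ^ S n * (2 ^ S n * (PI / 2 + 2 * INR m * PI) / k)) with (((1/2)^(S n) * 2^(S n)) * (PI / 2 + 2
  * INR m * PI)) by (field; lra). rewrite E. ring.
Qed.
Lemma special_j n m j : (j < n)%nat -> sin (k * gam j * special n m) = 0.
Proof.
intros H. assert (E : (1/2)^(S j) * 2^(S j) = 1) by (rewrite <- Rpow_mult_distr; replace (1/2*2) with 1 by lra;
  apply pow1).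
assert (Z : sin (2 * (PI / 2 + 2 * INR m * PI)) = 0) by (rewrite sin_2a, cos_period, cos_PI2; ring).
replace (k * gam j * special n m) with (2^(n - j - 1) * (2 * (PI / 2 + 2 * INR m * PI))); [now apply sin_pow2_zero|].
unfold special, gam. replace (S n) with (S j + S (n - j - 1))%nat by lia. rewrite pow_add.
replace (k * (1 / 2) ^ S j * (2 ^ S j * 2 ^ S (n - j - 1) * (PI / 2 + 2 * INR m * PI) / k)) with (((1/2)^(S j) *
  2^(S j)) * (2 ^ S (n - j - 1) * (PI / 2 + 2 * INR m * PI))) by (field; lra).
rewrite E. simpl. ring.
Qed.
Lemma special_large n x : exists m, x < special n m.
Proof.
destruct (INR_unbounded (Rabs x * k)) as [m Hm]. exists m. pose proof (Rle_abs x). pose proof (Rabs_pos x).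
apply Rmult_lt_reg_r with k; auto. replace (special n m * k) with (2^(S n) * (PI / 2 + 2 * INR m * PI)) by (unfold
  special; field; lra).
pose proof PI2_1. pose proof (pos_INR m). assert (1 <= 2^(S n)) by (apply pow_R1_Rle; lra).
assert (INR m <= PI / 2 + 2 * INR m * PI) by nra. assert (x * k <= Rabs x * k) by (apply Rmult_le_compat_r; lra). nra.
Qed.

Lemma comb_axis n c m eta : (m <= n)%nat -> 0 < eta -> exists r0, forall i,
  r0 < special n i -> Rabs (comb c (utot v2) m (mkpt 0 0 (special n i))) <= eta.
Proof.
revert eta. induction m as [|m IH]; intros eta Hm He; [exists 0; intros; simpl; rewrite Rabs_R0; lra|].
destruct (IH (eta/2) ltac:(lia) ltac:(lra)) as [r1 Q1]. pose proof (Rabs_pos (c m)).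
destruct (utot_axis m (eta / 2 / (Rabs (c m) + 1))) as [r2 Q2]; [apply Rdiv_lt_0_compat; lra|].
exists (Rmax r1 r2). assert (m1 := Rmax_l r1 r2). assert (m2 := Rmax_r r1 r2). intros i Hi.
  specialize (Q1 i ltac:(lra)). specialize (Q2 (special n i) ltac:(lra)).
rewrite special_j, Rmult_0_r, Rplus_0_r in Q2 by lia. simpl. eapply Rle_trans; [apply Rabs_triang|].
  rewrite Rabs_mult.
assert (Rabs (c m) * Rabs (utot v2 m (mkpt 0 0 (special n i))) <= eta / 2); [|lra].
apply Rle_trans with ((Rabs (c m) + 1) * (eta / 2 / (Rabs (c m) + 1))); [|right; field; lra].
  apply Rmult_le_compat; try apply Rabs_pos; lra.
Qed.

Theorem surface_le a b : f1 a b <= f2 a b.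
Proof.
apply Rnot_lt_le. intros Hlt. destruct cavity_bsupp as [L [L0 [HL HB]]].
destruct (modes_dependent k O L cavity_mode Hk O_open (Rlt_le _ _ L0) cavity_is_mode HB) as [n [c HZ]].
assert (V := combination_vanishes n c a b L Hlt HL HZ).
(* At the special radii the n-th field is within 1/2 of -2, and the combination of the lower ones
   within 1/2 of 0. Their sum cannot vanish, since the relation has coefficient 1 in front of the
   n-th field. *)
destruct (comb_axis n c n (1/2) (le_n n) ltac:(lra)) as [r1 Q1]. destruct (utot_axis n (1/2) ltac:(lra)) as [r2 Q2].
destruct (special_large n (Rabs r1 + Rabs r2 + L)) as [i Hi]. pose proof (Rle_abs r1). pose proof (Rle_abs r2).
  pose proof (Rabs_pos r1). pose proof (Rabs_pos r2).
specialize (Q1 i ltac:(lra)). specialize (Q2 (special n i) ltac:(lra)). specialize (V (special n i) ltac:(lra)).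
  rewrite special_n in Q2.
apply Rabs_le_between in Q1, Q2. lra.
Qed.
End Ordering.

Theorem mainTheorem4 :
  forall (k : R) (f1 f2 : R -> R -> R) (usc1 usc2 : pt -> pt -> Cx)
         (F1 F2 : pt -> pt -> Cx),
  k > 0 ->
  locally_perturbed f1 -> locally_perturbed f2 ->
  (forall d, S2minus d -> dirichlet_scattered k f1 d (usc1 d)) ->
  (forall d, S2minus d -> dirichlet_scattered k f2 d (usc2 d)) ->
  (forall d, S2minus d -> far_field k f1 (usc1 d) (F1 d)) ->
  (forall d, S2minus d -> far_field k f2 (usc2 d) (F2 d)) ->
  (forall xh d, S2plus xh -> S2minus d -> F1 d xh = F2 d xh) ->
  forall a b, f1 a b = f2 a b.
Proof.
intros k f1 f2 usc1 usc2 F1 F2 Hk P1 P2 S1 S2 FF1 FF2 FE a b. apply Rle_antisym.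
- exact (surface_le k f1 f2 usc1 usc2 F1 F2 Hk P1 P2 S1 S2 FF1 FF2 FE a b).
- exact (surface_le k f2 f1 usc2 usc1 F2 F1 Hk P2 P1 S2 S1 FF2 FF1 (fun xh d Hx Hd => eq_sym (FE xh d Hx Hd)) a b).
Qed.
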